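(* Let $\phi$ be a (standard) Drinfeld $A$-module of rank $r\ge1$ over a field $K\supset\mathbb{F}_q$, and let $M$ be the associated $A$-motive. For any place $\mathfrak p\neq\infty$ of $F$, there is a natural $\Gamma_K$-equivariant isomorphism of $F_{\mathfrak p}$-vector spaces $$V_{\mathfrak p}(\phi)\cong T_0(M_{F,\mathfrak p})^\vee\otimes_A\Omega_A.$$ (This includes the case where $\mathfrak p$ is the kernel of the characteristic homomorphism of $\phi$.)
   Context: $F$ is the function field of a smooth connected projective curve $C$ over the finite field $\mathbb{F}_q$, $\infty\in C$ a fixed closed point, $A\subset F$ the subring of functions regular outside $\infty$; places $\mathfrak p\neq\infty$ of $F$ are the maximal ideals of $A$, with completions $A_{\mathfrak p}\subset F_{\mathfrak p}$. $\deg_A(a):=\dim_{\mathbb{F}_q}(A/Aa)$ for $0\neq a\in A$. A (standard) Drinfeld $A$-module of rank $r$ over $K$ is an $\mathbb{F}_q$-algebra homomorphism $\phi:A\to K[\tau]$ ($\tau\xi=\xi^q\tau$), $a\mapsto\phi_a$, with $\phi_a$ of degree $r\deg_A(a)$ in $\tau$ for all $a\neq0$; its characteristic homomorphism sends $a$ to the constant coefficient of $\phi_a$. The associated $A$-motive is $M:=K[\tau]$ with $(a\otimes\xi)m:=\xi m\phi_a$ for $a\otimes\xi\in A\otimes_{\mathbb{F}_q}K$ and $\tau$ acting by left multiplication. $\bar K$ is an algebraic closure of $K$ and $\Gamma_K:=\mathrm{Aut}(\bar K/K)\cong\mathrm{Gal}(K^{\mathrm{sep}}/K)$. With $(\sum_i\psi_i\tau^i)(\xi):=\sum_i\psi_i\xi^{q^i}$,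 let $\phi[\mathfrak p^n]:=\{\xi\in\bar K:\phi_a(\xi)=0\ \forall a\in\mathfrak p^n\}$. The rational Tate module is $V_{\mathfrak p}(\phi):=T_{\mathfrak p}(\phi)\otimes_{A_{\mathfrak p}}F_{\mathfrak p}$ with $T_{\mathfrak p}(\phi):=\mathrm{Hom}_A(F_{\mathfrak p}/A_{\mathfrak p},\bigcup_n\phi[\mathfrak p^n])$, with its natural action of $\Gamma_K$. $M_{F,\mathfrak p}:=(F_{\mathfrak p}\widehat\otimes_{\mathbb{F}_q}K)\otimes_{A\otimes_{\mathbb{F}_q}K}M$ with the induced $\sigma$-linear operator $\tau$, where $\sigma(a\widehat\otimes\xi)=a\widehat\otimes\xi^q$ ($K$ discrete), and $T_0(M_{F,\mathfrak p}):=(M_{F,\mathfrak p}\widehat\otimes_K\bar K)^\tau$ denotes the $\tau$-invariants of its base change $(F_{\mathfrak p}\widehat\otimes_{\mathbb{F}_q}\bar K)\otimes_{F_{\mathfrak p}\widehat\otimes_{\mathbb{F}_q}K}M_{F,\mathfrak p}$, an $F_{\mathfrak p}$-vector space with the action of $\Gamma_K$ through $\bar K$. $(\ )^\vee$ is the $F_{\mathfrak p}$-linear dual with contragredient action. $\Omega_A$ is the module of Kähler differentials of $A$ over $\mathbb{F}_q$, an invertible $A$-module with trivial $\Gamma_K$-action. *)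

(* Defs.v *)
From HB Require Import structures.
From mathcomp Require Import all_boot all_order all_algebra all_field.
From mathcomp Require Import zify ring.
From mathcomp Require Import boolp classical_sets functions.

Set Implicit Arguments.
Unset Strict Implicit.
Unset Printing Implicit Defensive.

Import Order.TTheory GRing.Theory Num.Theory.
Local Open Scope ring_scope.
Local Open Scope quotient_scope.

(* M (x)_I N for abelian groups M and N on which the elements of I act through
   aM and aN: formal sums of pairs modulo the congruence generated by
   biadditivity and (i m) (x) n = m (x) (i n). *)
Section BalancedTensor.
Variables (I : Type) (M N : zmodType) (aM : I -> M -> M) (aN : I -> N -> N).

Inductive tens_cong : seq (M * N) -> seq (M * N) -> Prop :=
| tens_refl s : tens_cong s s
| tens_sym s t : tens_cong s t -> tens_cong t s
| tens_trans t s u : tens_cong s t -> tens_cong t u -> tens_cong s u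
| tens_cat s s' t t' :
    tens_cong s s' -> tens_cong t t' -> tens_cong (s ++ t) (s' ++ t')
| tens_catC s t : tens_cong (s ++ t) (t ++ s)
| tens_0l n : tens_cong [:: (0, n)] [::]
| tens_Dl m m' n : tens_cong [:: (m + m', n)] [:: (m, n); (m', n)]
| tens_Dr m n n' : tens_cong [:: (m, n + n')] [:: (m, n); (m, n')]
| tens_bal i m n : tens_cong [:: (aM i m, n)] [:: (m, aN i n)].

Definition tens_eqb (s t : seq (M * N)) : bool := `[< tens_cong s t >].

Fact tens_eqb_equiv : equiv_class_of tens_eqb.
Proof.
split=> [s|s t|t s u].
- by apply/asboolP; apply: tens_refl.
- by apply/asboolP/asboolP; apply: tens_sym.
- by move=> /asboolP st /asboolP tu; apply/asboolP; apply: tens_trans st tu.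
Qed.

Canonical tens_equiv := EquivRelPack tens_eqb_equiv.
Canonical tens_encModRel := defaultEncModRel tens_eqb.

Definition tens := {eq_quot tens_eqb}.

HB.instance Definition _ := Choice.on tens.
HB.instance Definition _ := EqQuotient.on tens.

Definition tens_sum (s : seq (M * N)) : tens := \pi s.

Lemma tens_sumP s t : tens_cong s t -> tens_sum s = tens_sum t.
Proof. by move=> st; apply/eqquotP/asboolP. Qed.

Lemma tens_sum_inj s t : tens_sum s = tens_sum t -> tens_cong s t.
Proof. by move/eqquotP/asboolP. Qed.

Lemma tens_reprK x : tens_sum (repr x) = x.
Proof. exact: reprK. Qed.

Lemma tens_repr s : tens_cong (repr (tens_sum s)) s.
Proof. by apply: tens_sum_inj; rewrite tens_reprK. Qed.

Definition neg_sum (s : seq (M * N)) := [seq (- p.1, p.2) | p <- s].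

Lemma neg_sumP s : tens_cong (neg_sum s ++ s) [::].
Proof.
elim: s => [|[m n] s IHs]; first exact: tens_refl.
rewrite /= -[_ :: _]/([:: (- m, n)] ++ (neg_sum s ++ [:: (m, n)] ++ s)).
apply: (@tens_trans ([:: (- m, n)] ++ ([:: (m, n)] ++ (neg_sum s ++ s)))).
  apply: tens_cat; first exact: tens_refl.
  by rewrite !catA; apply: tens_cat; [apply: tens_catC | apply: tens_refl].
rewrite catA -[[::]](cats0 (Nil (M * N))); apply: tens_cat => //.
apply: tens_trans (tens_0l n); rewrite -(addNr m).
by apply: tens_sym; apply: tens_Dl.
Qed.

Lemma neg_sum_cong s t : tens_cong s t -> tens_cong (neg_sum s) (neg_sum t).
Proof.
move=> st; apply: (@tens_trans (neg_sum s ++ (neg_sum t ++ t))).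
  rewrite -[X in tens_cong X]cats0; apply: tens_cat; first exact: tens_refl.
  exact/tens_sym/neg_sumP.
apply: (@tens_trans (neg_sum s ++ (neg_sum t ++ s))).
  do 2![apply: tens_cat; first exact: tens_refl].
  exact: tens_sym.
apply: (@tens_trans (neg_sum t ++ (neg_sum s ++ s))).
  by rewrite !catA; apply: tens_cat; [apply: tens_catC | apply: tens_refl].
rewrite -[X in tens_cong _ X]cats0; apply: tens_cat; first exact: tens_refl.
exact: neg_sumP.
Qed.

Definition tens_add (x y : tens) := tens_sum (repr x ++ repr y).
Definition tens_opp (x : tens) := tens_sum (neg_sum (repr x)).

Lemma tens_addE s t : tens_add (tens_sum s) (tens_sum t) = tens_sum (s ++ t).
Proof. by apply: tens_sumP; apply: tens_cat; apply: tens_repr. Qed.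

Lemma tens_oppE s : tens_opp (tens_sum s) = tens_sum (neg_sum s).
Proof. by apply: tens_sumP; apply: neg_sum_cong; apply: tens_repr. Qed.

Fact tens_addA : associative tens_add.
Proof.
move=> x y z; rewrite -(tens_reprK x) -(tens_reprK y) -(tens_reprK z).
by rewrite !tens_addE catA.
Qed.

Fact tens_addC : commutative tens_add.
Proof. by move=> x y; apply: tens_sumP; apply: tens_catC. Qed.

Fact tens_add0 : left_id (tens_sum [::]) tens_add.
Proof. by move=> x; rewrite -(tens_reprK x) tens_addE. Qed.

Fact tens_addN : left_inverse (tens_sum [::]) tens_opp tens_add.
Proof.
move=> x; rewrite -(tens_reprK x) tens_oppE tens_addE.
by apply: tens_sumP; apply: neg_sumP.
Qed.

HB.instance Definition _ :=
  GRing.isZmodule.Build tens tens_addA tens_addC tens_add0 tens_addN.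

Definition tmk (m : M) (n : N) : tens := tens_sum [:: (m, n)].

Lemma tens_sumE s : tens_sum s = \sum_(p <- s) tmk p.1 p.2.
Proof.
elim: s => [|[m n] s IHs]; first by rewrite big_nil.
by rewrite big_cons -IHs [RHS]tens_addE.
Qed.

Lemma tens_ind (P : tens -> Prop) :
  P 0 -> (forall x y, P x -> P y -> P (x + y)) ->
  (forall m n, P (tmk m n)) -> forall x, P x.
Proof.
move=> P0 PD Pmk x; rewrite -(tens_reprK x) tens_sumE.
by elim/big_ind: _ => // p _; apply: Pmk.
Qed.

Lemma tmkDl n : {morph tmk^~ n : m m' / m + m'}.
Proof. by move=> m m'; rewrite [RHS]tens_addE; apply/tens_sumP/tens_Dl. Qed.

Lemma tmkDr m : {morph tmk m : n n' / n + n'}.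
Proof. by move=> n n'; rewrite [RHS]tens_addE; apply/tens_sumP/tens_Dr. Qed.

Lemma tmk_bal i m n : tmk (aM i m) n = tmk m (aN i n).
Proof. by apply/tens_sumP/tens_bal. Qed.

Definition balanced (W : zmodType) (f : M -> N -> W) :=
  [/\ forall n, {morph f^~ n : m m' / m + m'},
      forall m, {morph f m : n n' / n + n'} &
      forall i m n, f (aM i m) n = f m (aN i n)].

(* The additive map m (x) n |-> f m n (meaningful when f is balanced). *)
Definition tens_lift (W : zmodType) (f : M -> N -> W) (x : tens) : W :=
  \sum_(p <- repr x) f p.1 p.2.

Section Lift.
Variables (W : zmodType) (f : M -> N -> W).
Hypothesis fB : balanced f.

Lemma tens_cong_lift s t : tens_cong s t ->
  \sum_(p <- s) f p.1 p.2 = \sum_(p <- t) f p.1 p.2.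
Proof.
have [fDl fDr fb] := fB.
elim=> {s t} [s|s t _ ->|t s u _ -> _ ->|s s' t t' _ IH1 _ IH2|s t|n|m m' n|m n n'|i m n] //.
- by rewrite !big_cat /= IH1 IH2.
- by rewrite !big_cat /= addrC.
- rewrite big_seq1 big_nil /=; apply: (@addrI _ (f 0 n)).
  by rewrite -fDl !addr0.
- by rewrite !big_cons !big_nil /= fDl !addr0.
- by rewrite !big_cons !big_nil /= fDr !addr0.
- by rewrite !big_seq1 /= fb.
Qed.

Lemma tens_liftE m n : tens_lift f (tmk m n) = f m n.
Proof. by rewrite /tens_lift (tens_cong_lift (tens_repr _)) big_seq1. Qed.

Lemma tens_liftD : {morph tens_lift f : x y / x + y}.
Proof.
move=> x y; rewrite -(tens_reprK x) -(tens_reprK y) [_ + _]tens_addE.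
by rewrite /tens_lift !(tens_cong_lift (tens_repr _)) big_cat.
Qed.

Lemma tens_lift0 : tens_lift f 0 = 0.
Proof. by apply: (@addrI _ (tens_lift f 0)); rewrite -tens_liftD !addr0. Qed.

End Lift.

Lemma tens_ext (W : zmodType) (f g : tens -> W) :
  {morph f : x y / x + y} -> {morph g : x y / x + y} ->
  (forall m n, f (tmk m n) = g (tmk m n)) -> f =1 g.
Proof.
have h0 (h : tens -> W) : {morph h : x y / x + y} -> h 0 = 0.
  by move=> hD; apply: (@addrI _ (h 0)); rewrite -hD !addr0.
move=> fD gD fg x; elim/tens_ind: x => [|x y fgx fgy|] //; first by rewrite !h0.
by rewrite fD gD fgx fgy.
Qed.

End BalancedTensor.

(* R (x)_k S for commutative k-algebras R and S *)
Section TensorAlgebra.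
Variables (k R S : comPzRingType).
Variables (iR : {rmorphism k -> R}) (iS : {rmorphism k -> S}).

Definition tens_alg :=
  tens (fun (c : k) (r : R) => iR c * r) (fun (c : k) (s : S) => iS c * s).
HB.instance Definition _ := GRing.Zmodule.on tens_alg.

Definition ten (r : R) (s : S) : tens_alg := tmk _ _ r s.

Lemma tenDl s : {morph ten^~ s : r r' / r + r'}. Proof. exact: tmkDl. Qed.
Lemma tenDr r : {morph ten r : s s' / s + s'}. Proof. exact: tmkDr. Qed.
Lemma ten_bal c r s : ten (iR c * r) s = ten r (iS c * s).
Proof. exact: (@tmk_bal _ _ _ _ _ c). Qed.

Definition mul_ten (r : R) (s : S) : tens_alg -> tens_alg :=
  tens_lift (fun r' s' => ten (r * r') (s * s')).

Lemma mul_ten_balanced r s : balanced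
  (fun (c : k) (r : R) => iR c * r) (fun (c : k) (s : S) => iS c * s)
  (fun r' s' => ten (r * r') (s * s')).
Proof.
split=> [s' x y|r' x y|c r' s']; first by rewrite mulrDr tenDl.
  by rewrite mulrDr tenDr.
by rewrite mulrCA ten_bal (mulrCA s).
Qed.

Lemma mul_tenE r s r' s' : mul_ten r s (ten r' s') = ten (r * r') (s * s').
Proof. by rewrite [LHS]tens_liftE //; apply: mul_ten_balanced. Qed.

Lemma mul_tenD r s : {morph mul_ten r s : x y / x + y}.
Proof. exact/tens_liftD/mul_ten_balanced. Qed.

Definition tens_mul (x y : tens_alg) : tens_alg :=
  tens_lift (fun r s => mul_ten r s y) x.

Lemma tens_mul_balanced y : balanced
  (fun (c : k) (r : R) => iR c * r) (fun (c : k) (s : S) => iS c * s)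
  (fun r s => mul_ten r s y).
Proof.
split=> [s r r'|r s s'|c r s].
- move: y; apply: tens_ext => [|x y|r1 s1]; first exact: mul_tenD.
    by rewrite !mul_tenD addrACA.
  by rewrite -/(ten r1 s1) !mul_tenE mulrDl tenDl.
- move: y; apply: tens_ext => [|x y|r1 s1]; first exact: mul_tenD.
    by rewrite !mul_tenD addrACA.
  by rewrite -/(ten r1 s1) !mul_tenE mulrDl tenDr.
- move: y; apply: tens_ext => [||r1 s1]; try exact: mul_tenD.
  by rewrite -/(ten r1 s1) !mul_tenE -!mulrA ten_bal.
Qed.

Lemma tens_mulE r s r' s' :
  tens_mul (ten r s) (ten r' s') = ten (r * r') (s * s').
Proof.
by rewrite /tens_mul tens_liftE ?mul_tenE //; apply: tens_mul_balanced.
Qed.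

Lemma tens_mulDl : left_distributive tens_mul +%R.
Proof. by move=> x y z; rewrite /tens_mul tens_liftD //; apply: tens_mul_balanced. Qed.

Lemma tens_mul_tenl r s y : tens_mul (ten r s) y = mul_ten r s y.
Proof. by rewrite /tens_mul tens_liftE //; apply: tens_mul_balanced. Qed.

Lemma tens_mulDr : right_distributive tens_mul +%R.
Proof.
move=> x y z; move: x; apply: tens_ext => [x x'|x x'|r s].
- by rewrite tens_mulDl.
- by rewrite !tens_mulDl addrACA.
- by rewrite -/(ten r s) !tens_mul_tenl mul_tenD.
Qed.

Lemma tens_mulC : commutative tens_mul.
Proof.
move=> x y; move: x; apply: tens_ext => [x x'|x x'|r s].
- by rewrite tens_mulDl.
- by rewrite tens_mulDr.
- move: y; apply: tens_ext => [y y'|y y'|r' s'].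
  + by rewrite tens_mulDr.
  + by rewrite tens_mulDl.
  + by rewrite -/(ten r s) -/(ten r' s') !tens_mulE mulrC (mulrC s).
Qed.

Lemma tens_mulA : associative tens_mul.
Proof.
move=> x y z; move: x; apply: tens_ext => [x x'|x x'|r s].
- by rewrite tens_mulDl.
- by rewrite !tens_mulDl.
move: y; apply: tens_ext => [y y'|y y'|r' s'].
- by rewrite tens_mulDl tens_mulDr.
- by rewrite tens_mulDr tens_mulDl.
move: z; apply: tens_ext => [z z'|z z'|r'' s''].
- by rewrite !tens_mulDr.
- by rewrite !tens_mulDr.
by rewrite -/(ten r s) -/(ten r' s') -/(ten r'' s'') !tens_mulE !mulrA.
Qed.

Lemma tens_mul1 : left_id (ten 1 1) tens_mul.
Proof.
apply: tens_ext => [x x'|//|r s]; first by rewrite tens_mulDr.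
by rewrite -/(ten r s) tens_mulE !mul1r.
Qed.

HB.instance Definition _ := GRing.Zmodule_isComPzRing.Build tens_alg
  tens_mulA tens_mulC tens_mul1 tens_mulDl.

Lemma tenM r s r' s' : ten r s * ten r' s' = ten (r * r') (s * s').
Proof. exact: tens_mulE. Qed.

Lemma ten_sum (x : tens_alg) : exists s, x = \sum_(p <- s) ten p.1 p.2.
Proof. by exists (repr x); rewrite -[LHS]tens_reprK tens_sumE. Qed.

End TensorAlgebra.

Arguments ten {k R S iR iS} r s.

Section TensorAlgebraMap.
Variables (k R S R' S' : comPzRingType).
Variables (iR : {rmorphism k -> R}) (iS : {rmorphism k -> S}).
Variables (iR' : {rmorphism k -> R'}) (iS' : {rmorphism k -> S'}).
Variables (f : {rmorphism R -> R'}) (g : {rmorphism S -> S'}).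
Hypotheses (fk : f \o iR =1 iR') (gk : g \o iS =1 iS').

Definition tens_alg_map of (f \o iR =1 iR') & (g \o iS =1 iS') :
    tens_alg iR iS -> tens_alg iR' iS' :=
  tens_lift (fun r s => ten (f r) (g s)).

Local Notation fg := (tens_alg_map fk gk).

Lemma tens_alg_map_balanced : balanced
  (fun (c : k) (r : R) => iR c * r) (fun (c : k) (s : S) => iS c * s)
  (fun r s => ten (f r) (g s) : tens_alg iR' iS').
Proof.
split=> [s r r'|r s s'|c r s]; rewrite ?rmorphD ?tenDl ?tenDr //=.
by rewrite !rmorphM /= (fk c : f (iR c) = _) ten_bal (gk c : g (iS c) = _).
Qed.

Lemma tens_alg_mapE r s : fg (ten r s) = ten (f r) (g s).
Proof. exact: (tens_liftE tens_alg_map_balanced). Qed.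

Lemma tens_alg_mapD : {morph fg : x y / x + y}.
Proof. exact: (tens_liftD tens_alg_map_balanced). Qed.

Fact tens_alg_map_zmod : zmod_morphism fg.
Proof.
have h0 : fg 0 = 0 by apply: (@addrI _ (fg 0)); rewrite -tens_alg_mapD !addr0.
move=> x y; rewrite tens_alg_mapD; congr (_ + _).
by apply: (@addrI _ (fg y)); rewrite -tens_alg_mapD !subrr h0.
Qed.

HB.instance Definition _ := GRing.isZmodMorphism.Build _ _ fg tens_alg_map_zmod.

Fact tens_alg_map_monoid : monoid_morphism fg.
Proof.
split; first by rewrite tens_alg_mapE !rmorph1.
move=> x y; move: x; apply: tens_ext => [x x'|x x'|r s].
- by rewrite mulrDl raddfD.
- by rewrite raddfD mulrDl.
move: y; apply: tens_ext => [y y'|y y'|r' s'].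
- by rewrite mulrDr raddfD.
- by rewrite raddfD mulrDr.
by rewrite -/(ten r s) -/(ten r' s') tenM !tens_alg_mapE !rmorphM tenM.
Qed.

HB.instance Definition _ :=
  GRing.isMonoidMorphism.Build _ _ fg tens_alg_map_monoid.

End TensorAlgebraMap.

(* M (x)_A N as a B-module, for a B-module M regarded as an A-module through
   A -> B, and an A-module N *)
Section TensorModule.
Variables (A B : comPzRingType) (i : {rmorphism A -> B}).
Variables (M : lmodType B) (N : lmodType A).

Definition tens_mod :=
  tens (fun (a : A) (m : M) => i a *: m) (fun (a : A) (n : N) => a *: n).
HB.instance Definition _ := GRing.Zmodule.on tens_mod.

Definition mten (m : M) (n : N) : tens_mod := tmk _ _ m n.

Lemma mtenDl n : {morph mten^~ n : m m' / m + m'}. Proof. exact: tmkDl. Qed.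
Lemma mtenDr m : {morph mten m : n n' / n + n'}. Proof. exact: tmkDr. Qed.
Lemma mten_bal a m n : mten (i a *: m) n = mten m (a *: n).
Proof. exact: (@tmk_bal _ _ _ _ _ a). Qed.

Definition mten_scale (b : B) : tens_mod -> tens_mod :=
  tens_lift (fun m n => mten (b *: m) n).

Lemma mten_scale_balanced b : balanced
  (fun (a : A) (m : M) => i a *: m) (fun (a : A) (n : N) => a *: n)
  (fun m n => mten (b *: m) n).
Proof.
split=> [n m m'|m n n'|a m n]; rewrite ?scalerDr ?mtenDl ?mtenDr //.
by rewrite scalerA mulrC -scalerA mten_bal.
Qed.

Lemma mten_scaleE b m n : mten_scale b (mten m n) = mten (b *: m) n.
Proof. exact: (tens_liftE (mten_scale_balanced b)). Qed.

Lemma mten_scaleDr : right_distributive mten_scale +%R.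
Proof. by move=> b; apply: (tens_liftD (mten_scale_balanced b)). Qed.

Fact mten_scaleA b c x : mten_scale b (mten_scale c x) = mten_scale (b * c) x.
Proof.
move: x; apply: tens_ext => [x y|x y|m n]; rewrite ?mten_scaleDr //.
by rewrite -/(mten m n) !mten_scaleE scalerA.
Qed.

Fact mten_scale1 : left_id 1 mten_scale.
Proof.
apply: tens_ext => [x y|x y|m n]; rewrite ?mten_scaleDr //.
by rewrite -/(mten m n) !mten_scaleE scale1r.
Qed.

Fact mten_scaleDl x : {morph mten_scale^~ x : b c / b + c}.
Proof.
move=> b c; move: x; apply: tens_ext => [x y|x y|m n]; rewrite ?mten_scaleDr //.
  by rewrite addrACA.
by rewrite -/(mten m n) !mten_scaleE scalerDl mtenDl.
Qed.

HB.instance Definition _ := GRing.Zmodule_isLmodule.Build B tens_mod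
  mten_scaleA mten_scale1 mten_scaleDr mten_scaleDl.

Lemma mtenZ b m n : b *: mten m n = mten (b *: m) n.
Proof. exact: mten_scaleE. Qed.

End TensorModule.

Arguments mten {A B i M N} m n.

(* f (x) g; the hypotheses below, with the scalars transported along s, are what
   makes it well defined *)
Section TensorModuleMap.
Variables (A B : comPzRingType) (i : {rmorphism A -> B}).
Variables (M : lmodType B) (N : lmodType A).
Variables (A' B' : comPzRingType) (i' : {rmorphism A' -> B'}).
Variables (M' : lmodType B') (N' : lmodType A').
Variables (f : M -> M') (g : N -> N').

Definition tens_mod_map : tens_mod i M N -> tens_mod i' M' N' :=
  tens_lift (fun m n => mten (f m) (g n)).

Variable s : A -> A'.
Hypotheses (fD : {morph f : x y / x + y}) (gD : {morph g : x y / x + y}).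
Hypotheses (fs : forall a m, f (i a *: m) = i' (s a) *: f m).
Hypotheses (gs : forall a n, g (a *: n) = s a *: g n).

Lemma tens_mod_map_balanced : balanced
  (fun (a : A) (m : M) => i a *: m) (fun (a : A) (n : N) => a *: n)
  (fun m n => mten (f m) (g n) : tens_mod i' M' N').
Proof.
by split=> [n m m'|m n n'|a m n]; rewrite ?fD ?gD ?mtenDl ?mtenDr ?fs ?gs ?mten_bal.
Qed.

Lemma tens_mod_mapE m n : tens_mod_map (mten m n) = mten (f m) (g n).
Proof. exact: (tens_liftE tens_mod_map_balanced). Qed.

Lemma tens_mod_mapD : {morph tens_mod_map : x y / x + y}.
Proof. exact: (tens_liftD tens_mod_map_balanced). Qed.

Lemma tens_mod_mapZ (h : B -> B') :
  (forall b m, f (b *: m) = h b *: f m) ->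
  forall b x, tens_mod_map (b *: x) = h b *: tens_mod_map x.
Proof.
move=> fh b; apply: tens_ext => [x y|x y|m n].
- by rewrite scalerDr tens_mod_mapD.
- by rewrite tens_mod_mapD scalerDr.
- by rewrite -/(mten m n) mtenZ !tens_mod_mapE fh mtenZ.
Qed.

End TensorModuleMap.

Definition restr (A B : pzRingType) (i : {rmorphism A -> B}) (M : lmodType B) :
  Type := M.

Section RestrictionOfScalars.
Variables (A B : pzRingType) (i : {rmorphism A -> B}) (M : lmodType B).
Local Notation rM := (restr i M).

HB.instance Definition _ := GRing.Zmodule.copy rM M.

Definition restr_scale (a : A) (m : rM) : rM := i a *: (m : M).

Fact restr_scaleA a b m : restr_scale a (restr_scale b m) = restr_scale (a * b) m.
Proof. by rewrite /restr_scale scalerA rmorphM. Qed.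
Fact restr_scale1 : left_id 1 restr_scale.
Proof. by move=> m; rewrite /restr_scale rmorph1 scale1r. Qed.
Fact restr_scaleDr : right_distributive restr_scale +%R.
Proof. by move=> a m n; apply: scalerDr. Qed.
Fact restr_scaleDl m : {morph restr_scale^~ m : a b / a + b}.
Proof. by move=> a b; rewrite /restr_scale rmorphD scalerDl. Qed.

HB.instance Definition _ := GRing.Zmodule_isLmodule.Build A rM
  restr_scaleA restr_scale1 restr_scaleDr restr_scaleDl.

End RestrictionOfScalars.

Record submodule (R : pzRingType) (V : lmodType R) := Submodule {
  in_submod :> V -> Prop;
  submod0 : in_submod 0;
  submodD : forall x y, in_submod x -> in_submod y -> in_submod (x + y);
  submodZ : forall a x, in_submod x -> in_submod (a *: x) }.

Section GeneratedSubmodule.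
Variables (R : pzRingType) (V : lmodType R) (P : V -> Prop).

Inductive in_span : V -> Prop :=
| span_0 : in_span 0
| span_D x y : in_span x -> in_span y -> in_span (x + y)
| span_Z a x : in_span x -> in_span (a *: x)
| span_gen x : P x -> in_span x.

Definition span : submodule V := Submodule span_0 span_D span_Z.
End GeneratedSubmodule.

Section QuotientModule.
Variables (R : pzRingType) (V : lmodType R) (S : submodule V).

Definition submod_pred : {pred V} := fun x => `[< S x >].

Fact submod_pred_zmod : zmod_closed submod_pred.
Proof.
split=> [|x y /asboolP Sx /asboolP Sy]; apply/asboolP; first exact: submod0.
by apply: submodD => //; rewrite -scaleN1r; apply: submodZ.
Qed.

HB.instance Definition _ := GRing.isZmodClosed.Build V submod_pred submod_pred_zmod.

Definition quot_mod : Type := {ideal_quot submod_pred}.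
HB.instance Definition _ := GRing.Zmodule.on quot_mod.

Definition quot_pi (x : V) : quot_mod := \pi x.

Lemma quot_piP x y : quot_pi x = quot_pi y <-> S (x - y).
Proof.
split=> [/eqP|Sxy]; first by rewrite -Quotient.idealrBE => /asboolP.
by apply/eqP; rewrite -Quotient.idealrBE; apply/asboolP.
Qed.

Lemma quot_pi_repr (x : quot_mod) : quot_pi (repr x) = x.
Proof. exact: reprK. Qed.

Lemma quot_piD : {morph quot_pi : x y / x + y}.
Proof. by move=> x y; rewrite /quot_pi raddfD. Qed.

Definition quot_scale (a : R) (x : quot_mod) : quot_mod := quot_pi (a *: repr x).

Lemma quot_scaleE a x : quot_scale a (quot_pi x) = quot_pi (a *: x).
Proof.
by apply/quot_piP; rewrite -scalerBr; apply/submodZ/quot_piP/quot_pi_repr.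
Qed.

Fact quot_scaleA a b x : quot_scale a (quot_scale b x) = quot_scale (a * b) x.
Proof. by rewrite -(quot_pi_repr x) !quot_scaleE scalerA. Qed.
Fact quot_scale1 : left_id 1 quot_scale.
Proof. by move=> x; rewrite -(quot_pi_repr x) quot_scaleE scale1r. Qed.
Fact quot_scaleDr : right_distributive quot_scale +%R.
Proof.
move=> a x y; rewrite -(quot_pi_repr x) -(quot_pi_repr y) -quot_piD.
by rewrite !quot_scaleE scalerDr quot_piD.
Qed.
Fact quot_scaleDl x : {morph quot_scale^~ x : a b / a + b}.
Proof.
by move=> a b; rewrite -(quot_pi_repr x) !quot_scaleE scalerDl quot_piD.
Qed.

HB.instance Definition _ := GRing.Zmodule_isLmodule.Build R quot_mod
  quot_scaleA quot_scale1 quot_scaleDr quot_scaleDl.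

End QuotientModule.

(* The module of Kaehler differentials of the commutative k-algebra A: the
   quotient of A (x)_k A, where a (x) b stands for a db, by the Leibniz rule *)
Section Kaehler.
Variables (k A : comPzRingType) (i : {rmorphism k -> A}).

Local Notation AA := (tens_mod i A^o (restr i A^o)).

Definition tensor_d (a b : A) : AA := mten (a : A^o) (b : restr i A^o).

Definition leibniz_rel (w : AA) : Prop := exists b c : A,
  w = tensor_d 1 (b * c) - tensor_d b c - tensor_d c b.

Definition Kaehler : Type := quot_mod (span leibniz_rel).
HB.instance Definition _ := GRing.Lmodule.on Kaehler.

End Kaehler.

Record filtration (R : comPzRingType) := Filtration {
  fil :> int -> R -> Prop;
  fil_0 : forall n, fil n 0;
  fil_B : forall n x y, fil n x -> fil n y -> fil n (x - y);
  fil_S : forall m n x, m <= n -> fil n x -> fil m x;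
  fil_M : forall m n x y, fil m x -> fil n y -> fil (m + n) (x * y);
  fil_1 : fil 0 1;
  fil_ex : forall x, exists n, fil n x }.

Section FilLemmas.
Variables (R : comPzRingType) (U : filtration R).

Lemma fil_N n x : U n x -> U n (- x).
Proof. by move=> Ux; rewrite -sub0r; apply: fil_B => //; apply: fil_0. Qed.
Lemma fil_D n x y : U n x -> U n y -> U n (x + y).
Proof. by move=> Ux Uy; rewrite -[y]opprK; apply: fil_B => //; apply: fil_N. Qed.

End FilLemmas.

(* Completion of R for the topology in which the U n are a basis of
   neighborhoods of 0: Cauchy sequences modulo null sequences *)
Section Completion.
Variables (R : comPzRingType) (U : filtration R).

Definition is_cauchy (u : nat -> R) := forall n : int, exists N : nat,
  forall i j, (N <= i)%N -> (N <= j)%N -> U n (u i - u j).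
Definition is_null (u : nat -> R) := forall n : int, exists N : nat,
  forall i, (N <= i)%N -> U n (u i).

Definition cauchy_pred : {pred nat -> R} := fun u => `[< is_cauchy u >].

Lemma cauchy_bounded u : is_cauchy u -> exists n, forall i, U n (u i).
Proof.
move=> /(_ 0)[N uN].
have [m um] : exists m, forall i, (i <= N)%N -> U m (u i).
  elim: (N) => [|k [m um]].
    by have [m um] := fil_ex U (u 0); exists m => i; rewrite leqn0 => /eqP->.
  have [m' um'] := fil_ex U (u k.+1); exists (Num.min m m') => i.
  rewrite leq_eqVlt => /orP[/eqP->|]; first by apply: fil_S um'; lia.
  by rewrite ltnS => /um; apply: fil_S; lia.
exists (Num.min m 0) => i; have [/um|/ltnW Ni] := leqP i N.
  by apply: fil_S; lia.
rewrite -[u i](subrK (u N)); apply: fil_D.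
  by apply: fil_S (uN _ _ Ni (leqnn _)); lia.
by apply: fil_S (um _ (leqnn N)); lia.
Qed.

Fact cauchy_subring : subring_closed cauchy_pred.
Proof.
split=> [|u v /asboolP uC /asboolP vC|u v /asboolP uC /asboolP vC].
- by apply/asboolP => n; exists 0 => i j _ _; rewrite subrr; apply: fil_0.
- apply/asboolP => n; have [[N uN] [N' vN]] := (uC n, vC n).
  exists (maxn N N') => i j; rewrite !geq_max => /andP[Ni N'i] /andP[Nj N'j].
  have -> : (u - v) i - (u - v) j = (u i - u j) - (v i - v j).
    by rewrite -[LHS]/((u i - v i) - (u j - v j)); ring.
  by apply: fil_B; [apply: uN | apply: vN].
- apply/asboolP => n; have [[a ua] [b vb]] := (cauchy_bounded uC, cauchy_bounded vC).
  have [[N uN] [N' vN]] := (uC (n - b), vC (n - a)).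
  exists (maxn N N') => i j; rewrite !geq_max => /andP[Ni N'i] /andP[Nj N'j].
  have -> : (u * v) i - (u * v) j = (u i - u j) * v i + u j * (v i - v j).
    by rewrite -[LHS]/(u i * v i - u j * v j); ring.
  apply: fil_D.
    by rewrite -[n](subrK b); apply: fil_M => //; apply: uN.
  by rewrite -[n](subrKC a); apply: fil_M => //; apply: vN.
Qed.

HB.instance Definition _ :=
  GRing.isSubringClosed.Build (nat -> R) cauchy_pred cauchy_subring.

Definition cauchy_seq : Type := {u : nat -> R | cauchy_pred u}.
HB.instance Definition _ := SubChoice.on cauchy_seq.
HB.instance Definition _ := 
  GRing.SubChoice_isSubComPzRing.Build _ cauchy_pred cauchy_seq cauchy_subring.

Lemma cauchy_seqP (u : cauchy_seq) : is_cauchy (val u).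
Proof. by case: u => u /= /asboolP. Qed.

Definition mk_cauchy u (uC : is_cauchy u) : cauchy_seq :=
  Sub u (introT (asboolP (is_cauchy u)) uC).

Definition null_pred : {pred cauchy_seq} := fun u => `[< is_null (val u) >].

Fact null_zmod : zmod_closed null_pred.
Proof.
split=> [|u v /asboolP u0 /asboolP v0]; apply/asboolP.
  by move=> n; exists 0 => i _; apply: fil_0.
move=> n; have [[N uN] [N' vN]] := (u0 n, v0 n).
exists (maxn N N') => i; rewrite !geq_max => /andP[Ni N'i].
by apply: fil_B; [apply: uN | apply: vN].
Qed.

HB.instance Definition _ := GRing.isZmodClosed.Build cauchy_seq null_pred null_zmod.

Lemma null_mul (u v : cauchy_seq) : is_null (val v) -> is_null (val (u * v)).
Proof.
move=> v0 n; have [a ua] := cauchy_bounded (cauchy_seqP u).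
have [N vN] := v0 (n - a); exists N => i Ni.
by rewrite -[n](subrKC a); apply: fil_M => //; apply: vN.
Qed.

Definition compl : Type := {ideal_quot null_pred}.
HB.instance Definition _ := GRing.Zmodule.on compl.

Definition lim_of (u : cauchy_seq) : compl := \pi u.

Lemma lim_ofP u v : lim_of u = lim_of v <-> is_null (val u - val v).
Proof.
split=> [/eqP|uv]; first by rewrite -Quotient.idealrBE => /asboolP.
by apply/eqP; rewrite -Quotient.idealrBE; apply/asboolP.
Qed.

Lemma lim_of_repr (x : compl) : lim_of (repr x) = x.
Proof. exact: reprK. Qed.

Lemma lim_ofD : {morph lim_of : u v / u + v}.
Proof. by move=> u v; rewrite /lim_of raddfD. Qed.
Lemma lim_of0 : lim_of 0 = 0.
Proof. by rewrite /lim_of raddf0. Qed.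
Lemma lim_of_eq0 u : lim_of u = 0 <-> is_null (val u).
Proof. by rewrite -lim_of0 lim_ofP subr0. Qed.
Lemma lim_ofB : {morph lim_of : u v / u - v}.
Proof. by move=> u v; rewrite /lim_of raddfB. Qed.

Definition compl_mul (x y : compl) : compl := lim_of (repr x * repr y).

Lemma compl_mulE u v : compl_mul (lim_of u) (lim_of v) = lim_of (u * v).
Proof.
apply/lim_ofP; set u' := repr _; set v' := repr _.
have -> : val (u' * v') - val (u * v) = val (u' * (v' - v) + v * (u' - u)).
  by rewrite -raddfB; congr val; ring.
move=> n.
have /lim_ofP uu' : lim_of u' = lim_of u by apply: lim_of_repr.
have /lim_ofP vv' : lim_of v' = lim_of v by apply: lim_of_repr.
have [[N uN] [N' vN]] := (null_mul v (v := u' - u) uu' n, null_mul u' (v := v' - v) vv' n).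
exists (maxn N N') => i; rewrite !geq_max => /andP[Ni N'i].
by apply: fil_D; [apply: vN | apply: uN].
Qed.

Fact compl_mulA : associative compl_mul.
Proof.
move=> x y z; rewrite -(lim_of_repr x) -(lim_of_repr y) -(lim_of_repr z).
by rewrite !compl_mulE mulrA.
Qed.
Fact compl_mulC : commutative compl_mul.
Proof. by move=> x y; rewrite /compl_mul mulrC. Qed.
Fact compl_mul1 : left_id (lim_of 1) compl_mul.
Proof. by move=> x; rewrite -(lim_of_repr x) compl_mulE mul1r. Qed.
Fact compl_mulDl : left_distributive compl_mul +%R.
Proof.
move=> x y z; rewrite -(lim_of_repr x) -(lim_of_repr y) -(lim_of_repr z).
by rewrite -lim_ofD !compl_mulE mulrDl lim_ofD.
Qed.

HB.instance Definition _ := GRing.Zmodule_isComPzRing.Build compl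
  compl_mulA compl_mulC compl_mul1 compl_mulDl.

Lemma lim_ofM : {morph lim_of : u v / u * v}.
Proof. by move=> u v; rewrite -compl_mulE. Qed.

Fact const_cauchy (x : R) : is_cauchy (fun=> x).
Proof. by move=> n; exists 0 => i j _ _; rewrite subrr; apply: fil_0. Qed.

Definition compl_in (x : R) : compl := lim_of (mk_cauchy (const_cauchy x)).

Fact compl_in_zmod : zmod_morphism compl_in.
Proof. by move=> x y; rewrite -[RHS]lim_ofB; congr lim_of; apply: val_inj. Qed.
HB.instance Definition _ := GRing.isZmodMorphism.Build R compl compl_in compl_in_zmod.
Fact compl_in_monoid : monoid_morphism compl_in.
Proof.
split=> [|x y]; first by congr lim_of; apply: val_inj.
by rewrite -[RHS]lim_ofM; congr lim_of; apply: val_inj.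
Qed.
HB.instance Definition _ := GRing.isMonoidMorphism.Build R compl compl_in compl_in_monoid.

Definition in_cfil (n : int) (x : compl) := exists2 u, x = lim_of u &
  exists N, forall i, (N <= i)%N -> U n (val u i).

Fact cfil_0 n : in_cfil n 0.
Proof.
by exists 0; [rewrite lim_of0 | exists 0 => i _; apply: fil_0].
Qed.
Fact cfil_B n x y : in_cfil n x -> in_cfil n y -> in_cfil n (x - y).
Proof.
move=> [u -> [N uN]] [v -> [N' vN]]; exists (u - v); first by rewrite lim_ofB.
exists (maxn N N') => i; rewrite !geq_max => /andP[Ni N'i].
by apply: fil_B; [apply: uN | apply: vN].
Qed.
Fact cfil_S m n x : m <= n -> in_cfil n x -> in_cfil m x.
Proof. by move=> mn [u -> [N uN]]; exists u => //; exists N => i /uN; apply: fil_S. Qed.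
Fact cfil_M m n x y : in_cfil m x -> in_cfil n y -> in_cfil (m + n) (x * y).
Proof.
move=> [u -> [N uN]] [v -> [N' vN]]; exists (u * v); first by rewrite lim_ofM.
exists (maxn N N') => i; rewrite !geq_max => /andP[Ni N'i].
by apply: fil_M; [apply: uN | apply: vN].
Qed.
Fact cfil_1 : in_cfil 0 1.
Proof. by exists 1 => //; exists 0 => i _; apply: fil_1. Qed.
Fact cfil_ex x : exists n, in_cfil n x.
Proof.
have [n un] := cauchy_bounded (cauchy_seqP (repr x)).
by exists n, (repr x); [rewrite lim_of_repr | exists 0 => i _; apply: un].
Qed.

Definition cfil : filtration compl :=
  Filtration cfil_0 cfil_B cfil_S cfil_M cfil_1 cfil_ex.

End Completion.

Section CompletionMap.
Variables (R S : comPzRingType) (U : filtration R) (V : filtration S).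
Variables (h : {rmorphism R -> S}) (hUV : forall n x, U n x -> V n (h x)).

Fact compl_map_cauchy (u : cauchy_seq U) : is_cauchy V (h \o val u).
Proof.
move=> n; have [N uN] := cauchy_seqP u n; exists N => i j Ni Nj.
by rewrite /= -rmorphB; apply/hUV/uN.
Qed.

Definition cauchy_map u : cauchy_seq V := mk_cauchy (compl_map_cauchy u).

Definition compl_map (x : compl U) : compl V := lim_of (cauchy_map (repr x)).

Local Notation hh := compl_map.

Lemma compl_mapE u : hh (lim_of u) = lim_of (cauchy_map u).
Proof.
apply/lim_ofP => n; set u' := repr _.
have /lim_ofP/(_ n)[N uN] : lim_of u' = lim_of u by apply: lim_of_repr.
exists N => i /uN /hUV; rewrite [(_ - _) i]/=.
by have -> : (val u' - val u) i = val u' i - val u i by []; rewrite rmorphB.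
Qed.

Lemma compl_map_in x : hh (compl_in U x) = compl_in V (h x).
Proof. by rewrite compl_mapE; congr lim_of; apply: val_inj. Qed.

Fact compl_map_zmod : zmod_morphism hh.
Proof.
move=> x y; rewrite -(lim_of_repr x) -(lim_of_repr y) -lim_ofB !compl_mapE.
rewrite -lim_ofB; congr lim_of; apply: val_inj; apply/funext => i /=.
exact: rmorphB.
Qed.
HB.instance Definition _ := GRing.isZmodMorphism.Build _ _ hh compl_map_zmod.

Fact compl_map_monoid : monoid_morphism hh.
Proof.
split.
  rewrite -[1 in LHS]/(lim_of 1) compl_mapE; congr lim_of; apply: val_inj.
  by apply/funext => i /=; apply: rmorph1.
move=> x y; rewrite -(lim_of_repr x) -(lim_of_repr y) -lim_ofM !compl_mapE.
rewrite -lim_ofM; congr lim_of; apply: val_inj; apply/funext => i /=.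
exact: rmorphM.
Qed.
HB.instance Definition _ := GRing.isMonoidMorphism.Build _ _ hh compl_map_monoid.

End CompletionMap.

Section FilRing.
Variables (R : comPzRingType) (U : filtration R).

Definition fil_pred : {pred R} := fun x => `[< U 0 x >].
Fact fil_subring : subring_closed fil_pred.
Proof.
split=> [|x y /asboolP Ux /asboolP Uy|x y /asboolP Ux /asboolP Uy];
  apply/asboolP; [exact: fil_1 | exact: fil_B | rewrite -[0]addr0; exact: fil_M].
Qed.
HB.instance Definition _ := GRing.isSubringClosed.Build R fil_pred fil_subring.

Definition fil_ring : Type := {x : R | fil_pred x}.
HB.instance Definition _ := SubChoice.on fil_ring.
HB.instance Definition _ := 
  GRing.SubChoice_isSubComPzRing.Build _ fil_pred fil_ring fil_subring.

Definition fil_val : fil_ring -> R := val.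
HB.instance Definition _ := GRing.RMorphism.on fil_val.

End FilRing.

(* The filtration of R (x)_k S by the images of the (U n) (x)_k S *)
Section TensorFiltration.
Variables (k R S : comPzRingType).
Variables (iR : {rmorphism k -> R}) (iS : {rmorphism k -> S}).
Variable U : filtration R.
Local Notation RS := (tens_alg iR iS).

Definition in_tens_fil (n : int) (x : RS) := exists2 s : seq (R * S),
  (forall p, p \in s -> U n p.1) & x = \sum_(p <- s) ten p.1 p.2.

Fact tens_fil_0 n : in_tens_fil n 0.
Proof. by exists [::]; rewrite ?big_nil. Qed.
Fact tens_fil_B n x y : in_tens_fil n x -> in_tens_fil n y -> in_tens_fil n (x - y).
Proof.
move=> [s sU ->] [t tU ->]; exists (s ++ [seq (- p.1, p.2) | p <- t]).
  move=> p; rewrite mem_cat => /orP[/sU//|/mapP[r /tU rU ->]].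
  exact: fil_N.
rewrite big_cat big_map /=; congr (_ + _); rewrite -sumrN; apply: eq_bigr => p _.
apply: (@addrI _ (ten p.1 p.2)); rewrite subrr -tenDl subrr.
by apply: (@addrI _ (ten 0 p.2)); rewrite -tenDl !addr0.
Qed.
Fact tens_fil_S m n x : m <= n -> in_tens_fil n x -> in_tens_fil m x.
Proof. by move=> mn [s sU ->]; exists s => // p /sU; apply: fil_S. Qed.
Fact tens_fil_M m n x y :
  in_tens_fil m x -> in_tens_fil n y -> in_tens_fil (m + n) (x * y).
Proof.
move=> [s sU ->] [t tU ->].
exists [seq (p.1 * r.1, p.2 * r.2) | p <- s, r <- t].
  by move=> p /allpairsP[[p1 p2] [/sU U1 /tU U2 ->]]; apply: fil_M.
rewrite big_distrlr big_allpairs_dep /=.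
by apply: eq_bigr => p _; apply: eq_bigr => r _; rewrite tenM.
Qed.
Fact tens_fil_1 : in_tens_fil 0 1.
Proof.
exists [:: (1, 1)]; last by rewrite big_seq1.
by move=> p; rewrite inE => /eqP->; apply: fil_1.
Qed.
Fact tens_fil_ex x : exists n, in_tens_fil n x.
Proof.
have [s ->] := ten_sum x; elim: s => [|p s [n IHn]].
  by exists 0; rewrite big_nil; apply: tens_fil_0.
have [m Um] := fil_ex U p.1; exists (Num.min m n); rewrite big_cons.
rewrite -[X in _ + X]opprK; apply: tens_fil_B.
  exists [:: p]; last by rewrite big_seq1.
  by move=> r; rewrite inE => /eqP->; apply: fil_S Um; lia.
rewrite -[X in in_tens_fil _ X]sub0r; apply: tens_fil_B.
  exact: tens_fil_0.
by apply: tens_fil_S IHn; lia.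
Qed.

Definition tens_fil : filtration RS :=
  Filtration tens_fil_0 tens_fil_B tens_fil_S tens_fil_M tens_fil_1 tens_fil_ex.

End TensorFiltration.

(* A function field F of one variable over Fq and its places; the closed points
   of the smooth projective curve with function field F are the normalized
   discrete valuations of F that are trivial on Fq *)
Section FunctionField.
Variables (Fq : finFieldType) (F : fieldType) (iF : {rmorphism Fq -> F}).

Definition is_function_field : Prop := exists x : F,
  (forall f : {poly Fq}, f != 0 -> (map_poly iF f).[x] != 0) /\
  exists (n : nat) (b : 'I_n -> F), forall y : F,
    exists (d : {poly Fq}) (c : 'I_n -> {poly Fq}), d != 0 /\
      y * (map_poly iF d).[x] = \sum_i (map_poly iF (c i)).[x] * b i.

(* [ord0] only fixes the irrelevant value at 0, so that a place is determined
   by its valuation. *)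
Record place := Place {
  ord :> F -> int;
  ord0 : ord 0 = 0;
  ordM : forall x y, x != 0 -> y != 0 -> ord (x * y) = ord x + ord y;
  ordD : forall x y, x != 0 -> y != 0 -> x + y != 0 ->
    Num.min (ord x) (ord y) <= ord (x + y);
  ord_const : forall c : Fq, ord (iF c) = 0;
  ord_surj : forall n, exists2 x, x != 0 & ord x = n }.

Definition ord_ge (v : place) (n : int) (x : F) : Prop := x = 0 \/ n <= ord v x.

Section PlaceFiltration.
Variable v : place.

Lemma ord1 : ord v 1 = 0. Proof. by rewrite -(rmorph1 iF) ord_const. Qed.

Lemma ordN1 : ord v (-1) = 0.
Proof. by rewrite -(rmorph1 iF) -rmorphN ord_const. Qed.

Fact ord_ge_0 n : ord_ge v n 0. Proof. by left. Qed.

Fact ord_ge_B n x y : ord_ge v n x -> ord_ge v n y -> ord_ge v n (x - y).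
Proof.
case: (eqVneq x 0) => [->|x0] nx; case: (eqVneq y 0) => [->|y0] ny.
- by rewrite subr0; left.
- case: ny => [/eqP|ny]; first by rewrite (negPf y0).
  by right; rewrite sub0r -mulN1r ordM ?oppr_eq0 ?oner_eq0 // ordN1 add0r.
- by rewrite subr0.
- case: nx => [/eqP|nx]; first by rewrite (negPf x0).
  case: ny => [/eqP|ny]; first by rewrite (negPf y0).
  case: (eqVneq (x - y) 0) => [->|xy0]; first by left.
  have ny0 : - y != 0 by rewrite oppr_eq0.
  have Dxy := ordD v x0 ny0 xy0; right; apply: le_trans Dxy.
  rewrite -mulN1r ordM ?oppr_eq0 ?oner_eq0 // ordN1 add0r.
  by rewrite le_min nx ny.
Qed.

Fact ord_ge_S m n x : m <= n -> ord_ge v n x -> ord_ge v m x.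
Proof. by move=> mn [->|nx]; [left | right; apply: le_trans mn nx]. Qed.

Fact ord_ge_M m n x y :
  ord_ge v m x -> ord_ge v n y -> ord_ge v (m + n) (x * y).
Proof.
move=> [->|mx]; first by rewrite mul0r; left.
move=> [->|ny]; first by rewrite mulr0; left.
case: (eqVneq x 0) => [->|x0]; first by rewrite mul0r; left.
case: (eqVneq y 0) => [->|y0]; first by rewrite mulr0; left.
by right; rewrite ordM // lerD.
Qed.

Fact ord_ge_1 : ord_ge v 0 1. Proof. by right; rewrite ord1. Qed.
Fact ord_ge_ex x : exists n, ord_ge v n x.
Proof. by exists (ord v x); right. Qed.

Definition place_fil : filtration F :=
  Filtration ord_ge_0 ord_ge_B ord_ge_S ord_ge_M ord_ge_1 ord_ge_ex.

Definition completion : Type := compl place_fil.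
HB.instance Definition _ := GRing.ComPzRing.on completion.

Fact completion_nz : 1 != 0 :> completion.
Proof.
apply/eqP => /lim_of_eq0/(_ 1)[N /(_ N (leqnn N))[|] /=].
  by move/eqP; rewrite oner_eq0.
by rewrite ord1.
Qed.

HB.instance Definition _ :=
  GRing.PzSemiRing_isNonZero.Build completion completion_nz.

Lemma ordV x : x != 0 -> ord v x^-1 = - ord v x.
Proof.
move=> x0; apply: (@addrI _ (ord v x)); rewrite subrr -ordM ?invr_eq0 //.
by rewrite mulfV // ord1.
Qed.

Lemma not_null_away (u : cauchy_seq place_fil) : ~ is_null place_fil (val u) ->
  exists n N, forall i, (N <= i)%N -> val u i != 0 /\ ord_ge v (- n) (val u i)^-1.
Proof.
move=> /existsNP[n]; rewrite -forallNE => un.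
have [N uN] := cauchy_seqP u n; exists n, N => i Ni.
have /existsNP[i0] := un N; rewrite not_implyE => -[Ni0 ui0].
have ui : ~ ord_ge v n (val u i).
  move=> uin; apply: ui0; rewrite -[val u i0](subrK (val u i)).
  apply: (@fil_D _ place_fil) => //; exact: uN.
have u0 : val u i != 0 by apply/eqP => u0; apply: ui; left.
split=> //; right; rewrite ordV // lerN2 ltW // ltNge.
by apply/negP => nu; apply: ui; right.
Qed.

Lemma inv_cauchy (u : cauchy_seq place_fil) : ~ is_null place_fil (val u) ->
  is_cauchy place_fil (fun i => (val u i)^-1).
Proof.
move=> /not_null_away[n [N uN]] k.
have [N' uN'] := cauchy_seqP u (k + n + n).
exists (maxn N N') => i j; rewrite !geq_max => /andP[Ni N'i] /andP[Nj N'j].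
have [[ui uin] [uj ujn]] := (uN _ Ni, uN _ Nj).
have -> : (val u i)^-1 - (val u j)^-1 =
    (val u j - val u i) * (val u i)^-1 * (val u j)^-1 by field; rewrite ui uj.
have -> : k = (k + n + n) + (- n) + (- n) by ring.
by apply: ord_ge_M => //; apply: ord_ge_M => //; apply: uN'.
Qed.

Definition inv_seq (u : cauchy_seq place_fil) : cauchy_seq place_fil :=
  if pselect (~ is_null place_fil (val u)) is left u0
  then mk_cauchy (inv_cauchy u0) else 0.

Definition completion_inv (x : completion) : completion := lim_of (inv_seq (repr x)).

Fact completion_mulV (x : completion) : x != 0 -> completion_inv x * x = 1.
Proof.
rewrite /completion_inv -{1 3}[x]lim_of_repr; set u := repr x => /eqP x0.
have u0 : ~ is_null place_fil (val u).
  by move=> u0; apply: x0; apply/lim_of_eq0.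
rewrite -lim_ofM; apply/(lim_ofP _ 1) => n.
rewrite /inv_seq; case: pselect => // u0'.
have [m [N uN]] := not_null_away u0; exists N => i /uN[ui _].
by left; rewrite -[LHS]/((val u i)^-1 * val u i - 1) mulVf // subrr.
Qed.

Fact completion_inv0 : completion_inv 0 = 0.
Proof.
rewrite /completion_inv /inv_seq; case: pselect => [u0|_]; last exact: lim_of0.
by case: u0; apply/lim_of_eq0/lim_of_repr.
Qed.

HB.instance Definition _ :=
  GRing.ComNzRing_isField.Build completion completion_mulV completion_inv0.

Definition compl_fil : filtration completion := cfil place_fil.

Definition completion_in (x : F) : completion := compl_in place_fil x.
HB.instance Definition _ := GRing.isZmodMorphism.Build F completion completion_in
  (@compl_in_zmod _ place_fil).
HB.instance Definition _ := GRing.isMonoidMorphism.Build F completion completion_in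
  (@compl_in_monoid _ place_fil).

End PlaceFiltration.

Variable inf : place.

Definition regular_pred : {pred F} :=
  fun f => `[< forall v : place, ~ (ord v =1 ord inf) -> ord_ge v 0 f >].

Fact regular_subring : subring_closed regular_pred.
Proof.
split=> [|x y /asboolP xr /asboolP yr|x y /asboolP xr /asboolP yr];
  apply/asboolP => v vinf; first exact: ord_ge_1.
- by apply: ord_ge_B; [apply: xr | apply: yr].
- by rewrite -[0]addr0; apply: ord_ge_M; [apply: xr | apply: yr].
Qed.

Definition regular : Type := {f : F | regular_pred f}.
HB.instance Definition _ := SubChoice.on regular.
HB.instance Definition _ :=
  GRing.SubChoice_isSubComPzRing.Build F regular_pred regular regular_subring.

Definition reg_val : regular -> F := val.
HB.instance Definition _ := GRing.RMorphism.on reg_val.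

Fact const_regular (c : Fq) : regular_pred (iF c).
Proof. by apply/asboolP => v _; right; rewrite ord_const. Qed.

Definition reg_const (c : Fq) : regular := Sub (iF c) (const_regular c).

Fact reg_const_zmod : zmod_morphism reg_const.
Proof. by move=> x y; apply: val_inj; rewrite /= rmorphB. Qed.
HB.instance Definition _ :=
  GRing.isZmodMorphism.Build Fq regular reg_const reg_const_zmod.
Fact reg_const_monoid : monoid_morphism reg_const.
Proof. by split=> [|x y]; apply: val_inj; rewrite /= ?rmorph1 ?rmorphM. Qed.
HB.instance Definition _ :=
  GRing.isMonoidMorphism.Build Fq regular reg_const reg_const_monoid.

(* dim_Fq (A / A a) = d: some d elements represent each class modulo A a by a
   unique Fq-linear combination *)
Definition is_degA (a : regular) (d : nat) : Prop :=
  exists b : 'I_d -> regular, forall x : regular,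
    exists! c : {ffun 'I_d -> Fq}, exists y : regular,
      x = \sum_i reg_const (c i) * b i + y * a.

Record finite_place := FinitePlace {
  fin_place :> place;
  fin_placeP : ~ (ord fin_place =1 ord inf) }.

Section FinitePlace.
Variable p : finite_place.

Lemma reg_ord_ge (a : regular) : ord_ge p 0 (reg_val a).
Proof. by have /asboolP := valP a; apply; apply: fin_placeP. Qed.

(* A_p inside F_p *)
Definition complA : Type := fil_ring (compl_fil p).
HB.instance Definition _ := GRing.ComPzRing.on complA.
Definition complA_val : complA -> completion p := val.
HB.instance Definition _ := GRing.RMorphism.on complA_val.

Fact reg_complA (a : regular) : fil_pred (compl_fil p) (completion_in p (reg_val a)).
Proof.
by apply/asboolP; exists (mk_cauchy (const_cauchy (place_fil p) (reg_val a))) => //;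
  exists 0 => i _; apply: reg_ord_ge.
Qed.

Definition reg_in (a : regular) : complA := Sub _ (reg_complA a).
Fact reg_in_zmod : zmod_morphism reg_in.
Proof. by move=> x y; apply: val_inj; rewrite /= !rmorphB. Qed.
HB.instance Definition _ := GRing.isZmodMorphism.Build _ _ reg_in reg_in_zmod.
Fact reg_in_monoid : monoid_morphism reg_in.
Proof. by split=> [|x y]; apply: val_inj; rewrite /= ?rmorph1 ?rmorphM. Qed.
HB.instance Definition _ := GRing.isMonoidMorphism.Build _ _ reg_in reg_in_monoid.

(* F_p / A_p, as an A_p-module *)
Local Notation FpA := (restr complA_val (completion p)^o).

Fact complA_submodZ (a : complA) (x : FpA) :
  compl_fil p 0 x -> compl_fil p 0 (a *: x).
Proof.
by move=> x0; rewrite -[0]addr0; apply: fil_M => //; have /asboolP := valP a.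
Qed.

Fact complA_submod0 : compl_fil p 0 (0 : FpA).
Proof. exact: fil_0. Qed.

Fact complA_submodD (x y : FpA) :
  compl_fil p 0 x -> compl_fil p 0 y -> compl_fil p 0 (x + y).
Proof. exact: fil_D. Qed.

Definition complA_submod : submodule FpA :=
  Submodule complA_submod0 complA_submodD complA_submodZ.

Definition FmodA : Type := quot_mod complA_submod.
HB.instance Definition _ := GRing.Lmodule.on FmodA.

Definition in_place_ideal (a : regular) : Prop := ord_ge p 1 (reg_val a).

Fixpoint in_ideal_pow (n : nat) (a : regular) : Prop :=
  if n is m.+1 then
    exists2 s : seq (regular * regular),
      (forall t, t \in s -> in_place_ideal t.1 /\ in_ideal_pow m t.2) &
      a = \sum_(t <- s) t.1 * t.2
  else True.

End FinitePlace.

End FunctionField.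

Lemma frobD (Fq : finFieldType) (K : fieldType) (iK : {rmorphism Fq -> K})
    (x y : K) :
  (x + y) ^+ #|Fq| = x ^+ #|Fq| + y ^+ #|Fq|.
Proof.
have [l lP lFq] := finPcharP Fq; apply: exprDn_pchar.
have lK : l \in [pchar K] by rewrite (fmorph_pchar iK).
rewrite (eq_pnat _ (pcharf_eq lK)) (card_pprimeChar lFq).
by rewrite pnatX pnat_id.
Qed.

Section Frobenius.
Variables (Fq : finFieldType) (K : fieldType) (iK : {rmorphism Fq -> K}).

Definition frob of {rmorphism Fq -> K} : K -> K := fun x => x ^+ #|Fq|.

Fact frob_zmod : zmod_morphism (frob iK).
Proof.
move=> x y; apply: (@addIr _ ((y : K) ^+ #|Fq|)).
by rewrite /frob -(frobD iK) !subrK.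
Qed.
HB.instance Definition _ := GRing.isZmodMorphism.Build K K (frob iK) frob_zmod.
Fact frob_monoid : monoid_morphism (frob iK).
Proof. by split=> [|x y]; rewrite /frob ?expr1n ?exprMn. Qed.
HB.instance Definition _ := GRing.isMonoidMorphism.Build K K (frob iK) frob_monoid.

Fact frob_const : frob iK \o iK =1 iK.
Proof. by move=> c; rewrite /= /frob -rmorphXn /= expf_card. Qed.

Definition frobn (i : nat) : {rmorphism K -> K} :=
  iter i (fun h : {rmorphism K -> K} => frob iK \o h : {rmorphism K -> K})
    (idfun : {rmorphism K -> K}).

Lemma frobnE i x : frobn i x = x ^+ (#|Fq| ^ i).
Proof.
elim: i => [|i IHi]; first by rewrite expn0 expr1.
by rewrite /= /frob -/(frobn i) IHi -exprM expnSr.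
Qed.

(* K[tau] with tau xi = xi^q tau, on the additive group of polynomials;
   the coefficient of 'X^i is that of tau^i. *)
Definition twisted of {rmorphism Fq -> K} : Type := {poly K}.
Local Notation Kt := (twisted iK).
HB.instance Definition _ := GRing.Zmodule.on Kt.

Definition tw_shift (i : nat) (p : {poly K}) : {poly K} :=
  map_poly (fun x => x ^+ (#|Fq| ^ i)) p * 'X^i.

Definition tw_mul (p r : Kt) : Kt :=
  \sum_(i < size (p : {poly K})) (p : {poly K})`_i *: tw_shift i r.

Lemma tw_shiftE i p : tw_shift i p = map_poly (frobn i) p * 'X^i.
Proof. by congr (_ * _); apply: eq_map_poly => x; rewrite frobnE. Qed.

Lemma tw_shiftD i : {morph tw_shift i : p r / p + r}.
Proof. by move=> p r; rewrite !tw_shiftE rmorphD mulrDl. Qed.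

Lemma tw_shiftZ i c p : tw_shift i (c *: p) = c ^+ (#|Fq| ^ i) *: tw_shift i p.
Proof. by rewrite !tw_shiftE map_polyZ frobnE scalerAl. Qed.

Lemma tw_shift_shift i j p : tw_shift i (tw_shift j p) = tw_shift (i + j) p.
Proof.
rewrite !tw_shiftE rmorphM /= map_polyXn -mulrA -exprD (addnC j).
rewrite -map_poly_comp; congr (_ * _); apply: eq_map_poly => x /=.
by rewrite !frobnE -exprM -expnD addnC.
Qed.

Lemma tw_shift_monom i c j :
  tw_shift i (c *: 'X^j) = c ^+ (#|Fq| ^ i) *: 'X^(i + j).
Proof. by rewrite tw_shiftZ tw_shiftE map_polyXn -exprD addnC. Qed.

Lemma tw_shift0 p : tw_shift 0 p = p.
Proof. by rewrite tw_shiftE mulr1 map_poly_id. Qed.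

Lemma tw_mulE n (p r : Kt) : (size (p : {poly K}) <= n)%N ->
  tw_mul p r = \sum_(i < n) (p : {poly K})`_i *: tw_shift i r.
Proof.
move=> pn; rewrite /tw_mul (big_ord_widen n (fun i => (p : {poly K})`_i *: tw_shift i r) pn).
rewrite big_mkcond /=; apply: eq_bigr => i _; case: ifPn => //.
by rewrite -leqNgt => /leq_sizeP->; rewrite ?scale0r.
Qed.

Lemma tw_mulDl : left_distributive tw_mul +%R.
Proof.
move=> p r s; set n := maxn (size (p : {poly K})) (size (r : {poly K})).
rewrite !(@tw_mulE n) ?leq_maxl ?leq_maxr ?size_polyD //.
rewrite -[RHS]big_split /=; apply: eq_bigr => i _.
by rewrite -[(p + r : {poly K})`_i]/((p + r : {poly K})`_i) coefD scalerDl.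
Qed.

Lemma tw_mulDr : right_distributive tw_mul +%R.
Proof.
move=> p r s; rewrite /tw_mul -[RHS]big_split; apply: eq_bigr => i _.
by rewrite tw_shiftD scalerDr.
Qed.

Lemma tw_mulZl c (p r : {poly K}) : tw_mul (c *: p) r = c *: (tw_mul p r : {poly K}).
Proof.
rewrite (@tw_mulE (size p)) ?size_scale_leq // scaler_sumr.
by apply: eq_bigr => i _; rewrite coefZ scalerA.
Qed.

Lemma tw_mul_monom c i (r : {poly K}) : tw_mul (c *: 'X^i) r = c *: tw_shift i r.
Proof.
rewrite tw_mulZl (@tw_mulE i.+1) ?size_polyXn // big_ord_recr /= coefXn eqxx.
rewrite scale1r big1 ?add0r // => j _.
by rewrite coefXn ltn_eqF // scale0r.
Qed.

Lemma poly_monom_ind (P : {poly K} -> Prop) :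
  P 0 -> (forall p r, P p -> P r -> P (p + r)) ->
  (forall c i, P (c *: 'X^i)) -> forall p, P p.
Proof.
move=> P0 PD Pm p; rewrite -[p]coefK poly_def.
by elim/big_ind: _ => // i _; apply: Pm.
Qed.

Lemma tw_mul0l r : tw_mul 0 r = 0.
Proof. by rewrite /tw_mul size_poly0 big_ord0. Qed.

Lemma tw_mul0r p : tw_mul p 0 = 0.
Proof. by apply: (@addrI _ (tw_mul p 0)); rewrite -tw_mulDr !addr0. Qed.

Lemma tw_mul_shift i (r s : {poly K}) : tw_mul (tw_shift i r) s = tw_shift i (tw_mul r s).
Proof.
elim/poly_monom_ind: r => [|r r' IH IH'|c j].
- by rewrite tw_shiftE rmorph0 mul0r !tw_mul0l tw_shiftE rmorph0 mul0r.
- by rewrite tw_shiftD [LHS]tw_mulDl IH IH' [tw_mul (r + r') s]tw_mulDl tw_shiftD.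
- by rewrite tw_shift_monom !tw_mul_monom tw_shiftZ tw_shift_shift.
Qed.

Fact tw_mulA : associative tw_mul.
Proof.
move=> p r s; elim/poly_monom_ind: p => [|p p' IH IH'|c i].
- by rewrite !tw_mul0l.
- by rewrite ![tw_mul (p + p') _]tw_mulDl [RHS]tw_mulDl IH IH'.
- by rewrite !tw_mul_monom tw_mulZl tw_mul_shift.
Qed.

Fact tw_mul1l : left_id (1 : {poly K}) tw_mul.
Proof.
move=> p; rewrite -(scale1r (1 : {poly K})) -(expr0 'X) tw_mul_monom scale1r.
exact: tw_shift0.
Qed.

Fact tw_mul1r : right_id (1 : {poly K}) tw_mul.
Proof.
elim/poly_monom_ind => [|p r IHp IHr|c i]; first exact: tw_mul0l.
  by rewrite [LHS]tw_mulDl IHp IHr.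
by rewrite tw_mul_monom -(scale1r (1 : {poly K})) -(expr0 'X) tw_shift_monom expr1n scale1r addn0.
Qed.

HB.instance Definition _ := GRing.Zmodule_isNzRing.Build Kt
  tw_mulA tw_mul1l tw_mul1r tw_mulDl tw_mulDr (oner_neq0 {poly K}).

Definition tw_const (c : K) : Kt := c%:P.
Definition tau : Kt := 'X.

Lemma tw_constE c (p : Kt) : tw_const c * p = c *: (p : {poly K}) :> {poly K}.
Proof.
rewrite -[LHS]/(tw_mul c%:P p) -alg_polyC -(expr0 'X) tw_mul_monom.
by rewrite tw_shift0.
Qed.

Fact tw_const_zmod : zmod_morphism tw_const.
Proof. by move=> x y; apply: polyCB. Qed.
HB.instance Definition _ := GRing.isZmodMorphism.Build K Kt tw_const tw_const_zmod.
Fact tw_const_monoid : monoid_morphism tw_const.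
Proof.
split=> // x y; rewrite [RHS]tw_constE /tw_const.
by rewrite -mul_polyC -polyCM.
Qed.
HB.instance Definition _ := GRing.isMonoidMorphism.Build K Kt tw_const tw_const_monoid.

Lemma tau_const c : tau * tw_const c = tw_const (frob iK c) * tau.
Proof.
rewrite tw_constE -[LHS]/(tw_mul 'X c%:P) -['X in LHS]scale1r -['X in LHS]expr1.
rewrite tw_mul_monom scale1r -alg_polyC -(expr0 'X) tw_shift_monom.
by rewrite expn1 addn0 expr1.
Qed.

Lemma tw_const_central c p : p * tw_const (iK c) = tw_const (iK c) * p.
Proof.
have iKc i : iK c ^+ (#|Fq| ^ i) = iK c.
  elim: i => [|i IHi]; first by rewrite expr1.
  by rewrite expnSr exprM IHi -rmorphXn /= expf_card.
elim/poly_monom_ind: (p) => [|r s IHr IHs|b i].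
- by rewrite mul0r mulr0.
- by rewrite [LHS]mulrDl [RHS]mulrDr IHr IHs.
- rewrite tw_constE -[LHS]/(tw_mul (b *: 'X^i) (iK c)%:P) tw_mul_monom.
  rewrite -(alg_polyC (iK c)) -(expr0 'X) tw_shift_monom addn0 iKc.
  by rewrite !scalerA mulrC.
Qed.

Section Evaluation.
Variables (L : fieldType) (j : {rmorphism K -> L}).

(* (sum_i psi_i tau^i)(xi) = sum_i psi_i xi^(q^i) *)
Definition tw_eval (psi : Kt) (xi : L) : L :=
  \sum_(i < size (psi : {poly K})) j (psi : {poly K})`_i * xi ^+ (#|Fq| ^ i).

Lemma tw_evalE n psi xi : (size (psi : {poly K}) <= n)%N ->
  tw_eval psi xi = \sum_(i < n) j (psi : {poly K})`_i * xi ^+ (#|Fq| ^ i).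
Proof.
move=> pn; rewrite /tw_eval.
rewrite (big_ord_widen n (fun i => j (psi : {poly K})`_i * xi ^+ (#|Fq| ^ i)) pn).
rewrite big_mkcond /=; apply: eq_bigr => i _; case: ifPn => //.
by rewrite -leqNgt => /leq_sizeP->; rewrite ?rmorph0 ?mul0r.
Qed.

Lemma pow_qD i : {morph (fun xi : L => xi ^+ (#|Fq| ^ i)) : x y / x + y}.
Proof.
move=> x y; elim: i => [|i IHi]; first by rewrite !expr1.
by rewrite expnSr !exprM IHi (frobD (j \o iK : {rmorphism Fq -> L})).
Qed.

Lemma tw_evalD psi : {morph tw_eval psi : x y / x + y}.
Proof.
move=> x y; rewrite /tw_eval -big_split; apply: eq_bigr => i _.
by rewrite pow_qD mulrDr.
Qed.

Lemma tw_eval_addl psi psi' xi :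
  tw_eval (psi + psi') xi = tw_eval psi xi + tw_eval psi' xi.
Proof.
set n := maxn (size (psi : {poly K})) (size (psi' : {poly K})).
rewrite !(@tw_evalE n) ?leq_maxl ?leq_maxr ?size_polyD //.
rewrite -big_split /=; apply: eq_bigr => i _.
by rewrite -[(psi + psi' : {poly K})`_i]/((psi + psi' : {poly K})`_i) coefD rmorphD mulrDl.
Qed.

Lemma tw_eval0l xi : tw_eval 0 xi = 0.
Proof. by rewrite /tw_eval size_poly0 big_ord0. Qed.

Lemma tw_eval0r psi : tw_eval psi 0 = 0.
Proof. by apply: (@addrI _ (tw_eval psi 0)); rewrite -tw_evalD !addr0. Qed.

Lemma tw_eval_monom c i xi : tw_eval (c *: 'X^i : {poly K}) xi = j c * xi ^+ (#|Fq| ^ i).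
Proof.
rewrite (@tw_evalE i.+1); last first.
  by apply: leq_trans (size_scale_leq _ _) _; rewrite size_polyXn.
rewrite big_ord_recr /= coefZ coefXn eqxx mulr1.
by rewrite big1 ?add0r // => k _; rewrite coefZ coefXn ltn_eqF // mulr0 rmorph0 mul0r.
Qed.

Lemma tw_evalM psi psi' xi : tw_eval (psi * psi') xi = tw_eval psi (tw_eval psi' xi).
Proof.
have evD (p r : {poly K}) x : tw_eval (p + r : {poly K}) x = tw_eval p x + tw_eval r x.
  exact: tw_eval_addl.
elim/poly_monom_ind: psi => [|p p' IH IH'|c i].
- by rewrite mul0r !tw_eval0l.
- by rewrite evD -IH -IH' -tw_eval_addl -mulrDl.
elim/poly_monom_ind: psi' => [|p p' IH IH'|d k].
- by rewrite mulr0 !tw_eval0l tw_eval0r.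
- by rewrite evD tw_evalD -IH -IH' -tw_eval_addl -mulrDr.
rewrite -[_ * _]/(tw_mul (c *: 'X^i) (d *: 'X^k)) tw_mul_monom tw_shift_monom.
rewrite scalerA !tw_eval_monom rmorphM rmorphXn exprMn -mulrA.
by rewrite -exprM -expnD (addnC k).
Qed.

Lemma tw_eval_const c xi : tw_eval (tw_const c) xi = j c * xi.
Proof. by rewrite /tw_const -alg_polyC -(expr0 'X) tw_eval_monom expn0 expr1. Qed.

End Evaluation.
End Frobenius.

(* The completed tensor product F_p (x)^_Fq K, K discrete *)
Section CompletedTensor.
Variables (Fq : finFieldType) (F : fieldType) (iF : {rmorphism Fq -> F}).
Variables (inf : place iF) (p : finite_place inf).

Definition const_Fp : {rmorphism Fq -> completion p} := completion_in p \o iF.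
Definition reg_Fp : {rmorphism regular inf -> completion p} :=
  completion_in p \o @reg_val _ _ _ inf.

Section OneField.
Variables (K : fieldType) (iK : {rmorphism Fq -> K}).

Definition FK : comPzRingType := compl (tens_fil const_Fp iK (compl_fil p)).

Definition FK_in : {rmorphism tens_alg const_Fp iK -> FK} :=
  @compl_in _ (tens_fil const_Fp iK (compl_fil p)).

Definition Fp_FK (a : completion p) : FK := FK_in (ten a 1).

Fact Fp_FK_zmod : zmod_morphism Fp_FK.
Proof.
have FD x y : Fp_FK (x + y) = Fp_FK x + Fp_FK y by rewrite /Fp_FK tenDl rmorphD.
move=> x y; apply: (@addIr _ (Fp_FK y)).
by rewrite -FD !subrK.
Qed.
HB.instance Definition _ := GRing.isZmodMorphism.Build (completion p) FK Fp_FK Fp_FK_zmod.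
Fact Fp_FK_monoid : monoid_morphism Fp_FK.
Proof.
split=> [|x y]; first exact: rmorph1.
by rewrite /Fp_FK -rmorphM tenM mulr1.
Qed.
HB.instance Definition _ := GRing.isMonoidMorphism.Build (completion p) FK Fp_FK Fp_FK_monoid.

(* A (x)_Fq K and its map to F_p (x)^_Fq K *)
Definition AK : comPzRingType := tens_alg (@reg_const _ _ _ inf) iK.

Definition AK_FK : {rmorphism AK -> FK} :=
  FK_in \o @tens_alg_map _ _ _ _ _ (@reg_const _ _ _ inf) iK const_Fp iK
             reg_Fp idfun (fun=> erefl) (fun=> erefl).

End OneField.

Section Functoriality.
Variables (K L : fieldType) (iK : {rmorphism Fq -> K}) (iL : {rmorphism Fq -> L}).
Variables (h : {rmorphism K -> L}) (hK : h \o iK =1 iL).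

Definition FK_ten_map :
    {rmorphism tens_alg const_Fp iK -> tens_alg const_Fp iL} :=
  @tens_alg_map _ _ _ _ _ const_Fp iK const_Fp iL idfun h (fun=> erefl) hK.

Fact FK_ten_map_fil n x : tens_fil const_Fp iK (compl_fil p) n x ->
  tens_fil const_Fp iL (compl_fil p) n (FK_ten_map x).
Proof.
move=> [s sU ->]; exists [seq (t.1, h t.2) | t <- s].
  by move=> t /mapP[r rs ->]; apply: (sU r).
by rewrite rmorph_sum big_map; apply: eq_bigr => t _; apply: tens_alg_mapE.
Qed.

Definition FK_map : {rmorphism FK iK -> FK iL} := compl_map FK_ten_map_fil.

Lemma FK_map_in x : FK_map (FK_in iK x) = FK_in iL (FK_ten_map x).
Proof. exact: compl_map_in. Qed.

Lemma FK_map_Fp a : FK_map (Fp_FK iK a) = Fp_FK iL a.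
Proof.
by rewrite /Fp_FK FK_map_in; congr (FK_in iL _); rewrite [LHS]tens_alg_mapE rmorph1.
Qed.

End Functoriality.

Lemma FK_map_comp (K L E : fieldType) (iK : {rmorphism Fq -> K})
    (iL : {rmorphism Fq -> L}) (iE : {rmorphism Fq -> E})
    (h : {rmorphism K -> L}) (g : {rmorphism L -> E}) (f : {rmorphism K -> E})
    (hK : h \o iK =1 iL) (gL : g \o iL =1 iE) (fK : f \o iK =1 iE) :
  g \o h =1 f -> forall x, FK_map gL (FK_map hK x) = FK_map fK x.
Proof.
move=> ghf x; rewrite -(lim_of_repr x).
rewrite /FK_map /= !compl_mapE; congr lim_of; apply: val_inj; apply/funext => i /=.
move: (val _ i); apply: tens_ext => [y z|y z|a b]; rewrite ?rmorphD //.
by rewrite /= -/(ten a b) !tens_alg_mapE /= -(ghf b).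
Qed.

End CompletedTensor.

Section DrinfeldModules.
Variables (Fq : finFieldType) (F : fieldType) (iF : {rmorphism Fq -> F}).
Variables (inf : place iF) (p : finite_place inf).
Variables (K : fieldType) (iK : {rmorphism Fq -> K}).
Local Notation A := (regular inf).
Local Notation Fp := (completion p).

Record drinfeld (r : nat) := Drinfeld {
  dr_map :> {rmorphism A -> twisted iK};
  dr_const : forall c, dr_map (reg_const inf c) = tw_const iK (iK c);
  dr_deg : forall a, a != 0 -> exists2 d, is_degA a d &
    size (dr_map a : {poly K}) = (r * d).+1 }.

Definition is_dr_hom r (phi phi' : drinfeld r) (u : twisted iK) : Prop :=
  forall a, u * phi a = phi' a * u.

(* M = K[tau] with (a (x) xi) m = xi m phi_a *)
Section Motive.
Variables (r : nat) (phi : drinfeld r).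

Definition motive of drinfeld r : Type := twisted iK.
Local Notation M := (motive phi).
HB.instance Definition _ := GRing.Zmodule.on M.

Definition motive_scale (x : AK inf iK) (m : M) : M :=
  tens_lift (fun a xi => tw_const iK xi * (m : twisted iK) * phi a) x.

Fact motive_balanced (m : M) : balanced
  (fun (c : Fq) (a : A) => reg_const inf c * a) (fun (c : Fq) (xi : K) => iK c * xi)
  (fun a xi => tw_const iK xi * (m : twisted iK) * phi a).
Proof.
split=> [xi a b|a xi xi'|c a xi].
- by rewrite rmorphD mulrDr.
- by rewrite rmorphD !mulrDl.
- by rewrite rmorphM dr_const !mulrA tw_const_central rmorphM !mulrA.
Qed.

Lemma motive_scaleE a xi (m : M) :
  motive_scale (ten a xi) m = tw_const iK xi * (m : twisted iK) * phi a.
Proof. exact: (tens_liftE (motive_balanced m)). Qed.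

Fact motive_scaleDl m : {morph motive_scale^~ m : x y / x + y}.
Proof. exact: (tens_liftD (motive_balanced m)). Qed.

Fact motive_scaleDr : right_distributive motive_scale +%R.
Proof.
move=> x m n; move: x; apply: tens_ext => [x y|x y|a xi].
- by rewrite motive_scaleDl.
- by rewrite !motive_scaleDl addrACA.
- by rewrite -/(ten a xi) !motive_scaleE mulrDr mulrDl.
Qed.

Fact motive_scaleA x y m :
  motive_scale x (motive_scale y m) = motive_scale (x * y) m.
Proof.
move: x; apply: tens_ext => [x x'|x x'|a xi].
- by rewrite motive_scaleDl.
- by rewrite mulrDl motive_scaleDl.
move: y; apply: tens_ext => [y y'|y y'|b eta].
- by rewrite motive_scaleDl motive_scaleDr.
- by rewrite mulrDr motive_scaleDl.
rewrite -/(ten a xi) -/(ten b eta) tenM !motive_scaleE.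
by rewrite [a * b]mulrC !rmorphM !mulrA.
Qed.

Fact motive_scale1 : left_id 1 motive_scale.
Proof. by move=> m; rewrite motive_scaleE !rmorph1 mul1r mulr1. Qed.

HB.instance Definition _ := GRing.Zmodule_isLmodule.Build (AK inf iK) M
  motive_scaleA motive_scale1 motive_scaleDr motive_scaleDl.

Lemma motive_scale_ten a xi (m : M) :
  (ten a xi : AK inf iK) *: m = tw_const iK xi * (m : twisted iK) * phi a :> twisted iK.
Proof. exact: motive_scaleE. Qed.

Definition motive_tau (m : M) : M := tau iK * (m : twisted iK).

End Motive.
End DrinfeldModules.

Record galois_aut (K L : fieldType) (j : {rmorphism K -> L}) := GaloisAut {
  gal_fun :> {rmorphism L -> L};
  gal_inv_fun : {rmorphism L -> L};
  gal_funK : cancel gal_fun gal_inv_fun;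
  gal_inv_funK : cancel gal_inv_fun gal_fun;
  gal_fix : gal_fun \o j =1 j }.

Section GaloisInverse.
Variables (K L : fieldType) (j : {rmorphism K -> L}) (g : galois_aut j).

Fact gal_inv_fix : gal_inv_fun g \o j =1 j.
Proof. by move=> x; rewrite /= -{1}(gal_fix g x) /= gal_funK. Qed.

Definition gal_inv : galois_aut j :=
  GaloisAut (gal_inv_funK g) (gal_funK g) gal_inv_fix.

End GaloisInverse.

Section LocalMotive.
Variables (Fq : finFieldType) (F : fieldType) (iF : {rmorphism Fq -> F}).
Variables (inf : place iF) (p : finite_place inf).
Variables (K : fieldType) (iK : {rmorphism Fq -> K}).
Variables (Kbar : fieldType) (j : {rmorphism K -> Kbar}).
Local Notation A := (regular inf).
Local Notation Fp := (completion p).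

Definition iKbar : {rmorphism Fq -> Kbar} := j \o iK.
Definition FK_bar : {rmorphism FK p iK -> FK p iKbar} :=
  @FK_map _ _ _ _ p _ _ iK iKbar j (fun=> erefl).

Definition sigmaF : {rmorphism FK p iK -> FK p iK} := FK_map p (frob_const iK).
Definition sigmaF_bar : {rmorphism FK p iKbar -> FK p iKbar} :=
  FK_map p (frob_const iKbar).

Definition sigmaAK : {rmorphism AK inf iK -> AK inf iK} :=
  @tens_alg_map _ _ _ _ _ (@reg_const _ _ _ inf) iK (@reg_const _ _ _ inf) iK
    idfun (frob iK) (fun=> erefl) (frob_const iK).

Lemma sigmaAK_ten a xi : sigmaAK (ten a xi) = ten a (frob iK xi).
Proof. exact: tens_alg_mapE. Qed.

Lemma sigmaF_AK x : sigmaF (AK_FK p iK x) = AK_FK p iK (sigmaAK x).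
Proof.
rewrite /= FK_map_in; congr (FK_in p iK _).
move: x; apply: tens_ext => [x y|x y|a xi]; rewrite ?rmorphD //.
by rewrite -/(ten a xi) !tens_alg_mapE /= !tens_alg_mapE.
Qed.

Lemma sigmaF_bar_FK x : sigmaF_bar (FK_bar x) = FK_bar (sigmaF x).
Proof.
have jq : frob iKbar \o j \o iK =1 iKbar by move=> c; apply: (frob_const iKbar).
have -> : sigmaF_bar (FK_bar x) =
    @FK_map _ _ _ _ p _ _ iK iKbar (frob iKbar \o j) jq x by apply: FK_map_comp.
by symmetry; apply: FK_map_comp => y; rewrite /= /frob rmorphXn.
Qed.

Lemma sigmaF_bar_Fp a : sigmaF_bar (Fp_FK iKbar a) = Fp_FK iKbar a.
Proof. exact: FK_map_Fp. Qed.

Section GaloisFK.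
Variable g : galois_aut j.

Fact gal_const : g \o iKbar =1 iKbar.
Proof. by move=> c; apply: (gal_fix g (iK c)). Qed.

Definition galFK : {rmorphism FK p iKbar -> FK p iKbar} := FK_map p gal_const.

Lemma galFK_bar x : galFK (FK_bar x) = FK_bar x.
Proof. by apply: FK_map_comp => y; apply: (gal_fix g). Qed.

Lemma galFK_sigma x : galFK (sigmaF_bar x) = sigmaF_bar (galFK x).
Proof.
have gq : g \o frob iKbar \o iKbar =1 iKbar.
  by by move=> c; rewrite -[RHS](gal_const c); congr (gal_fun g _); apply: frob_const.
have -> : galFK (sigmaF_bar x) =
    @FK_map _ _ _ _ p _ _ iKbar iKbar (g \o frob iKbar) gq x by apply: FK_map_comp.
by symmetry; apply: FK_map_comp => y; rewrite /= /frob rmorphXn.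
Qed.

End GaloisFK.

Section OneModule.
Variables (r : nat) (phi : drinfeld inf iK r).

(* M_{F,p} and its base change to Kbar *)
Definition MF : lmodType (FK p iK) :=
  tens_mod (AK_FK p iK) (FK p iK)^o (motive phi).
Definition MF_tau : MF -> MF :=
  @tens_mod_map _ _ (AK_FK p iK) (FK p iK)^o (motive phi)
    _ _ (AK_FK p iK) (FK p iK)^o (motive phi) sigmaF (@motive_tau _ _ _ _ _ _ _ phi).

Definition MF_bar : lmodType (FK p iKbar) := tens_mod FK_bar (FK p iKbar)^o MF.
Definition MF_bar_tau : MF_bar -> MF_bar :=
  @tens_mod_map _ _ FK_bar (FK p iKbar)^o MF _ _ FK_bar (FK p iKbar)^o MF
    sigmaF_bar MF_tau.

Lemma motive_tauD : {morph @motive_tau _ _ _ _ _ _ _ phi : m n / m + n}.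
Proof. by move=> m n; apply: mulrDr. Qed.

Lemma motive_tau_semilinear (x : AK inf iK) (m : motive phi) :
  motive_tau (x *: m) = sigmaAK x *: motive_tau m.
Proof.
move: x; apply: tens_ext => [x y|x y|a xi].
- by rewrite scalerDl motive_tauD.
- by rewrite rmorphD scalerDl.
rewrite -/(ten a xi) sigmaAK_ten /motive_tau !motive_scale_ten.
by rewrite !mulrA tau_const.
Qed.

Lemma MF_tau_bal (x : AK inf iK) (b : (FK p iK)^o) :
  sigmaF (AK_FK p iK x *: b) = AK_FK p iK (sigmaAK x) *: (sigmaF b : (FK p iK)^o).
Proof. by rewrite -sigmaF_AK; apply: rmorphM. Qed.

Lemma MF_tauE b m : MF_tau (mten b m) = mten (sigmaF b : (FK p iK)^o) (motive_tau m).
Proof.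
apply: (tens_mod_mapE (s := sigmaAK)); [exact: rmorphD | exact: motive_tauD | |].
  exact: MF_tau_bal.
exact: motive_tau_semilinear.
Qed.

Lemma MF_tauD : {morph MF_tau : x y / x + y}.
Proof.
apply: (tens_mod_mapD (s := sigmaAK)); [exact: rmorphD | exact: motive_tauD | |].
  exact: MF_tau_bal.
exact: motive_tau_semilinear.
Qed.

Lemma MF_tau_semilinear b (x : MF) : MF_tau (b *: x) = sigmaF b *: MF_tau x.
Proof.
apply: (tens_mod_mapZ (s := sigmaAK)); [exact: rmorphD | exact: motive_tauD | | |].
- exact: MF_tau_bal.
- exact: motive_tau_semilinear.
- by move=> c d; apply: rmorphM.
Qed.

Lemma MF_bar_tau_bal (x : FK p iK) (b : (FK p iKbar)^o) :
  sigmaF_bar (FK_bar x *: b) = FK_bar (sigmaF x) *: (sigmaF_bar b : (FK p iKbar)^o).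
Proof. by rewrite -sigmaF_bar_FK; apply: rmorphM. Qed.

Lemma MF_bar_tauE b x :
  MF_bar_tau (mten b x) = mten (sigmaF_bar b : (FK p iKbar)^o) (MF_tau x).
Proof.
apply: (tens_mod_mapE (s := sigmaF)); [exact: rmorphD | exact: MF_tauD | |].
  exact: MF_bar_tau_bal.
exact: MF_tau_semilinear.
Qed.

Lemma MF_bar_tauD : {morph MF_bar_tau : x y / x + y}.
Proof.
apply: (tens_mod_mapD (s := sigmaF)); [exact: rmorphD | exact: MF_tauD | |].
  exact: MF_bar_tau_bal.
exact: MF_tau_semilinear.
Qed.

Lemma MF_bar_tau_semilinear b (x : MF_bar) :
  MF_bar_tau (b *: x) = sigmaF_bar b *: MF_bar_tau x.
Proof.
apply: (tens_mod_mapZ (s := sigmaF)); [exact: rmorphD | exact: MF_tauD | | |].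
- exact: MF_bar_tau_bal.
- exact: MF_tau_semilinear.
- by move=> c d; apply: rmorphM.
Qed.

(* T_0: the tau-invariants, an F_p-vector space *)
Local Notation V := (restr (@Fp_FK _ _ _ _ p _ iKbar) MF_bar).

Definition T0_pred : {pred V} := fun x => MF_bar_tau x == x.

Fact T0_submod : submod_closed T0_pred.
Proof.
split=> [|a x y /eqP xT /eqP yT].
  by apply/eqP/(@addrI _ (MF_bar_tau 0)); rewrite -MF_bar_tauD !addr0.
apply/eqP; rewrite [LHS]MF_bar_tauD MF_bar_tau_semilinear sigmaF_bar_Fp.
by rewrite xT yT.
Qed.

Definition T0 : Type := {x : V | T0_pred x}.
HB.instance Definition _ := SubChoice.on T0.
HB.instance Definition _ := GRing.SubChoice_isSubLmodule.Build Fp V T0_pred T0 T0_submod.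

Definition T0_val (x : T0) : MF_bar := val x.

Lemma T0P x : MF_bar_tau (T0_val x) = T0_val x.
Proof. by apply/eqP; apply: (valP x). Qed.

Definition dual_pred : {pred T0 -> Fp^o} := fun f => `[< linear f >].

Fact dual_submod : submod_closed dual_pred.
Proof.
split=> [|a f g /asboolP fL /asboolP gL]; apply/asboolP => c x y.
  by rewrite -[LHS]/(0 : Fp) -[RHS]/(c *: (0 : Fp^o) + 0) scaler0 addr0.
rewrite -[LHS]/(a *: f (c *: x + y) + g (c *: x + y)) fL gL.
rewrite -[RHS]/(c *: (a *: f x + g x) + (a *: f y + g y)).
by rewrite !scalerDr !scalerA mulrC addrACA.
Qed.

Definition T0_dual : Type := {f : T0 -> Fp^o | dual_pred f}.
HB.instance Definition _ := SubChoice.on T0_dual.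
HB.instance Definition _ :=
  GRing.SubChoice_isSubLmodule.Build Fp (T0 -> Fp^o) dual_pred T0_dual dual_submod.

Definition mk_dual f (fL : linear f) : T0_dual :=
  Sub f (introT (asboolP (linear f)) fL).

Lemma dualP (f : T0_dual) : linear (val f).
Proof. by have /asboolP := valP f. Qed.

(* T_0^\/ (x)_A Omega_A, as an F_p-vector space *)
Definition dual_Omega : lmodType Fp :=
  tens_mod (reg_Fp p) T0_dual (Kaehler (@reg_const _ _ _ inf)).

Section Galois.
Variable g : galois_aut j.

Definition MF_bar_gal : MF_bar -> MF_bar :=
  @tens_mod_map _ _ FK_bar (FK p iKbar)^o MF _ _ FK_bar (FK p iKbar)^o MF
    (galFK g) id.

Lemma MF_bar_gal_bal (x : FK p iK) (b : (FK p iKbar)^o) :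
  galFK g (FK_bar x *: b) = FK_bar x *: (galFK g b : (FK p iKbar)^o).
Proof. by rewrite -[in RHS](galFK_bar g); apply: rmorphM. Qed.

Lemma MF_bar_galE b x :
  MF_bar_gal (mten b x) = mten (galFK g b : (FK p iKbar)^o) x.
Proof.
by apply: (tens_mod_mapE (s := id)) => //; [exact: rmorphD | exact: MF_bar_gal_bal].
Qed.

Lemma MF_bar_galD : {morph MF_bar_gal : x y / x + y}.
Proof.
by apply: (tens_mod_mapD (s := id)) => //; [exact: rmorphD | exact: MF_bar_gal_bal].
Qed.

Lemma MF_bar_gal_semilinear b (x : MF_bar) :
  MF_bar_gal (b *: x) = galFK g b *: MF_bar_gal x.
Proof.
apply: (tens_mod_mapZ (s := id)) => //; first exact: rmorphD.
  exact: MF_bar_gal_bal.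
by move=> c d; apply: rmorphM.
Qed.

Lemma MF_bar_gal_tau x : MF_bar_tau (MF_bar_gal x) = MF_bar_gal (MF_bar_tau x).
Proof.
move: x; apply: tens_ext => [x y|x y|b x].
- by rewrite MF_bar_galD MF_bar_tauD.
- by rewrite MF_bar_tauD MF_bar_galD.
by rewrite -/(mten b x) MF_bar_galE !MF_bar_tauE MF_bar_galE galFK_sigma.
Qed.

Fact T0_gal_subproof (x : T0) : T0_pred (MF_bar_gal (T0_val x)).
Proof. by apply/eqP; rewrite MF_bar_gal_tau T0P. Qed.

Definition T0_gal (x : T0) : T0 := Sub (MF_bar_gal (T0_val x) : V) (T0_gal_subproof x).

Fact T0_gal_linear (c : Fp) (x y : T0) : T0_gal (c *: x + y) = c *: T0_gal x + T0_gal y.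
Proof.
apply: val_inj; rewrite [LHS]MF_bar_galD MF_bar_gal_semilinear.
by rewrite [galFK g _]FK_map_Fp.
Qed.

End Galois.

Fact dual_gal_subproof (g : galois_aut j) (f : T0_dual) :
  linear (val f \o T0_gal (gal_inv g)).
Proof. by move=> c x y; rewrite /= T0_gal_linear dualP. Qed.

Definition dual_gal (g : galois_aut j) (f : T0_dual) : T0_dual :=
  mk_dual (dual_gal_subproof g f).

Definition dual_Omega_gal (g : galois_aut j) : dual_Omega -> dual_Omega :=
  @tens_mod_map _ _ (reg_Fp p) T0_dual (Kaehler (@reg_const _ _ _ inf))
    _ _ (reg_Fp p) T0_dual (Kaehler (@reg_const _ _ _ inf)) (dual_gal g) id.

Lemma dual_Omega_galE g f w :
  dual_Omega_gal g (mten f w) = mten (dual_gal g f) w.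
Proof.
apply: (tens_mod_mapE (s := id)) => // [f1 f2|a f1]; exact: val_inj.
Qed.

(* The Tate module: Hom_A (F_p / A_p, U_n phi[p^n]) *)
Definition torsion (n : nat) (xi : Kbar) : Prop :=
  forall a, in_ideal_pow p n a -> tw_eval j (phi a) xi = 0.

Definition is_Tate (f : FmodA p -> Kbar) : Prop :=
  [/\ {morph f : x y / x + y},
      forall (a : A) x, f (reg_in p a *: x) = tw_eval j (phi a) (f x) &
      forall x, exists n, torsion n (f x)].

Definition Tate_pred : {pred FmodA p -> Kbar} := fun f => `[< is_Tate f >].

Lemma ideal_pow_le m n a : (m <= n)%N -> in_ideal_pow p n a -> in_ideal_pow p m a.
Proof.
elim: n m a => [|n IHn] [|m] a //; rewrite ltnS => mn [s sI ->].
by exists s => // t /sI[t1 t2]; split=> //; apply: IHn t2.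
Qed.

Fact Tate_zmod : zmod_closed Tate_pred.
Proof.
have ev0 (psi : twisted iK) : tw_eval j psi 0 = 0 by apply: tw_eval0r.
have evB (psi : twisted iK) x y : tw_eval j psi (x - y) = tw_eval j psi x - tw_eval j psi y.
  by apply: (@addIr _ (tw_eval j psi y)); rewrite -tw_evalD !subrK.
split=> [|f h /asboolP[fD fA ft] /asboolP[hD hA ht]]; apply/asboolP; split.
- by move=> x y; rewrite -[LHS]/(0 : Kbar) -[RHS]/(0 + 0 : Kbar) addr0.
- by move=> a x; rewrite -[LHS]/(0 : Kbar) -[RHS]/(tw_eval j (phi a) 0) ev0.
- by move=> x; exists 0 => a _; apply: ev0.
- move=> x y; rewrite -[LHS]/(f (x + y) - h (x + y)) fD hD opprD addrACA //.
- by move=> a x; rewrite -[LHS]/(f _ - h _) fA hA -evB.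
- move=> x; have [[n fn] [m hm]] := (ft x, ht x).
  exists (maxn n m) => a aI; rewrite -[(f - h) x]/(f x - h x) evB fn ?hm ?subrr //.
    by apply: ideal_pow_le aI; apply: leq_maxr.
  by apply: ideal_pow_le aI; apply: leq_maxl.
Qed.

Definition Tate : Type := {f : FmodA p -> Kbar | Tate_pred f}.
HB.instance Definition _ := SubChoice.on Tate.
HB.instance Definition _ :=
  GRing.SubChoice_isSubZmodule.Build (FmodA p -> Kbar) Tate_pred Tate Tate_zmod.

Lemma TateP (f : Tate) : is_Tate (val f). Proof. by have /asboolP := valP f. Qed.

Definition mk_Tate f (fT : is_Tate f) : Tate := Sub f (introT (asboolP (is_Tate f)) fT).

Fact Tate_scale_subproof (c : complA p) (f : Tate) :
  is_Tate (fun x => val f (c *: x)).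
Proof.
have [fD fA ft] := TateP f; split=> [x y|a x|x]; first by rewrite scalerDr fD.
  by rewrite scalerA mulrC -scalerA fA.
exact: ft.
Qed.

Definition Tate_scale c f : Tate := mk_Tate (Tate_scale_subproof c f).

Fact Tate_scaleA c d f : Tate_scale c (Tate_scale d f) = Tate_scale (c * d) f.
Proof.
apply: val_inj; apply/funext => x /=.
by rewrite scalerA mulrC.
Qed.
Fact Tate_scale1 : left_id 1 Tate_scale.
Proof. by move=> f; apply: val_inj; apply/funext => x /=; rewrite scale1r. Qed.
Fact Tate_scaleDr : right_distributive Tate_scale +%R.
Proof. by move=> c f h; apply: val_inj. Qed.
Fact Tate_scaleDl f : {morph Tate_scale^~ f : c d / c + d}.
Proof.
move=> c d; apply: val_inj; apply/funext => x /=; rewrite scalerDl.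
by have [fD _ _] := TateP f; apply: fD.
Qed.

HB.instance Definition _ := GRing.Zmodule_isLmodule.Build (complA p) Tate
  Tate_scaleA Tate_scale1 Tate_scaleDr Tate_scaleDl.

(* The rational Tate module F_p (x)_{A_p} T_p *)
Definition rational_Tate : lmodType Fp := tens_mod (@complA_val _ _ _ _ p) Fp^o Tate.

Section GaloisTate.
Variable g : galois_aut j.

Lemma gal_eval psi xi : g (tw_eval (iK := iK) j psi xi) = tw_eval j psi (g xi).
Proof.
rewrite /tw_eval rmorph_sum; apply: eq_bigr => i _.
by rewrite rmorphM rmorphXn; congr (_ * _); apply: (gal_fix g).
Qed.

Fact Tate_gal_subproof (f : Tate) : is_Tate (g \o val f).
Proof.
have [fD fA ft] := TateP f; split=> [x y|a x|x]; rewrite /= ?fD ?fA ?rmorphD //.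
  exact: gal_eval.
by have [n fn] := ft x; exists n => a /fn fa; rewrite /= -gal_eval fa rmorph0.
Qed.

Definition Tate_gal (f : Tate) : Tate := mk_Tate (Tate_gal_subproof f).

Definition rational_Tate_gal : rational_Tate -> rational_Tate :=
  @tens_mod_map _ _ (@complA_val _ _ _ _ p) Fp^o Tate _ _ (@complA_val _ _ _ _ p) Fp^o Tate id Tate_gal.

Lemma rational_Tate_galE c f :
  rational_Tate_gal (mten c f) = mten c (Tate_gal f).
Proof.
apply: (tens_mod_mapE (s := id)) => // [f1 f2|a f1]; apply: val_inj => //.
by apply/funext => x /=; apply: rmorphD.
Qed.

End GaloisTate.

End OneModule.

(* A homomorphism u : phi -> phi' acts covariantly on Tate modules by
   xi |-> u(xi), and contravariantly on motives by m |-> m u. *)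
Section Homomorphism.
Variables (r : nat) (phi phi' : drinfeld inf iK r) (u : twisted iK).
Hypothesis uP : is_dr_hom phi phi' u.

Definition motive_hom (m : motive phi') : motive phi := (m : twisted iK) * u.

Definition MF_hom : MF phi' -> MF phi :=
  @tens_mod_map _ _ (AK_FK p iK) (FK p iK)^o (motive phi')
    _ _ (AK_FK p iK) (FK p iK)^o (motive phi) id motive_hom.
Definition MF_bar_hom : MF_bar phi' -> MF_bar phi :=
  @tens_mod_map _ _ FK_bar (FK p iKbar)^o (MF phi')
    _ _ FK_bar (FK p iKbar)^o (MF phi) id MF_hom.

Lemma motive_homD : {morph motive_hom : m n / m + n}.
Proof. by move=> m n; apply: mulrDl. Qed.

Lemma motive_hom_linear (x : AK inf iK) (m : motive phi') :
  motive_hom (x *: m) = x *: motive_hom m.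
Proof.
move: x; apply: tens_ext => [x y|x y|a xi].
- by rewrite scalerDl motive_homD.
- by rewrite scalerDl.
rewrite -/(ten a xi) [RHS]motive_scale_ten /motive_hom [_ *: m]motive_scale_ten.
by rewrite -!mulrA uP.
Qed.

Lemma MF_homE b m : MF_hom (mten b m) = mten b (motive_hom m).
Proof.
by apply: (tens_mod_mapE (s := id)) => //; [exact: motive_homD | exact: motive_hom_linear].
Qed.

Lemma MF_homD : {morph MF_hom : x y / x + y}.
Proof.
by apply: (tens_mod_mapD (s := id)) => //; [exact: motive_homD | exact: motive_hom_linear].
Qed.

Lemma MF_hom_linear b (x : MF phi') : MF_hom (b *: x) = b *: MF_hom x.
Proof.
by apply: (tens_mod_mapZ (s := id)) => //; [exact: motive_homD | exact: motive_hom_linear].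
Qed.

Lemma MF_hom_tau x : MF_tau (MF_hom x) = MF_hom (MF_tau x).
Proof.
move: x; apply: tens_ext => [x y|x y|b m].
- by rewrite MF_homD MF_tauD.
- by rewrite MF_tauD MF_homD.
by rewrite -/(mten b m) MF_homE !MF_tauE MF_homE /motive_tau /motive_hom mulrA.
Qed.

Lemma MF_bar_homE b x : MF_bar_hom (mten b x) = mten b (MF_hom x).
Proof.
by apply: (tens_mod_mapE (s := id)) => //; [exact: MF_homD | exact: MF_hom_linear].
Qed.

Lemma MF_bar_homD : {morph MF_bar_hom : x y / x + y}.
Proof.
by apply: (tens_mod_mapD (s := id)) => //; [exact: MF_homD | exact: MF_hom_linear].
Qed.

Lemma MF_bar_hom_linear b (x : MF_bar phi') : MF_bar_hom (b *: x) = b *: MF_bar_hom x.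
Proof.
by apply: (tens_mod_mapZ (s := id)) => //; [exact: MF_homD | exact: MF_hom_linear].
Qed.

Lemma MF_bar_hom_tau x : MF_bar_tau (MF_bar_hom x) = MF_bar_hom (MF_bar_tau x).
Proof.
move: x; apply: tens_ext => [x y|x y|b x].
- by rewrite MF_bar_homD MF_bar_tauD.
- by rewrite MF_bar_tauD MF_bar_homD.
by rewrite -/(mten b x) MF_bar_homE !MF_bar_tauE MF_bar_homE MF_hom_tau.
Qed.

Fact T0_hom_subproof (x : T0 phi') : T0_pred (MF_bar_hom (T0_val x)).
Proof. by apply/eqP; rewrite MF_bar_hom_tau T0P. Qed.

Definition T0_hom (x : T0 phi') : T0 phi :=
  Sub (MF_bar_hom (T0_val x) : restr (@Fp_FK _ _ _ _ p _ iKbar) (MF_bar phi))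
    (T0_hom_subproof x).

Fact T0_hom_linear (c : Fp) (x y : T0 phi') :
  T0_hom (c *: x + y) = c *: T0_hom x + T0_hom y.
Proof. by apply: val_inj; rewrite [LHS]MF_bar_homD MF_bar_hom_linear. Qed.

Fact dual_hom_subproof (f : T0_dual phi) : linear (val f \o T0_hom).
Proof. by move=> c x y; rewrite /= T0_hom_linear dualP. Qed.

Definition dual_hom (f : T0_dual phi) : T0_dual phi' := mk_dual (dual_hom_subproof f).

Definition dual_Omega_hom : dual_Omega phi -> dual_Omega phi' :=
  @tens_mod_map _ _ (reg_Fp p) (T0_dual phi) (Kaehler (@reg_const _ _ _ inf))
    _ _ (reg_Fp p) (T0_dual phi') (Kaehler (@reg_const _ _ _ inf)) dual_hom id.

Lemma dual_Omega_homE f w : dual_Omega_hom (mten f w) = mten (dual_hom f) w.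
Proof.
apply: (tens_mod_mapE (s := id)) => // [f1 f2|a f1]; exact: val_inj.
Qed.

Fact Tate_hom_subproof (f : Tate phi) : is_Tate phi' (tw_eval j u \o val f).
Proof.
have [fD fA ft] := TateP f; split=> [x y|a x|x]; rewrite /=.
- by rewrite fD tw_evalD.
- by rewrite fA -!tw_evalM uP.
- have [n fn] := ft x; exists n => a /fn fa; rewrite /=.
  by rewrite -tw_evalM -uP tw_evalM fa tw_eval0r.
Qed.

Definition Tate_hom (f : Tate phi) : Tate phi' := mk_Tate (Tate_hom_subproof f).

Definition rational_Tate_hom : rational_Tate phi -> rational_Tate phi' :=
  @tens_mod_map _ _ (@complA_val _ _ _ _ p) Fp^o (Tate phi)
    _ _ (@complA_val _ _ _ _ p) Fp^o (Tate phi') id Tate_hom.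

Lemma rational_Tate_homE c f :
  rational_Tate_hom (mten c f) = mten c (Tate_hom f).
Proof.
apply: (tens_mod_mapE (s := id)) => // [f1 f2|a f1]; apply: val_inj => //.
by apply/funext => x /=; apply: tw_evalD.
Qed.

End Homomorphism.

End LocalMotive.

(* Main.v *)
(* Choose a in A whose only zero is p (finiteness of the class number, with the degrees
   of the phi_b as height on A) and write P = phi_a.  A residue gives a functional lam
   on F_p for which every continuous Fq-linear functional is lam (c * _) for a unique
   c, and a nonzero differential identifies Omega_A (x)_A F_p with F_p.

   An element of V_p(phi) is an A-linear map f from F_p to Kbar that vanishes on an
   open subgroup.  Letting F_p (x)^ Kbar act on continuous functions from F_p to Kbar,
   f extends m |-> (z |-> m(f z)) to a pairing psi_f on the motive; on a tau-invariant
   w it has values in Fq, so psi_f(w)(z) = lam (c z) for a unique c =: Phi(f)(w).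

   Bijectivity of Phi is tested on the lattice of the combinations of 1, tau, tau^2,
   ... with integral coefficients, in which Kbar[tau] is dense: the residues of right
   division by P detect the coefficients, so that an m in Kbar[tau] is divisible by a^n
   in the lattice exactly when it lies in Kbar[tau] P^n.  An m with tau m - m in Kbar[tau] P^n lifts to an
   invariant because tau - 1 is surjective modulo P (Lang), also when P is inseparable;
   Moore interpolation on ker P^n then provides invariants dual to a basis of ker P^n. *)
From HB Require Import structures.
Require Import Defs.
From mathcomp Require Import all_boot all_order all_algebra all_field.
From mathcomp Require Import zify ring.
From mathcomp Require Import boolp classical_sets functions.

Set Implicit Arguments.
Unset Strict Implicit.
Unset Printing Implicit Defensive.

Import Order.TTheory GRing.Theory Num.Theory.
Local Open Scope ring_scope.

(** * Function fields and their places *)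

(** The obstacle is that no dimension is known in advance. The kernel of P^n has at most q^(n deg P)
    elements, and fewer when p is the characteristic; neither projectivity nor the rank of the
    motive over A (x) K is available. Hence dimensions of the two sides are never compared:
    injectivity and surjectivity of Phi are both read off from finite dual systems, and the lattice
    has to be shown separated by hand. For this its coefficients are cut down to Kbar[[a]], where
    expansions in powers of P are unique, whereas over F_p (x)^ Kbar the deg P generators 1, tau,
    ... are dependent in general.

    Working with an a that has no other zero than p replaces localization at p by divisibility by
    powers of one element, to which right division by P in Kbar[tau] applies. In the proof that such
    an a exists, the degree in tau of phi_b, additive on products and bounded by the maximum on
    sums, replaces the product formula. The choices of a, lam and the differential are made once for
    all modules, whence the naturality of the isomorphism. *)

Section Counting.
Variables (Fq : finFieldType) (F : fieldType) (iF : {rmorphism Fq -> F}).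

Definition peval (x : F) (h : {poly Fq}) : F := (map_poly iF h).[x].
HB.instance Definition _ x :=
  GRing.RMorphism.copy (peval x) (horner_eval x \o map_poly iF).

Lemma pevalE x h : peval x h = (map_poly iF h).[x]. Proof. by []. Qed.

Lemma pevalC x c : peval x c%:P = iF c.
Proof. by rewrite pevalE map_polyC hornerC. Qed.

Lemma pevalX x : peval x 'X = x.
Proof. by rewrite pevalE map_polyX hornerX. Qed.

Lemma peval0 x : peval x 0 = 0. Proof. exact: rmorph0. Qed.
Lemma peval1 x : peval x 1 = 1. Proof. exact: rmorph1. Qed.
Lemma pevalD x g h : peval x (g + h) = peval x g + peval x h.
Proof. exact: rmorphD. Qed.
Lemma pevalN x h : peval x (- h) = - peval x h.
Proof. exact: rmorphN. Qed.
Lemma pevalB x g h : peval x (g - h) = peval x g - peval x h.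
Proof. exact: rmorphB. Qed.
Lemma pevalM x g h : peval x (g * h) = peval x g * peval x h.
Proof. exact: rmorphM. Qed.

Lemma pevalXn x n : peval x 'X^n = x ^+ n.
Proof. by rewrite rmorphXn /= pevalX. Qed.

Lemma peval_coef x (h : {poly Fq}) n : (size h <= n)%N ->
  peval x h = \sum_(i < n) iF h`_i * x ^+ i.
Proof.
move=> hn; rewrite pevalE (@horner_coef_wide _ n) ?size_map_poly //.
by apply: eq_bigr => i _; rewrite coef_map.
Qed.

Definition transcendental (x : F) := forall h : {poly Fq}, h != 0 -> peval x h != 0.

(** [k] bounds sizes rather than degrees, so that these combinations are the images of the n by k
    matrices over Fq that [additive_pigeonhole] counts. *)
Definition poly_span (n : nat) (b : 'I_n -> F) (x : F) (k : nat) (y : F) :=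
  exists2 c : 'I_n -> {poly Fq}, (forall i, size (c i) <= k)%N &
    y = \sum_i peval x (c i) * b i.

(** Spanning over Fq(x) with the denominator cleared, so that no field of rational functions has to
    be mapped to F. *)
Definition spanning (n : nat) (b : 'I_n -> F) (x : F) :=
  forall y, exists (d : {poly Fq}) k, d != 0 /\ poly_span b x k (peval x d * y).

Definition poly_free (n : nat) (b : 'I_n -> F) (x : F) :=
  forall c : 'I_n -> {poly Fq}, \sum_i peval x (c i) * b i = 0 -> forall i, c i = 0.

Section Span.
Variables (n : nat) (b : 'I_n -> F) (x : F).
Local Notation S := (poly_span b x).

Lemma poly_span_le k l y : (k <= l)%N -> S k y -> S l y.
Proof. by move=> kl [c ck ->]; exists c => // i; apply: leq_trans (ck i) kl. Qed.

Lemma poly_span0 k : S k 0.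
Proof.
exists (fun=> 0) => [i|]; first by rewrite size_poly0.
by rewrite big1 // => i _; rewrite peval0 mul0r.
Qed.

Lemma poly_spanD k y z : S k y -> S k z -> S k (y + z).
Proof.
move=> [c ck ->] [d dk ->]; exists (fun i => c i + d i) => [i|].
  by rewrite (leq_trans (size_polyD _ _)) // geq_max ck dk.
by rewrite -big_split; apply: eq_bigr => i _; rewrite pevalD mulrDl.
Qed.

Lemma poly_span_sum (I : Type) (r : seq I) (P : pred I) (f : I -> F) k :
  (forall i, P i -> S k (f i)) -> S k (\sum_(i <- r | P i) f i).
Proof.
move=> fS; elim/big_ind: _ => //; first exact: poly_span0.
exact: poly_spanD.
Qed.

Lemma poly_spanM k l (h : {poly Fq}) y : (size h <= k.+1)%N -> S l y -> S (k + l) (peval x h * y).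
Proof.
move=> hk [c cl ->]; exists (fun i => h * c i) => [i|].
  case: (eqVneq h 0) => [->|h0]; first by rewrite mul0r size_poly0.
  case: (eqVneq (c i) 0) => [->|c0]; first by rewrite mulr0 size_poly0.
  rewrite size_mul // -ltnS (ltn_predK (m := 0)) ?addn_gt0 ?size_poly_gt0 ?h0 //.
  by rewrite -addSn leq_add.
by rewrite mulr_sumr; apply: eq_bigr => i _; rewrite pevalM mulrA.
Qed.

Lemma poly_spanMC k (h : {poly Fq}) y : S k y -> S ((size h).-1 + k) (peval x h * y).
Proof. by apply: poly_spanM; case: (size h). Qed.

Lemma common_denom (I : finType) (y : I -> F) : spanning b x ->
  exists (d : {poly Fq}) k, d != 0 /\ forall i, S k (peval x d * y i).
Proof.
move=> bS.
have {bS}/choice[d /choice[k dk]] i := bS (y i).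
pose e i := \prod_(j | j != i) d j.
exists (\prod_i d i), (\sum_i ((size (e i)).-1 + k i))%N; split=> [|i].
  by rewrite prodf_seq_neq0; apply/allP => i _; have [] := dk i.
have [_ Si] := dk i.
have -> : peval x (\prod_i d i) * y i = peval x (e i) * (peval x (d i) * y i).
  by rewrite (bigD1 i) // -/(e i) pevalM mulrA [_ * peval x (d i)]mulrC.
by apply: poly_span_le (poly_spanMC (e i) Si); rewrite (bigD1 i) //= leq_addr.
Qed.

End Span.

(* Two of the #|Fq|^(r s) matrices have the same image, so that their difference
   is in the kernel. *)
Lemma additive_pigeonhole (r s r' s' : nat)
    (f : 'M[Fq]_(r, s) -> F) (g : 'M[Fq]_(r', s') -> F) :
  (forall M N, f (M - N) = f M - f N) -> (forall M, exists N, f M = g N) ->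
  (r' * s' < r * s)%N -> exists2 M, M != 0 & f M = 0.
Proof.
move=> fB /choice[h fh] lt_rs.
have /injectivePn[M [N MN hMN]] : ~~ injectiveb (finfun h).
  apply/negP => /injectiveP/leq_card; rewrite !card_mx leq_exp2l ?finNzRing_gt1 //.
  by rewrite leqNgt lt_rs.
by exists (M - N); rewrite ?subr_eq0 // fB !fh; move: hMN; rewrite !ffunE => ->; rewrite subrr.
Qed.

Lemma rVpoly_sizeS d (v : 'rV[Fq]_d) : (size (rVpoly v) <= d)%N.
Proof. exact: size_poly. Qed.

Lemma poly_span_mx n (b : 'I_n -> F) x k y : poly_span b x k y ->
  exists N : 'M[Fq]_(n, k), y = \sum_i peval x (rVpoly (row i N)) * b i.
Proof.
move=> [c ck ->]; exists (\matrix_i poly_rV (c i)); apply: eq_bigr => i _.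
by rewrite rowK poly_rV_K.
Qed.

(* If t acts on the b_i with degree E in x, then F has dimension at most n E
   over Fq(t). *)
Lemma poly_dependent (n : nat) (b : 'I_n -> F) (x : F) (xT : transcendental x)
    (bS : spanning b x) (t : F) (dt : {poly Fq}) (E : nat) :
  dt != 0 -> (size dt <= E.+1)%N ->
  (forall i, poly_span b x E.+1 (peval x dt * t * b i)) ->
  forall (I : finType) (y : I -> F), (n * E < #|I|)%N ->
  exists2 h : I -> {poly Fq}, (exists i, h i != 0) & \sum_i peval t (h i) * y i = 0.
Proof.
move=> dt0 dtE tb I y nEI.
have tS k z : poly_span b x k z -> poly_span b x (E + k) (peval x dt * t * z).
  move=> [c ck ->]; rewrite mulr_sumr; apply: poly_span_sum => i _.
  rewrite mulrCA; have [k0|k0] := posnP k.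
    have := ck i; rewrite k0 leqn0 size_poly_eq0 => /eqP->.
    by rewrite peval0 mul0r; apply: poly_span0.
  have := @poly_spanM n b x k.-1 E.+1 (c i) _ _ (tb i).
  have -> : (k.-1 + E.+1 = E + k)%N by lia.
  by apply; have := ck i; lia.
have [dy [E' [dy0 yS]]] := common_denom y bS.
have tl k l i : (l <= k)%N ->
    poly_span b x (E * k + E') (peval x dt ^+ k * t ^+ l * (peval x dy * y i)).
  elim: k l => [|k IHk] l; first by rewrite leqn0 => /eqP->; rewrite !mul1r muln0.
  case: l => [_|l lk].
    rewrite exprS expr0 mulr1 -mulrA mulnS -addnA; apply: poly_spanM => //.
    by have := IHk 0 isT; rewrite expr0 mulr1.
  rewrite !exprS (_ : _ * _ * _ =
    peval x dt * t * (peval x dt ^+ k * t ^+ l * (peval x dy * y i))); last by ring.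
  by rewrite mulnS -addnA; apply/tS/IHk.
(* With at least n E + 1 indices, the #|I| (k + 1) coefficients of the [h i] outnumber the n (E k +
   E') coefficients of the image once k >= n E'. *)
pose k := (n * E')%N.
pose f (M : 'M[Fq]_(#|I|, k.+1)) :=
  \sum_i peval t (rVpoly (row (enum_rank i) M)) * y i.
have fB M N : f (M - N) = f M - f N.
  rewrite -sumrB; apply: eq_bigr => i _.
  by rewrite [row _ _]linearB [rVpoly _]linearB pevalB mulrBl.
pose D := peval x dt ^+ k * peval x dy.
have D0 : D != 0 by rewrite mulf_neq0 ?expf_neq0 ?xT.
have [|||M M0 fM] := @additive_pigeonhole _ _ n (E * k + E')%N (fun M => D * f M)
   (fun N => \sum_i peval x (rVpoly (row i N)) * b i).
- by move=> M N; rewrite fB mulrBr.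
- move=> M; apply: poly_span_mx; rewrite mulr_sumr; apply: poly_span_sum => i _.
  rewrite (peval_coef _ (rVpoly_sizeS _)) mulr_suml mulr_sumr.
  apply: poly_span_sum => l _.
  rewrite (_ : _ * _ = peval x ((rVpoly (row (enum_rank i) M))`_l)%:P *
    (peval x dt ^+ k * t ^+ l * (peval x dy * y i))); last by rewrite pevalC /D; ring.
  rewrite -[X in poly_span _ _ X]add0n; apply: poly_spanM; first exact: size_polyC_leq1.
  by apply: tl; rewrite -ltnS.
- by rewrite /k; nia.
exists (fun i => rVpoly (row (enum_rank i) M)).
  have [/forallP M00|/forallPn[i i0]] := boolP [forall i, row i M == 0].
    by case/eqP: M0; apply/row_matrixP => i; rewrite row0; apply/eqP.
  exists (enum_val i); rewrite enum_valK; apply: contraNneq i0 => rM.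
  by rewrite -[row i M]rVpolyK rM raddf0.
by apply/eqP; rewrite -(inj_eq (mulfI D0)) mulr0 fM.
Qed.

End Counting.

(** * Linear dependence over Fq[t] and orders of poles *)

Section FunctionFieldPlaces.
Variables (Fq : finFieldType) (F : fieldType) (iF : {rmorphism Fq -> F}).
Hypothesis ff : is_function_field iF.
Implicit Types (x y z : F) (v w : place iF) (h : {poly Fq}).

(** The relation asks for a nonzero polynomial, not for a nonzero value of it, so t may be
    arbitrary: when t is algebraic over Fq, its minimal polynomial serves. *)
Lemma dependent_over (t : F) : exists m : nat,
  forall (I : finType) (y : I -> F), (m < #|I|)%N ->
  exists2 h : I -> {poly Fq}, (exists i, h i != 0) & \sum_i peval iF t (h i) * y i = 0.
Proof.
have [x [xT [n [b bS]]]] := ff.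
have bspan : spanning iF b x.
  move=> y; have [d [c [d0 yd]]] := bS y; exists d, (\max_i size (c i))%N; split=> //.
  exists c => [i|]; first exact: (leq_bigmax i).
  by rewrite mulrC -yd.
have [d [k [d0 tS]]] := common_denom (fun i => t * b i) bspan.
exists (n * maxn k (size d))%N => I y; apply: (poly_dependent xT bspan d0).
  by rewrite leqW // leq_maxr.
by move=> i; rewrite -mulrA; apply: poly_span_le (tS i); rewrite leqW // leq_maxl.
Qed.

Lemma exists_basis (t : F) : exists n (b : 'I_n -> F),
  poly_free iF b t /\ spanning iF b t.
Proof.
have [m mP] := dependent_over t.
pose P n := `[< exists b : 'I_n -> F, poly_free iF b t >].
have P0 : exists n, P n.
  by exists 0%N; apply/asboolP; exists (fun=> 0) => c _ [].
have Pm n : P n -> (n <= m)%N.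
  move=> /asboolP[b bf]; rewrite leqNgt; apply/negP => mn.
  have [|h [i hi] /bf h0] := mP 'I_n b; first by rewrite card_ord.
  by rewrite h0 eqxx in hi.
case: (ex_maxnP P0 Pm) => n /asboolP[b bf] nmax; exists n, b; split=> // y.
pose b' (i : 'I_n.+1) := if unlift ord0 i is Some j then b j else y.
have /existsNP[c /not_implyP[cb /existsNP[i ci]]] : ~ poly_free iF b' t.
  move=> b'f; have /nmax : P n.+1 by apply/asboolP; exists b'.
  by rewrite ltnn.
move: cb; rewrite big_ord_recl {1}/b' unlift_none.
under eq_bigr => l _ do rewrite /b' liftK.
move=> cb; exists (c ord0), (\max_(l < n) size (c (lift ord0 l)))%N; split.
  apply/eqP => c0; move: cb; rewrite c0 peval0 mul0r add0r => /bf cl.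
  by case: (unliftP ord0 i) => [l|] il; apply: ci; rewrite il.
exists (fun l => - c (lift ord0 l)) => [l|].
  rewrite size_polyN; exact: (leq_bigmax l).
rewrite -[LHS](addrK (\sum_(l < n) peval iF t (c (lift ord0 l)) * b l)) cb sub0r.
by rewrite -sumrN; apply: eq_bigr => l _; rewrite pevalN mulNr.
Qed.

(** Multiplication by x^N raises degrees in x by N, whence the explicit bound n N with the given
    basis, where [dependent_over] leaves the bound unspecified; the count in [riemann] depends on
    it. *)
Lemma dependent_over_power n (b : 'I_n -> F) x N : transcendental iF x -> spanning iF b x ->
  forall (I : finType) (y : I -> F), (n * N < #|I|)%N ->
  exists2 h : I -> {poly Fq}, (exists i, h i != 0) &
    \sum_i peval iF (x ^+ N) (h i) * y i = 0.
Proof.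
move=> xT bS I y; apply: (poly_dependent xT bS (oner_neq0 _)).
  by rewrite size_poly1.
move=> i; rewrite peval1 mul1r -(pevalXn iF) -addn1.
apply: poly_spanM; first by rewrite size_polyXn.
exists (fun l => if l == i then 1 else 0) => [l|].
  by case: ifP; rewrite ?size_poly1 ?size_poly0.
rewrite (bigD1 i) //= eqxx peval1 mul1r big1 ?addr0 // => l /negPf->.
by rewrite peval0 mul0r.
Qed.

Section OnePlace.
Variable v : place iF.

Lemma ordX x n : x != 0 -> ord v (x ^+ n) = ord v x * n%:Z.
Proof.
move=> x0; elim: n => [|n IHn]; first by rewrite Defs.ord1 mulr0.
by rewrite exprS ordM ?expf_neq0 // IHn intS mulrDr mulr1.
Qed.

Lemma ord_neq0 x : ord v x != 0 -> x != 0.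
Proof. by apply: contraNneq => ->; rewrite Defs.ord0. Qed.

Lemma ord_geE n x : x != 0 -> ord_ge v n x -> n <= ord v x.
Proof. by move=> x0 [/eqP|//]; rewrite (negPf x0). Qed.

Lemma ord_geD n x y : ord_ge v n x -> ord_ge v n y -> ord_ge v n (x + y).
Proof. exact: (@fil_D _ (place_fil v)). Qed.

Lemma ord_geN n x : ord_ge v n x -> ord_ge v n (- x).
Proof. exact: (@fil_N _ (place_fil v)). Qed.

Lemma ord_ge_sum (I : Type) (r : seq I) (P : pred I) (f : I -> F) n :
  (forall i, P i -> ord_ge v n (f i)) -> ord_ge v n (\sum_(i <- r | P i) f i).
Proof.
move=> fn; elim/big_ind: _ => //; first by left.
exact: ord_geD.
Qed.

Lemma ord_ge_const c : ord_ge v 0 (iF c).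
Proof. by right; rewrite ord_const. Qed.

Lemma ord_ge0M x y : ord_ge v 0 x -> ord_ge v 0 y -> ord_ge v 0 (x * y).
Proof. by move=> x0 y0; rewrite -[0]addr0; apply: ord_ge_M. Qed.

Lemma ord_ge0X x n : ord_ge v 0 x -> ord_ge v 0 (x ^+ n).
Proof.
by move=> x0; elim: n => [|n IHn]; [apply: ord_ge_1 | rewrite exprS; apply: ord_ge0M].
Qed.

Lemma ord_ge_inv x : ord v x < 0 -> ord_ge v 0 x^-1.
Proof. by move=> x0; right; rewrite ordV ?ord_neq0 ?lt_eqF //; lia. Qed.

Lemma ordN x : ord v (- x) = ord v x.
Proof.
case: (eqVneq x 0) => [->|x0]; first by rewrite oppr0.
by rewrite -mulN1r ordM ?oppr_eq0 ?oner_eq0 // ordN1 add0r.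
Qed.

Lemma ordD_le n x y : x != 0 -> y != 0 -> x + y != 0 ->
  n <= ord v x -> n <= ord v y -> n <= ord v (x + y).
Proof.
by move=> x0 y0 xy0 nx ny; apply: le_trans (ordD v x0 y0 xy0); rewrite le_min nx ny.
Qed.

Lemma ord_ge_add_lt x y : x != 0 -> ord_ge v (ord v x + 1) y ->
  x + y != 0 /\ ord v (x + y) = ord v x.
Proof.
move=> x0 yx; case: (eqVneq y 0) => [->|y0]; first by rewrite addr0.
have {}yx := ord_geE y0 yx.
have xy0 : x + y != 0.
  apply/eqP => /eqP; rewrite addr_eq0 => /eqP xy.
  by move: yx; rewrite xy ordN; lia.
have le_x : ord v x <= ord v (x + y) by apply: ordD_le => //; lia.
split=> //; apply/eqP; rewrite eq_le le_x andbT leNgt; apply/negP => lt_x.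
have : ord v x + 1 <= ord v (x + y - y).
  by apply: ordD_le; rewrite ?oppr_eq0 ?addrK // ?ordN //; lia.
by rewrite addrK; lia.
Qed.

Lemma ord_dominant (I : finType) (f : I -> F) i0 : f i0 != 0 ->
  (forall i, i != i0 -> ord_ge v (ord v (f i0) + 1) (f i)) -> \sum_i f i != 0.
Proof.
move=> f0 fi; rewrite (bigD1 i0) //=.
by case: (@ord_ge_add_lt (f i0) (\sum_(i | i != i0) f i)) => //; apply: ord_ge_sum.
Qed.

Lemma ord_ge_peval x h : ord_ge v 0 x -> ord_ge v 0 (peval iF x h).
Proof.
move=> x0; rewrite (peval_coef iF x (leqnn _)); apply: ord_ge_sum => i _.
by apply: ord_ge0M; [apply: ord_ge_const | apply: ord_ge0X].
Qed.

Lemma ord_peval x h : ord v x < 0 -> h != 0 ->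
  peval iF x h != 0 /\ ord v (peval iF x h) = ord v x * (size h).-1%:Z.
Proof.
move=> x0 h0; have xn0 : x != 0 by rewrite ord_neq0 // lt_eqF.
have sh : size h = (size h).-1.+1 by rewrite prednK ?size_poly_gt0.
rewrite (peval_coef iF x (leqnn _)) sh big_ord_recr /=.
set y := iF _ * _; rewrite addrC.
have lh0 : iF h`_(size h).-1 != 0 by rewrite fmorph_eq0 -lead_coefE lead_coef_eq0.
have yE : ord v y = ord v x * (size h).-1%:Z.
  by rewrite ordM ?expf_neq0 // ord_const add0r ordX.
rewrite -yE; apply: ord_ge_add_lt; first by rewrite mulf_neq0 ?expf_neq0.
apply: ord_ge_sum => i _; rewrite -[_ + 1]add0r; apply: ord_ge_M.
  exact: ord_ge_const.
right; rewrite yE ordX //; move: (ltn_ord i) x0.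
by case: i => /= k _; move: (size h).-1 (ord v x) => s e ks e0; nia.
Qed.

Lemma transcendental_pole x : ord v x < 0 -> transcendental iF x.
Proof. by move=> x0 h h0; have [] := ord_peval x0 h0. Qed.

End OnePlace.

Lemma algebraic_relation x y : exists (m : nat) (h : nat -> {poly Fq}),
  h m != 0 /\ \sum_(i < m.+1) peval iF x (h i) * y ^+ i = 0.
Proof.
have [n nP] := dependent_over x.
have [|h [i0 hi0] hy] := nP 'I_n.+1 (fun i => y ^+ i); first by rewrite card_ord.
case: (@arg_maxnP _ i0 (fun i => h i != 0) (fun i => i : nat) hi0) => i hi imax.
exists i, (fun l => h (inord l)); split; first by rewrite inord_val.
rewrite -[RHS]hy (big_ord_widen n.+1 (fun l => peval iF x (h (inord l)) * y ^+ l)) //.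
rewrite big_mkcond; apply: eq_bigr => l _ /=; rewrite inord_val; case: ifPn => // il.
case: (eqVneq (h l) 0) => [->|/imax li]; first by rewrite peval0 mul0r.
by case/negP: il; rewrite ltnS.
Qed.

(** h is the leading coefficient of a relation of y over Fq[x], hence serves all places at once: if
    h y had a pole where x has none, the leading term would dominate the relation. *)
Lemma integral_multiple x y : transcendental iF x -> exists2 h, h != 0 &
  forall v, ord_ge v 0 x -> ord_ge v 0 (peval iF x h * y).
Proof.
move=> xT; have [m [h [hm hy]]] := algebraic_relation x y.
exists (h m) => // v x0.
case: (eqVneq y 0) => [->|y0]; first by rewrite mulr0; left.
right; rewrite leNgt; apply/negP => hy0.
have hx0 i : ord_ge v 0 (peval iF x (h i)) by apply: ord_ge_peval.
have hm0 : peval iF x (h m) != 0 by apply: xT.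
have hmv := ord_geE hm0 (hx0 m); rewrite ordM // in hy0.
have : \sum_(i < m.+1) peval iF x (h i) * y ^+ i != 0; last by rewrite hy eqxx.
apply: (@ord_dominant v _ _ ord_max) => [|i im]; first by rewrite mulf_neq0 ?expf_neq0.
have {}im : (i < m)%N.
  by have := ltn_ord i; rewrite ltnS leq_eqVlt => /orP[/eqP E|//]; case/eqP: im; apply: val_inj.
rewrite /= ordM ?expf_neq0 // ordX //.
apply: (@ord_ge_S _ _ _ v _ (0 + ord v y * i%:Z)).
  by move: (ord v _) (ord v y) hmv hy0 => a c; nia.
by apply: ord_ge_M => //; right; rewrite ordX.
Qed.

(** C exceeds the degrees of all coefficients of a relation of y over Fq[x]: at a pole of x where
    the pole of y has more than C times its order, the leading term would dominate. *)
Lemma bounded_poles x y : exists C : nat,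
  forall v, ord v x < 0 -> ord_ge v 0 (y / x ^+ C).
Proof.
have [m [h [hm hy]]] := algebraic_relation x y.
exists (\sum_(i < m.+1) size (h i))%N => v x0; set C := (\sum_i _)%N.
have xn0 : x != 0 by rewrite (@ord_neq0 v) // lt_eqF.
case: (eqVneq y 0) => [->|y0]; first by rewrite mul0r; left.
right; rewrite leNgt ordM ?invr_eq0 ?expf_neq0 // ordV ?expf_neq0 // ordX //.
apply/negP => yC.
have [hm0 hmE] := ord_peval x0 hm.
have : \sum_(i < m.+1) peval iF x (h i) * y ^+ i != 0; last by rewrite hy eqxx.
apply: (@ord_dominant v _ _ ord_max) => [|i im]; first by rewrite mulf_neq0 ?expf_neq0.
have {}im : (i < m)%N.
  by have := ltn_ord i; rewrite ltnS leq_eqVlt => /orP[/eqP E|//]; case/eqP: im; apply: val_inj.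
case: (eqVneq (h i) 0) => [->|hi]; first by rewrite peval0 mul0r; left.
have [hi0 hiE] := ord_peval x0 hi.
right; rewrite !ordM ?expf_neq0 // !ordX // hmE hiE /=.
have sC : (size (h i) <= C)%N by rewrite /C (bigD1 i) //= leq_addr.
have : ((size (h i)).-1 <= C)%N by lia.
move: (size (h i)).-1 (size (h m)).-1 => a c.
move: (ord v x) (ord v y) (C) (nat_of_ord i) x0 yC im => e f D k e0 yC km aD.
have : f + (- e) * D%:Z <= -1 by lia.
have : e * D%:Z <= e * a%:Z by nia.
move=> H1 H2; have : (m - k)%:Z * f <= (m - k)%:Z * (e * D%:Z - 1) by nia.
rewrite -subzn ?(ltnW km) //; nia.
Qed.

End FunctionFieldPlaces.

Section FractionField.
Variables (Fq : finFieldType) (F : fieldType) (iF : {rmorphism Fq -> F}).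
Hypothesis ff : is_function_field iF.
Implicit Types (x y z : F) (v w : place iF) (h : {poly Fq}).

(** Otherwise ord_v z <= 0 forces ord_w z <= 0, which makes ord_w a nonnegative multiple of ord_v;
    surjectivity of the valuations forces the factor 1. *)
Lemma place_separation v w : ~ (Defs.ord v =1 Defs.ord w) ->
  exists z, ord v z < 0 /\ 0 < ord w z.
Proof.
move=> vw; apply: contrapT => /forallNP no_z.
have pos z : ord v z < 0 -> ord w z <= 0.
  by move=> vz; rewrite leNgt; apply/negP => wz; apply: (no_z z).
have nonneg z : ord v z <= 0 -> ord w z <= 0.
  move=> vz; case: (eqVneq z 0) => [->|z0]; first by rewrite Defs.ord0.
  rewrite leNgt; apply/negP => wz.
  have [t t0 vt] := ord_surj v (-1).
  (* The factor t turns ord_v z <= 0 into a strict inequality, and the power of z keeps the order at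
     w positive. *)
  have := pos (z ^+ `|ord w t|.+1 * t); rewrite !ordM ?expf_neq0 // !ordX // vt.
  by move: (ord v z) (ord w z) (ord w t) vz wz => a b c; nia.
have eq0 z : z != 0 -> ord v z = 0 -> ord w z = 0.
  move=> z0 vz; have := nonneg z; have := nonneg z^-1; rewrite !ordV // vz oppr0 lexx.
  by move=> /(_ isT) + /(_ isT); lia.
have [t t0 vt] := ord_surj v (-1).
have wE z : ord w z = - ord v z * ord w t.
  case: (eqVneq z 0) => [->|z0]; first by rewrite !Defs.ord0 mul0r.
  have [k [zk|zk]] : exists k, ord v z = k%:Z \/ ord v z = - k%:Z.
    by exists `|ord v z|%N; lia.
    have := eq0 (z * t ^+ k); rewrite mulf_neq0 ?expf_neq0 // !ordM ?expf_neq0 // !ordX //.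
    by rewrite zk vt => /(_ isT); lia.
  have := eq0 (z * t^-1 ^+ k); rewrite mulf_neq0 ?expf_neq0 ?invr_eq0 //.
  rewrite !ordM ?expf_neq0 ?invr_eq0 // !ordX ?invr_eq0 // !ordV //.
  by rewrite zk vt => /(_ isT); lia.
have wt : ord w t <= 0 by apply: nonneg; rewrite vt.
have [u u0 wu] := ord_surj w 1.
have wt1 : ord w t = -1.
  have := wE u; rewrite wu; move: (ord v u) (ord w t) wt => a b b0 ab.
  have a1 : 1 <= a by nia.
  have b1 : b <= -1 by nia.
  nia.
by apply: vw => z; rewrite wE wt1; lia.
Qed.

Lemma weak_approximation v (T : eqType) (vs : T -> place iF) (s : seq T) :
  (forall i, i \in s -> ~ (Defs.ord v =1 Defs.ord (vs i))) ->
  exists g, ord v g < 0 /\ forall i, i \in s -> 0 < ord (vs i) g.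
Proof.
move=> vP.
(* The inverse is constructed instead, with a zero at v and poles at the [vs i], because a
   dominating pole survives addition. *)
suff [g [vg sg]] : exists g, 0 < ord v g /\ forall i, i \in s -> ord (vs i) g < 0.
  have g0 : g != 0 by rewrite (@ord_neq0 _ _ _ v) // gt_eqF.
  by exists g^-1; split=> [|i /sg]; rewrite ordV //; lia.
elim: s vP => [|i s IHs] vP; first by have [g _ vg] := ord_surj v 1; exists g; rewrite vg.
have [|y [vy sy]] := IHs; first by move=> k ks; apply: vP; rewrite inE ks orbT.
have [|z [iz vz]] := @place_separation (vs i) v.
  by move=> e; apply: (vP i (mem_head _ _)) => x; rewrite e.
have [y0 z0] : y != 0 /\ z != 0 by split; apply: (@ord_neq0 _ _ _ v); rewrite gt_eqF.
have [R Ry] : exists R : nat, forall k, k \in i :: s -> (`|ord (vs k) y| < R)%N.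
  exists (\sum_(k <- i :: s) `|ord (vs k) y|).+1%N => k ks.
  by rewrite ltnS (big_rem k) //= leq_addr.
(* At a pole of z, the exponent R + 1 beats the order of y, which is less than R in absolute value;
   where z is integral, y keeps its pole. *)
exists (y + z ^+ R.+1).
have lt0 k : k \in i :: s -> ord (vs k) y < 0 \/ ord (vs k) z < 0 ->
    y + z ^+ R.+1 != 0 /\ ord (vs k) (y + z ^+ R.+1) < 0.
  move=> /Ry yR yz; case: (ltP (ord (vs k) z) 0) => [kz|kz].
    rewrite addrC; have [||n0 ->] := @ord_ge_add_lt _ _ _ (vs k) (z ^+ R.+1) y.
    - by rewrite expf_neq0.
    - right; rewrite ordX //; move: (ord _ y) (ord _ z) yR kz => a b; nia.
    - by split=> //; rewrite ordX //; move: (ord _ z) kz => b; nia.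
  have ky : ord (vs k) y < 0 by case: yz => //; rewrite ltNge kz.
  have [||n0 ->] // := @ord_ge_add_lt _ _ _ (vs k) y (z ^+ R.+1).
  right; rewrite ordX //; move: (ord _ y) (ord _ z) ky kz => a b; nia.
split=> [|k]; last first.
  move=> ks; have [] // := lt0 k ks; move: ks; rewrite inE => /orP[/eqP->|/sy]; first by right.
  by left.
have [|w0 _] := lt0 i (mem_head _ _); first by right.
have : 1 <= ord v (y + z ^+ R.+1); last by lia.
apply: ordD_le; rewrite ?expf_neq0 ?ordX //.
by move: (ord v z) vz => a; nia.
Qed.

(** The number of poles is bounded by the degree of F over Fq(x): functions g_i with a pole at v_i
    and zeros at the other v_k are independent over Fq[x], since the term i whose coefficient has
    the largest degree dominates at v_i. *)
Lemma finitely_many_poles x : exists N (vs : 'I_N -> place iF),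
  forall v, ord v x < 0 -> exists i, Defs.ord v =1 Defs.ord (vs i).
Proof.
have [m mP] := dependent_over ff x.
pose P n := `[< exists vs : 'I_n -> place iF, (forall i, ord (vs i) x < 0) /\
  forall i k, i != k -> ~ (Defs.ord (vs i) =1 Defs.ord (vs k)) >].
have P0 : exists n, P n.
  by exists 0%N; apply/asboolP; exists (fun i : 'I_0 => False_rect _ (notF (ltn_ord i))); split=> -[].
have Pm n : P n -> (n <= m)%N.
  move=> /asboolP[vs [vsx vsP]]; rewrite leqNgt; apply/negP => mn.
  have /choice[g gP] i : exists g, ord (vs i) g < 0 /\
      forall k, k \in [seq k <- enum 'I_n | k != i] -> 0 < ord (vs k) g.
    by apply: weak_approximation => k; rewrite mem_filter eq_sym => /andP[/vsP].
  have [|h [i0 hi0] hg] := mP 'I_n g; first by rewrite card_ord.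
  case: (@arg_maxnP _ i0 (fun i => h i != 0) (fun i => size (h i)) hi0) => i hi imax.
  have : \sum_i peval iF x (h i) * g i != 0; last by rewrite hg eqxx.
  have g0 k : g k != 0 by have [gk _] := gP k; rewrite (@ord_neq0 _ _ _ (vs k)) // lt_eqF.
  have [hx0 hxE] := ord_peval (vsx i) hi.
  apply: (@ord_dominant _ _ _ (vs i) _ _ i) => [|k ki]; first by rewrite mulf_neq0.
  case: (eqVneq (h k) 0) => [->|hk]; first by rewrite peval0 mul0r; left.
  have [hk0 hkE] := ord_peval (vsx i) hk.
  right; rewrite !ordM // hxE hkE.
  have [gi _] := gP i; have [_ /(_ i)] := gP k.
  rewrite mem_filter mem_enum eq_sym ki => /(_ isT) gk.
  have : ((size (h k)).-1 <= (size (h i)).-1)%N by have := imax k hk; lia.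
  move: (size (h k)).-1 (size (h i)).-1 (ord _ (g k)) (ord _ (g i)) (ord _ x) (vsx i) gi gk.
  by move=> a b c d e *; nia.
case: (ex_maxnP P0 Pm) => n /asboolP[vs [vsx vsP]] nmax; exists n, vs => v vx.
apply: contrapT => /forallNP vvs.
have /nmax : P n.+1; last by rewrite ltnn.
apply/asboolP; exists (fun i => if unlift ord0 i is Some k then vs k else v).
split=> [i|i k]; first by case: unliftP.
case: (unliftP ord0 i) => [i'|] ->; case: (unliftP ord0 k) => [k'|] -> ik //.
- by apply: vsP; apply: contraNneq ik => ->.
- by move=> e; apply: (vvs i') => z; rewrite e.
Qed.

(* The coefficients of the highest power of t in a relation of elements whose
   poles are bounded by those of t give a combination without such poles. *)
Lemma leading_combination (t : F) (t0 : t != 0) (I : finType) (y : I -> F)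
    (h : I -> {poly Fq}) : (exists i, h i != 0) -> \sum_i peval iF t (h i) * y i = 0 ->
  exists2 u : I -> Fq, (exists i, u i != 0) & forall v, ord v t < 0 ->
    (forall i, ord_ge v 0 (y i / t)) -> ord_ge v 0 (\sum_i iF (u i) * y i).
Proof.
move=> [i0 hi0] hy.
case: (@arg_maxnP _ i0 (fun i => h i != 0) (fun i => size (h i)) hi0) => i hi imax.
set D := (size (h i)).-1.
have sD k : (size (h k) <= D.+1)%N.
  case: (eqVneq (h k) 0) => [->|/imax]; first by rewrite size_poly0.
  by rewrite /D prednK // size_poly_gt0.
exists (fun k => (h k)`_D) => [|v vt yt].
  by exists i; rewrite -lead_coefE lead_coef_eq0.
have -> : \sum_k iF (h k)`_D * y k =
    - \sum_k \sum_(e < D) iF (h k)`_e * (y k / t) * t^-1 ^+ (D - e).-1.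
  apply/eqP; rewrite -addr_eq0 -(inj_eq (mulfI (expf_neq0 D t0))) mulr0 -big_split /=.
  rewrite mulr_sumr -[X in _ == X]hy; apply/eqP/eq_bigr => k _.
  rewrite (peval_coef iF t (sD k)) big_ord_recr /= mulrDr mulrDl [RHS]addrC; congr (_ + _).
    by ring.
  rewrite mulr_sumr mulr_suml; apply: eq_bigr => e _.
  have -> : t ^+ D = t ^+ e * t * t ^+ (D - e).-1.
    rewrite -exprSr -exprD; congr (_ ^+ _); have := ltn_ord e; lia.
  by rewrite exprVn; field; rewrite t0 expf_neq0.
apply: ord_geN; apply: ord_ge_sum => k _; apply: ord_ge_sum => e _.
apply: ord_ge0M; last exact/ord_ge0X/ord_ge_inv.
by apply: ord_ge0M => //; apply: ord_ge_const.
Qed.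

End FractionField.

(** * Riemann's inequality and F as the field of fractions of A *)

Section Riemann.
Variables (Fq : finFieldType) (F : fieldType) (iF : {rmorphism Fq -> F}).
Hypothesis ff : is_function_field iF.
Variable inf : place iF.
Implicit Types (x y z : F) (v w : place iF) (h : {poly Fq}).
Local Notation A := (regular inf).

(* Dimension count as in Riemann's inequality: the x^l b_i with l <= k have poles
   at the poles of x only, and those other than inf impose too few conditions. *)
Lemma riemann x (C' : nat) : ord inf x < 0 -> exists2 y, y != 0 &
  (forall v, ord_ge v 0 x -> ord_ge v 0 y) /\
  (forall v, ord v x < 0 -> ~ (Defs.ord v =1 Defs.ord inf) -> ord_ge v 0 (x ^+ C' * y)).
Proof.
move=> xinf; have xT := transcendental_pole xinf.
have xn0 : x != 0 by rewrite (@ord_neq0 _ _ _ inf) // lt_eqF.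
have [n [b [bf bS]]] := exists_basis ff x.
have /choice[d dP] i : exists d : {poly Fq}, d != 0 /\
    forall v, ord_ge v 0 x -> ord_ge v 0 (peval iF x d * b i).
  by have [d d0 db] := integral_multiple ff (b i) xT; exists d.
pose b' i := peval iF x (d i) * b i.
have /choice[Cb CbP] i := bounded_poles ff x (b' i).
pose C := (\sum_i Cb i)%N.
have b'C v i : ord v x < 0 -> ord_ge v 0 (b' i / x ^+ C).
  move=> vx; have -> : C = (Cb i + (C - Cb i))%N.
    by rewrite subnKC // /C (bigD1 i) //= leq_addr.
  rewrite exprD invfM mulrA; apply: ord_ge0M; first exact: CbP.
  by rewrite -exprVn; apply/ord_ge0X/ord_ge_inv.
have [M [vs vsP]] := finitely_many_poles ff x.
(* The powers of g absorb the poles at [inf] and vanish at the other poles of x, so that including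
   them leaves the conditions at these other poles intact. *)
have [g [ginf gvs]] : exists g, ord inf g < 0 /\
    forall i, i \in [seq i <- enum 'I_M | `[< ~ (Defs.ord inf =1 Defs.ord (vs i)) >]] ->
      0 < ord (vs i) g.
  by apply: weak_approximation => i; rewrite mem_filter => /andP[/asboolP].
have gn0 : g != 0 by rewrite (@ord_neq0 _ _ _ inf) // lt_eqF.
have g_pos v : ord v x < 0 -> ~ (Defs.ord v =1 Defs.ord inf) -> ord_ge v 0 g.
  move=> /vsP[i vi] vinf; right; rewrite vi ltW // gvs // mem_filter mem_enum andbT.
  by apply/asboolP => e; apply: vinf => z; rewrite vi e.
have [c0 c0P] := bounded_poles ff x g.
(* k is large enough for x^N to bound the poles of the N' powers of g, and n (k + 1) + N' exceeds n
   N, the bound of [dependent_over_power]. *)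
pose N' := (n * (C' + C)).+1; pose k := (c0.+1 * N')%N; pose N := (C' + (k + C))%N.
pose y (i : 'I_n * 'I_k.+1 + 'I_N') :=
  match i with inl i => x ^+ (C' + i.2) * b' i.1 | inr l => g ^+ l.+1 end.
have yN v i : ord v x < 0 -> ord_ge v 0 (y i / x ^+ N).
  move=> vx; have xV e : ord_ge v 0 (x ^+ e)^-1.
    by rewrite -exprVn; apply/ord_ge0X/ord_ge_inv.
  case: i => [[i l]|l] /=.
    have -> : x ^+ N = x ^+ (C' + l) * x ^+ C * x ^+ (k - l).
      by rewrite -!exprD; congr (_ ^+ _); have := ltn_ord l; rewrite /N; lia.
    rewrite (_ : _ / _ = b' i / x ^+ C * (x ^+ (k - l))^-1).
      by apply: ord_ge0M => //; apply: b'C.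
    by field; rewrite !expf_neq0.
  have -> : x ^+ N = (x ^+ c0) ^+ l.+1 * x ^+ (N - c0 * l.+1).
    rewrite -exprM -exprD; congr (_ ^+ _); have := ltn_ord l; rewrite /N /k; nia.
  rewrite (_ : _ / _ = (g / x ^+ c0) ^+ l.+1 * (x ^+ (N - c0 * l.+1))^-1).
    by apply: ord_ge0M => //; apply/ord_ge0X/c0P.
  by rewrite invfM exprMn exprVn mulrA.
have [|h h0 hy] := dependent_over_power xT bS (N := N) y.
  rewrite card_sum card_prod !card_ord /N /N'; nia.
have xN0 : x ^+ N != 0 by rewrite expf_neq0.
have [u [i0 ui0] uP] := leading_combination xN0 h0 hy.
have N0 : (0 < N)%N by rewrite /N /k /N'; lia.
have {}uP v : ord v x < 0 -> ord_ge v 0 (\sum_i iF (u i) * y i).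
  move=> vx; apply: uP => [|i]; last exact: yN.
  by rewrite ordX //; move: (ord v x) vx => a; nia.
pose z := \sum_(i : 'I_n * 'I_k.+1) iF (u (inl i)) * (x ^+ i.2 * b' i.1).
pose w := \sum_l iF (u (inr l)) * g ^+ l.+1.
have zw : \sum_i iF (u i) * y i = x ^+ C' * z + w.
  rewrite big_sumType /=; congr (_ + _).
  by rewrite mulr_sumr; apply: eq_bigr => i _; rewrite exprD; ring.
exists z.
  (* If z vanished, freeness of the [b i] would leave only w, a polynomial in g without constant
     term that has no pole at [inf], hence zero. *)
  apply: contraNneq ui0 => z0.
  pose c i := (\poly_(l < k.+1) u (inl (i, inord l))) * d i.
  have ul i : u (inl i) = 0.
    have /bf/(_ i.1)/eqP : \sum_i peval iF x (c i) * b i = 0.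
      rewrite -[RHS]z0 /z.
      transitivity (\sum_i \sum_(l < k.+1) iF (u (inl (i, l))) * (x ^+ l * b' i)).
        2: by rewrite pair_bigA; apply: eq_bigr => -[].
      apply: eq_bigr => i1 _.
      rewrite pevalM -mulrA -/(b' i1) (peval_coef iF x (size_poly _ _)) mulr_suml.
      by apply: eq_bigr => l _; rewrite coef_poly ltn_ord inord_val mulrA.
    rewrite mulf_eq0 (negPf (proj1 (dP _))) orbF => /eqP/polyP/(_ i.2).
    by rewrite coef_poly ltn_ord inord_val coef0 -surjective_pairing.
  case: i0 => [i0|l0]; first by rewrite ul.
  pose hg := \poly_(l < N'.+1) (if l is l'.+1 then u (inr (inord l')) else 0).
  have wE : w = peval iF g hg.
    rewrite (peval_coef iF g (size_poly _ _)) big_ord_recl coef_poly rmorph0 mul0r add0r.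
    by apply: eq_bigr => l _; rewrite coef_poly /= /bump add1n ltnS ltn_ord inord_val.
  apply/eqP; case: (eqVneq hg 0) => [/polyP/(_ l0.+1)|hg0].
    by rewrite coef_poly ltnS ltn_ord inord_val coef0.
  have [w0 wv] := ord_peval ginf hg0.
  have := uP inf xinf; rewrite zw z0 mulr0 add0r wE => /(ord_geE w0); rewrite wv.
  have : size hg != 1%N.
    apply/negP => /eqP s1; have : lead_coef hg != 0 by rewrite lead_coef_eq0.
    by rewrite lead_coefE s1 coef_poly eqxx.
  have : size hg != 0%N by rewrite size_poly_eq0.
  move: (size hg) (ord inf g) ginf => s a; nia.
have zO v : ord_ge v 0 x -> ord_ge v 0 z.
  move=> vx; apply: ord_ge_sum => i _; apply: ord_ge0M; first exact: ord_ge_const.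
  apply: ord_ge0M; first exact: ord_ge0X.
  by have [_] := dP i.1; apply.
split=> // v vx vinf; rewrite -[_ * z](addrK w) -zw.
apply: ord_geD; first exact: uP.
apply: ord_geN; apply: ord_ge_sum => l _; apply: ord_ge0M; first exact: ord_ge_const.
exact/ord_ge0X/g_pos.
Qed.

Lemma regular_memP y : (forall v, ~ (Defs.ord v =1 Defs.ord inf) -> ord_ge v 0 y) ->
  exists a : A, reg_val a = y.
Proof. by move=> /asboolP yr; exists (Sub y yr). Qed.

(** Here y is the quotient of [peval iF x h * y] by [peval iF x h], whose poles are among those of
    x; multiplication by the z of [riemann] cancels these poles everywhere but at [inf]. *)
Lemma regular_frac y : exists b c : A, c != 0 /\ y * reg_val c = reg_val b.
Proof.
have [x x0 xinf'] := ord_surj inf (-1).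
have xinf : ord inf x < 0 by rewrite xinf'.
have xT := transcendental_pole xinf.
have [h h0 hy] := integral_multiple ff y xT.
have [C CP] := bounded_poles ff x (peval iF x h * y).
have [C2 C2P] := bounded_poles ff x (peval iF x h).
have [z z0 [zreg zpole]] := riemann (C + C2) xinf.
have xz v : ord v x < 0 \/ ord_ge v 0 x.
  by case: (ltP (ord v x) 0) => vx; [left | right; right].
have zv e v : (e <= C + C2)%N -> ord v x < 0 -> ~ (Defs.ord v =1 Defs.ord inf) ->
    ord_ge v 0 (x ^+ e * z).
  move=> eC vx vinf; rewrite (_ : _ * z = x ^+ (C + C2) * z * (x ^+ (C + C2 - e))^-1).
    apply: ord_ge0M; first exact: zpole.
    by rewrite -exprVn; apply/ord_ge0X/ord_ge_inv.
  have -> : x ^+ (C + C2) = x ^+ e * x ^+ (C + C2 - e) by rewrite -exprD subnKC.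
  by rewrite [_ * _ * z]mulrAC mulfK // expf_neq0.
have reg t e : (e <= C + C2)%N -> (forall v, ord_ge v 0 x -> ord_ge v 0 t) ->
    (forall v, ord v x < 0 -> ord_ge v 0 (t / x ^+ e)) -> exists a : A, reg_val a = z * t.
  move=> eC t1 t2; apply: regular_memP => v vinf; case: (xz v) => vx.
    rewrite (_ : z * t = (x ^+ e * z) * (t / x ^+ e)); last by field; rewrite expf_neq0.
    by apply: ord_ge0M; [apply: zv | apply: t2].
  by apply: ord_ge0M; [apply: zreg | apply: t1].
have [|||b bE] := reg (peval iF x h * y) C; rewrite ?leq_addr //.
have [||c cE] := reg (peval iF x h) C2 _ _ C2P; rewrite ?leq_addl //.
  by move=> v; apply: ord_ge_peval.
exists b, c; split; last by rewrite bE cE; ring.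
apply/eqP => c0; have : z * peval iF x h != 0 by rewrite mulf_neq0 ?xT.
by rewrite -cE c0 rmorph0 eqxx.
Qed.

Section FinitePlaceElements.
Variable p : finite_place inf.

Lemma reg_val_inj : injective (@reg_val _ _ _ inf). Proof. exact: val_inj. Qed.

Lemma reg_val_eq0 (a : A) : (reg_val a == 0) = (a == 0).
Proof. by rewrite -(rmorph0 (@reg_val _ _ _ inf)) (inj_eq reg_val_inj). Qed.

Lemma reg_val_neq0 (a : A) : a != 0 -> reg_val a != 0.
Proof. by rewrite reg_val_eq0. Qed.

Lemma regular_ord_pos : exists2 c : A, c != 0 & 0 < ord p (reg_val c).
Proof.
have [t t0 pt] := ord_surj p 1; have [b [c [c0 tc]]] := regular_frac t.
have cv0 := reg_val_neq0 c0.
have bv0 : reg_val b != 0 by rewrite -tc mulf_neq0.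
exists b; first by rewrite -reg_val_eq0.
rewrite -tc ordM // pt; have := ord_geE cv0 (reg_ord_ge p c).
by move: (ord p _) => e; lia.
Qed.

End FinitePlaceElements.
End Riemann.

(** * Twisted polynomials *)

Section TwistedPolynomials.
Variables (Fq : finFieldType) (L : fieldType) (iL : {rmorphism Fq -> L}).
Local Notation Lt := (twisted iL).
Local Notation q := #|Fq|.
Local Notation pol m := (m%R : {poly L}).
Implicit Types m d P : Lt.

Lemma coef_exp_default (r : {poly L}) k i : (size r <= k)%N -> r`_k ^+ (q ^ i) = 0.
Proof.
move=> rk; rewrite nth_default // expr0n expn_eq0 -leqn0 leqNgt.
by rewrite (ltn_trans _ (finNzRing_gt1 Fq)).
Qed.

Lemma tw_coefD m d k : (pol (m + d))`_k = (pol m)`_k + (pol d)`_k.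
Proof. exact: coefD. Qed.

Lemma coef_tw_shift i (r : {poly L}) k :
  (tw_shift Fq i r)`_k = if (k < i)%N then 0 else r`_(k - i) ^+ (q ^ i).
Proof.
rewrite /tw_shift coefMXn; case: ifP => // _.
by rewrite coef_map_id0 // expr0n expn_eq0 -leqn0 leqNgt (ltn_trans _ (finNzRing_gt1 Fq)).
Qed.

Lemma tw_coefM n m d k : (size (pol m) <= n)%N -> (pol (m * d))`_k =
  \sum_(i < n) (pol m)`_i * (if (k < i)%N then 0 else (pol d)`_(k - i) ^+ (q ^ i)).
Proof.
move=> mn; rewrite -[pol (m * d)]/(tw_mul m d : {poly L}) (tw_mulE _ mn) coef_sum.
by apply: eq_bigr => i _; rewrite coefZ coef_tw_shift.
Qed.

Lemma size_twM m d : m != 0 -> d != 0 ->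
  size (pol (m * d)) = (size (pol m) + size (pol d)).-1.
Proof.
move=> m0 d0; have [s ms] : exists s, size (pol m) = s.+1.
  by exists (size (pol m)).-1; rewrite prednK // size_poly_gt0.
have [t dt] : exists t, size (pol d) = t.+1.
  by exists (size (pol d)).-1; rewrite prednK // size_poly_gt0.
rewrite ms dt addSn addnS /=; apply/eqP; rewrite eqn_leq; apply/andP; split.
  apply/leq_sizeP => k kst; rewrite (tw_coefM _ _ (leqnn _)) big1 // => i _.
  case: ifP => _; first by rewrite mulr0.
  rewrite (coef_exp_default (r := d)) ?mulr0 //.
  by case: i => i /=; rewrite ms dt; lia.
rewrite ltnNge; apply/negP => /leq_sizeP/(_ (s + t)%N (leqnn _)).
rewrite (tw_coefM _ _ (eq_leq ms)) big_ord_recr big1 /= => [|i _].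
  rewrite add0r ltnNge leq_addr /= addKn => /eqP.
  rewrite mulf_eq0 expf_eq0 -[s]/(s.+1.-1) -ms -[t]/(t.+1.-1) -dt -!lead_coefE.
  by rewrite !lead_coef_eq0 (negPf m0) (negPf d0) andbF.
case: ifP => _; first by rewrite mulr0.
rewrite (coef_exp_default (r := d)) ?mulr0 //.
by case: i => i /=; rewrite dt; lia.
Qed.

Lemma size_twM_leq m d : (size (pol (m * d)) <= (size (pol m) + size (pol d)).-1)%N.
Proof.
case: (eqVneq m 0) => [->|m0]; first by rewrite mul0r size_poly0.
case: (eqVneq d 0) => [->|d0]; first by rewrite mulr0 size_poly0.
by rewrite size_twM.
Qed.

Lemma twM_eq0 m d : (m * d == 0) = (m == 0) || (d == 0).
Proof.
apply/idP/orP => [|[]/eqP->]; [|by rewrite mul0r|by rewrite mulr0].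
case: (eqVneq m 0) => [|m0]; first by left.
case: (eqVneq d 0) => [|d0]; first by right.
rewrite -size_poly_eq0 size_twM // => /eqP.
have : (0 < size (pol m))%N by rewrite size_poly_gt0.
have : (0 < size (pol d))%N by rewrite size_poly_gt0.
by lia.
Qed.

(* Right division: any field will do, as only powers of the leading coefficient
   of P have to be inverted. *)
Lemma tw_division P m : P != 0 -> exists2 QR : Lt * Lt, m = QR.1 * P + QR.2 &
  (size (pol QR.2) < size (pol P))%N.
Proof.
move=> P0; have [n] := ubnP (size (pol m)); elim: n m => // n IHn m mn.
have [mP|Pm] := ltnP (size (pol m)) (size (pol P)).
  by exists (0, m); rewrite //= mul0r add0r.
have sP : (0 < size (pol P))%N by rewrite size_poly_gt0.
have m0 : pol m != 0 by rewrite -size_poly_gt0 (leq_trans sP Pm).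
pose e := (size (pol m) - size (pol P))%N.
pose c : Lt := (lead_coef (pol m) / lead_coef (pol P) ^+ (q ^ e)) *: 'X^e.
have cE k : (pol c)`_k = (lead_coef (pol m) / lead_coef (pol P) ^+ (q ^ e)) * (k == e)%:R.
  by rewrite coefZ coefXn.
have cs : (size (pol c) <= e.+1)%N.
  by apply: leq_trans (size_scale_leq _ _) _; rewrite size_polyXn.
have lP0 : lead_coef (pol P) ^+ (q ^ e) != 0 by rewrite expf_neq0 // lead_coef_eq0.
have [|[Q R] /= mE RP] := IHn (m - c * P).
  have: (size (pol (m - c * P)) < size (pol m))%N; last by move: mn; lia.
  rewrite -(prednK (leq_trans sP Pm)) ltnS; apply/leq_sizeP => k.
  rewrite leq_eqVlt => km.
  have -> : (pol (m - c * P))`_k = (pol m)`_k - (pol (c * P))`_k by apply: coefB.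
  rewrite (tw_coefM _ _ cs) big_ord_recr /= big1 => [|i _]; last first.
    by rewrite cE ltn_eqF // mulr0 mul0r.
  rewrite add0r cE eqxx mulr1; case/orP: km => [/eqP<-|km].
    have -> : ((size (pol m)).-1 < e)%N = false.
      by move: sP Pm; rewrite /e; move: (size _) (size _) => a b; lia.
    have -> : ((size (pol m)).-1 - e = (size (pol P)).-1)%N.
      by move: sP Pm; rewrite /e; move: (size _) (size _) => a b; lia.
    by rewrite -!lead_coefE divfK ?subrr.
  rewrite [X in X - _ = _]nth_default; last first.
    by move: km; case: (size _).
  case: ifP => _; first by rewrite mulr0 subrr.
  rewrite (coef_exp_default (r := P) (k := k - e)) ?mulr0 ?subrr //.
  by move: km sP Pm; rewrite /e; move: (size _) (size _) => a b; lia.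
by exists (Q + c, R); rewrite //= mulrDl addrAC -mE subrK.
Qed.

Lemma tw_division_unique P Q R Q' R' : (size (pol R) < size (pol P))%N ->
  (size (pol R') < size (pol P))%N -> Q * P + R = Q' * P + R' -> Q = Q' /\ R = R'.
Proof.
move=> sR sR' QR.
have P0 : P != 0 by rewrite -[P]/(pol P) -size_poly_gt0 (leq_trans _ sR).
have QRE : (Q - Q') * P = R' - R.
  by rewrite mulrBl; apply/eqP; rewrite subr_eq addrAC eq_sym subr_eq addrC -QR addrC.
have sRR : (size (pol (R' - R)) < size (pol P))%N.
  apply: leq_ltn_trans (size_polyD _ _) _.
  by rewrite size_polyN gtn_max sR sR'.
case: (eqVneq (Q - Q') 0) => [QQ|QQ].
  have /eqP := QQ; rewrite subr_eq0 => /eqP->; split=> //.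
  by move/eqP: QRE; rewrite QQ mul0r eq_sym subr_eq0 => /eqP.
move: sRR; rewrite -QRE size_twM //.
have : (0 < size (pol (Q - Q')))%N by rewrite size_poly_gt0.
by lia.
Qed.

End TwistedPolynomials.

Section TwistedMap.
Variables (Fq : finFieldType) (K L : fieldType) (iK : {rmorphism Fq -> K}).
Variables (j : {rmorphism K -> L}).
Local Notation iL := (j \o iK : {rmorphism Fq -> L}).

Definition tw_map (m : twisted iK) : twisted iL := map_poly j m.

Fact tw_map_zmod : zmod_morphism tw_map.
Proof. by move=> m d; apply: (rmorphB (map_poly j)). Qed.
HB.instance Definition _ := GRing.isZmodMorphism.Build _ _ tw_map tw_map_zmod.

Lemma tw_map_coef m k : (tw_map m : {poly L})`_k = j (m : {poly K})`_k.
Proof. exact: coef_map. Qed.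

Lemma size_tw_map m : size (tw_map m : {poly L}) = size (m : {poly K}).
Proof. exact: size_map_poly. Qed.

Fact tw_map_monoid : monoid_morphism tw_map.
Proof.
split=> [|m d]; first exact: (rmorph1 (map_poly j)).
apply/polyP => k; rewrite tw_map_coef (tw_coefM _ _ (leqnn _)) rmorph_sum.
rewrite (tw_coefM (n := size (m : {poly K}))) ?size_tw_map //.
apply: eq_bigr => i _; rewrite rmorphM !tw_map_coef; congr (_ * _).
by case: ifP => _; rewrite ?rmorph0 ?rmorphXn.
Qed.
HB.instance Definition _ := GRing.isMonoidMorphism.Build _ _ tw_map tw_map_monoid.

Lemma tw_map_const c : tw_map (tw_const iK c) = tw_const iL (j c).
Proof. exact: map_polyC. Qed.

Lemma tw_map_tau : tw_map (tau iK) = tau iL.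
Proof. exact: map_polyX. Qed.

Lemma tw_map_eval m xi : tw_eval j m xi = tw_eval (idfun : {rmorphism L -> L}) (tw_map m) xi.
Proof.
by rewrite /tw_eval size_tw_map; apply: eq_bigr => i _; rewrite /= tw_map_coef.
Qed.

End TwistedMap.

(** * A local generator at p *)

Section Regular.
Variables (Fq : finFieldType) (F : fieldType) (iF : {rmorphism Fq -> F}).
Variable inf : place iF.
Local Notation A := (regular inf).
Local Notation rc := (reg_const inf).

Lemma regM_inj (a : A) : a != 0 -> injective (fun b => b * a).
Proof.
move=> a0 b c /(congr1 (@reg_val _ _ _ inf)); rewrite !rmorphM => /mulIf bc.
by apply/reg_val_inj/bc/reg_val_neq0.
Qed.

Lemma regM_eq0 (a b : A) : a != 0 -> b != 0 -> b * a != 0.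
Proof.
by move=> a0 b0; apply: contraNneq b0 => ba; apply/eqP/(regM_inj a0); rewrite ba mul0r.
Qed.

Lemma regX_neq0 (a : A) n : a != 0 -> a ^+ n != 0.
Proof. by rewrite -!reg_val_eq0 rmorphXn => a0; apply: expf_neq0. Qed.

Lemma reg_val_const c : reg_val (rc c) = iF c. Proof. by []. Qed.

Definition degA_spans (a : A) (d : nat) (e : 'I_d -> A) := forall x,
  exists (c : 'I_d -> Fq) (y : A), x = \sum_i rc (c i) * e i + y * a.
Definition degA_free (a : A) (d : nat) (e : 'I_d -> A) := forall (c : 'I_d -> Fq) (y : A),
  \sum_i rc (c i) * e i = y * a -> forall i, c i = 0.

Lemma degA_basis a d : is_degA a d -> exists e : 'I_d -> A, degA_spans a e /\ degA_free a e.
Proof.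
move=> [e eP]; exists e; split=> [x|c y cy i].
  by have [c [[y xy] _]] := eP x; exists c, y.
have [c0 [_ c0P]] := eP (y * a).
have E : \sum_i rc ([ffun i => c i] i) * e i = y * a.
  by rewrite -cy; apply: eq_bigr => k _; rewrite ffunE.
have c01 : c0 = [ffun i => c i].
  by apply: c0P; exists 0; rewrite E mul0r addr0.
have c02 : c0 = [ffun=> 0].
  apply: c0P; exists y; rewrite big1 ?add0r // => k _.
  by rewrite ffunE rmorph0 mul0r.
by move: c01; rewrite c02 => /ffunP/(_ i); rewrite !ffunE.
Qed.

Lemma degA_dependent a d (I : finType) (y : I -> A) : is_degA a d -> (d < #|I|)%N ->
  exists u : I -> Fq, (exists i, u i != 0) /\ exists z, \sum_i rc (u i) * y i = z * a.
Proof.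
move=> /degA_basis[e [eS _]] dI.
have /choice[c /choice[z cz]] x := eS x.
pose f (u : {ffun I -> Fq}) := [ffun i => c (\sum_i rc (u i) * y i) i].
have /injectivePn[u [v uv fuv]] : ~~ injectiveb f.
  apply/negP => /injectiveP/leq_card; rewrite !card_ffun card_ord.
  by rewrite leq_exp2l ?finNzRing_gt1 // leqNgt dI.
exists (fun i => u i - v i); split.
  apply/existsP; apply: contraNT uv => /existsPn uv; apply/eqP/ffunP => i.
  by apply/eqP; rewrite -subr_eq0; have := uv i; rewrite negbK.
exists (z (\sum_i rc (u i) * y i) - z (\sum_i rc (v i) * y i)).
under eq_bigr => i _ do rewrite rmorphB mulrBl.
rewrite sumrB [X in X - _ = _]cz [X in _ - X = _]cz.
rewrite (eq_bigr (fun i => rc (c (\sum_i rc (v i) * y i) i) * e i)).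
  by ring.
by move=> i _; move/ffunP/(_ i): fuv; rewrite !ffunE => ->.
Qed.

Lemma degA_power_free a d (e : 'I_d -> A) m (u : 'I_d * 'I_m -> Fq) (z : A) :
  a != 0 -> degA_free a e -> \sum_i rc (u i) * (e i.1 * a ^+ i.2) = z * a ^+ m ->
  forall i, u i = 0.
Proof.
move=> a0 eF; elim: m u => [|m IHm] u; first by move=> _ [i []].
have -> : \sum_i rc (u i) * (e i.1 * a ^+ i.2) =
    \sum_i rc (u (i, ord0)) * e i +
    (\sum_(i : 'I_d * 'I_m) rc (u (i.1, lift ord0 i.2)) * (e i.1 * a ^+ i.2)) * a.
  transitivity (\sum_i \sum_(k < m.+1) rc (u (i, k)) * (e i * a ^+ k)).
    by rewrite pair_bigA; apply: eq_bigr => -[].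
  under eq_bigr => i _ do rewrite big_ord_recl expr0 mulr1.
  rewrite big_split /=; congr (_ + _).
  rewrite -(pair_bigA _ (fun i (k : 'I_m) => rc (u (i, lift ord0 k)) * (e i * a ^+ k))) /=.
  rewrite mulr_suml; apply: eq_bigr => i _; rewrite mulr_suml; apply: eq_bigr => k _.
  by rewrite /bump add1n exprSr !mulrA.
set S := \sum_(i : 'I_d * 'I_m) _; rewrite exprSr mulrA => E.
have u0 : forall i, u (i, ord0) = 0.
  by apply: (eF _ (z * a ^+ m - S)); rewrite mulrBl -E addrK.
move: E; rewrite big1 => [|i _]; last by rewrite u0 rmorph0 mul0r.
rewrite add0r => /(regM_inj a0) S0.
have uS := IHm (fun i => u (i.1, lift ord0 i.2)) S0.
case=> i k; case: (unliftP ord0 k) => [k'|] ->; last exact: u0.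
exact: (uS (i, k')).
Qed.

End Regular.

(** * Elements of small degree in ideals supported at p *)

Section SmallGenerator.
Variables (Fq : finFieldType) (F : fieldType) (iF : {rmorphism Fq -> F}).
Hypothesis ff : is_function_field iF.
Variables (inf : place iF) (p : finite_place inf).
Variables (K : fieldType) (iK : {rmorphism Fq -> K}).
Variables (r : nat) (r_gt0 : (0 < r)%N) (phi : drinfeld inf iK r).
Local Notation A := (regular inf).
Local Notation rc := (reg_const inf).
Local Notation sz b := (size (phi b : {poly K})).

Variable c : A.
Hypotheses (c0 : c != 0) (c_pos : 0 < ord p (reg_val c)).
Local Notation l := (ord p (reg_val c)).

Definition pow_ideal (n : nat) (b : A) := ord_ge p (l * n%:Z) (reg_val b).
Local Notation I := pow_ideal.

Lemma pow_ideal0 n : I n 0. Proof. by rewrite /I rmorph0; left. Qed.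
Lemma pow_idealD n b b' : I n b -> I n b' -> I n (b + b').
Proof. by rewrite /I rmorphD; apply: ord_geD. Qed.
Lemma pow_idealM n b b' : I n b' -> I n (b * b').
Proof.
move=> b'n; rewrite /I rmorphM -[l * _]add0r; apply: ord_ge_M => //.
exact: reg_ord_ge.
Qed.
Lemma pow_ideal_sum n (J : finType) (f : J -> A) : (forall i, I n (f i)) ->
  I n (\sum_i f i).
Proof.
by move=> fI; elim/big_ind: _ => //; [apply: pow_ideal0 | apply: pow_idealD].
Qed.
Lemma pow_idealX n : I n (c ^+ n).
Proof.
rewrite /I rmorphXn; right; rewrite ordX; first exact: lexx.
exact: reg_val_neq0.
Qed.

(* Minkowski: b has the smallest size that counting allows. *)
Lemma small_element : exists C : nat, forall n, exists2 b : A, b != 0 /\ I n b &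
  forall y : 'I_C.+1 -> A, (forall i, I n (y i)) ->
  exists u : 'I_C.+1 -> Fq, (exists i, u i != 0) /\ exists z, \sum_i rc (u i) * y i = z * b.
Proof.
have [d cd cs] := dr_deg phi c0; have [e [eS eF]] := degA_basis cd.
have d_gt0 : (0 < d)%N.
  case: d cd cs e eS eF => // _ _ e eS _; have [u [y]] := eS 1.
  rewrite big_ord0 add0r => /(congr1 (@reg_val _ _ _ inf)); rewrite rmorphM rmorph1 /=.
  move=> yc; have yv0 : reg_val y != 0.
    by apply/eqP => y0; move/eqP: yc; rewrite y0 mul0r oner_eq0.
  have := ordM p yv0 (reg_val_neq0 c0); rewrite -yc Defs.ord1.
  by have := ord_geE yv0 (reg_ord_ge p y); move: (ord p _) (ord p _) c_pos => *; lia.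
pose C := (\max_i sz (e i))%N; exists C => n.
(* The largest such s, called D below, is the dimension of A / I n, finite because [c ^+ n] lies in
   [I n]. *)
pose P s := `[< exists y : 'I_s -> A, forall u : 'I_s -> Fq,
  I n (\sum_i rc (u i) * y i) -> forall i, u i = 0 >].
have P0 : exists s, P s by exists 0%N; apply/asboolP; exists (fun=> 0) => u _ [].
have [dn cdn cn] := dr_deg phi (regX_neq0 n c0).
have Pdn s : P s -> (s <= dn)%N.
  move=> /asboolP[y yF]; rewrite leqNgt; apply/negP => ds.
  have [|u [[i /eqP ui] [z uz]]] := degA_dependent y cdn; first by rewrite card_ord.
  by apply/ui/yF; rewrite uz; apply/pow_idealM/pow_idealX.
case: (ex_maxnP P0 Pdn) => D /asboolP[Y YF] Dmax.
have dep (J : finType) (y : J -> A) : (D < #|J|)%N ->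
    exists u : J -> Fq, (exists i, u i != 0) /\ I n (\sum_i rc (u i) * y i).
  move=> DJ; apply: contrapT => no_u; have /Dmax : P #|J|; last by rewrite leqNgt DJ.
  apply/asboolP; exists (y \o enum_val) => u uy i.
  apply: contrapT => /eqP ui; apply: no_u; exists (u \o enum_rank); split.
    by exists (enum_val i); rewrite /= enum_valK.
  rewrite (reindex _ (onW_bij _ (@enum_val_bij J))) /=.
  by under eq_bigr => k _ do rewrite enum_valK.
(* The least m with d m > D: some nontrivial combination b of the e_i c^k with k < m then lies in I
   n, and its degree is at most D + C with C independent of n. *)
pose m := (D %/ d).+1.
have [|u [[i ui] ub]] := dep ('I_d * 'I_m)%type (fun i => e i.1 * c ^+ i.2).
  by rewrite card_prod !card_ord /m mulnC -ltn_divLR.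
set b := \sum_i _ in ub.
have b0 : b != 0 by apply: contra_neq ui => b0; apply: (degA_power_free (z := 0) c0 eF); rewrite mul0r.
exists b => // y yI.
have [del bdel bs] := dr_deg phi b0.
have szc k : (sz (c ^+ k) <= (r * d * k).+1)%N.
  elim: k => [|k IHk]; first by rewrite expr0 rmorph1 size_poly1.
  rewrite exprSr rmorphM; apply: leq_trans (size_twM_leq _ _) _.
  by rewrite cs mulnSr; move: IHk; move: (size _) (r * d)%N (r * d * k)%N => *; lia.
have bC : (sz b <= C + r * D)%N.
  rewrite /b raddf_sum; apply: leq_trans (size_sum _ _ _) _.
  apply/bigmax_leqP => k _ /=; rewrite !rmorphM dr_const.
  apply: leq_trans (size_twM_leq _ _) _.
  have : (size (tw_const iK (iK (u k)) : {poly K}) <= 1)%N by apply: size_polyC_leq1.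
  have : (sz (e k.1) <= C)%N by apply: (leq_bigmax k.1).
  have := size_twM_leq (phi (e k.1)) (phi (c ^+ k.2)).
  have : (r * d * k.2 <= r * D)%N.
    rewrite -mulnA leq_mul2l mulnC -leq_divRL // -ltnS ltn_ord orbT //.
  have := szc k.2.
  move: (size _) (size (phi (c ^+ k.2) : {poly K})) (size (phi (e k.1) : {poly K})).
  move=> a1 a2 a3; move: (size (tw_const _ _ : {poly K})) (r * D)%N (r * d * k.2)%N.
  by move=> *; lia.
have delC : (del <= D + C)%N.
  rewrite leqNgt; apply/negP => lt_del; move: bC; rewrite bs leqNgt ltnS.
  have : (r * (D + C).+1 <= r * del)%N by rewrite leq_mul2l lt_del orbT.
  by move: (C) (D) (r * del)%N r_gt0 => C1 D1 x r0; nia.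
(* Since dim A / A b <= D + C, the C + 1 elements [y i] and the D elements [Y i] are dependent
   modulo b; reduction modulo I n kills the coefficients of the [Y i], which are free there. *)
pose w (i : 'I_C.+1 + 'I_D) := match i with inl i => y i | inr i => Y i end.
have [|v [[k vk] [z vz]]] := degA_dependent w bdel.
  by rewrite card_sum !card_ord; lia.
move: vz; rewrite big_sumType /= => vz.
have vY i' : v (inr i') = 0.
  apply: (YF (fun i => v (inr i))); have -> : \sum_i rc (v (inr i)) * Y i =
      z * b + (-1) * \sum_i rc (v (inl i)) * y i by rewrite -vz; ring.
  apply: pow_idealD; first exact: pow_idealM.
  by apply/pow_idealM/pow_ideal_sum => i0; apply: pow_idealM.
exists (fun i => v (inl i)); split.
  by case: k vk => [k|k] vk; [exists k | rewrite vY eqxx in vk].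
exists z; rewrite -vz [X in _ + X]big1 ?addr0 // => i0 _.
by rewrite vY rmorph0 mul0r.
Qed.

End SmallGenerator.

Section LocalGenerator.
Variables (Fq : finFieldType) (F : fieldType) (iF : {rmorphism Fq -> F}).
Hypothesis ff : is_function_field iF.
Variables (inf : place iF) (p : finite_place inf).
Variables (K : fieldType) (iK : {rmorphism Fq -> K}).
Variables (r : nat) (r_gt0 : (0 < r)%N) (phi : drinfeld inf iK r).
Local Notation A := (regular inf).
Local Notation rc := (reg_const inf).
Local Notation rv := (@reg_val _ _ _ inf).

(** In terms of ideals, p^h = A a. Divisibility by a^n in A thereby becomes a condition at p
    alone. *)
Definition local_generator (h : nat) (a : A) :=
  [/\ (0 < h)%N, Defs.ord p (rv a) = h%:Z &
      forall b, ord_ge p h%:Z (rv b) -> exists b', b = b' * a].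

Lemma combination_neq0 (c : A) n (u : 'I_n -> Fq) : 0 < ord p (rv c) ->
  (exists i, u i != 0) -> \sum_(i < n) rc (u i) * c ^+ i != 0.
Proof.
move=> c_pos [i0 ui0].
have cv0 : rv c != 0 by rewrite (@ord_neq0 _ _ _ p) // gt_eqF.
case: (@arg_minnP _ i0 (fun i => u i != 0) (fun i => i : nat) ui0) => i ui imin.
rewrite -reg_val_eq0 rmorph_sum; apply: (@ord_dominant _ _ _ p _ _ i) => [|k ki].
  by rewrite rmorphM rmorphXn mulf_neq0 ?expf_neq0 //= fmorph_eq0.
case: (eqVneq (u k) 0) => [->|uk]; first by rewrite rmorph0 mul0r rmorph0; left.
right; rewrite !rmorphM !rmorphXn /= !reg_val_const.
rewrite !ordM ?expf_neq0 ?fmorph_eq0 // !ord_const !ordX // !add0r.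
have : (i < k)%N.
  rewrite ltn_neqAle imin // andbT; apply: contraNneq ki => e.
  by apply/eqP/val_inj.
by case: (i) (k) => /= a _ [b _] /=; move: (ord p _) c_pos => e e0 ab; nia.
Qed.

(** In the application I n / A b has dimension at most C, so each of its elements is killed by a
    nonzero polynomial in c of degree at most C. There are finitely many of these over Fq, and their
    product depends neither on n nor on the element. *)
Lemma common_annihilator (c : A) (C : nat) : 0 < ord p (rv c) ->
  exists2 y : A, y != 0 & forall (b z : A),
    (exists u : 'I_C.+1 -> Fq, (exists i, u i != 0) /\
       exists w, \sum_i rc (u i) * (c ^+ i * z) = w * b) -> exists w, y * z = w * b.
Proof.
move=> c_pos.
exists (\prod_(u : {ffun 'I_C.+1 -> Fq} | [exists i, u i != 0]) \sum_i rc (u i) * c ^+ i).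
  rewrite -reg_val_eq0 rmorph_prod; apply/prodf_neq0 => u /existsP u0.
  by rewrite reg_val_eq0 combination_neq0.
move=> b z [u [[i ui] [w uw]]]; pose u' := [ffun i => u i].
have u'0 : [exists i, u' i != 0] by apply/existsP; exists i; rewrite ffunE.
rewrite (bigD1 u') //= mulrAC; set P := \prod_(_ | _) _.
exists (w * P); rewrite [w * P * b]mulrAC -uw mulr_suml; congr (_ * _).
by apply: eq_bigr => k _; rewrite ffunE mulrA.
Qed.

(** At a pole of u other than [inf], some u^j z would have a pole: A is completely integrally
    closed. *)
Lemma powers_regular (u z : F) : z != 0 ->
  (forall j : nat, exists b : A, u ^+ j * z = rv b) -> exists a : A, u = rv a.
Proof.
move=> z0 uz; have [a aE] : exists a : A, rv a = u; last by exists a.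
apply: regular_memP => v vinf.
case: (eqVneq u 0) => [->|u0]; first by left.
right; rewrite leNgt; apply/negP => vu.
have [b bE] := uz `|ord v z|.+1.
have /asboolP/(_ v vinf) := valP b; rewrite -[val b]/(rv b) -bE.
move=> /ord_geE; rewrite mulf_neq0 ?expf_neq0 // => /(_ isT).
rewrite ordM ?expf_neq0 // ordX //.
by move: (ord v z) (ord v u) vu => e f; nia.
Qed.

(* Finiteness of the class number: among the ideals {ord_p >= n l}, two are
   isomorphic, and an isomorphism is the multiplication by the quotient of two
   elements as in small_element. *)
Lemma exists_local_generator : exists h a, local_generator h a.
Proof.
have [c c0 c_pos] := regular_ord_pos ff p.
have cv0 := reg_val_neq0 c0.
pose I := pow_ideal p c.
have [C bP] := small_element r_gt0 phi c0 c_pos.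
have {bP}/choice[b bP] n : exists b : A, [/\ b != 0, I n b & forall y : 'I_C.+1 -> A,
    (forall i, I n (y i)) -> exists u : 'I_C.+1 -> Fq, (exists i, u i != 0) /\
      exists z, \sum_i rc (u i) * y i = z * b].
  by have [b [b0 bI] by_] := bP n; exists b.
have [y y0 yP] := common_annihilator C c_pos.
have ykill n z : I n z -> exists w, y * z = w * b n.
  move=> zI; have [_ _ bn] := bP n; apply: yP; apply: bn => i.
  exact: pow_idealM.
have [d yd _] := dr_deg phi y0; have [e [eS _]] := degA_basis yd.
pose rep (u : {ffun 'I_d -> Fq}) : A := \sum_i rc (u i) * e i.
(* J n is the ideal y b_n^-1 I_n. It contains A y because b_n lies in I_n, and the finite ring A / A
   y leaves finitely many possibilities. An equality J n = J m means that I_m = (b_m / b_n) I_n. *)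
pose J n w := exists2 z, I n z & y * z = w * b n.
have JD n w w' : J n w -> J n w' -> J n (w + w').
  move=> [z zI zw] [z' zI' zw']; exists (z + z'); first exact: pow_idealD.
  by rewrite mulrDr zw zw' mulrDl.
have JM n x w : J n w -> J n (x * w).
  move=> [z zI zw]; exists (x * z); first exact: pow_idealM.
  by rewrite mulrCA zw mulrA.
have JB n w w' : J n w -> J n w' -> J n (w - w').
  by move=> Jw Jw'; apply: JD => //; rewrite -mulN1r; apply: JM.
have Jy n x : J n (x * y).
  by apply: JM; have [_ bI _] := bP n; exists (b n).
pose S n := [set u : {ffun 'I_d -> Fq} | `[< J n (rep u) >]].
pose f (n : 'I_(#|{: {set {ffun 'I_d -> Fq}}}|.+1)) := S n.
have /injectivePn[n [m nm fnm]] : ~~ injectiveb f.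
  by apply/negP => /injectiveP/leq_card; rewrite card_ord ltnn.
have JS n1 m1 w : S n1 = S m1 -> J n1 w -> J m1 w.
  move=> Snm; have [u [x ->]] := eS w.
  have -> : \sum_i rc (u i) * e i = rep [ffun i => u i].
    by apply: eq_bigr => i _; rewrite ffunE.
  move=> /JB/(_ (Jy n1 x)); rewrite addrK => Ju; apply: JD (Jy m1 x).
  move/setP/(_ [ffun i => u i]): Snm; rewrite !inE => E.
  by apply/asboolP; rewrite -E; apply/asboolP.
wlog lt_nm : n m nm fnm / (n < m)%N.
  move=> IH; have [lt_nm|lt_mn|/val_inj e_nm] := ltngtP n m; first exact: (IH n m).
    by apply: (IH m n) => //; rewrite eq_sym.
  by rewrite e_nm eqxx in nm.
have {}JS w : J n w <-> J m w by split; apply: JS.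
have [bn0 bnI _] := bP n; have [bm0 bmI _] := bP m.
pose u := rv (b m) / rv (b n).
have bnv0 := reg_val_neq0 bn0; have bmv0 := reg_val_neq0 bm0.
have u0 : u != 0 by rewrite mulf_neq0 ?invr_eq0.
have yv0 := reg_val_neq0 y0.
have uI z : I n z -> exists2 z', I m z' & u * rv z = rv z'.
  move=> zI; have [w zw] := ykill n z zI.
  have [z' z'I z'w] : J m w by apply/JS; exists z.
  exists z' => //; apply: (mulfI yv0); apply: (mulfI bnv0).
  move/(congr1 rv): zw; move/(congr1 rv): z'w; rewrite !rmorphM /= => z'w zw.
  rewrite z'w.
  have -> : rv (b n) * (rv y * (u * rv z)) = rv (b m) * (rv y * rv z).
    by rewrite /u; field.
  by rewrite zw; ring.
have Iu z : I m z -> exists2 z', I n z' & rv z = u * rv z'.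
  move=> zI; have [w zw] := ykill m z zI.
  have [z' z'I z'w] : J n w by apply/JS; exists z.
  exists z' => //; apply: (mulfI yv0); apply: (mulfI bnv0).
  move/(congr1 rv): zw; move/(congr1 rv): z'w; rewrite !rmorphM /= => z'w zw.
  have -> : rv (b n) * (rv y * (u * rv z')) = rv (b m) * (rv y * rv z').
    by rewrite /u; field.
  by rewrite zw z'w; ring.
have cX k : rv (c ^+ k) = rv c ^+ k by rewrite rmorphXn.
have InS z : I m z -> I n z.
  rewrite /I /pow_ideal; apply: ord_ge_S.
  by apply: ler_wpM2l; [apply: ltW | rewrite lez_nat ltnW].
have cnv0 : rv c ^+ n != 0 by rewrite expf_neq0.
(* u maps I n into I m, hence into I n again, so that all u^j c^n lie in A. *)
have [a uE] : exists a : A, u = rv a.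
  apply: (powers_regular cnv0) => j.
  suff [z zI zE] : exists2 z, I n z & u ^+ j * rv c ^+ n = rv z by exists z.
  elim: j => [|j [z zI zE]]; first by exists (c ^+ n); [apply: pow_idealX | rewrite mul1r cX].
  by have [z' /InS z'I z'E] := uI z zI; exists z' => //; rewrite exprS -mulrA zE.
pose h := (`|ord p (rv c)| * (m - n))%N.
have hE : h%:Z = ord p (rv c) * (m%:Z - n%:Z).
  rewrite /h PoszM gtz0_abs // subzn //; exact: ltnW.
have ordu : ord p u = h%:Z.
  apply/eqP; rewrite eq_le; apply/andP; split.
    have [z zI zE] := Iu _ (pow_idealX p c0 m).
    have zv0 : rv z != 0.
      by apply: contraNneq (expf_neq0 m cv0) => z0; rewrite -cX zE z0 mulr0.
    have := ord_geE zv0 zI; have := congr1 (Defs.ord p) zE.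
    rewrite cX ordX // ordM // hE mulrBr.
    set X := ord p (rv c) * m%:Z; set Y := ord p (rv c) * n%:Z.
  by move: X Y (ord p u) (ord p (rv z)); clear; lia.
  have [z zI zE] := uI _ (pow_idealX p c0 n).
  have zv0 : rv z != 0 by rewrite -zE cX mulf_neq0.
  have := ord_geE zv0 zI; have := congr1 (Defs.ord p) zE.
  rewrite cX ordM // ordX // hE mulrBr.
  set X := ord p (rv c) * m%:Z; set Y := ord p (rv c) * n%:Z.
  by move: X Y (ord p u) (ord p (rv z)); clear; lia.
exists h, a; split; rewrite -?uE //.
  by rewrite /h muln_gt0 subn_gt0 lt_nm andbT absz_gt0 gt_eqF.
move=> t th.
have [b' b'E] : exists b' : A, rv t / u = rv b'.
  apply: (powers_regular cnv0) => j.
  suff [z zI zE] : exists2 z, I n z & (rv t / u) ^+ j * rv c ^+ n = rv z by exists z.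
  elim: j => [|j [z zI zE]]; first by exists (c ^+ n); [apply: pow_idealX | rewrite mul1r cX].
  have tzI : I m (t * z).
    rewrite /I /pow_ideal rmorphM /=.
    have -> : ord p (rv c) * m%:Z = h%:Z + ord p (rv c) * n%:Z.
      by rewrite hE; ring.
    exact: ord_ge_M.
  have [z' z'I z'E] := Iu _ tzI; exists z' => //.
  rewrite exprS -mulrA zE; apply: (mulfI u0); rewrite -z'E rmorphM /=.
  by rewrite mulrA [u * _]mulrCA divff // mulr1.
by exists b'; apply: reg_val_inj; rewrite rmorphM /= -uE -b'E divfK.
Qed.

End LocalGenerator.

(** * The completion at p *)

Section CompletionLemmas.
Variables (R : comPzRingType) (U : filtration R).

Lemma compl_approx (z : compl U) (n : int) : exists x, in_cfil n (z - compl_in U x).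
Proof.
rewrite -(lim_of_repr z); set u := repr z; have [N uN] := cauchy_seqP u n.
exists (val u N); rewrite -lim_ofB; eexists; first by [].
by exists N => i Ni; apply: uN.
Qed.

Lemma compl_in_fil (x : R) (n : int) : in_cfil n (compl_in U x) -> U n x.
Proof.
move=> [u /lim_ofP/(_ n)[N xu] [N' uN']].
rewrite -[x](subrK (val u (maxn N N'))); apply: fil_D.
  exact: (xu _ (leq_maxl _ _)).
by apply: uN'; rewrite leq_maxr.
Qed.

Lemma fil_compl_in (x : R) (n : int) : U n x -> in_cfil n (compl_in U x).
Proof. by move=> Ux; eexists; [by [] | exists 0%N => i _]. Qed.

Lemma compl_separated (z : compl U) : (forall n, in_cfil n z) -> z = 0.
Proof.
move=> zn; rewrite -(lim_of_repr z); apply/lim_of_eq0 => n.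
have [v zv [N vN]] := zn n.
have /lim_ofP/(_ n)[N' uv] : lim_of (repr z) = lim_of v by rewrite lim_of_repr.
exists (maxn N N') => i; rewrite geq_max => /andP[Ni N'i].
rewrite -[val _ i](subrK (val v i)); apply: fil_D; last exact: vN.
exact: uv.
Qed.

Lemma lim_of_approx (u : cauchy_seq U) (n : int) (N : nat) :
  (forall i, (N <= i)%N -> U n (val u i - val u N)) ->
  in_cfil n (lim_of u - compl_in U (val u N)).
Proof. by move=> uN; rewrite -lim_ofB; eexists; [by [] | exists N]. Qed.

End CompletionLemmas.

Section LocalRing.
Variables (Fq : finFieldType) (F : fieldType) (iF : {rmorphism Fq -> F}).
Hypothesis ff : is_function_field iF.
Variables (inf : place iF) (p : finite_place inf).
Local Notation A := (regular inf).
Local Notation rc := (reg_const inf).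
Local Notation rv := (@reg_val _ _ _ inf).
Local Notation Fp := (completion p).
Local Notation rF := (reg_Fp p).
Variables (h : nat) (a : A) (d : nat) (e : 'I_d -> A).
Hypotheses (aP : local_generator p h a) (eS : degA_spans a e).

Lemma local_generator_neq0 : rv a != 0.
Proof. by rewrite (@ord_neq0 _ _ _ p) //; have [+ -> _] := aP; case: (h). Qed.

Let av0 := local_generator_neq0.

Lemma local_generator_neq0' : a != 0.
Proof. by rewrite -reg_val_eq0. Qed.

Lemma local_generatorX n b : ord_ge p (h * n)%N%:Z (rv b) -> exists b', b = b' * a ^+ n.
Proof.
have [h0 ah adiv] := aP; elim: n b => [|n IHn] b; first by exists b; rewrite mulr1.
rewrite mulnS => bn; have [|b' bE] := adiv b; first by apply: ord_ge_S bn; lia.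
have [|b'' b'E] := IHn b'; last by exists b''; rewrite bE b'E exprSr mulrA.
have -> : rv b' = rv b * (rv a)^-1 by rewrite bE rmorphM mulfK.
have -> : (h * n)%N%:Z = (h + h * n)%N%:Z + (- h%:Z) by lia.
by apply: ord_ge_M => //; right; rewrite ordV // ah.
Qed.

Lemma degA_power_spans n (x : A) : exists (c : 'I_d * 'I_n -> Fq) (y : A),
  x = \sum_i rc (c i) * (e i.1 * a ^+ i.2) + y * a ^+ n.
Proof.
elim: n x => [|n IHn] x.
  exists (fun=> 0), x; rewrite mulr1 big1 ?add0r // => i _.
  by rewrite rmorph0 mul0r.
have [c0 [y ->]] := eS x; have [c [y' ->]] := IHn y.
exists (fun i => if unlift ord0 i.2 is Some k then c (i.1, k) else c0 i.1), y'.
rewrite mulrDl addrA exprSr mulrA; congr (_ + _).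
transitivity (\sum_i \sum_(k < n.+1)
    rc (if unlift ord0 k is Some k' then c (i, k') else c0 i) * (e i * a ^+ k)); last first.
  by rewrite pair_bigA; apply: eq_bigr => -[].
under [RHS]eq_bigr => i _ do rewrite big_ord_recl unlift_none mulr1.
rewrite big_split /=; congr (_ + _).
transitivity ((\sum_i \sum_(k < n) rc (c (i, k)) * (e i * a ^+ k)) * a).
  by rewrite pair_bigA; congr (_ * _); apply: eq_bigr => -[].
rewrite mulr_suml; apply: eq_bigr => i _; rewrite mulr_suml; apply: eq_bigr => k _.
by rewrite liftK /bump add1n exprSr !mulrA.
Qed.

(* The powers of u are not distinct modulo a^n, so that u is invertible there. *)
Lemma invert_mod (u : A) n : rv u != 0 -> Defs.ord p (rv u) = 0 ->
  exists w : A, ord_ge p (h * n)%N%:Z (1 - rv u * rv w).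
Proof.
move=> u0 pu.
have /choice[c /choice[y cy]] x := degA_power_spans n x.
pose f (i : 'I_(#|{ffun 'I_d * 'I_n -> Fq}|.+1)) := [ffun k => c (u ^+ i) k].
have /injectivePn[i [k ik fik]] : ~~ injectiveb f.
  by apply/negP => /injectiveP/leq_card; rewrite card_ord ltnn.
wlog lt_ik : i k ik fik / (i < k)%N.
  move=> IH; have [lt_ik|lt_ki|/val_inj e_ik] := ltngtP i k; first exact: (IH i k).
    by apply: (IH k i) => //; rewrite eq_sym.
  by rewrite e_ik eqxx in ik.
have [z uz] : exists z, u ^+ i - u ^+ k = z * a ^+ n.
  exists (y (u ^+ i) - y (u ^+ k)); rewrite [u ^+ i in LHS]cy [u ^+ k in LHS]cy.
  rewrite (eq_bigr (fun l => rc (c (u ^+ k) l) * (e l.1 * a ^+ l.2))); first by ring.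
  by move=> l _; move/ffunP/(_ l): fik; rewrite !ffunE => ->.
exists (u ^+ (k - i).-1); rewrite rmorphXn -exprS prednK ?subn_gt0 //.
have -> : 1 - rv u ^+ (k - i) = (rv u ^+ i)^-1 * rv (u ^+ i - u ^+ k).
  rewrite rmorphB !rmorphXn /=.
  have -> : rv u ^+ k = rv u ^+ i * rv u ^+ (k - i) by rewrite -exprD subnKC // ltnW.
  by rewrite mulrBr mulKf ?mulVf ?expf_neq0.
rewrite uz -[_%:Z]add0r; apply: ord_ge_M.
  by right; rewrite ordV ?expf_neq0 // ordX // pu mul0r.
rewrite (rmorphM rv) (rmorphXn rv) -[_%:Z]add0r; apply: ord_ge_M; first exact: reg_ord_ge.
by right; rewrite ordX //; have [_ -> _] := aP; rewrite PoszM.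
Qed.

(** With x = b / c and k the order of c, the power c^h is u a^k for some u prime to p, so that x =
    b' / u; such a u is invertible modulo a^n. *)
Lemma regular_dense x n : ord_ge p 0 x -> exists b : A, ord_ge p (h * n)%N%:Z (x - rv b).
Proof.
case: (eqVneq x 0) => [->|x0 px]; first by exists 0; rewrite rmorph0 subrr; left.
have [h0 ah _] := aP.
have [b [c [c0 xc]]] := regular_frac ff inf x.
have cv0 := reg_val_neq0 c0.
have [k ck] : exists k : nat, Defs.ord p (rv c) = k%:Z.
  exists `|ord p (rv c)|%N; rewrite gez0_abs //.
  exact: (ord_geE cv0 (reg_ord_ge p c)).
have [|u uE] := @local_generatorX k (c ^+ h).
  by rewrite rmorphXn; right; rewrite ordX // ck mulrC -PoszM.
have [|b' bE] := @local_generatorX k (b * c ^+ h.-1).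
  rewrite (rmorphM rv) (rmorphXn rv) /= -xc -mulrA -exprS prednK // -[_%:Z]add0r.
  by apply: ord_ge_M => //; right; rewrite ordX // ck mulrC -PoszM.
have ak0 : rv a ^+ k != 0 by rewrite expf_neq0.
have uv : rv c ^+ h = rv u * rv a ^+ k by rewrite -!rmorphXn -rmorphM -uE.
have bv : rv b * rv c ^+ h.-1 = rv b' * rv a ^+ k.
  by rewrite -!rmorphXn -!rmorphM -bE.
have u0 : rv u != 0.
  by apply: contraNneq (expf_neq0 h cv0) => u0; rewrite uv u0 mul0r.
have xE : x * rv u = rv b'.
  apply: (mulIf ak0); rewrite -bv -mulrA -uv -xc -{1}(prednK h0) exprS; ring.
have [|w uw] := @invert_mod u n u0.
  have := congr1 (Defs.ord p) uv; rewrite ordX // ordM // ordX // ck ah.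
  by rewrite mulrC => /eqP; rewrite -subr_eq0 opprD addrCA subrr addr0 oppr_eq0 => /eqP.
exists (b' * w); rewrite (rmorphM rv) /= -xE -mulrA -{1}[x]mulr1 -mulrBr -[_%:Z]add0r.
exact: ord_ge_M.
Qed.

Definition integral (z : Fp) := compl_fil p 0 z.

Lemma integral0 : integral 0. Proof. exact: fil_0. Qed.
Lemma integral1 : integral 1. Proof. exact: fil_1. Qed.
Lemma integralD z w : integral z -> integral w -> integral (z + w).
Proof. exact: fil_D. Qed.
Lemma integralN z : integral z -> integral (- z).
Proof. exact: fil_N. Qed.
Lemma integralB z w : integral z -> integral w -> integral (z - w).
Proof. exact: fil_B. Qed.
Lemma integralM z w : integral z -> integral w -> integral (z * w).
Proof. by move=> z0 w0; rewrite /integral -[0]addr0; apply: fil_M. Qed.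
Lemma integralX z n : integral z -> integral (z ^+ n).
Proof.
by move=> z0; elim: n => [|n IHn]; [apply: integral1 | rewrite exprS; apply: integralM].
Qed.
Lemma integral_sum (I : Type) (s : seq I) (P : pred I) (f : I -> Fp) :
  (forall i, P i -> integral (f i)) -> integral (\sum_(i <- s | P i) f i).
Proof.
by move=> fI; elim/big_ind: _ => //; [apply: integral0 | apply: integralD].
Qed.

Lemma integral_reg b : integral (rF b).
Proof. exact/fil_compl_in/reg_ord_ge. Qed.

Lemma rF_neq0 : rF a != 0.
Proof. by rewrite fmorph_eq0. Qed.

Let a0 := rF_neq0.

Lemma compl_fil_aX n : compl_fil p (h * n)%N%:Z (rF a ^+ n).
Proof.
rewrite -rmorphXn; apply: fil_compl_in; rewrite rmorphXn; right.
by rewrite ordX //; have [_ -> _] := aP; rewrite PoszM.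
Qed.

Lemma compl_fil_aV n : compl_fil p (- (h * n)%N%:Z) (rF a ^+ n)^-1.
Proof.
rewrite -rmorphXn -fmorphV; apply: fil_compl_in; rewrite rmorphXn; right.
by rewrite ordV ?expf_neq0 // ordX //; have [_ -> _] := aP; rewrite PoszM.
Qed.

Lemma integral_divP n z : compl_fil p (h * n)%N%:Z z <-> integral (z / rF a ^+ n).
Proof.
split=> zn.
  by rewrite /integral -(subrr (h * n)%N%:Z); apply: fil_M => //; apply: compl_fil_aV.
rewrite -[z](divfK (expf_neq0 n a0)) -[_%:Z]add0r; apply: fil_M => //.
exact: compl_fil_aX.
Qed.

Lemma fil_integral_div (m : int) : exists n : nat, forall z, integral (z / rF a ^+ n) ->
  compl_fil p m z.
Proof.
exists `|m|%N => z /integral_divP; apply: fil_S; have [h0 _ _] := aP.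
by move: h0; move: (h) => k k0; nia.
Qed.

Lemma integral_multiple_ex z : exists n : nat, integral (rF a ^+ n * z).
Proof.
have [m zm] := fil_ex (compl_fil p) z; exists `|m|%N.
apply: (@fil_S _ _ _ ((h * `|m|)%N%:Z + m)).
  by have [h0 _ _] := aP; move: h0; move: (h) => k k0; nia.
by apply: fil_M => //; apply: compl_fil_aX.
Qed.

Lemma integral_dense z n : integral z -> exists b : A, integral ((z - rF b) / rF a ^+ n).
Proof.
move=> z0; have [x zx] := compl_approx z (h * n)%N%:Z.
have x0 : ord_ge p 0 x.
  apply: (@compl_in_fil _ (place_fil p)); rewrite -[compl_in _ _](subKr z); apply: integralB => //.
  exact: (@fil_S _ (compl_fil p) 0 (h * n)%N%:Z).
have [b xb] := regular_dense n x0; exists b; apply/integral_divP.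
rewrite -(subrKA (completion_in p x)); apply: fil_D => //.
by rewrite -rmorphB; apply: fil_compl_in.
Qed.

Lemma reg_div b n : integral (rF b / rF a ^+ n) -> exists b', b = b' * a ^+ n.
Proof. by move/integral_divP/compl_in_fil/local_generatorX. Qed.

Lemma dense_frac z n : exists (b : A) (k : nat),
  integral ((z - rF b / rF a ^+ k) / rF a ^+ n).
Proof.
have [k kz] := integral_multiple_ex z; have [b zb] := integral_dense (n + k) kz.
exists b, k; have -> : z - rF b / rF a ^+ k = (rF a ^+ k * z - rF b) / rF a ^+ k.
  by rewrite mulrBl [_ * z]mulrC mulfK ?expf_neq0.
by rewrite -mulrA -invfM -exprD addnC.
Qed.

Lemma series_limit (f : nat -> A) : exists z : Fp, forall n,
  integral ((z - \sum_(k < n) rF (f k) * rF a ^+ k) / rF a ^+ n).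
Proof.
pose s n := rv (\sum_(k < n) f k * a ^+ k).
have sB i n : (n <= i)%N -> ord_ge p (h * n)%N%:Z (s i - s n).
  move=> ni; rewrite /s -rmorphB.
  rewrite (big_ord_widen i (fun k => f k * a ^+ k) ni).
  rewrite (bigID (fun k : 'I_i => (k < n)%N) predT) /= addrC addrK rmorph_sum.
  apply: ord_ge_sum => k; rewrite -leqNgt => nk; rewrite (rmorphM rv) (rmorphXn rv) /=.
  rewrite -[_%:Z]add0r; apply: ord_ge_M; first exact: reg_ord_ge.
  right; rewrite ordX //; have [_ -> _] := aP.
  by rewrite PoszM; apply: ler_wpM2l => //; rewrite lez_nat.
have sC : is_cauchy (place_fil p) s.
  move=> m; exists `|m|%N => i i' mi mi'.
  have hm : m <= (h * `|m|)%N%:Z by have [h0 _ _] := aP; move: h0; move: (h) => k k0; nia.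
  apply: (fil_S hm).
  rewrite -[s i](subrK (s `|m|%N)) -[s i'](subrK (s `|m|%N)).
  rewrite opprD addrACA subrr addr0; apply: ord_ge_B; exact: sB.
exists (lim_of (mk_cauchy sC)) => n; apply/integral_divP.
have -> : \sum_(k < n) rF (f k) * rF a ^+ k = completion_in p (s n).
  by rewrite /s !rmorph_sum; apply: eq_bigr => k _; rewrite !rmorphM !rmorphXn.
by apply: (@lim_of_approx _ _ (mk_cauchy sC)) => i; apply: sB.
Qed.

End LocalRing.

(** * Kaehler differentials *)

Section FrobeniusDegree.
Variables (Fq : finFieldType) (F : fieldType) (iF : {rmorphism Fq -> F}).
Hypothesis ff : is_function_field iF.
Variables (l : nat) (lF : l \in [pchar F]).
Implicit Types (x y z : F).

Lemma pchar_exprD x y : (x + y) ^+ l = x ^+ l + y ^+ l.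
Proof. exact: (pFrobenius_autD_comm lF (mulrC _ _)). Qed.

Lemma pchar_exprN x : (- x) ^+ l = - x ^+ l.
Proof. exact: (pFrobenius_autN lF). Qed.

Lemma pchar_expr_sum (I : Type) (s : seq I) (P : pred I) (f : I -> F) :
  (\sum_(i <- s | P i) f i) ^+ l = \sum_(i <- s | P i) f i ^+ l.
Proof. exact: (rmorph_sum (pFrobenius_aut lF)). Qed.

Lemma pchar_gt0 : (0 < l)%N.
Proof. exact: prime_gt0 (pcharf_prime lF). Qed.

(* [F : F^l] <= l *)
Lemma frobenius_dependent (y : 'I_l.+1 -> F) :
  exists c : 'I_l.+1 -> F, (exists i, c i != 0) /\ \sum_i c i ^+ l * y i = 0.
Proof.
have [x [xT _]] := ff; have [n [b [bf bS]]] := exists_basis ff x.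
have n_gt0 : (0 < n)%N.
  case: n b bf bS => // b _ bS; have [d [k [d0 [c _]]]] := bS 1.
  by rewrite mulr1 big_ord0 => /eqP; rewrite (negPf (xT d d0)).
have [d [E [d0 dS]]] := common_denom (fun i : 'I_l.+1 * 'I_n => b i.2 ^+ l * y i.1) bS.
pose f (M : 'M[Fq]_(l.+1 * n, E.+1)) i k := rVpoly (row (mxvec_index i k) M).
pose c M i := \sum_k peval iF x (f M i k) * b k.
have cB M N i : c (M - N) i = c M i - c N i.
  rewrite -sumrB; apply: eq_bigr => k _.
  by rewrite /f [row _ _]linearB [rVpoly _]linearB pevalB mulrBl.
(* Coefficients of size at most E + 1 have l-th powers of degree at most l E, so that (l + 1) n (E +
   1) unknowns face n (l E + E) conditions. *)
have [|||M M0 cM] := @additive_pigeonhole _ _ _ _ n (l * E + E)%N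
    (fun M => peval iF x d * \sum_i c M i ^+ l * y i)
    (fun N => \sum_i peval iF x (rVpoly (row i N)) * b i).
- move=> M N; rewrite -mulrBr -sumrB; congr (_ * _); apply: eq_bigr => i _.
  by rewrite cB pchar_exprD pchar_exprN mulrBl.
- move=> M; apply: poly_span_mx; rewrite mulr_sumr; apply: poly_span_sum => i _.
  rewrite pchar_expr_sum mulr_suml mulr_sumr; apply: poly_span_sum => k _.
  rewrite (_ : _ * _ = peval iF x (f M i k ^+ l) * (peval iF x d * (b k ^+ l * y i))).
    apply: poly_spanM; last exact: (dS (i, k)).
    apply: leq_trans (size_poly_exp_leq _ _) _; rewrite ltnS mulnC leq_mul2l.
    by apply/orP; right; have := rVpoly_sizeS (row (mxvec_index i k) M); case: (size _).
  by rewrite [peval iF x (_ ^+ _)]rmorphXn /= exprMn; ring.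
- by rewrite mulSn; move: n_gt0; clear; nia.
exists (c M); split; last first.
  by move/eqP: cM; rewrite mulf_eq0 (negPf (xT d d0)) => /eqP.
apply: contrapT => /forallNP c0; case/eqP: M0; apply/row_matrixP => ik.
case/mxvec_indexP: ik => i k.
have /bf/(_ k) fk : \sum_k peval iF x (f M i k) * b k = 0.
  by apply/eqP; apply: contrapT => /negP; apply: c0.
by rewrite row0 -[row _ _]rVpolyK [rVpoly _]fk raddf0.
Qed.

End FrobeniusDegree.

(** * The derivation with respect to an element of order prime to l *)

Section Derivation.
Variables (Fq : finFieldType) (F : fieldType) (iF : {rmorphism Fq -> F}).
Hypothesis ff : is_function_field iF.
Variables (l : nat) (lF : l \in [pchar F]).
Variables (v : place iF) (t : F).
Hypotheses (t0 : t != 0) (vt : ~~ (l %| `|ord v t|)%N).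

(* The valuations of the g_k^l t^k are distinct modulo l. *)
Lemma frobenius_free (g : 'I_l -> F) : \sum_k g k ^+ l * t ^+ k = 0 -> forall k, g k = 0.
Proof.
move=> gt k; apply/eqP; apply: contrapT => /negP gk.
have l_gt0 := pchar_gt0 lF.
pose o k := ord v (g k ^+ l * t ^+ k).
case: (@arg_minP _ _ _ k (fun k => g k != 0) o gk) => i gi imin.
have /eqP : \sum_k g k ^+ l * t ^+ k != 0; last by [].
apply: (@ord_dominant _ _ _ v _ _ i) => [|m mi]; first by rewrite mulf_neq0 ?expf_neq0.
case: (eqVneq (g m) 0) => [->|gm]; first by rewrite expr0n (gtn_eqF l_gt0) mul0r; left.
right; rewrite -/(o i) -/(o m) lezD1 lt_neqAle imin // andbT.
apply: contraNneq vt => om.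
have : (l%:Z %| ord v t * (m%:Z - i%:Z))%Z.
  move: om; rewrite /o !ordM ?expf_neq0 // !ordX // => om.
  apply/dvdzP; exists (ord v (g i) - ord v (g m)).
  by move: om; move: (ord v _) (ord v _) (ord v t) => x y z; clear; lia.
rewrite dvdzE abszM Euclid_dvdM ?(pcharf_prime lF) // => /orP[//|].
rewrite /= => lmi; case/eqP: mi; apply: val_inj; apply/eqP.
have := ltn_ord m; have := ltn_ord i.
case: (ltngtP m i) => // lt_mi il ml; have := dvdn_leq _ lmi; lia.
Qed.

Lemma frobenius_basis x : exists c : 'I_l -> F, x = \sum_k c k ^+ l * t ^+ k.
Proof.
pose y (i : 'I_l.+1) := if unlift ord0 i is Some k then t ^+ k else x.
have [c [[i ci]]] := frobenius_dependent ff lF y.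
rewrite big_ord_recl {1}/y unlift_none.
under eq_bigr => k _ do rewrite /y liftK.
have [c0|c0 cy] := eqVneq (c ord0) 0.
  rewrite c0 expr0n (gtn_eqF (pchar_gt0 lF)) mul0r add0r.
  move=> /(frobenius_free (g := fun k => c (lift ord0 k))) ck.
  by case: (unliftP ord0 i) ci => [k|] ->; rewrite ?ck ?c0 eqxx.
exists (fun k => - (c (lift ord0 k) / c ord0)).
apply: (mulfI (expf_neq0 l c0)); apply/eqP; rewrite -subr_eq0; apply/eqP.
rewrite -[RHS]cy; congr (_ + _); rewrite mulr_sumr -sumrN; apply: eq_bigr => k _.
by rewrite (pchar_exprN lF) exprMn exprVn mulNr mulrN opprK [_ / _]mulrC -mulrA mulVKf ?expf_neq0.
Qed.

Definition power_coefs (P : {poly F}) := forall i, exists c, P`_i = c ^+ l.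

Lemma power_coefsD P Q : power_coefs P -> power_coefs Q -> power_coefs (P + Q).
Proof.
move=> Pl Ql i; have [[c Pc] [d Qd]] := (Pl i, Ql i).
by exists (c + d); rewrite coefD Pc Qd (pchar_exprD lF).
Qed.

Lemma power_coefsN P : power_coefs P -> power_coefs (- P).
Proof.
by move=> Pl i; have [c Pc] := Pl i; exists (- c); rewrite coefN Pc (pchar_exprN lF).
Qed.

Lemma power_coefsM P Q : power_coefs P -> power_coefs Q -> power_coefs (P * Q).
Proof.
move=> /choice[c Pc] /choice[d Qd] i.
exists (\sum_(k < i.+1) c k * d (i - k)%N); rewrite coefM (pchar_expr_sum lF).
by apply: eq_bigr => k _; rewrite exprMn Pc Qd.
Qed.

(** When the exponents are grouped modulo l, the partial sums at t vanish separately by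
    [frobenius_free], and t d/dt multiplies the k-th one by k. So the derivative at t of a
    polynomial over F^l depends only on its value at t. *)
Lemma power_coefs_deriv P : power_coefs P -> P.[t] = 0 -> P^`().[t] = 0.
Proof.
move=> /choice[c Pc] Pt; have l_gt0 := pchar_gt0 lF.
pose k0 (i : 'I_(size P)) : 'I_l := Ordinal (ltn_pmod i l_gt0).
pose g (k : 'I_l) := \sum_(i | k0 i == k) c i * t ^+ (i %/ l).
have gE k : g k ^+ l * t ^+ k = \sum_(i | k0 i == k) P`_i * t ^+ i.
  rewrite (pchar_expr_sum lF) mulr_suml; apply: eq_bigr => i /eqP<-.
  by rewrite exprMn Pc -exprM -mulrA -exprD -divn_eq.
have g0 : forall k, g k = 0.
  apply: frobenius_free; rewrite -[RHS]Pt horner_coef.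
  by rewrite (partition_big k0 predT) //=; apply: eq_bigr => k _; apply: gE.
have tP : t * P^`().[t] = \sum_(i < size P) i%:R * (P`_i * t ^+ i).
  rewrite (@horner_coef_wide _ (size P).-1) ?size_poly // mulr_sumr.
  case: (size P) => [|n]; first by rewrite !big_ord0.
  rewrite [RHS]big_ord_recl mul0r add0r; apply: eq_bigr => i _.
  by rewrite coef_deriv /= /bump add1n -mulr_natl exprS; ring.
apply: (mulfI t0); rewrite mulr0 tP (partition_big k0 predT) //= big1 // => k _.
transitivity (k%:R * (g k ^+ l * t ^+ k)); last first.
  by rewrite g0 expr0n (gtn_eqF l_gt0) mul0r mulr0.
rewrite gE mulr_sumr; apply: eq_bigr => i /eqP<- /=; congr (_ * _).
rewrite {1}(divn_eq i l) natrD natrM (pcharf0 lF) mulr0 add0r //.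
Qed.

End Derivation.

Section ExistsDerivation.
Variables (Fq : finFieldType) (F : fieldType) (iF : {rmorphism Fq -> F}).
Hypothesis ff : is_function_field iF.
Variables (l : nat) (lF : l \in [pchar F]).
Variables (v : place iF) (t : F).
Hypotheses (t0 : t != 0) (vt : ~~ (l %| `|ord v t|)%N).

Lemma power_coefs_repr x : exists2 P, power_coefs l P & P.[t] = x.
Proof.
have [c ->] := frobenius_basis ff lF t0 vt x.
pose f k := if insub k is Some i then c i ^+ l else 0.
exists (\poly_(k < l) f k).
  move=> i; rewrite coef_poly; case: ltnP => il; last first.
    by exists 0; rewrite expr0n (gtn_eqF (pchar_gt0 lF)).
  by exists (c (Ordinal il)); rewrite /f insubT.
rewrite (@horner_coef_wide _ l) ?size_poly //; apply: eq_bigr => k _.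
by rewrite coef_poly ltn_ord /f valK.
Qed.

(** Since F = F^l[t], the rule P(t) |-> P'(t) for P with coefficients in F^l is defined on all of F.
    Constants are killed because each is a q-th power. *)
Lemma exists_derivation : exists D : F -> F, [/\ {morph D : x y / x + y},
  forall x y, D (x * y) = x * D y + y * D x, D t = 1 & forall c, D (iF c) = 0].
Proof.
have /choice[P PP] x : exists P : {poly F}, power_coefs l P /\ P.[t] = x.
  by have [P ? ?] := power_coefs_repr x; exists P.
pose D x := (P x)^`().[t].
have DE Q : power_coefs l Q -> D Q.[t] = Q^`().[t].
  move=> Ql; have [Pl Pt] := PP Q.[t]; apply/eqP; rewrite -subr_eq0 -hornerN -hornerD.
  rewrite -derivN -derivD; apply/eqP/(power_coefs_deriv lF t0 vt).
    by apply: power_coefsD => //; apply: power_coefsN.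
  by rewrite hornerD hornerN Pt subrr.
have DD : {morph D : x y / x + y}.
  move=> x y; have [[Px xE] [Py yE]] := (PP x, PP y).
  rewrite -{1}xE -{1}yE -hornerD DE ?derivD ?hornerD //.
  exact: power_coefsD.
have DM x y : D (x * y) = x * D y + y * D x.
  have [[Px xE] [Py yE]] := (PP x, PP y).
  rewrite -{1}xE -{1}yE -hornerM DE; last exact: power_coefsM.
  by rewrite derivM hornerD !hornerM xE yE addrC; congr (_ + _); rewrite mulrC.
have D1 : D 1 = 0.
  by have := DM 1 1; rewrite !mul1r -[LHS]addr0 => /addrI.
have DX x n : D (x ^+ n) = (n%:R * x ^+ n.-1) * D x.
  elim: n => [|n IHn]; first by rewrite D1 !mul0r.
  rewrite exprS DM IHn /= -natr1; case: n {IHn} => [|n]; first by rewrite !expr0; ring.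
  by rewrite exprS /=; ring.
exists D; split=> //.
  rewrite -{1}[t]hornerX DE ?derivX ?hornerC // => i.
  exists (i == 1%N)%:R; rewrite coefX; case: (i == 1%N); rewrite ?expr1n //.
  by rewrite expr0n (gtn_eqF (pchar_gt0 lF)).
move=> c; rewrite -[c]expf_card rmorphXn DX.
suff -> : (#|Fq|%:R : F) = 0 by rewrite !mul0r.
have lq : l \in [pchar Fq] by rewrite -(fmorph_pchar iF).
have lP := pcharf_prime lF.
apply/eqP; rewrite -(dvdn_pcharf lF) (card_pprimeChar lq) dvdn_exp //.
rewrite lt0n; apply/eqP => n0; have := finNzRing_gt1 Fq.
by rewrite (card_pprimeChar lq) n0.
Qed.

End ExistsDerivation.

(** * The universal property of Kaehler differentials *)

Section QuotientLift.
Variables (R : pzRingType) (V : lmodType R) (S : submodule V) (W : zmodType).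
Variables (f : V -> W) (act : R -> W -> W).
Hypotheses (fD : {morph f : x y / x + y}) (fZ : forall b x, f (b *: x) = act b (f x)).
Hypothesis fS : forall x, S x -> f x = 0.

Definition quot_lift (w : quot_mod S) : W := f (repr w).

Lemma quot_liftE x : quot_lift (quot_pi S x) = f x.
Proof.
have fB y z : f (y - z) = f y - f z.
  by apply: (@addIr _ (f z)); rewrite -fD !subrK.
apply/eqP; rewrite -subr_eq0 -fB; apply/eqP/fS/quot_piP.
exact: quot_pi_repr.
Qed.

Lemma quot_liftD : {morph quot_lift : x y / x + y}.
Proof.
move=> x y; rewrite -(quot_pi_repr x) -(quot_pi_repr y) -quot_piD !quot_liftE.
exact: fD.
Qed.

Lemma quot_liftZ b x : quot_lift (b *: x) = act b (quot_lift x).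
Proof. by rewrite -(quot_pi_repr x) [b *: _]quot_scaleE !quot_liftE fZ. Qed.

End QuotientLift.

Lemma span_kernel (R : pzRingType) (V : lmodType R) (W : zmodType) (P : V -> Prop)
    (f : V -> W) : f 0 = 0 -> {morph f : x y / x + y} ->
  (forall b x, f x = 0 -> f (b *: x) = 0) -> (forall x, P x -> f x = 0) ->
  forall x, Defs.span P x -> f x = 0.
Proof.
move=> f0 fD fZ fP x; elim=> {x} [|x y _ x0 _ y0|b x _ x0|x /fP] //; last exact: fZ.
by rewrite fD x0 y0 addr0.
Qed.

Section UniversalDerivation.
Variables (k A : comPzRingType) (i : {rmorphism k -> A}).
Local Notation Om := (Kaehler i).
Local Notation S := (Defs.span (@leibniz_rel _ _ i)).

Definition univ_d (b : A) : Om := quot_pi S (tensor_d i 1 b).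

Lemma scale_univ_d (b c : A) : b *: univ_d c = quot_pi S (tensor_d i b c).
Proof.
rewrite [LHS]quot_scaleE; congr quot_pi.
by rewrite /tensor_d mtenZ -[_ *: _]/(b * 1) mulr1.
Qed.

Lemma univ_dD b c : univ_d (b + c) = univ_d b + univ_d c.
Proof. by rewrite -quot_piD -mtenDr. Qed.

Lemma univ_dM b c : univ_d (b * c) = b *: univ_d c + c *: univ_d b.
Proof.
rewrite !scale_univ_d -quot_piD; apply/quot_piP; apply: span_gen.
by exists b, c; rewrite opprD addrA.
Qed.

Lemma univ_d1 : univ_d 1 = 0.
Proof. by apply: (@addrI _ (univ_d 1)); rewrite addr0 -{3}(mulr1 1) univ_dM !scale1r. Qed.

Lemma univ_dX b n : univ_d (b ^+ n) = (n%:R * b ^+ n.-1) *: univ_d b.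
Proof.
elim: n => [|n IHn]; first by rewrite univ_d1 mul0r scale0r.
rewrite exprS univ_dM IHn /= scalerA -scalerDl; congr (_ *: _).
by case: n {IHn} => [|n]; rewrite -natr1 ?expr0 ?exprS /=; ring.
Qed.

Lemma univ_d_sum (I : finType) (f : I -> A) : univ_d (\sum_i f i) = \sum_i univ_d (f i).
Proof.
apply: (big_morph _ univ_dD).
by apply: (@addrI _ (univ_d 0)); rewrite -univ_dD !addr0.
Qed.

(** All l-th powers have differential zero, so differentiating the relation only meets the
    differential of y0. The factor b^l clears the denominators of an expansion of y over F^l. *)
Lemma univ_d_relation l b n (c : 'I_n -> A) x y y0 : l%:R = 0 :> A ->
  b ^+ l * y = \sum_k c k ^+ l * y0 ^+ k ->
  b ^+ l *: (x *: univ_d y) =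
    (x * \sum_(k < n) c k ^+ l * (k%:R * y0 ^+ k.-1)) *: univ_d y0.
Proof.
move=> l0 byE.
have dl z : univ_d (z ^+ l) = 0 by rewrite univ_dX l0 mul0r scale0r.
rewrite scalerA mulrC -!scalerA; congr (_ *: _).
have <- : univ_d (b ^+ l * y) = b ^+ l *: univ_d y by rewrite univ_dM dl scaler0 addr0.
rewrite byE scaler_suml univ_d_sum; apply: eq_bigr => k' _.
by rewrite univ_dM dl scaler0 addr0 univ_dX scalerA.
Qed.

Lemma Kaehler_ind (P : Om -> Prop) : P 0 -> (forall x y, P x -> P y -> P (x + y)) ->
  (forall b c, P (b *: univ_d c)) -> forall x, P x.
Proof.
move=> P0 PD Pd x; rewrite -(quot_pi_repr x); move: (repr x) => {}x.
elim/tens_ind: x => [|y z Py Pz|b c].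
- by have -> : quot_pi S 0 = 0 by rewrite /quot_pi raddf0.
- by rewrite quot_piD; apply: PD.
by have := Pd b c; rewrite scale_univ_d.
Qed.

Section Universal.
Variables (W : comPzRingType) (rF : {rmorphism A -> W}) (del : A -> W).
Hypotheses (delD : {morph del : x y / x + y})
  (delM : forall x y, del (x * y) = rF x * del y + rF y * del x)
  (delC : forall c, del (i c) = 0).

Definition diff_lift0 : tens_mod i A^o (restr i A^o) -> W :=
  tens_lift (fun b c => rF b * del c).

Lemma diff_lift0_balanced : balanced (fun (c : k) (m : A^o) => i c *: m)
   (fun (c : k) (n : restr i A^o) => c *: n) (fun b c => rF b * del c).
Proof.
split=> [c b b'|b c c'|u b c].
- by rewrite rmorphD mulrDl.
- by rewrite delD mulrDr.
- rewrite -[_ *: b]/(i u * b) -[_ *: c]/(i u * c) rmorphM delM delC mulr0 addr0.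
  by rewrite mulrCA mulrA.
Qed.

Lemma diff_lift0E b c : diff_lift0 (tensor_d i b c) = rF b * del c.
Proof. exact: (tens_liftE diff_lift0_balanced). Qed.

Lemma diff_lift0D : {morph diff_lift0 : x y / x + y}.
Proof. exact: (tens_liftD diff_lift0_balanced). Qed.

Lemma diff_lift00 : diff_lift0 0 = 0.
Proof. exact: (tens_lift0 diff_lift0_balanced). Qed.

Lemma diff_lift0B x y : diff_lift0 (x - y) = diff_lift0 x - diff_lift0 y.
Proof. by apply: (@addIr _ (diff_lift0 y)); rewrite -diff_lift0D !subrK. Qed.

Lemma diff_lift0Z b x : diff_lift0 (b *: x) = rF b * diff_lift0 x.
Proof.
move: x; apply: tens_ext => [x y|x y|m n].
- by rewrite scalerDr diff_lift0D.
- by rewrite diff_lift0D mulrDr.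
rewrite -/(mten m n) mtenZ [LHS]diff_lift0E [X in _ = _ * X]diff_lift0E.
by rewrite -[_ *: m]/(b * m) rmorphM mulrA.
Qed.

Lemma leibniz_kernel x : leibniz_rel x -> diff_lift0 x = 0.
Proof.
move=> [b [c ->]].
have H (X Y : W) : 1 * (X + Y) - X - Y = 0.
  by rewrite mul1r [X + Y]addrC addrK subrr.
rewrite !diff_lift0B.
rewrite !diff_lift0E.
rewrite rmorph1.
rewrite delM.
exact: H.
Qed.

Definition diff_lift : Om -> W := quot_lift diff_lift0.

Lemma diff_lift_S x : S x -> diff_lift0 x = 0.
Proof.
apply: span_kernel; [exact: diff_lift00 | exact: diff_lift0D | | exact: leibniz_kernel].
by move=> b {}x x0; rewrite diff_lift0Z x0 mulr0.
Qed.

Lemma diff_liftD : {morph diff_lift : x y / x + y}.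
Proof. exact: (quot_liftD diff_lift0D diff_lift_S). Qed.

Lemma diff_liftZ b x : diff_lift (b *: x) = rF b * diff_lift x.
Proof.
exact: (quot_liftZ (act := fun b y => rF b * y) diff_lift0D diff_lift0Z diff_lift_S).
Qed.

Lemma diff_lift_d b : diff_lift (univ_d b) = del b.
Proof.
by rewrite [LHS](quot_liftE diff_lift0D diff_lift_S) diff_lift0E rmorph1 mul1r.
Qed.

End Universal.

End UniversalDerivation.

(** Scalars b with rF b != 0 act invertibly on V, so that a relation b w = c w0 can be divided by b
    in the tensor product. *)
Lemma mten_line (A : comPzRingType) (L : fieldType) (rF : {rmorphism A -> L})
    (V : lmodType L) (Om : lmodType A) (w0 : Om) (kd : Om -> L) :
  (forall b x, kd (b *: x) = rF b * kd x) -> kd w0 = 1 ->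
  (forall w, exists b c, rF b != 0 /\ b *: w = c *: w0) ->
  forall (f : V) (w : Om), mten f w = mten (kd w *: f) w0 :> tens_mod rF V Om.
Proof.
move=> kdZ kd0 kdP f w; have [b [c [b0 bw]]] := kdP w.
have kw : rF b * kd w = rF c by rewrite -kdZ bw kdZ kd0 mulr1.
rewrite -{1}[f](scalerKV (a := rF b)) ?unitfE // mten_bal bw -mten_bal.
by rewrite scalerA -kw mulrAC divff ?mul1r.
Qed.

Section Differentials.
Variables (Fq : finFieldType) (F : fieldType) (iF : {rmorphism Fq -> F}).
Hypothesis ff : is_function_field iF.
Variables (inf : place iF) (p : finite_place inf).
Local Notation A := (regular inf).
Local Notation rc := (reg_const inf).
Local Notation rv := (@reg_val _ _ _ inf).
Local Notation Fp := (completion p).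
Local Notation rF := (reg_Fp p).
Local Notation Om := (Kaehler rc).
Local Notation univ_d := (univ_d rc).

Lemma common_regular_denom (I : finType) (y : I -> F) : exists (b : A) (c : I -> A),
  b != 0 /\ forall i, rv b * y i = rv (c i).
Proof.
have /choice[c /choice[b bc]] i : exists c b : A, c != 0 /\ y i * rv c = rv b.
  by have [b [c ?]] := regular_frac ff inf (y i); exists c, b.
exists (\prod_i c i), (fun i => b i * \prod_(k | k != i) c k); split=> [|i].
  by rewrite -reg_val_eq0 rmorph_prod; apply/prodf_neq0 => i _; rewrite reg_val_eq0; have [] := bc i.
have [_ bi] := bc i.
by rewrite (bigD1 i) // !rmorphM /= -bi mulrC mulrA.
Qed.

Lemma Kaehler_line : exists (w0 : Om) (kd : Om -> Fp),
  [/\ {morph kd : x y / x + y}, forall b x, kd (b *: x) = rF b * kd x, kd w0 = 1 &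
      forall w, exists b c, rF b != 0 /\ b *: w = c *: w0].
Proof.
have [l lP lq] := finPcharP Fq; have lF : l \in [pchar F] by rewrite (fmorph_pchar iF).
(* A function of order 1 at p is a quotient of two elements of A, whose orders cannot both be
   divisible by l. *)
have [y0 y00 ly0] : exists2 y0 : A, y0 != 0 & ~~ (l %| `|Defs.ord p (rv y0)|)%N.
  have [t t0 pt] := ord_surj p 1; have [b [c [c0 tc]]] := regular_frac ff inf t.
  have cv0 := reg_val_neq0 c0.
  have bv0 : rv b != 0 by rewrite -tc mulf_neq0.
  case: (boolP (l %| `|Defs.ord p (rv c)|)%N) => lc; last by exists c.
  exists b; first by rewrite -reg_val_eq0.
  apply/negP => lb; have : (l%:Z %| Defs.ord p t)%Z.
    rewrite -[Defs.ord p t](addrK (Defs.ord p (rv c))) -ordM // tc.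
    by apply: rpredB; rewrite dvdzE.
  by rewrite pt dvdzE dvdn1 => /eqP l1; move: lP; rewrite -[l]/(absz l%:Z) l1.
have t0 := reg_val_neq0 y00.
have [D [DD DM Dt DC]] := exists_derivation ff lF t0 ly0.
pose del (b : A) : Fp := completion_in p (D (rv b)).
have delD : {morph del : x y / x + y} by move=> x y; rewrite /del rmorphD DD rmorphD.
have delM x y : del (x * y) = rF x * del y + rF y * del x.
  by rewrite /del rmorphM DM rmorphD !rmorphM.
have delC c : del (rc c) = 0 by rewrite /del reg_val_const DC rmorph0.
exists (univ_d y0), (diff_lift rF del); split.
- exact: diff_liftD.
- exact: diff_liftZ.
- by rewrite diff_lift_d // /del Dt rmorph1.
move=> w; suff [b [c [b0 bw]]] : exists b c : A, b != 0 /\ b *: w = c *: univ_d y0.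
  by exists b, c; split; [rewrite fmorph_eq0 reg_val_eq0 | exact: bw].
elim/Kaehler_ind: w => [|x y [b [c [b0 bc]]] [b' [c' [b0' bc']]]|x y].
- by exists 1, 0; rewrite scaler0 scale0r -reg_val_eq0 rmorph1 oner_neq0.
- exists (b * b'), (b' * c + b * c'); split; first exact: regM_eq0.
  by rewrite scalerDr scalerDl -!scalerA -bc' -bc !scalerA [b' * b]mulrC.
have [g gE] := frobenius_basis ff lF t0 ly0 (rv y).
have [b [c [b0 bc]]] := common_regular_denom g.
have byE : b ^+ l * y = \sum_k c k ^+ l * y0 ^+ k.
  apply: reg_val_inj; rewrite rmorphM rmorphXn rmorph_sum /= gE mulr_sumr.
  by apply: eq_bigr => k _; rewrite rmorphM !rmorphXn /= -bc exprMn mulrA.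
have l0 : (l%:R : A) = 0.
  by apply: reg_val_inj; rewrite rmorph_nat rmorph0 (pcharf0 lF).
exists (b ^+ l), (x * \sum_k c k ^+ l * (k%:R * y0 ^+ k.-1)); split.
  exact: regX_neq0.
exact: univ_d_relation.
Qed.

End Differentials.

(** * The residue pairing *)

Section Residue.
Variables (Fq : finFieldType) (F : fieldType) (iF : {rmorphism Fq -> F}).
Hypothesis ff : is_function_field iF.
Variables (inf : place iF) (p : finite_place inf).
Local Notation A := (regular inf).
Local Notation rc := (reg_const inf).
Local Notation rv := (@reg_val _ _ _ inf).
Local Notation Fp := (completion p).
Local Notation rF := (reg_Fp p).
Variables (h : nat) (a : A) (d : nat) (e : 'I_d -> A).
Hypotheses (aP : local_generator p h a) (eS : degA_spans a e) (eF : degA_free a e).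

Let a0 : rF a != 0 := rF_neq0 aP.
Let aX0 n : rF a ^+ n != 0 := expf_neq0 n a0.

(** The exponent is k + 1 because the coefficient of 1/a is wanted: it is the lowest digit of b in
    base a after k divisions. *)
Definition pole_part (z : Fp) (b : A) (k : nat) := integral (z - rF b / rF a ^+ k.+1).

Lemma pole_part_ex z : exists bk : A * nat, pole_part z bk.1 bk.2.
Proof.
have [b [k]] := dense_frac ff aP eS z 0; rewrite expr0 divr1 => zb.
exists (b * a, k); rewrite /pole_part /= rmorphM exprSr /= invfM mulrA.
by rewrite [_ / rF a]mulrAC mulfK.
Qed.

Definition pole_repr z := sval (cid (pole_part_ex z)).

Lemma pole_reprP z : pole_part z (pole_repr z).1 (pole_repr z).2.
Proof. by rewrite /pole_repr; case: cid. Qed.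

Lemma pole_partD z w b c k : pole_part z b k -> pole_part w c k -> pole_part (z + w) (b + c) k.
Proof.
move=> zb wc; rewrite /pole_part rmorphD mulrDl opprD addrACA; exact: integralD.
Qed.

Lemma pole_partM z b k c : pole_part z b k -> pole_part (rF c * z) (c * b) k.
Proof.
move=> zb; rewrite /pole_part rmorphM /= -mulrA -mulrBr; apply: integralM => //.
exact: integral_reg.
Qed.

Lemma pole_part_shift z b k l : pole_part z b k -> pole_part z (b * a ^+ l) (k + l).
Proof.
move=> zb; rewrite /pole_part rmorphM rmorphXn /= -addSn exprD invfM mulrA.
by rewrite [_ * (rF a ^+ k.+1)^-1]mulrAC mulfK.
Qed.

Lemma pole_part0 z b k : pole_part z b k -> integral z -> exists c, b = c * a ^+ k.+1.
Proof.
move=> zb z0; apply: (reg_div aP).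
by rewrite -[_ / _](subKr z); apply: integralB.
Qed.

Lemma pole_part_unit k : pole_part (rF a ^+ k.+1)^-1 1 k.
Proof. by rewrite /pole_part rmorph1 mul1r subrr; apply: integral0. Qed.

(* A torsion-free A-module with a retraction Q of the multiplication by a, and a
   functional c modulo a: the coefficient of 1/a of the elements of X[1/a]. *)
Section Functional.
Variables (X Y : zmodType) (act : A -> X -> X) (Q : X -> X) (c : X -> Y).
Hypotheses (actDl : forall x, {morph act^~ x : b b' / b + b'})
  (actDr : forall b, {morph act b : x y / x + y})
  (actA : forall b b' x, act (b * b') x = act b (act b' x)).
Hypotheses (QD : {morph Q : x y / x + y}) (cD : {morph c : x y / x + y}).
Hypotheses (Qa : forall x, Q (act a x) = x) (ca : forall x, c (act a x) = 0).

(** With X = A this gives the residue on F_p; with X = Kbar[tau] and right multiplication by phi_b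
    it gives the digits of an element of the motive. *)
Definition resid (z : Fp) (x : X) : Y :=
  c (iter (pole_repr z).2 Q (act (pole_repr z).1 x)).

Lemma iterQD k : {morph iter k Q : x y / x + y}.
Proof. by move=> x y; elim: k => //= k ->; rewrite QD. Qed.

Lemma iterQX k b x : iter k Q (act (b * a ^+ k) x) = act b x.
Proof.
elim: k b => [|k IHk] b; first by rewrite mulr1.
by rewrite exprSr mulrA mulrC actA iterSr Qa IHk.
Qed.

(** Two polar parts of z, brought to the same denominator, differ by a multiple of a^(k + k' + 1);
    after k + k' divisions there remains a multiple of a, which c kills. *)
Lemma residE z b k x : pole_part z b k -> resid z x = c (iter k Q (act b x)).
Proof.
move=> zb; have := pole_reprP z; rewrite /resid; move: (pole_repr z) => [b' k'] /= zb'.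
have c0 : c 0 = 0 by apply: (@addrI _ (c 0)); rewrite -cD !addr0.
have [y yE] : exists y, b' * a ^+ k - b * a ^+ k' = y * a ^+ (k + k').+1.
  apply: (@pole_part0 0); last exact: integral0.
  rewrite -(subrr z); apply: pole_partD; first by rewrite addnC; apply: pole_part_shift.
  have := pole_partM (-1) (pole_part_shift k' zb).
  by rewrite rmorphN1 !mulN1r.
have -> : iter k' Q (act b' x) = iter (k + k') Q (act (b' * a ^+ k) x).
  by rewrite addnC iterD iterQX.
have -> : iter k Q (act b x) = iter (k + k') Q (act (b * a ^+ k') x).
  by rewrite iterD iterQX.
have -> : b' * a ^+ k = b * a ^+ k' + a * y * a ^+ (k + k').
  by rewrite -mulrA mulrCA -exprS -yE addrC subrK.
by rewrite actDl iterQD cD [X in _ + c X]iterQX [act (a * y) x]actA ca addr0.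
Qed.

Lemma residDl x : {morph resid^~ x : z w / z + w}.
Proof.
move=> z w; have [zP wP] := (pole_reprP z, pole_reprP w).
have z1 := pole_part_shift (pole_repr w).2 zP.
have := pole_part_shift (pole_repr z).2 wP; rewrite addnC => w1.
rewrite (residE _ (pole_partD z1 w1)) (residE _ z1) (residE _ w1).
by rewrite actDl iterQD cD.
Qed.

Lemma residDr z : {morph resid z : x y / x + y}.
Proof. by move=> x y; rewrite /resid actDr iterQD cD. Qed.

Lemma resid_act z b x : resid z (act b x) = resid (rF b * z) x.
Proof.
rewrite (residE _ (pole_reprP z)) (residE _ (pole_partM b (pole_reprP z))).
by rewrite mulrC actA.
Qed.

Lemma resid_integral z x : integral z -> resid z x = 0.
Proof.
move=> z0; have [b bE] := pole_part0 (pole_reprP z) z0.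
by rewrite /resid bE exprS mulrA iterQX mulrC actA ca.
Qed.

Lemma resid_unit k x : (forall x, act 1 x = x) ->
  resid (rF a ^+ k.+1)^-1 x = c (iter k Q x).
Proof. by move=> act1; rewrite (residE _ (pole_part_unit k)) act1. Qed.

Lemma resid_map (fX : X -> X) (fY : Y -> Y) : (forall x, Q (fX x) = fX (Q x)) ->
  (forall x, c (fX x) = fY (c x)) -> (forall b x, act b (fX x) = fX (act b x)) ->
  forall z x, resid z (fX x) = fY (resid z x).
Proof.
move=> fQ fc fa z x; rewrite /resid fa; set k := (_).2; move: (act _ x) => {}x.
by elim: k x => [|k IHk] x; rewrite ?fc // !iterSr fQ IHk.
Qed.

End Functional.
End Residue.

(** * Self-duality of F_p under a residue *)

Section Duality.
Variables (Fq : finFieldType) (F : fieldType) (iF : {rmorphism Fq -> F}).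
Hypothesis ff : is_function_field iF.
Variables (inf : place iF) (p : finite_place inf).
Local Notation A := (regular inf).
Local Notation rc := (reg_const inf).
Local Notation rv := (@reg_val _ _ _ inf).
Local Notation Fp := (completion p).
Local Notation rF := (reg_Fp p).
Local Notation cF := (const_Fp p).
Variables (h : nat) (a : A) (d : nat) (e : 'I_d -> A).
Hypotheses (aP : local_generator p h a) (eS : degA_spans a e) (eF : degA_free a e).

Let a0 : rF a != 0 := rF_neq0 aP.
Let aX0 n : rF a ^+ n != 0 := expf_neq0 n a0.
Let aA0 : a != 0 := local_generator_neq0' aP.

Lemma rF_const u : rF (rc u) = cF u. Proof. by []. Qed.

Lemma generator_not_unit b : 1 <> b * a.
Proof.
move=> /(congr1 rv); rewrite rmorphM rmorph1 /= => ba.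
have bv0 : rv b != 0 by apply/eqP => b0; move/eqP: ba; rewrite b0 mul0r oner_eq0.
have := ordM p bv0 (local_generator_neq0 aP); rewrite -ba Defs.ord1.
have [h0 -> _] := aP; have := ord_geE bv0 (reg_ord_ge p b).
by move: h0 (Defs.ord p _); clear; lia.
Qed.

Lemma integral_aV : ~ integral (rF a)^-1.
Proof.
have -> : (rF a)^-1 = rF 1 / rF a ^+ 1 by rewrite rmorph1 mul1r.
move=> /(reg_div aP)[b]; rewrite expr1; exact: generator_not_unit.
Qed.

Lemma digits_unique (u u' : 'I_d -> Fq) y y' :
  \sum_i rc (u i) * e i + y * a = \sum_i rc (u' i) * e i + y' * a ->
  (forall i, u i = u' i) /\ y = y'.
Proof.
move=> E; have uu i : u i - u' i = 0.
  apply: (eF (c := fun i => u i - u' i) (y := y' - y)).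
  under eq_bigr => k _ do rewrite rmorphB mulrBl.
  rewrite sumrB mulrBl; apply/eqP; rewrite subr_eq addrAC eq_sym subr_eq.
  by rewrite [y' * a + _]addrC -E.
have {}uu i : u i = u' i by apply/eqP; rewrite -subr_eq0 uu.
split=> //; apply: (regM_inj aA0); move: E.
by rewrite (eq_bigr (fun i => rc (u' i) * e i)) => [/addrI//|i _]; rewrite uu.
Qed.

Lemma exists_residue : exists lam : Fp -> Fq, [/\ {morph lam : x y / x + y},
  forall u z, lam (cF u * z) = u * lam z, forall z, integral z -> lam z = 0 &
  exists z, lam z != 0].
Proof.
have /choice[c /choice[Q cQ]] x : exists c : 'I_d -> Fq, exists y, x = \sum_i rc (c i) * e i + y * a.
  by have [c [y xE]] := eS x; exists c, y.
have d0 : (0 < d)%N.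
  rewrite lt0n; apply/negP => /eqP d0; have [u [y]] := eS 1.
  rewrite big1 ?add0r => [/generator_not_unit//|i _].
  by have := ltn_ord i; rewrite {2}d0.
pose i0 := Ordinal d0; pose ci x := c x i0.
have cQ_uniq x (u : 'I_d -> Fq) y : x = \sum_i rc (u i) * e i + y * a -> ci x = u i0 /\ Q x = y.
  move=> xE; have [] := @digits_unique (c x) u (Q x) y; first by rewrite -cQ.
  by move=> cu Qy; rewrite /ci cu.
have addE x y : x + y = \sum_i rc (c x i + c y i) * e i + (Q x + Q y) * a.
  rewrite {1}[x]cQ {1}[y]cQ mulrDl addrACA; congr (_ + _).
  by rewrite -big_split; apply: eq_bigr => i _; rewrite rmorphD mulrDl.
have QD : {morph Q : x y / x + y} by move=> x y; have [_] := cQ_uniq _ _ _ (addE x y).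
have cD : {morph ci : x y / x + y} by move=> x y; have [] := cQ_uniq _ _ _ (addE x y).
have aE x : a * x = \sum_i rc 0 * e i + x * a.
  by rewrite big1 ?add0r 1?mulrC // => i _; rewrite rmorph0 mul0r.
have Qa x : Q (a * x) = x by have [_] := cQ_uniq _ (fun=> 0) _ (aE x).
have ca x : ci (a * x) = 0 by have [] := cQ_uniq _ (fun=> 0) _ (aE x).
have constE u x : rc u * x = \sum_i rc (u * c x i) * e i + (rc u * Q x) * a.
  rewrite {1}[x]cQ mulrDr mulr_sumr mulrA; congr (_ + _); apply: eq_bigr => i _.
  by rewrite rmorphM mulrA.
have actDl (x : A) : {morph ( *%R)^~ x : b b' / b + b'} by move=> b b'; apply: mulrDl.
have actDr (b : A) : {morph *%R b : x y / x + y} by move=> x y; apply: mulrDr.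
have actA (b b' x : A) : b * b' * x = b * (b' * x) by rewrite mulrA.
pose lam z := resid ff aP eS *%R Q ci z 1.
exists lam; split.
- exact: residDl.
- move=> u z; rewrite /lam -rF_const -resid_act //.
  apply: (resid_map ff aP eS (fX := *%R (rc u)) (fY := *%R u)) => [x|x|b x].
  + by have [_] := cQ_uniq _ _ _ (constE u x).
  + by have [] := cQ_uniq _ _ _ (constE u x).
  + by rewrite mulrCA.
- by move=> z z0; apply: resid_integral.
exists (rF (e i0) / rF a); rewrite /lam -resid_act // -[rF a]expr1 resid_unit // ; last exact: mul1r.
rewrite /= mulr1.
have /cQ_uniq[-> _] : e i0 = \sum_i rc (i == i0)%:R * e i + 0 * a.
  rewrite (bigD1 i0) // big1 => [|i /negPf->]; last by rewrite rmorph0 mul0r.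
  by rewrite [i0 == i0]eqxx rmorph1 mul1r mul0r /= !addr0.
by rewrite eqxx oner_neq0.
Qed.

(* One of z and 1/(t z) is integral, for a uniformizer t. *)
Lemma integral_or_inv (t : F) z : Defs.ord p t = 1 -> ~ integral z ->
  integral (completion_in p t * z)^-1.
Proof.
move=> pt zn; have t0 : t != 0 by rewrite (@ord_neq0 _ _ _ p) // pt.
have ct0 : completion_in p t != 0 by rewrite fmorph_eq0.
have z0 : z != 0 by apply: contra_not_neq zn => ->; apply: integral0.
pose y := (completion_in p t * z)^-1.
have yz : completion_in p t * z * y = 1 by exact: (mulfV (mulf_neq0 ct0 z0)).
have [y1 yy1] := compl_approx y 0.
apply: contrapT => yn.
have y1n : ~ ord_ge p 0 y1.
  move=> y10; apply: yn; rewrite -/y -(subrK (completion_in p y1) y); apply: integralD => //.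
  exact: fil_compl_in.
have y10 : y1 != 0 by apply: contra_not_neq y1n => ->; left.
have y1neg : Defs.ord p y1 < 0 by rewrite ltNge; apply/negP => H; apply: y1n; right.
pose N := - Defs.ord p y1.
have N0 : 0 < N by rewrite /N oppr_gt0.
have [z1 zz1] := compl_approx z N.
have z1n : ~ ord_ge p 0 z1.
  move=> z10; apply: zn; rewrite -(subrK (completion_in p z1) z); apply: integralD.
    by apply: (@fil_S _ (compl_fil p) 0 N) => //; apply: ltW.
  exact: fil_compl_in.
have z10 : z1 != 0 by apply: contra_not_neq z1n => ->; left.
have z1neg : Defs.ord p z1 < 0 by rewrite ltNge; apply/negP => H; apply: z1n; right.
pose ct := completion_in p t; pose cy := completion_in p y1; pose cz := completion_in p z1.
have ctf : compl_fil p 1 ct by apply: fil_compl_in; right; rewrite pt.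
have czf : compl_fil p (Defs.ord p z1) cz by apply: fil_compl_in; right.
have cyf : compl_fil p (- N) cy by apply: fil_compl_in; right; rewrite opprK.
have : compl_fil p (1 + Defs.ord p z1) (ct * cz * cy).
  have -> : ct * cz * cy = 1 - (ct * (z - cz) * y + ct * cz * (y - cy)).
    by rewrite !mulrBr !mulrBl -/cy yz addrA subrK opprB addrC subrK.
  have yf : compl_fil p (- N) y.
    rewrite -(subrK cy y); apply: fil_D => //.
    by apply: (@fil_S _ (compl_fil p) (- N) 0) => //; rewrite oppr_le0 ltW.
  apply: fil_B.
    apply: (@fil_S _ (compl_fil p) _ 0); last exact: fil_1.
    by move: z1neg; move: (Defs.ord p z1); clear; lia.
  apply: fil_D.
    apply: (@fil_S _ (compl_fil p) _ (1 + N + - N)).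
      by rewrite addrK; move: z1neg; move: (Defs.ord p z1); clear; lia.
    by apply: fil_M => //; apply: fil_M.
  by rewrite -[1 + _]addr0; apply: fil_M => //; apply: fil_M.
rewrite -!rmorphM => /compl_in_fil/ord_geE; rewrite !mulf_neq0 // => /(_ isT).
rewrite !ordM ?mulf_neq0 // pt.
by move: y1neg z1neg; move: (Defs.ord p z1) (Defs.ord p y1); clear; lia.
Qed.

(** Let m be least such that the residue is nonzero on t^-m A_p. Scaling the argument by t^(1 - m)
    gives a functional that vanishes on A_p but not on t^-1 A_p, and x A_p contains t^-1 A_p as soon
    as x is not integral. *)
Lemma exists_normalized_residue : exists lam : Fp -> Fq, [/\ {morph lam : x y / x + y},
  forall u z, lam (cF u * z) = u * lam z, forall z, integral z -> lam z = 0 &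
  forall x, (forall z, integral z -> lam (x * z) = 0) -> integral x].
Proof.
have [lam [lamD lamZ lam0 [z1 lamz]]] := exists_residue.
have [t t0 pt] := ord_surj p 1; pose ct := completion_in p t.
have ct0 : ct != 0 by rewrite fmorph_eq0.
have ctX n : ct ^+ n != 0 by rewrite expf_neq0.
have cti : integral ct.
  by apply: fil_compl_in; right; rewrite pt.
pose P m := `[< exists z, integral (ct ^+ m * z) /\ lam z != 0 >].
have Pex : exists m, P m.
  have [n an] := integral_multiple_ex aP z1; exists (h * n)%N; apply/asboolP; exists z1; split=> //.
  have [u uE] : exists u, t ^+ (h * n) = rv a ^+ n * u /\ ord_ge p 0 u.
    exists (t ^+ (h * n) / rv a ^+ n); split; first by rewrite mulrC divfK // expf_neq0 // (local_generator_neq0 aP).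
    have av0 := local_generator_neq0 aP; have [_ av _] := aP.
    right; rewrite ordM ?invr_eq0 ?expf_neq0 // ordV ?expf_neq0 // !ordX // pt av.
    by rewrite mul1r PoszM subrr.
  have [uE1 u0] := uE.
  rewrite /ct -rmorphXn uE1 rmorphM rmorphXn /= mulrAC; apply: integralM => //.
  exact: fil_compl_in.
case: (ex_minnP Pex) => m /asboolP[z0 [z0i lamz0]] m_min.
have m0 : (0 < m)%N.
  by rewrite lt0n; apply: contraNneq lamz0 => m0; rewrite lam0 //; move: z0i; rewrite m0 mul1r.
pose s := ct ^- m.-1.
exists (fun z => lam (s * z)); split.
- by move=> x y; rewrite mulrDr lamD.
- by move=> u z; rewrite mulrCA lamZ.
- move=> z zi; apply/eqP; apply: contrapT => /negP lz.
  have /m_min : P m.-1 by apply/asboolP; exists (s * z); rewrite /s mulVKf; [split | exact: ctX].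
  by rewrite -{1}(prednK m0) ltnn.
move=> x xP; apply: contrapT => xn; have xi := integral_or_inv pt xn.
have x0 : x != 0 by apply: contra_not_neq xn => ->; apply: integral0.
have := xP ((ct * x)^-1 * (ct ^+ m * z0)).
rewrite (_ : s * _ = z0); first by move=> H; rewrite H ?eqxx // in lamz0; apply: integralM.
have aux (L : fieldType) (w c y z : L) : w != 0 -> c != 0 ->
    w * ((c * w)^-1 * (y * c * z)) = y * z.
  by move=> w0 c0; field; rewrite w0 c0.
by rewrite -{1}(prednK m0) exprSr (aux _ x ct) // /s mulKf.
Qed.

End Duality.

Section Dualizing.
Variables (Fq : finFieldType) (F : fieldType) (iF : {rmorphism Fq -> F}).
Hypothesis ff : is_function_field iF.
Variables (inf : place iF) (p : finite_place inf).
Local Notation A := (regular inf).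
Local Notation rc := (reg_const inf).
Local Notation rv := (@reg_val _ _ _ inf).
Local Notation Fp := (completion p).
Local Notation rF := (reg_Fp p).
Local Notation cF := (const_Fp p).

Definition continuous_at (a : A) (T : zmodType) (f : Fp -> T) :=
  exists N, forall z, integral (z / rF a ^+ N) -> f z = 0.

Definition dualizing (a : A) (lam : Fp -> Fq) :=
  [/\ {morph lam : x y / x + y}, forall u z, lam (cF u * z) = u * lam z,
      forall z, integral z -> lam z = 0,
      forall c, (forall z, lam (c * z) = 0) -> c = 0 &
      forall mu : Fp -> Fq, {morph mu : x y / x + y} ->
        (forall u z, mu (cF u * z) = u * mu z) -> continuous_at a mu ->
        exists c, forall z, mu z = lam (c * z)].

Variables (h : nat) (a : A) (d : nat) (e : 'I_d -> A).
Hypotheses (aP : local_generator p h a) (eS : degA_spans a e) (eF : degA_free a e).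

Let a0 : rF a != 0 := rF_neq0 aP.
Let aX0 n : rF a ^+ n != 0 := expf_neq0 n a0.
Let aA0 : a != 0 := local_generator_neq0' aP.

Section Normalized.
Variable lam : Fp -> Fq.
Hypotheses (lamD : {morph lam : x y / x + y}) (lamZ : forall u z, lam (cF u * z) = u * lam z)
  (lam0 : forall z, integral z -> lam z = 0)
  (lamN : forall x, (forall z, integral z -> lam (x * z) = 0) -> integral x).

Lemma additive_zero (T U : zmodType) (f : T -> U) : {morph f : x y / x + y} -> f 0 = 0.
Proof. by move=> fD; apply: (@addrI _ (f 0)); rewrite -fD !addr0. Qed.

Lemma additive_sub (T U : zmodType) (f : T -> U) : {morph f : x y / x + y} ->
  forall x y, f (x - y) = f x - f y.
Proof. by move=> fD x y; apply: (@addIr _ (f y)); rewrite -fD !subrK. Qed.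

Lemma additive_sum (T U : zmodType) (f : T -> U) : {morph f : x y / x + y} ->
  forall (I : Type) (r : seq I) (P : pred I) (g : I -> T),
  f (\sum_(i <- r | P i) g i) = \sum_(i <- r | P i) f (g i).
Proof. by move=> fD I r P g; apply: (big_morph f fD); apply: additive_zero. Qed.

Lemma pairing_nondegenerate n (x : A) :
  (forall y : A, lam (rF (x * y) / rF a ^+ n) = 0) -> exists x', x = x' * a ^+ n.
Proof.
move=> xy; apply: (reg_div aP); apply: lamN => z zi.
have [y zy] := integral_dense ff aP eS n zi.
rewrite -[z](subrK (rF y)) mulrDr lamD [_ * rF y]mulrAC -rmorphM xy addr0.
rewrite -mulrA [X in rF x * X]mulrC; apply: lam0; apply: integralM => //.
exact: integral_reg.
Qed.

(* On the finite group A/a^n the pairing is perfect by counting. *)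
Lemma represent_level n (mu : Fp -> Fq) : {morph mu : x y / x + y} ->
  (forall u z, mu (cF u * z) = u * mu z) -> (forall z, integral z -> mu z = 0) ->
  exists x : A, forall y, lam (rF (x * y) / rF a ^+ n) = mu (rF y / rF a ^+ n).
Proof.
move=> muD muZ mu0; pose I := ('I_d * 'I_n)%type.
pose b (i : I) := e i.1 * a ^+ i.2.
pose x (u : {ffun I -> Fq}) := \sum_i rc (u i) * b i.
pose f u := [ffun i => lam (rF (x u * b i) / rF a ^+ n)].
have lin (g : Fp -> Fq) : {morph g : x y / x + y} -> (forall u z, g (cF u * z) = u * g z) ->
    (forall z, integral z -> g z = 0) -> forall w (v : I -> Fq) y',
    g (rF (w * (\sum_i rc (v i) * b i + y' * a ^+ n)) / rF a ^+ n) =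
    \sum_i v i * g (rF (w * b i) / rF a ^+ n).
  move=> gD gZ g0 w v y'; rewrite mulrDr rmorphD mulrDl gD [X in _ + X]g0 ?addr0.
    rewrite mulr_sumr rmorph_sum mulr_suml (additive_sum gD); apply: eq_bigr => i _.
    by rewrite -gZ mulrCA rmorphM -mulrA.
  by rewrite mulrA rmorphM rmorphXn /= mulfK //; apply: integral_reg.
have spansP y : exists v y', y = \sum_i rc (v i) * b i + y' * a ^+ n.
  exact: (degA_power_spans eS n).
have f_inj : injective f.
  move=> u u' fu; apply/ffunP => i; apply/eqP; rewrite -subr_eq0; apply/eqP.
  have [y|x' xE] := @pairing_nondegenerate n (x u - x u').
    have [v [y' ->]] := spansP y; rewrite lin // big1 // => k _.
    rewrite mulrBl rmorphB mulrBl (additive_sub lamD).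
    by move/ffunP/(_ k): fu; rewrite !ffunE => ->; rewrite subrr mulr0.
  apply: (@degA_power_free _ _ _ _ a d e n (fun i => u i - u' i) x') => //.
  rewrite -xE /x -sumrB; apply: eq_bigr => k _.
  by rewrite rmorphB mulrBl.
have [g _ gK] := injF_bij f_inj.
exists (x (g [ffun i => mu (rF (b i) / rF a ^+ n)])) => y.
have [v [y' ->]] := spansP y; rewrite lin //.
rewrite -[X in mu (rF X / _)]mul1r lin //; apply: eq_bigr => i _; congr (_ * _).
rewrite mul1r; set u := [ffun i => _].
by have := congr1 (fun w : {ffun _} => w i) (gK u); rewrite !ffunE.
Qed.

(** By nondegeneracy the solutions of levels n and n + 1 agree modulo a^n, so that they converge; c
    is their limit. *)
Lemma represent_integral (mu : Fp -> Fq) : {morph mu : x y / x + y} ->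
  (forall u z, mu (cF u * z) = u * mu z) -> (forall z, integral z -> mu z = 0) ->
  exists c, forall z, mu z = lam (c * z).
Proof.
move=> muD muZ mu0.
have /choice[x xP] n := represent_level n muD muZ mu0.
have /choice[f fP] n : exists f, x n.+1 - x n = f * a ^+ n.
  apply: pairing_nondegenerate => y.
  rewrite mulrBl rmorphB mulrBl (additive_sub lamD) xP.
  have aux X : rF (X * a) / rF a ^+ n.+1 = rF X / rF a ^+ n.
    by rewrite rmorphM exprS invfM mulrA mulfK.
  by have := xP n.+1 (y * a); rewrite mulrA !aux => ->; rewrite subrr.
have xE n : x n = x 0 + \sum_(k < n) f k * a ^+ k.
  elim: n => [|n IHn]; first by rewrite big_ord0 addr0.
  by rewrite big_ord_recr /= addrA -IHn -fP addrC subrK.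
have [c0 c0P] := series_limit aP f.
pose c := rF (x 0) + c0.
have cx n : integral ((c - rF (x n)) / rF a ^+ n).
  have -> : c - rF (x n) = c0 - \sum_(k < n) rF (f k) * rF a ^+ k.
    rewrite xE rmorphD /c opprD addrACA subrr add0r rmorph_sum.
    by congr (_ - _); apply: eq_bigr => k _; rewrite rmorphM rmorphXn.
  exact: c0P.
have ci : integral c.
  rewrite -[c](subrK (rF (x 0))); apply: integralD; last exact: integral_reg.
  by have := cx 0; rewrite divr1.
exists c => z.
have [b [n]] := dense_frac ff aP eS z 0; rewrite divr1 => zb.
rewrite -[z](subrK (rF b / rF a ^+ n)) muD mu0 // add0r mulrDr lamD [X in _ = X + _]lam0.
  rewrite add0r -[c](subrK (rF (x n))) mulrDl lamD [X in _ = X + _]lam0.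
    by rewrite add0r mulrA -rmorphM xP.
  by rewrite mulrCA mulrC; apply: integralM (cx n) _; exact: integral_reg.
exact: integralM.
Qed.

(** Scaling the argument by a power of a makes a continuous functional vanish on A_p, where
    [represent_integral] applies. *)
Lemma normalized_dualizing : dualizing a lam.
Proof.
split=> // [c c0|mu muD muZ [N muN]].
  apply: contrapT => /eqP cn0; apply: (integral_aV aP).
  apply: lamN => z _; rewrite -[_ * z](mulVKf cn0); exact: c0.
have [|||c cP] := @represent_integral (fun z => mu (rF a ^+ N * z)).
- by move=> x y; rewrite mulrDr muD.
- by move=> u z; rewrite mulrCA muZ.
- by move=> z zi; apply: muN; rewrite [_ ^+ N * z]mulrC mulfK.
exists (c / rF a ^+ N) => z.
by rewrite -mulrA -cP mulVKf.
Qed.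

End Normalized.

Lemma exists_dualizing : exists lam, dualizing a lam.
Proof.
have [lam [lamD lamZ lam0 lamN]] := exists_normalized_residue ff aP eS eF.
by exists lam; apply: normalized_dualizing.
Qed.

End Dualizing.

(** * Kernels of twisted polynomials over an algebraically closed field *)

Section TwistedClosed.
Variables (Fq : finFieldType) (L : closedFieldType) (iL : {rmorphism Fq -> L}).
Local Notation Lt := (twisted iL).
Local Notation q := #|Fq|.
Local Notation pol m := (m%R : {poly L}).
Local Notation ev := (tw_eval (iK := iL) (idfun : {rmorphism L -> L})).
Local Notation tau := (Defs.tau iL).
Implicit Types m d P : Lt.

Let q_gt1 : (1 < q)%N. Proof. exact: finNzRing_gt1. Qed.
Let q_gt0 : (0 < q)%N. Proof. exact: ltnW. Qed.
Let qX_gt0 n : (0 < q ^ n)%N. Proof. by rewrite expn_gt0 q_gt0. Qed.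

Lemma ev_const u x : ev (tw_const iL u) x = u * x.
Proof. exact: tw_eval_const. Qed.

Lemma ev_tau x : ev tau x = x ^+ q.
Proof.
have -> : tau = (1 *: 'X^1 : {poly L}) by rewrite scale1r expr1.
by rewrite tw_eval_monom mul1r expn1.
Qed.

Lemma evZ m u x : ev m (iL u * x) = iL u * ev m x.
Proof. by rewrite -!ev_const -!tw_evalM tw_const_central. Qed.

Lemma evB m d x : ev (m - d) x = ev m x - ev d x.
Proof. by apply: (@addIr _ (ev d x)); rewrite -tw_eval_addl !subrK. Qed.

Lemma ev_sum m (I : finType) (f : I -> L) : ev m (\sum_i f i) = \sum_i ev m (f i).
Proof. by apply: (big_morph _ (tw_evalD _ m)); apply: tw_eval0r. Qed.

Lemma ev_combination m n (u : 'I_n -> Fq) (z : 'I_n -> L) :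
  ev m (\sum_i iL (u i) * z i) = \sum_i iL (u i) * ev m (z i).
Proof. by rewrite ev_sum; apply: eq_bigr => i _; rewrite evZ. Qed.

Lemma ev_tauX h x : ev (tau ^+ h) x = x ^+ (q ^ h).
Proof.
elim: h => [|h IHh]; first by rewrite expr0 -(rmorph1 (tw_const iL)) ev_const mul1r expr1.
by rewrite exprS tw_evalM IHh ev_tau -exprM -expnSr.
Qed.

Definition lin_poly m : {poly L} := \sum_(i < size (pol m)) (pol m)`_i *: 'X^(q ^ i).

Lemma lin_polyE m x : (lin_poly m).[x] = ev m x.
Proof.
by rewrite horner_sum; apply: eq_bigr => i _; rewrite hornerZ hornerXn.
Qed.

Lemma size_lin_poly m : m != 0 -> size (lin_poly m) = (q ^ (size (pol m)).-1).+1.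
Proof.
move=> m0; rewrite /lin_poly; have : lead_coef (pol m) != 0 by rewrite lead_coef_eq0.
have : (0 < size (pol m))%N by rewrite size_poly_gt0.
rewrite lead_coefE; move: (size _) => [|n] //= _ lm.
rewrite big_ord_recr /= addrC size_polyDl size_scale ?size_polyXn //.
rewrite ltnS; apply: leq_trans (size_sum _ _ _) _; apply/bigmax_leqP => i _.
apply: leq_trans (size_scale_leq _ _) _; rewrite size_polyXn.
by rewrite ltn_exp2l.
Qed.

Lemma zeros_bound m (s : seq L) : m != 0 -> uniq s -> (forall x, x \in s -> ev m x = 0) ->
  (size s <= q ^ (size (pol m)).-1)%N.
Proof.
move=> m0 us sm; rewrite -ltnS -size_lin_poly //; apply: max_poly_roots => //.
  by rewrite -size_poly_gt0 size_lin_poly.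
by apply/allP => x xs; rewrite /root lin_polyE sm.
Qed.

Lemma qX_char i : (q ^ i.+1)%:R = 0 :> L.
Proof.
have [l lP lq] := finPcharP Fq; have lL : l \in [pchar L] by rewrite (fmorph_pchar iL).
apply/eqP; rewrite -(dvdn_pcharf lL) expnS dvdn_mulr // (card_pprimeChar lq) dvdn_exp //.
by rewrite lt0n; apply/eqP => n0; move: q_gt1; rewrite (card_pprimeChar lq) n0.
Qed.

(** The derivative of an additive polynomial is its linear coefficient, here a nonzero constant, so
    there are no multiple roots. *)
Lemma separable_zeros m : (pol m)`_0 != 0 -> exists s : seq L,
  [/\ uniq s, forall x, x \in s -> ev m x = 0 & size s = (q ^ (size (pol m)).-1)%N].
Proof.
move=> m0; have mn0 : m != 0 by apply: contraNneq m0 => ->; rewrite coef0.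
have lm0 : lin_poly m != 0 by rewrite -size_poly_gt0 size_lin_poly.
have dm : (lin_poly m)^`() = ((pol m)`_0)%:P.
  rewrite /lin_poly; have : (0 < size (pol m))%N by rewrite size_poly_gt0.
  move: (size _) => [|n] // _; rewrite raddf_sum big_ord_recl big1 => [|i _] /=.
    by rewrite addr0 derivZ derivXn /= expr0 alg_polyC.
  by rewrite derivZ derivXn /bump add1n -mulr_natr -polyC_natr qX_char mulr0 scaler0.
have [s sE] := closed_field_poly_normal (lin_poly m).
have sep : separable_poly (lin_poly m).
  by rewrite separable_poly.unlock dm -alg_polyC coprimepZr // coprimep1.
have us : uniq s.
  move: sep; rewrite sE -separable_prod_XsubC.
  by rewrite (eqp_separable (eqp_scale _ _)) // lead_coef_eq0.
exists s; split=> // [x xs|].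
  apply/eqP; rewrite -lin_polyE sE hornerZ mulf_eq0; apply/orP; right.
  by rewrite -[_ == 0]/(root _ x) root_prod_XsubC.
have := congr1 (fun p : {poly L} => size p) sE.
by rewrite size_lin_poly // size_scale ?lead_coef_eq0 // size_prod_XsubC => -[].
Qed.

(** The remainder of d modulo P vanishes at all zeros of P, which are too many for its degree
    because P is separable. *)
Lemma separable_divides P d : (pol P)`_0 != 0 -> (forall x, ev P x = 0 -> ev d x = 0) ->
  exists c, d = c * P.
Proof.
move=> P0 Pd; have Pn0 : P != 0 by apply: contraNneq P0 => ->; rewrite coef0.
have [[c R] /= dE sR] := tw_division d Pn0; exists c.
case: (eqVneq R 0) => [R0|R0]; first by rewrite dE R0 addr0.
have [s [us sP ss]] := separable_zeros P0.
have := zeros_bound R0 us; rewrite ss leq_exp2l //.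
have -> : ((size (pol P)).-1 <= (size (pol R)).-1)%N = false.
  have : (0 < size (pol R))%N by rewrite size_poly_gt0.
  by move: sR; move: (size _) (size _) => a b; clear; lia.
move=> H; exfalso; have : false = true; last by [].
apply: H => x xs; have := Pd x (sP x xs); rewrite dE tw_eval_addl tw_evalM sP //.
by rewrite tw_eval0r add0r.
Qed.

Lemma root_exists n (c : L) : (0 < n)%N -> exists x, x ^+ n = c.
Proof.
move=> n0; have [x xE] := solve_monicpoly (fun i => if i == 0%N then c else 0) n0.
exists x; rewrite xE; case: n n0 {xE} => // n _.
rewrite big_ord_recl mulr1 big1 ?addr0 // => i _; exact: mul0r.
Qed.

Lemma tau_comm m : exists m', tau * m = m' * tau.
Proof.
elim/poly_monom_ind: m => [|m d [m' mE] [d' dE]|c i].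
- by exists 0; rewrite mulr0 mul0r.
- by exists (m' + d'); rewrite mulrDr mulrDl mE dE.
have tauE k : (tau ^+ k : {poly L}) = 1 *: 'X^k.
  elim: k => [|k IHk]; first by rewrite !expr0 scale1r.
  have tE : tau = (1 *: 'X^1 : {poly L}) by rewrite scale1r expr1.
  rewrite exprS -[LHS]/(tw_mul tau (tau ^+ k)) IHk tE tw_mul_monom (tw_shift_monom iL).
  by rewrite expr1n !scale1r add1n.
have mE : (c *: 'X^i : Lt) = tw_const iL c * tau ^+ i by rewrite tw_constE tauE scale1r.
exists (tw_const iL (c ^+ q) * tau ^+ i).
by rewrite [X in tau * X]mE mulrA tau_const -!mulrA -exprS -exprSr.
Qed.

Lemma tauX_comm h m : exists m', tau ^+ h * m = m' * tau ^+ h.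
Proof.
elim: h m => [|h IHh] m; first by exists m; rewrite mul1r mulr1.
have [m' mE] := tau_comm m; have [m'' m'E] := IHh m'.
by exists m''; rewrite exprSr -mulrA mE mulrA m'E -mulrA -exprSr.
Qed.

(** L is perfect: a twisted polynomial without constant term is tau times the one formed with the
    q-th roots of its coefficients. *)
Lemma tau_factor P : P != 0 -> exists h P', P = tau ^+ h * P' /\ (pol P')`_0 != 0.
Proof.
have [n] := ubnP (size (pol P)); elim: n P => // n IHn P Pn P0.
case: (eqVneq ((pol P)`_0) 0) => [c0|c0]; last by exists 0%N, P; rewrite mul1r.
have /choice[rt rtP] (c : L) : exists x, x ^+ q = c by apply: root_exists.
pose P1 : Lt := \poly_(i < (size (pol P)).-1) rt (pol P)`_i.+1.
have PE : P = tau * P1.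
  apply/polyP => k; rewrite (@tw_coefM _ _ _ 2) ?size_polyX //.
  rewrite big_ord_recl big_ord1 !coefX mul0r add0r mul1r.
  case: k => [|k] /=; first by rewrite c0.
  rewrite subSS subn0 expn1 coef_poly; case: ifP => kP; first by rewrite rtP.
  rewrite expr0n (gtn_eqF q_gt0) nth_default //.
  by move: kP; case: (size _) => [|s] //=; rewrite ltnNge ltnS => /negbFE.
have P10 : P1 != 0 by apply: contra_neq P0 => P10; rewrite PE P10 mulr0.
have tau0 : tau != 0 by rewrite -[tau != 0]/('X != 0 :> {poly L}) polyX_eq0.
have [|h [P' [P1E P'0]]] := IHn P1 _ P10.
  move: Pn; rewrite PE size_twM // size_polyX.
  have : (0 < size (pol P1))%N by rewrite size_poly_gt0.
  by move: (size _) => s; clear; lia.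
by exists h.+1, P'; rewrite exprS -mulrA -P1E.
Qed.

(* The kernel of P only sees its separable part. *)
Lemma tau_absorb P : P != 0 -> exists h, forall d,
  (forall x, ev P x = 0 -> ev d x = 0) -> exists c, tau ^+ h * d = c * P.
Proof.
move=> P0; have [h [P' [PE P'0]]] := tau_factor P0; exists h => d Pd.
have [|c dE] := @separable_divides P' d P'0.
  by move=> x P'x; apply: Pd; rewrite PE tw_evalM P'x tw_eval0r.
have [c' cE] := tauX_comm h c.
by exists c'; rewrite dE mulrA cE PE mulrA.
Qed.

Lemma tau_telescope P m u : tau * m - m = u * P -> forall h, exists v,
  tau ^+ h * m - m = v * P.
Proof.
move=> mu; elim=> [|h [v hv]]; first by exists 0; rewrite mul1r subrr mul0r.
exists (tau * v + u); rewrite mulrDl -mulrA -hv -mu mulrBr mulrA -exprS.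
by rewrite addrA subrK.
Qed.

(** Modulo right multiples of P, m agrees with tau^h m, and the latter is itself such a multiple by
    [tau_absorb]. This is what makes the kernel of an inseparable P sufficient for testing
    invariants. *)
Lemma invariant_divides P m u : P != 0 -> tau * m - m = u * P ->
  (forall x, ev P x = 0 -> ev m x = 0) -> exists v, m = v * P.
Proof.
move=> P0 mu mP; have [h hP] := tau_absorb P0; have [c cE] := hP m mP.
have [v vE] := tau_telescope mu h; exists (c - v).
by rewrite mulrBl -cE -vE opprB addrC subrK.
Qed.

Definition Fq_free n (z : 'I_n -> L) := forall u : 'I_n -> Fq,
  \sum_i iL (u i) * z i = 0 -> forall i, u i = 0.

Lemma Fq_free_combinations n (z : 'I_n -> L) : Fq_free z ->
  uniq [seq \sum_i iL (u i) * z i | u : {ffun 'I_n -> Fq}].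
Proof.
move=> zF; rewrite map_inj_uniq ?enum_uniq // => u v uv.
apply/ffunP => i; apply/eqP; rewrite -subr_eq0; apply/eqP.
apply: (zF (fun i => u i - v i)).
under eq_bigr => k _ do rewrite rmorphB mulrBl.
by rewrite sumrB uv subrr.
Qed.

Lemma Fq_free_bound n (z : 'I_n -> L) m : m != 0 -> Fq_free z ->
  (forall i, ev m (z i) = 0) -> (n <= (size (pol m)).-1)%N.
Proof.
move=> m0 zF zm; have := zeros_bound m0 (Fq_free_combinations zF).
rewrite size_map -cardE card_ffun card_ord leq_exp2l //; apply=> x /mapP[u _ ->].
by rewrite ev_combination big1 // => i _; rewrite zm mulr0.
Qed.

Lemma kernel_basis P : P != 0 -> exists n (z : 'I_n -> L),
  [/\ forall i, ev P (z i) = 0, Fq_free z &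
      forall x, ev P x = 0 -> exists u : 'I_n -> Fq, x = \sum_i iL (u i) * z i].
Proof.
move=> P0; pose Q n := `[< exists z : 'I_n -> L, (forall i, ev P (z i) = 0) /\ Fq_free z >].
have Q0 : exists n, Q n by exists 0%N; apply/asboolP; exists (fun=> 0); split=> [[]//|u _ []].
have Qb n : Q n -> (n <= (size (pol P)).-1)%N.
  by move=> /asboolP[z [zP zF]]; apply: Fq_free_bound zP.
case: (ex_maxnP Q0 Qb) => n /asboolP[z [zP zF]] n_max; exists n, z; split=> // x xP.
pose z' (i : 'I_n.+1) := if unlift ord0 i is Some k then z k else x.
have /existsNP[u /not_implyP[ux /existsNP[i ui]]] : ~ Fq_free z'.
  move=> z'F; have /n_max : Q n.+1; last by rewrite ltnn.
  by apply/asboolP; exists z'; split=> // k; rewrite /z'; case: unlift.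
move: ux; rewrite big_ord_recl {1}/z' unlift_none.
under eq_bigr => k _ do rewrite /z' liftK.
have [u0|u0 ux] := eqVneq (u ord0) 0.
  rewrite u0 rmorph0 mul0r add0r => /(zF (fun k => u (lift ord0 k))) uk.
  by case: (unliftP ord0 i) ui => [k|] ->; rewrite ?uk ?u0.
have iu0 : iL (u ord0) != 0 by rewrite fmorph_eq0.
exists (fun k => - (u (lift ord0 k) / u ord0)).
apply: (mulfI iu0); apply/eqP; rewrite -subr_eq0; apply/eqP.
rewrite -[RHS]ux; congr (_ + _); rewrite mulr_sumr -sumrN; apply: eq_bigr => k _.
by rewrite rmorphN fmorph_div mulNr mulrN opprK mulrA [_ * (_ / _)]mulrC divfK.
Qed.

(* Moore's determinant does not vanish. *)
Lemma interpolation n (z : 'I_n -> L) (y : 'I_n -> L) : Fq_free z ->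
  exists m, forall i, ev m (z i) = y i.
Proof.
move=> zF; pose B := \matrix_(k < n, i < n) z i ^+ (q ^ k).
have evB (c : 'rV[L]_n) i : ev (rVpoly c : Lt) (z i) = (c *m B) 0 i.
  rewrite (@tw_evalE _ _ iL _ _ n) ?size_poly // mxE; apply: eq_bigr => k _.
  by rewrite mxE coef_rVpoly_ord.
have Bu : B \in unitmx.
  rewrite -row_free_unit; apply/row_freeP.
  suff : row_free B by move/row_freeP.
  rewrite -kermx_eq0; apply/eqP/row_matrixP => i; rewrite row0.
  set c := row i _; have cB : c *m B = 0 by apply/sub_kermxP/row_sub.
  apply: contrapT => /eqP c0.
  have m0 : (rVpoly c : Lt) != 0.
    by apply: contra_neq c0 => c0; rewrite -[c]rVpolyK c0 raddf0.
  have := Fq_free_bound m0 zF; rewrite leqNgt.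
  have -> : ((size (pol (rVpoly c : Lt))).-1 < n)%N.
    have : (0 < size (pol (rVpoly c : Lt)))%N by rewrite size_poly_gt0.
    have : (size (rVpoly c) <= n)%N by exact: size_poly.
    move: (size _) => s; clear; lia.
  move=> H; have : false; last by []; apply: H => k.
  by rewrite evB cB mxE.
exists (rVpoly (\row_i y i *m invmx B) : Lt) => i.
by rewrite evB mulmxKV // mxE.
Qed.

(** Solving y^q - y = -e(z_i) on a basis of ker P and interpolating gives a c for which e1 = e +
    (tau c - c) vanishes on ker P, so that tau^h e1 is a multiple of P. Adding the sum of the tau^i
    e1 with i < h to c replaces e1 by tau^h e1. *)
Lemma lang_modulo P e : P != 0 -> exists c u, e + (tau * c - c) = u * P.
Proof.
move=> P0; have [n [z [zP zF zS]]] := kernel_basis P0.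
have /choice[y yE] i : exists y, y ^+ q - y = - ev e (z i).
  have [y yE] := solve_monicpoly
    (fun k => if k == 0%N then - ev e (z i) else if k == 1%N then 1 else 0) q_gt0.
  exists y; rewrite yE; case: (q) q_gt1 => [|[|k]] // _.
  rewrite big_ord_recl big_ord_recl /= big1 => [|j _]; last by rewrite mul0r.
  by rewrite expr0 mulr1 expr1 mul1r addr0 addrK.
have [c cE] := interpolation y zF.
pose e1 := e + (tau * c - c).
have [h hP] := tau_absorb P0.
have [|u uE] := hP e1.
  move=> x /zS[v ->]; rewrite ev_combination big1 // => i _.
  by rewrite tw_eval_addl evB tw_evalM ev_tau cE yE subrr mulr0.
pose c2 := \sum_(i < h) tau ^+ i * e1.
have c2E : tau * c2 - c2 = tau ^+ h * e1 - e1.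
  rewrite /c2; elim: (h) => [|k IHk]; first by rewrite big_ord0 mulr0 mul1r !subrr.
  rewrite big_ord_recr /= mulrDr opprD addrACA IHk mulrA -exprS.
  by rewrite addrC addrA subrK.
exists (c + c2), u; rewrite -uE -[RHS](addrNK e1) -c2E /e1.
by rewrite mulrDr opprD (addrACA (tau * c)) [LHS]addrA [RHS]addrC.
Qed.

(** The values 0 and 1 are fixed by Frobenius. So tau m - m vanishes on ker P for the interpolating
    m, and passing to tau^h m keeps the values while making the difference divisible by P. *)
Lemma dual_invariants P n (z : 'I_n -> L) : P != 0 -> Fq_free z ->
  (forall x, ev P x = 0 -> exists u : 'I_n -> Fq, x = \sum_i iL (u i) * z i) ->
  forall i, exists m u, tau * m - m = u * P /\ forall k, ev m (z k) = (k == i)%:R.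
Proof.
move=> P0 zF zS i; have [m mE] := interpolation (fun k => (k == i)%:R) zF.
have bq (b : bool) h : (b%:R : L) ^+ (q ^ h) = b%:R.
  by case: b; rewrite ?expr1n // expr0n (gtn_eqF (qX_gt0 h)).
have [h hP] := tau_absorb P0; have [|u uE] := hP (tau * m - m).
  move=> x /zS[v ->]; rewrite ev_combination big1 // => k _.
  by rewrite evB tw_evalM ev_tau mE -[q]expn1 bq subrr mulr0.
exists (tau ^+ h * m), u; split=> [|k]; last by rewrite tw_evalM mE ev_tauX bq.
by rewrite mulrA -exprS exprSr -mulrA -uE mulrBr.
Qed.

End TwistedClosed.

(** * Functions on F_p and coordinates on the completed motive *)

(* A completed tensor product R (x)^_k L acts on the continuous k-linear functions
   from R to L by (a (x) xi) f = (z |-> xi f(a z)). *)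
Section Action.
Variables (k R L : comPzRingType) (iR : {rmorphism k -> R}) (iL : {rmorphism k -> L}).
Variable U : filtration R.
Local Notation T := (tens_alg iR iL).
Local Notation TU := (tens_fil iR iL U).
Local Notation C := (compl TU).
Local Notation Cin := (compl_in TU).
Implicit Types (f g : R -> L) (x y : T) (b c : C).

Definition admissible f := [/\ {morph f : x y / x + y},
  forall u z, f (iR u * z) = iL u * f z & exists m, forall z, U m z -> f z = 0].

Lemma admissibleD f g : admissible f -> admissible g -> admissible (f + g).
Proof.
move=> [fD fZ [m fm]] [gD gZ [n gn]]; split.
- by move=> y z; rewrite -[LHS]/(f _ + g _) fD gD addrACA.
- by move=> u z; rewrite -[LHS]/(f _ + g _) fZ gZ -mulrDr.
exists (Num.max m n) => z Uz; rewrite -[LHS]/(f _ + g _) fm ?gn ?addr0 //.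
  by apply: fil_S Uz; rewrite le_max lexx orbT.
by apply: fil_S Uz; rewrite le_max lexx.
Qed.

Definition act0 x f (z : R) : L := tens_lift (fun a xi => xi * f (a * z)) x.

Section OneFunction.
Variable f : R -> L.
Hypothesis fA : admissible f.

Lemma act0_balanced z : balanced (fun (u : k) (a : R) => iR u * a)
  (fun (u : k) (xi : L) => iL u * xi) (fun a xi => xi * f (a * z)).
Proof.
have [fD fZ _] := fA; split=> [xi a b|a xi xi'|u a xi].
- by rewrite mulrDl fD mulrDr.
- by rewrite mulrDl.
- by rewrite -mulrA fZ mulrCA mulrA.
Qed.

Lemma act0E a xi z : act0 (ten a xi) f z = xi * f (a * z).
Proof. exact: (tens_liftE (act0_balanced z)). Qed.

Lemma act0D z : {morph (fun x => act0 x f z) : x y / x + y}.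
Proof. exact: (tens_liftD (act0_balanced z)). Qed.

Lemma act00 z : act0 0 f z = 0.
Proof. exact: (tens_lift0 (act0_balanced z)). Qed.

Lemma act0B x y z : act0 (x - y) f z = act0 x f z - act0 y f z.
Proof. by apply: (@addIr _ (act0 y f z)); rewrite -act0D !subrK. Qed.

Lemma act0_sum (s : seq (R * L)) z :
  act0 (\sum_(p <- s) ten p.1 p.2) f z = \sum_(p <- s) p.2 * f (p.1 * z).
Proof.
rewrite (big_morph (fun x => act0 x f z) (act0D z) (act00 z)).
by apply: eq_bigr => p _; rewrite act0E.
Qed.

Definition killed (n : int) (z : R) := forall w, U n w -> f (w * z) = 0.

Lemma killed_ex z : exists n, killed n z.
Proof.
have [_ _ [m fm]] := fA; have [l Uz] := fil_ex U z.
by exists (m - l) => w Uw; apply: fm; rewrite -[m](subrK l); apply: fil_M.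
Qed.

Lemma killed_le n m z : n <= m -> killed n z -> killed m z.
Proof. by move=> nm kn w Uw; apply: kn; apply: fil_S Uw. Qed.

Lemma killed_common (s : seq R) : exists n, forall z, z \in s -> killed n z.
Proof.
elim: s => [|z s [n sn]]; first by exists 0.
have [m zm] := killed_ex z; exists (Num.max m n) => w; rewrite inE => /orP[/eqP->|/sn].
  by apply: killed_le zm; rewrite le_max lexx.
by apply: killed_le; rewrite le_max lexx orbT.
Qed.

Lemma act0_fil n x z : TU n x -> killed n z -> act0 x f z = 0.
Proof.
move=> [s sU ->] kz; rewrite act0_sum big_seq big1 // => p ps.
by rewrite kz ?mulr0 //; apply: sU.
Qed.

End OneFunction.

Definition approximates b f z x := exists n, killed f n z /\ in_cfil n (b - Cin x).

(** The value at z is that of any approximation of b so fine that f does not see the error at z; no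
    limit in L is taken. The default 0 never occurs for admissible f, by [approx_ex]. *)
Definition act b f z : L :=
  if pselect (exists x, approximates b f z x) is left e then act0 (sval (cid e)) f z else 0.

Lemma approx_ex b f z : admissible f -> exists x, approximates b f z x.
Proof.
move=> fA; have [n kz] := killed_ex fA z; have [x bx] := compl_approx b n.
by exists x, n.
Qed.

Lemma actE b f z x : admissible f -> approximates b f z x -> act b f z = act0 x f z.
Proof.
move=> fA [n [kn bx]]; rewrite /act; case: pselect => [e|]; last first.
  by case; apply: approx_ex.
case: cid => y [m [km b_y]] /=.
have key n1 n2 x1 x2 : n1 <= n2 -> killed f n1 z -> in_cfil n1 (b - Cin x1) ->
    in_cfil n2 (b - Cin x2) -> act0 x1 f z = act0 x2 f z.
  move=> le_n k1 b1 b2; apply/eqP; rewrite -subr_eq0 -act0B //; apply/eqP.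
  apply: (act0_fil fA _ k1); apply: compl_in_fil.
  have -> : Cin (x1 - x2) = (b - Cin x2) - (b - Cin x1).
    by rewrite rmorphB opprB [RHS]addrC addrA subrK.
  by apply: cfil_B => //; apply: cfil_S b2.
by case: (leP n m) => [|/ltW] mn; [symmetry|]; apply: key mn _ _ _.
Qed.

Lemma act_in x f z : admissible f -> act (Cin x) f z = act0 x f z.
Proof.
move=> fA; apply: actE => //; have [n kn] := killed_ex fA z.
by exists n; split=> //; rewrite subrr; apply: cfil_0.
Qed.

Lemma act1 f z : admissible f -> act 1 f z = f z.
Proof.
move=> fA; have <- : Cin 1 = 1 by apply: rmorph1.
by rewrite act_in // -[1]/(ten 1 1) act0E // !mul1r.
Qed.

Lemma actDl b c f z : admissible f -> act (b + c) f z = act b f z + act c f z.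
Proof.
move=> fA; have [n kn] := killed_ex fA z.
have [[x bx] [y cy]] := (compl_approx b n, compl_approx c n).
rewrite (actE (b := b) fA (x := x)); last by exists n.
rewrite (actE (b := c) fA (x := y)); last by exists n.
rewrite (actE (b := b + c) fA (x := x + y)) ?act0D //; exists n; split=> //.
by rewrite rmorphD opprD addrACA; apply: (@fil_D _ (cfil TU)).
Qed.

Lemma actDr b f g z : admissible f -> admissible g ->
  act b (f + g) z = act b f z + act b g z.
Proof.
move=> fA gA; have fgA := admissibleD fA gA.
have [[n fn] [m gm]] := (killed_ex fA z, killed_ex gA z).
pose N := Num.max n m.
have {}fn : killed f N z by apply: killed_le fn; rewrite le_max lexx.
have {}gm : killed g N z by apply: killed_le gm; rewrite le_max lexx orbT.
have [x bx] := compl_approx b N.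
rewrite (actE (f := f) fA (x := x)); last by exists N.
rewrite (actE (f := g) gA (x := x)); last by exists N.
rewrite (actE (f := f + g) fgA (x := x)); last first.
  by exists N; split=> // w Uw; rewrite -[LHS]/(f _ + g _) fn // gm // addr0.
have [s ->] := ten_sum x; rewrite !act0_sum // -big_split; apply: eq_bigr => p _.
exact: mulrDr.
Qed.

Lemma act_cfil b f z n : admissible f -> in_cfil n b -> killed f n z -> act b f z = 0.
Proof.
move=> fA bn kn; rewrite (actE fA (x := 0)) ?act00 //; exists n; split=> //.
by rewrite rmorph0 subr0.
Qed.

Lemma act_additive b f : admissible f -> {morph act b f : y z / y + z}.
Proof.
move=> fA y z; have [n kn] := killed_common fA [:: y; z; y + z].
have {}kn w : w \in [:: y; z; y + z] -> killed f n w by apply: kn.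
have [x bx] := compl_approx b n.
have E w : w \in [:: y; z; y + z] -> act b f w = act0 x f w.
  by move=> /kn kw; apply: actE => //; exists n.
rewrite !E ?inE ?eqxx ?orbT //; have [s ->] := ten_sum x.
rewrite !act0_sum // -big_split; apply: eq_bigr => p _.
by have [fD _ _] := fA; rewrite mulrDr fD mulrDr.
Qed.

Lemma admissible_act b f : admissible f -> admissible (act b f).
Proof.
move=> fA; have [fD fZ [m fm]] := fA; split; first exact: act_additive.
  move=> u z; have [n kn] := killed_common fA [:: z; iR u * z].
  have [x bx] := compl_approx b n.
  have E w : w \in [:: z; iR u * z] -> act b f w = act0 x f w.
    by move=> /kn kw; apply: actE => //; exists n.
  rewrite !E ?inE ?eqxx ?orbT //; have [s ->] := ten_sum x.
  rewrite !act0_sum // mulr_sumr; apply: eq_bigr => p _.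
  by rewrite mulrCA fZ mulrCA.
have [n bn] := cfil_ex b; exists (m - n) => z Uz; apply: (act_cfil fA bn).
by move=> w Uw; apply: fm; rewrite -[m](subrK n) addrC; apply: fil_M.
Qed.

(** The precisions are chosen one after the other: first x for b, with respect to both f and
    [act c f]; then y for c, at all the points p.1 z that the finitely many terms of x produce. *)
Lemma actM b c f z : admissible f -> act (b * c) f z = act b (act c f) z.
Proof.
move=> fA; have cfA := admissible_act c fA.
have [n kn] := killed_ex fA z; have [n' kn'] := killed_ex cfA z.
have [l cl] := cfil_ex c; pose N := Num.max (n - l) n'.
have [x bx] := compl_approx b N.
have [s xE] := ten_sum x; have [l' xl] := fil_ex TU x.
have [n'' kn''] := killed_common fA [seq p.1 * z | p <- s].
pose M := Num.max (n - l') n''; have [y cy] := compl_approx c M.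
rewrite (actE (b := b) cfA (x := x)); last first.
  by exists N; split=> //; apply: killed_le kn'; rewrite le_max lexx orbT.
rewrite (actE (b := b * c) fA (x := x * y)); last first.
  exists n; split=> //; rewrite rmorphM.
  rewrite -(subrKA (Cin x * c)) -mulrBl -mulrBr; apply: (@fil_D _ (cfil TU)).
    rewrite -[n](subrK l); apply: cfil_M => //; apply: cfil_S bx.
    by rewrite le_max lexx.
  rewrite -[n](subrK l') addrC; apply: cfil_M; first exact: fil_compl_in.
  by apply: cfil_S cy; rewrite le_max lexx.
have [t yE] := ten_sum y.
rewrite xE act0_sum // mulr_suml (big_morph (fun x => act0 x f z) (act0D fA z) (act00 fA z)).
rewrite !big_seq; apply: eq_bigr => p ps.
rewrite (actE fA (x := y)); last first.
  exists M; split=> //; apply: (killed_le _ (kn'' _ _)); first by rewrite le_max lexx orbT.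
  by apply/mapP; exists p.
rewrite yE mulr_sumr (big_morph (fun x => act0 x f z) (act0D fA z) (act00 fA z)).
rewrite act0_sum // mulr_sumr; apply: eq_bigr => r _.
by rewrite tenM act0E // -(mulrA p.2) [p.1 * r.1]mulrC -(mulrA r.1).
Qed.

Lemma act_in_ten a xi f z : admissible f -> act (Cin (ten a xi)) f z = xi * f (a * z).
Proof. by move=> fA; rewrite act_in // act0E. Qed.

End Action.

Section ActionMap.
Variables (k R L L' : comPzRingType) (iR : {rmorphism k -> R}).
Variables (iL : {rmorphism k -> L}) (iL' : {rmorphism k -> L'}) (g : {rmorphism L -> L'}).
Hypothesis gk : g \o iL =1 iL'.
Variable U : filtration R.
Local Notation T := (tens_alg iR iL).
Local Notation TU := (tens_fil iR iL U).
Local Notation TU' := (tens_fil iR iL' U).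
Variable (G : {rmorphism T -> tens_alg iR iL'}).
Hypotheses (GE : forall a xi, G (ten a xi) = ten a (g xi))
  (GU : forall n x, TU n x -> TU' n (G x)).

Lemma admissible_map f : admissible iR iL U f -> admissible iR iL' U (g \o f).
Proof.
move=> [fD fZ [m fm]]; split=> [y z|u z|] /=; first by rewrite fD rmorphD.
  by rewrite fZ rmorphM; congr (_ * _); apply: gk.
by exists m => z /fm fz; rewrite /= fz rmorph0.
Qed.

Lemma act_map f (b : compl TU) z : admissible iR iL U f ->
  act (compl_map GU b) (g \o f) z = g (act b f z).
Proof.
move=> fA; have gfA := admissible_map fA; have [n kn] := killed_ex fA z.
have [x bx] := compl_approx b n.
rewrite (actE fA (x := x)); last by exists n.
rewrite (actE gfA (x := G x)); last first.
  exists n; split; first by move=> w /kn fw; rewrite /= fw rmorph0.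
  rewrite -(compl_map_in GU) -rmorphB; have [u -> [N uN]] := bx.
  by rewrite /= compl_mapE; exists (cauchy_map GU u) => //; exists N => i /uN /GU.
have [s ->] := ten_sum x; rewrite (act0_sum fA) [G _]rmorph_sum rmorph_sum.
rewrite (big_morph (fun x => act0 x (g \o f) z) (act0D gfA z) (act00 gfA z)).
by apply: eq_bigr => p _; rewrite GE (act0E gfA) rmorphM.
Qed.

End ActionMap.

(** * Maps out of the twofold base change of a module *)

Section DoubleLift.
Variables (A B C : comPzRingType) (i : {rmorphism A -> B}) (i' : {rmorphism B -> C}).
Variables (M : lmodType A) (W : zmodType) (adm : W -> Prop) (act : C -> W -> W).
Hypotheses (adm0 : adm 0) (admD : forall v w, adm v -> adm w -> adm (v + w))
  (admA : forall c w, adm w -> adm (act c w))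
  (actDl : forall c c' w, adm w -> act (c + c') w = act c w + act c' w)
  (actDr : forall c v w, adm v -> adm w -> act c (v + w) = act c v + act c w)
  (actM : forall c c' w, adm w -> act (c * c') w = act c (act c' w)).
Variable G : M -> W.
Hypotheses (GD : {morph G : m n / m + n}) (Gadm : forall m, adm (G m))
  (Gact : forall x m, G (x *: m) = act (i' (i x)) (G m)).

Local Notation MF := (tens_mod i B^o M).
Local Notation MFb := (tens_mod i' C^o MF).

(** W is only an abelian group on which C operates, with the laws of a module valid on [adm]; this
    is why admissibility is carried through every law below. *)
Definition lift1 : MF -> W := tens_lift (fun b m => act (i' b) (G m)).

Lemma lift1_balanced : balanced (fun (x : A) (b : B^o) => i x *: b)
  (fun (x : A) (m : M) => x *: m) (fun b m => act (i' b) (G m)).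
Proof.
split=> [m b b'|b m m'|x b m]; first by rewrite rmorphD actDl.
  by rewrite GD actDr.
by rewrite -[_ *: b]/(i x * b) mulrC rmorphM actM // Gact.
Qed.

Lemma lift1E b m : lift1 (mten b m) = act (i' b) (G m).
Proof. exact: (tens_liftE lift1_balanced). Qed.

Lemma lift1D : {morph lift1 : x y / x + y}.
Proof. exact: (tens_liftD lift1_balanced). Qed.

Lemma lift10 : lift1 0 = 0.
Proof. exact: (tens_lift0 lift1_balanced). Qed.

Lemma lift1_adm y : adm (lift1 y).
Proof.
elim/tens_ind: y => [|x y xa ya|b m].
- by rewrite lift10.
- by rewrite lift1D; apply: admD.
- by rewrite -/(mten b m) lift1E; apply: admA.
Qed.

Lemma lift1Z b y : lift1 (b *: y) = act (i' b) (lift1 y).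
Proof.
elim/tens_ind: y => [|x y xb yb|c m].
- rewrite scaler0 lift10.
  by apply: (@addrI _ (act (i' b) 0)); rewrite -actDr // !addr0.
- by rewrite scalerDr !lift1D xb yb actDr //; apply: lift1_adm.
- by rewrite -/(mten c m) mtenZ !lift1E -actM // -rmorphM.
Qed.

Definition lift2 : MFb -> W := tens_lift (fun c y => act c (lift1 y)).

Lemma lift2_balanced : balanced (fun (b : B) (c : C^o) => i' b *: c)
  (fun (b : B) (y : MF) => b *: y) (fun c y => act c (lift1 y)).
Proof.
split=> [y c c'|c y y'|b c y]; first by rewrite actDl //; apply: lift1_adm.
  by rewrite lift1D actDr //; apply: lift1_adm.
rewrite -[_ *: c]/(i' b * c) mulrC actM ?lift1Z //; exact: lift1_adm.
Qed.

Lemma lift2E c y : lift2 (mten c y) = act c (lift1 y).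
Proof. exact: (tens_liftE lift2_balanced). Qed.

Lemma lift2D : {morph lift2 : x y / x + y}.
Proof. exact: (tens_liftD lift2_balanced). Qed.

Lemma lift20 : lift2 0 = 0.
Proof. exact: (tens_lift0 lift2_balanced). Qed.

Lemma lift2_adm y : adm (lift2 y).
Proof.
elim/tens_ind: y => [|x y xa ya|c y]; first by rewrite lift20.
  by rewrite lift2D; apply: admD.
by rewrite -/(mten c y) lift2E; apply/admA/lift1_adm.
Qed.

Lemma lift2Z c y : lift2 (c *: y) = act c (lift2 y).
Proof.
elim/tens_ind: y => [|x y xb yb|c' y].
- rewrite scaler0 lift20.
  by apply: (@addrI _ (act c 0)); rewrite -actDr // !addr0.
- by rewrite scalerDr !lift2D xb yb actDr //; apply: lift2_adm.
- by rewrite -/(mten c' y) mtenZ !lift2E -actM //; apply: lift1_adm.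
Qed.

Lemma double_ind (P : MFb -> Prop) : P 0 -> (forall x y, P x -> P y -> P (x + y)) ->
  (forall c m, P (mten (c : C^o) (mten (1 : B^o) m : MF))) -> forall y, P y.
Proof.
move=> P0 PD Pm; suff Pmten (c : C^o) (y : MF) : P (mten c y).
  by apply: tens_ind => // c y; apply: Pmten.
elim/tens_ind: y => [|x y Px Py|b m].
- suff -> : mten c 0 = 0 :> MFb by [].
  by apply: (@addrI _ (mten c 0)); rewrite -mtenDr !addr0.
- by have := PD _ _ Px Py; rewrite -mtenDr.
have -> : tmk _ _ b m = (b : B) *: (mten (1 : B^o) m : MF).
  by rewrite mtenZ -[_ *: _]/(b * 1) mulr1.
by rewrite -mten_bal; apply: Pm.
Qed.

End DoubleLift.

Section TauPowers.
Variables (Fq : finFieldType) (K : fieldType) (iK : {rmorphism Fq -> K}).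
Local Notation pol m := (m%R : {poly K}).
Implicit Types m : twisted iK.

Lemma tauXE i : (Defs.tau iK ^+ i : {poly K}) = 'X^i.
Proof.
elim: i => [|i IHi]; first by rewrite !expr0.
have tE : Defs.tau iK = (1 *: 'X^1 : {poly K}) by rewrite scale1r expr1.
rewrite exprS -[LHS]/(tw_mul (Defs.tau iK) (Defs.tau iK ^+ i)) IHi tE tw_mul_monom.
by rewrite -['X^i]scale1r (tw_shift_monom iK) expr1n !scale1r add1n.
Qed.

Lemma tw_decomposition n m : (size (pol m) <= n)%N ->
  m = \sum_(i < n) tw_const iK (pol m)`_i * Defs.tau iK ^+ i.
Proof.
move=> mn; apply/polyP => k.
have -> : (pol (\sum_(i < n) tw_const iK (pol m)`_i * Defs.tau iK ^+ i))`_k =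
    \sum_(i < n) (pol m)`_i * (i == k :> nat)%:R.
  have cD : {morph (fun d : twisted iK => (pol d)`_k) : d d' / d + d'} by move=> d d'; apply: coefD.
  by rewrite [LHS](additive_sum cD); apply: eq_bigr => i _; rewrite tw_constE tauXE coefZ coefXn eq_sym.
have [kn|nk] := ltnP k n.
  rewrite (bigD1 (Ordinal kn)) //= eqxx mulr1 big1 ?addr0 // => i ik.
  by case: eqP => [E|_]; [case/eqP: ik; apply: val_inj | rewrite mulr0].
rewrite nth_default ?(leq_trans mn) // big1 // => i _.
by rewrite ltn_eqF ?mulr0 // (leq_trans (ltn_ord i)).
Qed.

Lemma size_tw_leq n (f : 'I_n -> K) :
  (size (pol (\sum_(i < n) tw_const iK (f i) * Defs.tau iK ^+ i)) <= n)%N.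
Proof.
apply: (big_ind (fun d : twisted iK => size (pol d) <= n)%N) => [|x y xn yn|i _].
- by rewrite size_poly0.
- by apply: leq_trans (size_polyD _ _) _; rewrite geq_max xn yn.
rewrite tw_constE tauXE; apply: leq_trans (size_scale_leq _ _) _.
by rewrite size_polyXn.
Qed.

Lemma tw_ind (P : twisted iK -> Prop) : P 0 -> (forall m d, P m -> P d -> P (m + d)) ->
  (forall c i, P (tw_const iK c * Defs.tau iK ^+ i)) -> forall m, P m.
Proof.
move=> P0 PD Pm m; rewrite [m](tw_decomposition (leqnn (size (pol m)))).
by apply: (big_ind P) => // i _; apply: Pm.
Qed.

End TauPowers.

(* A module Y over C generated by symbols [c, m], with m in K[tau]: the base change
   of the motive of phi, where E is the structural map of R (x) L to C. *)
Section Coordinates.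
Variables (Fq : finFieldType) (K L : fieldType) (iK : {rmorphism Fq -> K}).
Variable j : {rmorphism K -> L}.
Local Notation iL := (j \o iK : {rmorphism Fq -> L}).
Local Notation Kt := (twisted iK).
Local Notation Lt := (twisted iL).
Local Notation tauK := (Defs.tau iK).
Local Notation pol m := (m%R : {poly _}).
Variables (A R C : comPzRingType) (rF : {rmorphism A -> R}) (phi : {rmorphism A -> Kt}).
Variables (Y : lmodType C) (E : R -> L -> C) (br : C -> Kt -> Y).
Hypotheses (EDr : forall b, {morph E b : x y / x + y})
  (EM : forall b b' x x', E b x * E b' x' = E (b * b') (x * x')) (E1 : E 1 1 = 1).
Hypotheses (brDl : forall m, {morph br^~ m : b c / b + c})
  (brDr : forall c, {morph br c : m d / m + d})
  (brZ : forall (b c : C) (m : Kt), b *: br c m = br (b * c) m)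
  (brB : forall c x m b, br c (tw_const iK x * m * phi b) = br (E (rF b) (j x) * c) m).

Lemma br_const c x m : br c (tw_const iK x * m) = br (E 1 (j x) * c) m.
Proof. by have := brB c x m 1; rewrite !rmorph1 mulr1. Qed.

Lemma br_phi c m b : br c (m * phi b) = br (E (rF b) 1 * c) m.
Proof. by have := brB c 1 m b; rewrite !rmorph1 mul1r. Qed.

(** The natural map from Kbar[tau] = Kbar (x)_K K[tau] to the base change. It goes through the
    coefficients because [br] only accepts polynomials over K. *)
Definition kappa (m : Lt) : Y :=
  \sum_(i < size (m : {poly L})) br (E 1 (m : {poly L})`_i) (tauK ^+ i).

Lemma E0 b : E b 0 = 0. Proof. exact: additive_zero. Qed.

Lemma br0l m : br 0 m = 0.
Proof. by apply: (@additive_zero _ _ (br^~ m)) => b c; apply: brDl. Qed.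

Lemma br0r c : br c 0 = 0. Proof. exact: (additive_zero (brDr c)). Qed.

Lemma kappaE n m : (size (m : {poly L}) <= n)%N ->
  kappa m = \sum_(i < n) br (E 1 (m : {poly L})`_i) (tauK ^+ i).
Proof.
move=> mn; rewrite /kappa.
rewrite (big_ord_widen n (fun i => br (E 1 (m : {poly L})`_i) (tauK ^+ i)) mn).
rewrite big_mkcond /=; apply: eq_bigr => i _; case: ifPn => //.
by rewrite -leqNgt => /leq_sizeP->; rewrite ?E0 ?br0l.
Qed.

Lemma kappaD : {morph kappa : m d / m + d}.
Proof.
move=> m d; set n := maxn (size (m : {poly L})) (size (d : {poly L})).
rewrite !(@kappaE n) ?leq_maxl ?leq_maxr ?size_polyD //.
rewrite -big_split /=; apply: eq_bigr => i _.
by rewrite tw_coefD EDr brDl.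
Qed.

Lemma kappa_monom x i : kappa (tw_const iL x * Defs.tau iL ^+ i) = br (E 1 x) (tauK ^+ i).
Proof.
rewrite tw_constE tauXE (@kappaE i.+1); last first.
  by apply: leq_trans (size_scale_leq _ _) _; rewrite size_polyXn.
rewrite big_ord_recr /= coefZ coefXn eqxx mulr1 big1 ?add0r // => k _.
by rewrite coefZ coefXn ltn_eqF // mulr0 E0 br0l.
Qed.

Lemma kappa_const x m : kappa (tw_const iL x * m) = E 1 x *: kappa m.
Proof.
elim/tw_ind: m => [|m d IHm IHd|y i].
- by rewrite mulr0 (additive_zero kappaD) scaler0.
- by rewrite mulrDr !kappaD IHm IHd scalerDr.
by rewrite mulrA -rmorphM !kappa_monom brZ EM mulr1.
Qed.

Lemma kappa_map m : kappa (tw_map j m) = br 1 m.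
Proof.
elim/tw_ind: m => [|m d IHm IHd|y i].
- by rewrite rmorph0 (additive_zero kappaD) br0r.
- by rewrite rmorphD kappaD IHm IHd brDr.
rewrite rmorphM rmorphXn /= tw_map_const tw_map_tau kappa_monom.
by rewrite br_const mulr1.
Qed.

Lemma kappa_phi m b : kappa (m * tw_map j (phi b)) = E (rF b) 1 *: kappa m.
Proof.
elim/tw_ind: m => [|m d IHm IHd|y i].
- by rewrite mul0r (additive_zero kappaD) scaler0.
- by rewrite mulrDl !kappaD IHm IHd scalerDr.
rewrite kappa_monom brZ -tw_map_tau -rmorphXn /= -mulrA -rmorphM kappa_const.
by rewrite kappa_map (brZ (E 1 y)) mulr1 br_phi mulrC.
Qed.

Lemma kappa_tau (sigma : C -> C) (tauY : Y -> Y) : {morph tauY : x y / x + y} ->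
  (forall c m, tauY (br c m) = br (sigma c) (tauK * m)) ->
  (forall x, sigma (E 1 x) = E 1 (frob iL x)) ->
  forall m, kappa (Defs.tau iL * m) = tauY (kappa m).
Proof.
move=> tauD tauE sE m; elim/tw_ind: m => [|m d IHm IHd|y i].
- by rewrite mulr0 (additive_zero kappaD) (additive_zero tauD).
- by rewrite mulrDr !kappaD IHm IHd tauD.
by rewrite mulrA tau_const -mulrA -exprS !kappa_monom tauE sE -exprS.
Qed.

Variables (a : A) (D : nat).
Hypotheses (aD : size (phi a : {poly K}) = D.+1) (D0 : (0 < D)%N).
Local Notation P := (tw_map j (phi a)).

(** D is the degree of P, so that division by P brings every power of tau into the combinations of
    the first D. The coefficients [b i] need not be unique, as these D powers may be dependent over
    C. *)
Definition lattice (S : C -> Prop) (y : Y) := exists2 b : 'I_D -> C,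
  forall i, S (b i) & y = \sum_i br (b i) (tauK ^+ i).

Section Lattice.
Variable S : C -> Prop.
Hypotheses (SD : forall b c, S b -> S c -> S (b + c)) (S0 : S 0).

Lemma lattice0 : lattice S 0.
Proof. by exists (fun=> 0) => //; rewrite big1 // => i _; rewrite br0l. Qed.

Lemma latticeD y z : lattice S y -> lattice S z -> lattice S (y + z).
Proof.
move=> [b bS ->] [c cS ->]; exists (fun i => b i + c i) => [i|]; first exact: SD.
by rewrite -big_split; apply: eq_bigr => i _; rewrite brDl.
Qed.

Lemma latticeZ (T : C -> Prop) c y : (forall b, S b -> T (c * b)) ->
  lattice S y -> lattice T (c *: y).
Proof.
move=> cS [b bS ->]; exists (fun i => c * b i) => [i|]; first exact/cS/bS.
by rewrite scaler_sumr; apply: eq_bigr => i _; rewrite brZ.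
Qed.

Hypotheses (SE : forall b x, S b -> S (E 1 x * b)) (Sa : forall b, S b -> S (E (rF a) 1 * b)).

Lemma lattice_small c m : S c -> (size (m : {poly K}) <= D)%N -> lattice S (br c m).
Proof.
move=> cS mD; exists (fun i => E 1 (j (m : {poly K})`_i) * c) => [i|]; first exact: SE.
rewrite {1}(tw_decomposition mD) (big_morph (br c) (brDr c) (br0r c)).
by apply: eq_bigr => i _; rewrite br_const.
Qed.

(** Division by P trades degree for a factor a: m = Q P + R gives [c, m] = [a c, Q] + [c, R] with Q
    shorter than m. *)
Lemma lattice_br c m : S c -> lattice S (br c m).
Proof.
have [n] := ubnP (size (m : {poly K})); elim: n m c => // n IHn m c mn cS.
have [mD|Dm] := leqP (size (m : {poly K})) D; first exact: lattice_small.
have P0 : phi a != 0 by rewrite -[_ != 0]/((phi a : {poly K}) != 0) -size_poly_gt0 aD.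
have [[Q R'] /= mE sR] := tw_division m P0; rewrite mE brDr.
apply: latticeD; last by apply: lattice_small => //; move: sR; rewrite aD ltnS.
rewrite br_phi; apply: IHn; last exact: Sa.
case: (eqVneq Q 0) => [->|Q0]; first by rewrite size_poly0; case: (n) mn Dm => //; lia.
have sQ : size (Q * phi a : {poly K}) = (size (Q : {poly K}) + D)%N.
  by rewrite size_twM // aD addnS.
have : (size (pol (Q * phi a)) <= size (m : {poly K}))%N.
  have -> : Q * phi a = m - R' by rewrite mE addrK.
  apply: leq_trans (size_polyD _ _) _; rewrite size_polyN geq_max leqnn /=.
  by apply: leq_trans (ltnW Dm); move: sR; rewrite aD ltnS.
by rewrite sQ; move: mn D0; clear; move: (size _) (size _) => s t; lia.
Qed.

End Lattice.

Lemma lattice_sub (S T : C -> Prop) y : (forall c, S c -> T c) -> lattice S y -> lattice T y.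
Proof. by move=> ST [b bS ->]; exists b => // i; apply: ST. Qed.

Lemma base_P_digits n (f : nat -> Lt) v : (forall k, (size (f k : {poly L}) <= D)%N) ->
  \sum_(k < n) f k * P ^+ k = v * P ^+ n -> forall k, (k < n)%N -> f k = 0.
Proof.
elim: n f v => // n IHn f v fD; rewrite big_ord_recl expr0 mulr1 addrC.
have -> : \sum_(i < n) f (lift ord0 i) * P ^+ lift ord0 i =
    (\sum_(i < n) f i.+1 * P ^+ i) * P.
  by rewrite mulr_suml; apply: eq_bigr => i _; rewrite -mulrA -exprSr.
rewrite exprSr mulrA -[RHS]addr0 => /tw_division_unique[].
- by rewrite size_tw_map aD ltnS.
- by rewrite size_tw_map aD size_poly0.
move=> fE f0 [|k] // kn; exact: (IHn (fun k => f k.+1) v).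
Qed.

End Coordinates.

(** * Density, completeness and separatedness of the lattice *)

Section FilteredLattice.
Variables (Fq : finFieldType) (K L : fieldType) (iK : {rmorphism Fq -> K}).
Variable j : {rmorphism K -> L}.
Local Notation iL := (j \o iK : {rmorphism Fq -> L}).
Local Notation Kt := (twisted iK).
Local Notation Lt := (twisted iL).
Local Notation tauK := (Defs.tau iK).
Local Notation pol m := (m%R : {poly _}).
Variables (A R C : comPzRingType) (rc : Fq -> A) (rF : {rmorphism A -> R}).
Variables (phi : {rmorphism A -> Kt}) (Y : lmodType C) (E : R -> L -> C) (br : C -> Kt -> Y).
Hypotheses (EDl : forall x, {morph E^~ x : b c / b + c}) (EDr : forall b, {morph E b : x y / x + y})
  (EM : forall b b' x x', E b x * E b' x' = E (b * b') (x * x')) (E1 : E 1 1 = 1)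
  (EZ : forall u b x, E (rF (rc u * b)) x = E (rF b) (iL u * x)).
Hypotheses (brDl : forall m, {morph br^~ m : b c / b + c})
  (brDr : forall c, {morph br c : m d / m + d})
  (brZ : forall (b c : C) (m : Kt), b *: br c m = br (b * c) m)
  (brB : forall c x m b, br c (tw_const iK x * m * phi b) = br (E (rF b) (j x) * c) m).
Variables (a : A) (aV : R) (D h d : nat) (e : 'I_d -> A).
Hypotheses (aVK : rF a * aV = 1) (aD : size (phi a : {poly K}) = D.+1) (D0 : (0 < D)%N).
Hypothesis eS : forall b, exists (u : 'I_d -> Fq) y, b = \sum_i rc (u i) * e i + y * a.
Variable U : filtration C.
Local Notation U_ n := (U (h * n)%N%:Z).
Hypotheses (UE : forall b x, U 0 (E (rF b) x)) (Ua : U h%:Z (E (rF a) 1))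
  (UaV : U (- h%:Z) (E aV 1)).
Hypotheses (Uapp : forall c n, U 0 c -> exists s : seq (A * L),
    U_ n (c - \sum_(t <- s) E (rF t.1) t.2))
  (Ulim : forall beta : nat -> L, exists c, forall n,
    U_ n (c - \sum_(k < n) E (rF a ^+ k) (beta k)))
  (Usep : forall c, (forall n, U_ n c) -> c = 0).
Local Notation P := (tw_map j (phi a)).
Local Notation kappa := (@kappa _ _ _ _ j _ _ _ E br).
Local Notation alpha := (E (rF a) 1).

Definition level n := lattice br D (U_ n).

Lemma E_X b n : E b 1 ^+ n = E (b ^+ n) 1.
Proof. by elim: n => [|n IHn]; rewrite ?E1 // !exprS IHn EM mulr1. Qed.

Lemma U_mul0 n c x : U 0 c -> U n x -> U n (c * x).
Proof. by move=> c0 xn; rewrite -[n]add0r; apply: fil_M. Qed.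

Lemma UE1 x : U 0 (E 1 x).
Proof. by rewrite -(rmorph1 rF). Qed.

Lemma U_alpha n k c : U_ n c -> U_ (k + n) (alpha ^+ k * c).
Proof.
move=> cn; rewrite mulnDr PoszD; apply: fil_M => //; elim: k => [|k IHk].
  by rewrite muln0; apply: fil_1.
by rewrite exprS mulnS PoszD; apply: fil_M.
Qed.

Lemma U_alphaV n k c : U_ (k + n) c -> U_ n (E aV 1 ^+ k * c).
Proof.
move=> cn; have -> : (h * n)%N%:Z = - (h * k)%N%:Z + (h * (k + n))%N%:Z.
  by rewrite mulnDr PoszD addKr.
apply: fil_M => //; elim: {cn} k => [|k IHk]; first by rewrite muln0; apply: fil_1.
by rewrite exprS mulnS PoszD opprD; apply: fil_M.
Qed.

Lemma level0 n : level n 0. Proof. by apply: lattice0 => //; apply: fil_0. Qed.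

Lemma levelD n y z : level n y -> level n z -> level n (y + z).
Proof. by apply: latticeD => // b c; apply: fil_D. Qed.

Lemma levelN n y : level n y -> level n (- y).
Proof.
by rewrite -scaleN1r; apply: latticeZ => // b bn; rewrite mulN1r; apply: fil_N.
Qed.

Lemma levelB n y z : level n y -> level n z -> level n (y - z).
Proof. by move=> yn zn; apply: levelD => //; apply: levelN. Qed.

Lemma level_sum n (I : Type) (s : seq I) (Q : pred I) (f : I -> Y) :
  (forall i, Q i -> level n (f i)) -> level n (\sum_(i <- s | Q i) f i).
Proof.
by move=> fn; apply: big_ind => //; [apply: level0 | apply: levelD].
Qed.

Lemma level_le m n y : (m <= n)%N -> level n y -> level m y.
Proof.
move=> mn; apply: lattice_sub => c; apply: fil_S.
by rewrite lez_nat leq_mul2l mn orbT.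
Qed.

Lemma levelZ n c y : U 0 c -> level n y -> level n (c *: y).
Proof. by move=> c0; apply: latticeZ => // b; apply: U_mul0. Qed.

Lemma level_alpha n k y : level n y -> level (k + n) (alpha ^+ k *: y).
Proof. by apply: latticeZ => // b; apply: U_alpha. Qed.

Lemma level_alphaV n k y : level (k + n) y -> level n (E aV 1 ^+ k *: y).
Proof. by apply: latticeZ => // b; apply: U_alphaV. Qed.

Lemma level_br n c m : U_ n c -> level n (br c m).
Proof.
apply: (lattice_br brDl brDr brB aD D0) => [b b'|b x|b].
- exact: fil_D.
- exact/U_mul0/UE1.
- exact/U_mul0/UE.
Qed.

Lemma level_kappa m : level 0 (kappa m).
Proof. by apply: level_sum => i _; apply: level_br; rewrite muln0; apply: UE1. Qed.

Lemma kappa_phiX m n : kappa (m * P ^+ n) = alpha ^+ n *: kappa m.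
Proof.
elim: n m => [|n IHn] m; first by rewrite !expr0 mulr1 scale1r.
by rewrite exprSr mulrA (kappa_phi EDr EM brDl brDr brZ brB) IHn scalerA -exprS.
Qed.

(** Coefficients are approximated by finite sums of b (x) x with b in A, and such a b can be
    absorbed into Kbar[tau] as right multiplication by phi_b. *)
Lemma level_approx n y : level 0 y -> exists m, level n (y - kappa m).
Proof.
rewrite /level muln0 => -[b b0 ->]; have /choice[s sP] i := Uapp n (b0 i).
exists (\sum_i \sum_(t <- s i) tw_const iL t.2 * (Defs.tau iL ^+ i) * tw_map j (phi t.1)).
rewrite (additive_sum (kappaD EDr brDl)) -sumrB; apply: level_sum => i _.
rewrite (additive_sum (kappaD EDr brDl)).
have -> : \sum_(t <- s i) kappa (tw_const iL t.2 * (Defs.tau iL ^+ i) * tw_map j (phi t.1)) =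
    br (\sum_(t <- s i) E (rF t.1) t.2) (tauK ^+ i).
  rewrite (additive_sum (brDl (tauK ^+ i))); apply: eq_bigr => t _.
  rewrite (kappa_phi EDr EM brDl brDr brZ brB) (kappa_monom j EDr brDl).
  by rewrite brZ EM mulr1 mul1r.
by rewrite -(additive_sub (brDl _)); apply: level_br.
Qed.

(** c is the power series in a with coefficients [beta] in L. Over such series, unlike over C, the
    powers 1, ..., tau^(D-1) will be independent, because the coefficients are digits in base P. *)
Definition expansion (c : C) (beta : nat -> L) := forall n,
  U_ n (c - \sum_(k < n) E (rF a ^+ k) (beta k)).

Definition expandable c := exists beta, expansion c beta.

Lemma expandable0 : expandable 0.
Proof.
exists (fun=> 0) => n; rewrite big1 ?subrr; first exact: fil_0.
by move=> k _; apply: (additive_zero (EDr _)).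
Qed.

Lemma expandableD b c : expandable b -> expandable c -> expandable (b + c).
Proof.
move=> [beta bP] [gam cP]; exists (fun k => beta k + gam k) => n.
under eq_bigr do rewrite EDr.
by rewrite big_split opprD addrACA; apply: fil_D.
Qed.

Lemma expandableE b x : expandable b -> expandable (E 1 x * b).
Proof.
move=> [beta bP]; exists (fun k => x * beta k) => n.
have -> : \sum_(k < n) E (rF a ^+ k) (x * beta k) =
    E 1 x * \sum_(k < n) E (rF a ^+ k) (beta k).
  by rewrite mulr_sumr; apply: eq_bigr => k _; rewrite EM mul1r.
by rewrite -mulrBr; apply: U_mul0 => //; apply: UE1.
Qed.

Lemma expandable_alpha b : expandable b -> expandable (alpha * b).
Proof.
move=> [beta bP]; exists (fun k => if k is l.+1 then beta l else 0) => -[|n].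
  rewrite big_ord0 subr0 muln0; apply: U_mul0 (UE _ _) _.
  by have := bP 0; rewrite big_ord0 subr0 muln0.
rewrite big_ord_recl (additive_zero (EDr _)) add0r.
have -> : \sum_(i < n) E (rF a ^+ lift ord0 i) (beta i) =
    alpha * \sum_(i < n) E (rF a ^+ i) (beta i).
  by rewrite mulr_sumr; apply: eq_bigr => i _; rewrite EM mul1r -exprS.
by rewrite -mulrBr mulnS PoszD; apply: fil_M.
Qed.

Lemma first_digits c : U 0 c -> exists beta : 'I_d -> L,
  U_ 1 (c - \sum_i E (rF (e i)) (beta i)).
Proof.
move=> c0; have [s sP] := Uapp 1 c0.
suff [beta bP] : exists beta : 'I_d -> L,
    U_ 1 (\sum_(t <- s) E (rF t.1) t.2 - \sum_i E (rF (e i)) (beta i)).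
  by exists beta; rewrite -(subrKA (\sum_(t <- s) E (rF t.1) t.2)); apply: fil_D.
elim: (s) => [|[b x] s' [beta bP]].
  exists (fun=> 0); rewrite big_nil big1 ?subrr; first exact: fil_0.
  by move=> i _; apply: (additive_zero (EDr _)).
have [u [y ->]] := eS b; exists (fun i => iL (u i) * x + beta i).
under [X in _ - X]eq_bigr do rewrite EDr.
rewrite big_cons big_split /= opprD addrACA; apply: fil_D => //.
rewrite rmorphD EDl rmorph_sum (additive_sum (EDl x)).
have -> : \sum_i E (rF (rc (u i) * e i)) x = \sum_i E (rF (e i)) (iL (u i) * x).
  by apply: eq_bigr => i _; apply: EZ.
rewrite addrAC subrr add0r rmorphM /= mulrC -[x]mul1r -EM muln1 -[h%:Z]addr0.
by apply: fil_M.
Qed.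

(** Iterating [first_digits] expands c in powers of a with digits in the L-span of the e_i; the
    terms belonging to one e_i form a series in L[[a]]. *)
Lemma expansion_basis c : U 0 c -> exists s : 'I_d -> C,
  (forall i, expandable (s i)) /\ c = \sum_i E (rF (e i)) 1 * s i.
Proof.
move=> c0.
have /choice[g gP] (x : C) : exists y : ('I_d -> L) * C, U 0 x ->
    U 0 y.2 /\ x = \sum_i E (rF (e i)) (y.1 i) + alpha * y.2.
  have [x0|x0] := pselect (U 0 x); last by exists (fun=> 0, 0).
  have [beta bP] := first_digits x0.
  exists (beta, E aV 1 * (x - \sum_i E (rF (e i)) (beta i))) => _ /=; split.
    by have := @U_alphaV 0 1 _ bP; rewrite muln0.
  by rewrite mulrA EM aVK mulr1 E1 mul1r addrC subrK.
pose x k := iter k (fun y => (g y).2) c.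
have x0 k : U 0 (x k) by elim: k => //= k /gP[].
pose beta i k := (g (x k)).1 i.
have cE n : c = \sum_i E (rF (e i)) 1 * (\sum_(k < n) E (rF a ^+ k) (beta i k)) +
    alpha ^+ n * x n.
  elim: n => [|n IHn].
    by rewrite mul1r big1 ?add0r // => i _; rewrite big_ord0 mulr0.
  rewrite {1}IHn; have [_ {1}->] := gP (x n) (x0 n).
  rewrite mulrDr addrA mulrA -exprSr; congr (_ + _).
  rewrite mulr_sumr -big_split; apply: eq_bigr => i _.
  by rewrite big_ord_recr /= mulrDr E_X !EM !mul1r [rF a ^+ n * _]mulrC.
have /choice[s sP] i := Ulim (beta i).
exists s; split=> [i|]; first by exists (beta i).
apply/eqP; rewrite -subr_eq0; apply/eqP/Usep => n.
rewrite {1}(cE n) addrAC; apply: fil_D; last first.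
  by rewrite -{1}[n]addn0; apply: U_alpha; rewrite muln0.
rewrite -sumrB; apply: (big_ind (U_ n)) => [|y z|i _]; [exact: fil_0 | exact: fil_D |].
by rewrite -mulrBr; apply: U_mul0 => //; rewrite -opprB; apply: fil_N.
Qed.

(** The e_i in the coefficients are moved into K[tau] as phi(e_i), and reduction modulo P keeps the
    coefficients in L[[a]]. *)
Lemma level_expandable y : level 0 y -> lattice br D expandable y.
Proof.
rewrite /level muln0 => -[b b0 ->].
have lat_br c m : expandable c -> lattice br D expandable (br c m).
  apply: (lattice_br brDl brDr brB aD D0); [exact: expandableD | |].
    by move=> ? ?; apply: expandableE.
  exact: expandable_alpha.
have lat0 : lattice br D expandable 0 by apply: (lattice0 brDl); apply: expandable0.
have latD y1 y2 : lattice br D expandable y1 -> lattice br D expandable y2 ->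
  lattice br D expandable (y1 + y2) by apply: (latticeD brDl); apply: expandableD.
apply: big_ind => // i _; have [s [sE ->]] := expansion_basis (b0 i).
rewrite (additive_sum (brDl _)); apply: big_ind => // k _.
by rewrite -(br_phi brB); apply: lat_br.
Qed.

Lemma digits_level (b : 'I_D -> C) (f : nat -> Lt) :
  (forall k, (size (pol (f k)) <= D)%N) -> (forall i, expansion (b i) (fun k => (pol (f k))`_i)) ->
  forall n, level n (\sum_i br (b i) (tauK ^+ i) - kappa (\sum_(k < n) f k * P ^+ k)).
Proof.
move=> fD bf n; rewrite (additive_sum (kappaD EDr brDl)).
have -> : \sum_(k < n) kappa (f k * P ^+ k) =
    \sum_(i < D) br (\sum_(k < n) E (rF a ^+ k) (pol (f k))`_i) (tauK ^+ i).
  under [RHS]eq_bigr do rewrite (additive_sum (brDl _)).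
  rewrite exchange_big; apply: eq_bigr => k _.
  rewrite kappa_phiX (kappaE j EDr brDl (fD k)) scaler_sumr; apply: eq_bigr => i _.
  by rewrite brZ E_X EM mulr1 mul1r.
rewrite -sumrB; apply: level_sum => i _.
by rewrite -(additive_sub (brDl _)); apply/level_br/bf.
Qed.

Lemma level_complete (f : nat -> Lt) : (forall k, (size (pol (f k)) <= D)%N) ->
  exists y, forall n, level n (y - kappa (\sum_(k < n) f k * P ^+ k)).
Proof.
move=> fD; have /choice[b bP] (i : 'I_D) := Ulim (fun k => (pol (f k))`_i).
by exists (\sum_i br (b i) (tauK ^+ i)); apply: digits_level.
Qed.

Hypothesis kappa_div : forall m n, level n (kappa m) -> exists v, m = v * P ^+ n.

(** With coefficients in L[[a]], y is a series of f_k P^k with f_k shorter than P. As y lies in all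
    levels, the partial sums lie in the levels of their lengths, hence are divisible by the
    corresponding powers of P, and uniqueness of digits gives f_k = 0. *)
Lemma level_separated y : (forall n, level n y) -> y = 0.
Proof.
move=> yL; have [b bE yE] := level_expandable (yL 0).
have /choice[beta bP] := bE.
pose f k : Lt := \sum_(i < D) tw_const iL (beta i k) * Defs.tau iL ^+ i.
have fD k : (size (pol (f k)) <= D)%N by apply: size_tw_leq.
have fE k (i : 'I_D) : (pol (f k))`_i = beta i k.
  have cD : {morph (fun m : Lt => (pol m)`_i) : m m' / m + m'} by move=> m m'; apply: coefD.
  rewrite [LHS](additive_sum cD) (bigD1 i) //= tw_constE tauXE coefZ coefXn eqxx mulr1.
  rewrite big1 ?addr0 // => k' k'i; rewrite tw_constE tauXE coefZ coefXn.
  by rewrite eq_sym -(inj_eq val_inj) in k'i; rewrite (negPf k'i) mulr0.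
have bf i : expansion (b i) (fun k => (pol (f k))`_i).
  by move=> n; under eq_bigr do rewrite fE; apply: bP.
have f0 k : f k = 0.
  have [|v] := @kappa_div (\sum_(l < k.+1) f l * P ^+ l) k.+1.
    rewrite -[kappa _](subKr y); apply: levelB => //.
    by rewrite {1}yE; apply: digits_level.
  by move/(base_P_digits aD fD); apply.
rewrite yE big1 // => i _; suff -> : b i = 0 by apply: br0l.
apply: Usep => n; have := bf i n; rewrite big1 ?subr0 // => k _.
by rewrite f0 coef0 (additive_zero (EDr _)).
Qed.

End FilteredLattice.

Section FilteredSeries.
Variables (T : comPzRingType) (V : filtration T) (h : nat).
Hypothesis h0 : (0 < h)%N.

Lemma bound_multiple (m : int) : m <= (h * `|m|)%N%:Z.
Proof. by move: h0; move: (h) => k k0; nia. Qed.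

Lemma filtered_series (x : nat -> T) : (forall k, V (h * k)%N%:Z (x k)) ->
  exists c : compl V, forall n, in_cfil (h * n)%N%:Z (c - \sum_(k < n) compl_in V (x k)).
Proof.
move=> xV; pose s n := \sum_(k < n) x k.
have sB i n : (n <= i)%N -> V (h * n)%N%:Z (s i - s n).
  move=> ni; rewrite /s (big_ord_widen i x ni).
  rewrite (bigID (fun k : 'I_i => (k < n)%N) predT) /= addrC addrK.
  apply: (big_ind (V (h * n)%N%:Z)) => [|y z|k]; [exact: fil_0 | exact: fil_D |].
  rewrite -leqNgt => nk; apply: fil_S (xV k); rewrite lez_nat leq_mul2l nk orbT //.
have sC : is_cauchy V s.
  move=> m; exists `|m|%N => i i' mi mi'; apply: (fil_S (bound_multiple m)).
  rewrite -[s i](subrK (s `|m|%N)) -[s i'](subrK (s `|m|%N)).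
  rewrite opprD addrACA subrr addr0; apply: fil_B; exact: sB.
exists (lim_of (mk_cauchy sC)) => n; rewrite -rmorph_sum.
by apply: (@lim_of_approx _ _ (mk_cauchy sC)) => i; apply: sB.
Qed.

Lemma filtered_separated (c : compl V) : (forall n, in_cfil (h * n)%N%:Z c) -> c = 0.
Proof.
move=> cn; apply: compl_separated => m; exact: cfil_S (bound_multiple m) (cn _).
Qed.

End FilteredSeries.

(** * The completed tensor product as a filtered ring *)

Section CompletedTensorCoordinates.
Variables (Fq : finFieldType) (F : fieldType) (iF : {rmorphism Fq -> F}).
Hypothesis ff : is_function_field iF.
Variables (inf : place iF) (p : finite_place inf).
Variables (L : fieldType) (iL : {rmorphism Fq -> L}).
Local Notation A := (regular inf).
Local Notation rc := (reg_const inf).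
Local Notation Fp := (completion p).
Local Notation rF := (reg_Fp p).
Local Notation FL := (FK p iL).
Variables (h : nat) (a : A) (d : nat) (e : 'I_d -> A).
Hypotheses (aP : local_generator p h a) (eS : degA_spans a e).

Definition FL_fil : filtration FL := cfil (tens_fil (const_Fp p) iL (compl_fil p)).

Definition elt (b : Fp) (x : L) : FL := FK_in p iL (ten b x).

Lemma eltDl x : {morph elt^~ x : b c / b + c}.
Proof. by move=> b c; rewrite /elt tenDl rmorphD. Qed.

Lemma eltDr b : {morph elt b : x y / x + y}.
Proof. by move=> x y; rewrite /elt tenDr rmorphD. Qed.

Lemma eltM b b' x x' : elt b x * elt b' x' = elt (b * b') (x * x').
Proof. by rewrite /elt -rmorphM tenM. Qed.

Lemma elt1 : elt 1 1 = 1. Proof. exact: (rmorph1 (FK_in p iL)). Qed.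

Lemma eltZ u b x : elt (rF (rc u * b)) x = elt (rF b) (iL u * x).
Proof. by rewrite /elt (rmorphM rF) -(@ten_bal _ _ _ (const_Fp p) iL u). Qed.

Lemma elt_fil n b x : compl_fil p n b -> FL_fil n (elt b x).
Proof.
move=> bn; apply: fil_compl_in; exists [:: (b, x)]; last by rewrite big_seq1.
by move=> t; rewrite inE => /eqP->.
Qed.

Lemma elt_reg b x : FL_fil 0 (elt (rF b) x).
Proof. exact/elt_fil/integral_reg. Qed.

Lemma elt_gen : FL_fil h%:Z (elt (rF a) 1).
Proof. by apply: elt_fil; have := compl_fil_aX aP 1; rewrite muln1. Qed.

Lemma elt_genV : FL_fil (- h%:Z) (elt (rF a)^-1 1).
Proof. by apply: elt_fil; have := compl_fil_aV aP 1; rewrite muln1. Qed.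

Lemma elt_approx c n : FL_fil 0 c -> exists s : seq (A * L),
  FL_fil (h * n)%N%:Z (c - \sum_(t <- s) elt (rF t.1) t.2).
Proof.
move=> c0; have [x cx] := compl_approx c (h * n)%N%:Z.
have [s sU xE] : in_tens_fil (compl_fil p) 0 x.
  apply: (@compl_in_fil _ (tens_fil (const_Fp p) iL (compl_fil p))).
  rewrite -[compl_in _ _](subKr c); apply: cfil_B => //; exact: cfil_S cx.
suff [s' s'P] : exists s' : seq (A * L),
    FL_fil (h * n)%N%:Z (\sum_(t <- s) elt t.1 t.2 - \sum_(t <- s') elt (rF t.1) t.2).
  exists s'; rewrite -(subrKA (\sum_(t <- s) elt t.1 t.2)).
  apply: (@fil_D _ FL_fil) => //.
  by move: cx; rewrite xE rmorph_sum.
elim: s sU {xE} => [|[b y] s IHs] sU.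
  by exists [::]; rewrite !big_nil subrr; apply: fil_0.
have [t ts|s' s'P] := IHs; first by apply: sU; rewrite inE ts orbT.
have bi : integral b by apply: (sU (b, y)); rewrite mem_head.
have [c' /(integral_divP aP) bc'] := integral_dense ff aP eS n bi.
exists ((c', y) :: s'); rewrite !big_cons opprD addrACA; apply: (@fil_D _ FL_fil) => //=.
by rewrite -(additive_sub (eltDl y)); apply: elt_fil.
Qed.

Let h0 : (0 < h)%N. Proof. by case: aP. Qed.

Lemma elt_series (beta : nat -> L) : exists c, forall n,
  FL_fil (h * n)%N%:Z (c - \sum_(k < n) elt (rF a ^+ k) (beta k)).
Proof.
apply: (@filtered_series _ (tens_fil (const_Fp p) iL (compl_fil p)) h h0
  (fun k => ten (rF a ^+ k) (beta k))) => k.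
exists [:: (rF a ^+ k, beta k)]; last by rewrite big_seq1.
by move=> t; rewrite inE => /eqP->; apply: compl_fil_aX.
Qed.

Lemma FL_separated (c : FL) : (forall n, FL_fil (h * n)%N%:Z c) -> c = 0.
Proof. exact: filtered_separated. Qed.

End CompletedTensorCoordinates.

Section MotiveCoordinates.
Variables (Fq : finFieldType) (F : fieldType) (iF : {rmorphism Fq -> F}).
Variables (inf : place iF) (p : finite_place inf).
Variables (K : fieldType) (iK : {rmorphism Fq -> K}).
Variables (L : fieldType) (j : {rmorphism K -> L}).
Variables (r : nat) (phi : drinfeld inf iK r).
Local Notation iL := (iKbar iK j).
Local Notation E := (@elt _ _ _ _ p _ iL).
Local Notation rF := (reg_Fp p).

Definition bracket (c : FK p iL) (m : twisted iK) : MF_bar p j phi :=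
  mten (c : (FK p iL)^o) (mten (1 : (FK p iK)^o) (m : motive phi) : MF p phi).

Lemma bracketDl m : {morph bracket^~ m : b c / b + c}.
Proof. by move=> b c; apply: mtenDl. Qed.

Lemma bracketDr c : {morph bracket c : m d / m + d}.
Proof. by move=> m d; rewrite /bracket -mtenDr -mtenDr. Qed.

Lemma bracketZ (b c : FK p iL) m : b *: bracket c m = bracket (b * c) m.
Proof. exact: mtenZ. Qed.

Lemma bracket_scale c (x : AK inf iK) (m : motive phi) :
  bracket c (x *: m) = bracket (FK_bar p iK j (AK_FK p iK x) * c) m.
Proof.
rewrite /bracket.
have -> : mten (1 : (FK p iK)^o) (x *: m) =
    (AK_FK p iK x) *: (mten (1 : (FK p iK)^o) m : MF p phi).
  by rewrite mtenZ -mten_bal.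
by rewrite -mten_bal.
Qed.

Lemma bracket_bal c x m b :
  bracket c (tw_const iK x * m * phi b) = bracket (E (rF b) (j x) * c) m.
Proof.
rewrite -(motive_scale_ten b x (m : motive phi)) bracket_scale; congr (bracket (_ * c) m).
by rewrite /= tens_alg_mapE FK_map_in; congr (FK_in p iL _); apply: tens_alg_mapE.
Qed.

Lemma bracket_ind (Q : MF_bar p j phi -> Prop) : Q 0 ->
  (forall x y, Q x -> Q y -> Q (x + y)) -> (forall c m, Q (bracket c m)) -> forall y, Q y.
Proof. by move=> Q0 QD Qb; apply: double_ind. Qed.

Lemma bracket_tau c m :
  MF_bar_tau (bracket c m) = bracket (sigmaF_bar p iK j c) (Defs.tau iK * m).
Proof. by rewrite /bracket MF_bar_tauE MF_tauE rmorph1. Qed.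

Lemma bracket_gal (g : galois_aut j) c m :
  MF_bar_gal g (bracket c m) = bracket (galFK p iK g c) m.
Proof. exact: MF_bar_galE. Qed.

Lemma sigma_fil n (c : FK p iL) : FL_fil p iL n c -> FL_fil p iL n (sigmaF_bar p iK j c).
Proof.
move=> [u -> [N uN]]; rewrite /sigmaF_bar /FK_map /= compl_mapE; eexists; first by [].
by exists N => i /uN ui; apply: FK_ten_map_fil.
Qed.

Lemma sigma_elt b x : sigmaF_bar p iK j (E b x) = E b (frob iL x).
Proof. by rewrite /elt FK_map_in; congr (FK_in p iL _); apply: tens_alg_mapE. Qed.

End MotiveCoordinates.

(** * Functionals on the base-changed motive *)

Section TestFunctionals.
Variables (Fq : finFieldType) (F : fieldType) (iF : {rmorphism Fq -> F}).
Variables (inf : place iF) (p : finite_place inf).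
Variables (K : fieldType) (iK : {rmorphism Fq -> K}).
Variables (L : fieldType) (j : {rmorphism K -> L}).
Variables (r : nat) (phi : drinfeld inf iK r).
Local Notation iL := (iKbar iK j).
Local Notation Lt := (twisted iL).
Local Notation Fp := (completion p).
Local Notation rF := (reg_Fp p).
Local Notation E := (@elt _ _ _ _ p _ iL).
Local Notation br := (@bracket _ _ _ _ p _ iK _ j _ phi).
Local Notation kap := (@kappa _ _ _ iK j _ _ _ E br).
Local Notation adm := (admissible (const_Fp p) iL (compl_fil p)).
Local Notation acts := (@act _ _ _ (const_Fp p) iL (compl_fil p)).

(** Such g are Kbar-linear maps from Kbar[tau] to continuous functions on F_p, compatible with A.
    Two kinds occur: m |-> m(f z) for f from the Tate module, and the digits in base P. *)
Definition test (g : Lt -> Fp -> L) :=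
  [/\ {morph g : m d / m + d}, forall m, adm (g m),
      forall x m z, g (tw_const iL x * m) z = x * g m z &
      forall m b z, g (m * tw_map j (phi b)) z = g m (rF b * z)].

Definition psi (g : Lt -> Fp -> L) : MF_bar p j phi -> Fp -> L :=
  lift2 acts (fun m : motive phi => g (tw_map j m)).

Lemma adm_0 : adm 0.
Proof. by split=> [y z|u z|]; [exact/esym/addr0 | exact/esym/mulr0 | exists 0]. Qed.

Lemma adm_add v w : adm v -> adm w -> adm (v + w).
Proof. exact: admissibleD. Qed.

Lemma adm_act c w : adm w -> adm (acts c w).
Proof. exact: admissible_act. Qed.

Lemma actsDl c c' w : adm w -> acts (c + c') w = acts c w + acts c' w.
Proof. by move=> wA; apply/funext => z; apply: actDl. Qed.

Lemma actsDr c v w : adm v -> adm w -> acts c (v + w) = acts c v + acts c w.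
Proof. by move=> vA wA; apply/funext => z; apply: actDr. Qed.

Lemma actsM c c' w : adm w -> acts (c * c') w = acts c (acts c' w).
Proof. by move=> wA; apply/funext => z; apply: actM. Qed.

Section OneTest.
Variable g : Lt -> Fp -> L.
Hypothesis gT : test g.
Local Notation G := (fun m : motive phi => g (tw_map j m)).

Lemma test_additive : {morph G : m n / m + n}.
Proof. by move=> m n; have [gD _ _ _] := gT; rewrite (raddfD (tw_map j)) gD. Qed.

Lemma test_adm m : adm (G m).
Proof. by have [_ gA _ _] := gT; apply: gA. Qed.

Lemma test_scale x m : G (x *: m) = acts (FK_bar p iK j (AK_FK p iK x)) (G m).
Proof.
have [gD gA gc gphi] := gT.
move: x; apply: tens_ext => [x y|x y|b xi].
- by rewrite scalerDl test_additive.
- by rewrite !rmorphD actsDl //; apply: gA.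
rewrite -/(ten b xi); apply/funext => z.
have -> : FK_bar p iK j (AK_FK p iK (ten b xi)) = E (rF b) (j xi).
  by rewrite /= tens_alg_mapE FK_map_in; congr (FK_in p iL _); apply: tens_alg_mapE.
rewrite [RHS]act_in_ten; last exact: gA.
rewrite motive_scale_ten !(rmorphM (tw_map j)) /= tw_map_const.
by rewrite -mulrA gc gphi.
Qed.

Lemma psi_bracket c m z : psi g (br c m) z = acts c (g (tw_map j m)) z.
Proof.
rewrite /psi /bracket (lift2E adm_0 adm_add adm_act actsDl actsDr actsM
  test_additive test_adm test_scale).
rewrite (lift1E actsDl actsDr actsM test_additive test_adm test_scale) rmorph1.
by congr (acts c _ z); apply/funext => y; apply/act1/test_adm.
Qed.

Lemma psiD : {morph psi g : x y / x + y}.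
Proof.
exact: (lift2D adm_0 adm_add adm_act actsDl actsDr actsM test_additive test_adm test_scale).
Qed.

Lemma psi_adm y : adm (psi g y).
Proof.
exact: (lift2_adm adm_0 adm_add adm_act actsDl actsDr actsM test_additive test_adm test_scale).
Qed.

Lemma psiZ c y : psi g (c *: y) = acts c (psi g y).
Proof.
exact: (lift2Z adm_0 adm_add adm_act actsDl actsDr actsM test_additive test_adm test_scale).
Qed.

Lemma psi_elt b x y z : psi g (E b x *: y) z = x * psi g y (b * z).
Proof. by rewrite psiZ; apply/act_in_ten/psi_adm. Qed.

Lemma psi_Fp b y z : psi g (Fp_FK iL b *: y) z = psi g y (b * z).
Proof. by rewrite psi_elt mul1r. Qed.

Lemma psi_kappa m z : psi g (kap m) z = g m z.
Proof.
have [gD gA gc gphi] := gT.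
have psiDz : {morph (fun y => psi g y z) : x y / x + y} by move=> x y; rewrite psiD.
have gDz : {morph (fun m => g m z) : x y / x + y} by move=> x y; rewrite gD.
rewrite [m in RHS](tw_decomposition (leqnn (size (m : {poly L})))).
rewrite /kappa (additive_sum psiDz) (additive_sum gDz); apply: eq_bigr => i _.
rewrite psi_bracket [LHS]act_in_ten; last exact: gA.
by rewrite gc (rmorphXn (tw_map j)) /= tw_map_tau mul1r.
Qed.

Lemma psi_level0 D h y z : (forall m w, integral w -> g m (w * z) = 0) ->
  level br D h (FL_fil p iL) 0 y -> psi g y z = 0.
Proof.
move=> gz; rewrite /level muln0 => -[b b0 ->]; have [gD gA gc gphi] := gT.
have psiDz : {morph (fun y => psi g y z) : x y / x + y} by move=> x y1; rewrite psiD.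
rewrite (additive_sum psiDz) big1 // => i _.
rewrite psi_bracket; apply: (act_cfil (gA _) (b0 i)) => w; exact: gz.
Qed.

End OneTest.

Lemma psi_tau g y z : test g -> (forall m z, g (Defs.tau iL * m) z = frob iL (g m z)) ->
  psi g (MF_bar_tau y) z = frob iL (psi g y z).
Proof.
move=> gT gtau; have [gD gA gc gphi] := gT; move: y; apply: bracket_ind => [|x y Hx Hy|c m].
- by rewrite (additive_zero (@MF_bar_tauD _ _ _ _ _ _ _ _ _ _ _))
    (additive_zero (psiD gT)) rmorph0.
- by rewrite MF_bar_tauD !psiD // -[LHS]/(psi g _ z + psi g _ z) Hx Hy rmorphD.
rewrite bracket_tau !psi_bracket // (rmorphM (tw_map j)) /= tw_map_tau.
have -> : g (Defs.tau iL * tw_map j m) = frob iL \o g (tw_map j m).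
  by apply/funext => w; apply: gtau.
apply: (act_map (frob_const iL)); last exact: gA.
by move=> b xi; apply: tens_alg_mapE.
Qed.

(** The comparison is required on K[tau] only: for m over Kbar, s would also move the coefficients
    of m. *)
Lemma psi_gal g g' (s : galois_aut j) y z : test g -> test g' ->
  (forall m z, g' (tw_map j m) z = s (g (tw_map j m) z)) ->
  psi g' (MF_bar_gal s y) z = s (psi g y z).
Proof.
move=> gT g'T gg'; have [gD gA gc gphi] := gT; move: y; apply: bracket_ind => [|x y Hx Hy|c m].
- by rewrite (additive_zero (@MF_bar_galD _ _ _ _ _ _ _ _ _ _ _ _))
    (additive_zero (psiD gT)) (additive_zero (psiD g'T)) rmorph0.
- rewrite MF_bar_galD (psiD g'T) (psiD gT) -[LHS]/(psi g' _ z + psi g' _ z) Hx Hy.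
  by rewrite -[X in _ = s X]/(psi g _ z + psi g _ z) rmorphD.
rewrite bracket_gal !psi_bracket //.
have -> : g' (tw_map j m) = s \o g (tw_map j m).
  by apply/funext => w; apply: gg'.
apply: (act_map (gal_const iK s)); last exact: gA.
by move=> b xi; apply: tens_alg_mapE.
Qed.

End TestFunctionals.

Section TestHom.
Variables (Fq : finFieldType) (F : fieldType) (iF : {rmorphism Fq -> F}).
Variables (inf : place iF) (p : finite_place inf).
Variables (K : fieldType) (iK : {rmorphism Fq -> K}).
Variables (L : fieldType) (j : {rmorphism K -> L}).
Variables (r : nat) (phi phi' : drinfeld inf iK r) (u : twisted iK).
Hypothesis uP : is_dr_hom phi phi' u.

Lemma bracket_hom (c : FK p (iKbar iK j)) m :
  MF_bar_hom phi u (bracket phi' c m) = bracket phi c (m * u).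
Proof. by rewrite /bracket (MF_bar_homE uP) (MF_homE uP). Qed.

Lemma psi_hom (g g' : twisted (iKbar iK j) -> completion p -> L)
    (y : MF_bar p j phi') z : test phi g -> test phi' g' ->
  (forall m z, g' (tw_map j m) z = g (tw_map j (m * u)) z) ->
  psi g' y z = psi g (MF_bar_hom phi u y) z.
Proof.
move=> gT g'T gg'; move: y; apply: bracket_ind => [|x y Hx Hy|c m].
- by rewrite (additive_zero (MF_bar_homD uP)) (additive_zero (psiD gT)) (additive_zero (psiD g'T)).
- have -> : psi g' (x + y) z = psi g' x z + psi g' y z by rewrite (psiD g'T).
  have -> : MF_bar_hom phi u (x + y) = MF_bar_hom phi u x + MF_bar_hom phi u y.
    exact: (MF_bar_homD uP).
  by rewrite Hx Hy (psiD gT).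
rewrite bracket_hom !psi_bracket //.
by have -> : g' (tw_map j m) = g (tw_map j (m * u)) by apply/funext => w; apply: gg'.
Qed.

End TestHom.

Section RightDivision.
Variables (Fq : finFieldType) (L : fieldType) (iL : {rmorphism Fq -> L}).
Local Notation Lt := (twisted iL).
Local Notation pol m := (m%R : {poly L}).
Variable P : Lt.
Hypothesis P0 : P != 0.

Fact right_division_ex m : exists QR : Lt * Lt, m = QR.1 * P + QR.2 /\
  (size (pol QR.2) < size (pol P))%N.
Proof. by have [QR] := tw_division m P0; exists QR. Qed.

Definition rquo m := (sval (cid (right_division_ex m))).1.
Definition rrem m := (sval (cid (right_division_ex m))).2.

Lemma rdivE m : m = rquo m * P + rrem m.
Proof. by rewrite /rquo /rrem; case: cid => -[Q R] []. Qed.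

Lemma rrem_size m : (size (pol (rrem m)) < size (pol P))%N.
Proof. by rewrite /rrem; case: cid => -[Q R] []. Qed.

Lemma rdiv_unique m Q R : m = Q * P + R -> (size (pol R) < size (pol P))%N ->
  rquo m = Q /\ rrem m = R.
Proof.
move=> mE sR; apply: tw_division_unique (rrem_size m) sR _.
by rewrite -rdivE.
Qed.

Lemma rdivD m d : rquo (m + d) = rquo m + rquo d /\ rrem (m + d) = rrem m + rrem d.
Proof.
apply: rdiv_unique; first by rewrite {1}(rdivE m) {1}(rdivE d) mulrDl addrACA.
by apply: leq_ltn_trans (size_polyD _ _) _; rewrite gtn_max !rrem_size.
Qed.

Lemma rdivM m : rquo (m * P) = m /\ rrem (m * P) = 0.
Proof. by apply: rdiv_unique; rewrite ?addr0 // size_poly0 size_poly_gt0. Qed.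

Lemma rdivZ x m : rquo (tw_const iL x * m) = tw_const iL x * rquo m /\
  rrem (tw_const iL x * m) = tw_const iL x * rrem m.
Proof.
apply: rdiv_unique; first by rewrite {1}(rdivE m) mulrDr mulrA.
rewrite tw_constE; exact: leq_ltn_trans (size_scale_leq _ _) (rrem_size _).
Qed.

End RightDivision.

(** * Digits in base P and divisibility in the lattice *)

Section MotiveLattice.
Variables (Fq : finFieldType) (F : fieldType) (iF : {rmorphism Fq -> F}).
Hypothesis ff : is_function_field iF.
Variables (inf : place iF) (p : finite_place inf).
Variables (K : fieldType) (iK : {rmorphism Fq -> K}).
Variables (L : fieldType) (j : {rmorphism K -> L}).
Variables (r : nat) (phi : drinfeld inf iK r).
Local Notation A := (regular inf).
Local Notation rc := (reg_const inf).
Local Notation iL := (iKbar iK j).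
Local Notation Lt := (twisted iL).
Local Notation Fp := (completion p).
Local Notation rF := (reg_Fp p).
Local Notation E := (@elt _ _ _ _ p _ iL).
Local Notation br := (@bracket _ _ _ _ p _ iK _ j _ phi).
Local Notation kap := (@kappa _ _ _ iK j _ _ _ E br).
Local Notation pol m := (m%R : {poly L}).
Variables (h : nat) (a : A) (d : nat) (e : 'I_d -> A) (D : nat).
Hypotheses (aP : local_generator p h a) (eS : degA_spans a e).
Hypotheses (aD : size (phi a : {poly K}) = D.+1) (D0 : (0 < D)%N).
Local Notation P := (tw_map j (phi a)).
Local Notation lev := (level br D h (FL_fil p iL)).

Let phiA b : twisted iL := tw_map j (phi b).

Lemma phiA_const u : phiA (rc u) = tw_const iL (iL u).
Proof. by rewrite /phiA dr_const tw_map_const. Qed.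

Lemma phiA_comm b c : phiA b * phiA c = phiA c * phiA b.
Proof. by rewrite /phiA -!(rmorphM (tw_map j)) -!rmorphM mulrC. Qed.

Let P0 : P != 0.
Proof. by rewrite -[_ != 0]/(pol P != 0) -size_poly_gt0 size_tw_map aD. Qed.

Let actL b (m : Lt) : Lt := m * phiA b.

Let digit l (m : Lt) := (pol (rrem P0 m))`_l.

Definition digit_test l (m : Lt) (z : Fp) : L :=
  resid ff aP eS actL (rquo P0) (digit l) z m.

Let actDl m : {morph actL^~ m : b b' / b + b'}.
Proof. by move=> b b'; rewrite /actL /phiA !rmorphD mulrDr. Qed.

Let actDr b : {morph actL b : m m' / m + m'}.
Proof. by move=> m m'; apply: mulrDl. Qed.

Let actA b b' m : actL (b * b') m = actL b (actL b' m).
Proof. by rewrite /actL -mulrA phiA_comm /phiA !rmorphM. Qed.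

Let quoD : {morph rquo P0 : m m' / m + m'}.
Proof. by move=> m m'; have [] := rdivD P0 m m'. Qed.

Let digitD l : {morph digit l : m m' / m + m'}.
Proof. by move=> m m'; rewrite /digit; have [_ ->] := rdivD P0 m m'; apply: coefD. Qed.

Let quoa m : rquo P0 (actL a m) = m.
Proof. by have [] := rdivM P0 m. Qed.

Let digita l m : digit l (actL a m) = 0.
Proof. by rewrite /digit /actL; have [_ ->] := rdivM P0 m; apply: coef0. Qed.

Lemma digit_test_const l x m z : digit_test l (tw_const iL x * m) z = x * digit_test l m z.
Proof.
apply: (resid_map ff aP eS (fX := fun m => tw_const iL x * m)) => [m1|m1|b m1].
- by have [] := rdivZ P0 x m1.
- by rewrite /digit; have [_ ->] := rdivZ P0 x m1; rewrite tw_constE coefZ.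
- by rewrite /actL mulrA.
Qed.

Lemma digit_test_phi l m b z : digit_test l (m * phiA b) z = digit_test l m (rF b * z).
Proof. exact: (resid_act ff aP eS actDl actA quoD (digitD l) quoa (digita l)). Qed.

Lemma digit_test_integral l m z : integral z -> digit_test l m z = 0.
Proof. exact: (resid_integral ff aP eS actA quoa (digita l)). Qed.

Lemma digit_testP l : test phi (digit_test l).
Proof.
split=> [m m'|m|x m z|m b z].
- by apply/funext => z; apply: (residDr ff aP eS actDr quoD (digitD l)).
- split=> [x y|u z|].
  + exact: (residDl ff aP eS actDl actA quoD (digitD l) quoa (digita l)).
  + rewrite -[const_Fp p u]/(rF (rc u)) -digit_test_phi phiA_const.
    by rewrite tw_const_central digit_test_const.
  + by exists 0 => z z0; apply: digit_test_integral.
- exact: digit_test_const.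
- exact: digit_test_phi.
Qed.

Lemma digit_test_unit l k m : digit_test l m (rF a ^+ k.+1)^-1 = digit l (iter k (rquo P0) m).
Proof.
apply: (resid_unit ff aP eS actDl actA quoD (digitD l) quoa (digita l)) => m'.
by rewrite /actL /phiA !rmorph1 mulr1.
Qed.

Let lev_alphaV n y : lev n y -> lev 0 (E (rF a)^-1 1 ^+ n *: y).
Proof. by move=> yn; apply: (level_alphaV (bracketZ phi) (elt_genV iL aP)); rewrite addn0. Qed.

(** The k-th digit of m in base P is read off at a^-(k+1). For an element a^n y of level n, this is
    the value for y at a^(n-k-1), which vanishes for k < n because that point is integral; so the
    first n remainders are zero. *)
Lemma kappa_divides m n : lev n (kap m) -> exists v, m = v * P ^+ n.
Proof.
move=> mn.
have m0 k l : (k < n)%N -> (l < D)%N -> digit l (iter k (rquo P0) m) = 0.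
  move=> kn lD; rewrite -digit_test_unit -(psi_kappa (digit_testP l)).
  have -> : kap m = E (rF a ^+ n) 1 *: (E (rF a)^-1 1 ^+ n *: kap m).
    rewrite scalerA (E_X (@eltM _ _ _ _ p _ iL) (elt1 p iL)) eltM mulr1 -exprMn mulfV ?expr1n.
      by rewrite elt1 scale1r.
    exact: rF_neq0 aP.
  rewrite (psi_elt (digit_testP l)) mul1r.
  apply: (psi_level0 (digit_testP l) _ (lev_alphaV mn)) => m' w wi.
  apply: digit_test_integral; apply: integralM => //.
  have -> : rF a ^+ n * (rF a ^+ k.+1)^-1 = rF a ^+ (n - k.+1).
    rewrite -{1}(subnK kn) exprD mulfK // expf_neq0 //; exact: rF_neq0 aP.
  by rewrite -(rmorphXn rF); apply: integral_reg.
have rem0 k : (k < n)%N -> rrem P0 (iter k (rquo P0) m) = 0.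
  move=> kn; apply/polyP => l; rewrite coef0; have [lD|Dl] := ltnP l D; first exact: m0.
  rewrite nth_default //; apply: leq_trans Dl.
  by have := rrem_size P0 (iter k (rquo P0) m); rewrite size_tw_map aD ltnS.
exists (iter n (rquo P0) m).
elim: n rem0 {mn m0} => [|n IHn] rem0; first by rewrite mulr1.
rewrite {1}IHn => [|k kn]; last by apply: rem0; apply: ltnW.
rewrite exprS mulrA; congr (_ * _).
by rewrite {1}(rdivE P0 (iter n (rquo P0) m)) rem0 // addr0.
Qed.

Lemma lev_separated y : (forall n, lev n y) -> y = 0.
Proof.
move=> yn; have := (level_separated (@eltDl _ _ _ _ p _ iL) (@eltDr _ _ _ _ p _ iL) (@eltM _ _ _ _ p _ iL)
  (elt1 p iL) (@eltZ _ _ _ _ p _ iL) (bracketDl phi) (bracketDr phi) (bracketZ phi)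
  (bracket_bal phi) (mulfV (rF_neq0 aP)) aD D0 eS (elt_reg p iL) (elt_gen iL aP)
  (elt_genV iL aP) (elt_approx ff aP eS) (elt_series iL aP) (FL_separated aP)).
by move=> H; apply: H => //; apply: kappa_divides.
Qed.

End MotiveLattice.

(** * Duality between torsion and invariants *)

Lemma cancel_middle (T : fieldType) (w x y z : T) : x != 0 -> w * (x * y * z) / x = w * (y * z).
Proof. by move=> x0; field. Qed.

Lemma cancel_outer (T : fieldType) (x y z : T) : x != 0 -> x * y * (z / x) = y * z.
Proof. by move=> x0; field. Qed.

Section FrobeniusFixed.
Variables (Fq : finFieldType) (L : fieldType) (iL : {rmorphism Fq -> L}).

Lemma frobenius_fixed (x : L) : x ^+ #|Fq| = x -> exists u, x = iL u.
Proof.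
move=> xq; have : root (map_poly iL ('X^#|Fq| - 'X)) x.
  by rewrite rmorphB /= map_polyXn map_polyX /root !hornerE xq subrr.
rewrite finField_genPoly rmorph_prod /=.
under eq_bigr do rewrite rmorphB /= map_polyX map_polyC.
rewrite -(big_map iL predT (fun c => 'X - c%:P)) root_prod_XsubC.
by move=> /mapP[u _ ->]; exists u.
Qed.

End FrobeniusFixed.

Section TorsionPairing.
Variables (Fq : finFieldType) (F : fieldType) (iF : {rmorphism Fq -> F}).
Hypothesis ff : is_function_field iF.
Variables (inf : place iF) (p : finite_place inf).
Variables (L : closedFieldType) (iL : {rmorphism Fq -> L}).
Local Notation A := (regular inf).
Local Notation rc := (reg_const inf).
Local Notation Fp := (completion p).
Local Notation rF := (reg_Fp p).
Local Notation cF := (const_Fp p).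
Local Notation Lt := (twisted iL).
Local Notation q := #|Fq|.
Local Notation pol m := (m%R : {poly L}).
Local Notation ev := (tw_eval (iK := iL) (idfun : {rmorphism L -> L})).
Local Notation tau := (Defs.tau iL).
Variables (h : nat) (a : A) (d : nat) (e : 'I_d -> A) (lam : Fp -> Fq).
Hypotheses (aP : local_generator p h a) (eS : degA_spans a e) (lamP : dualizing a lam).
Variable phi : {rmorphism A -> Lt}.
Hypothesis phi_const : forall u, phi (rc u) = tw_const iL (iL u).
Local Notation P := (phi a).
Hypothesis P0 : P != 0.
Variables (Y : lmodType Fp) (tauY : Y -> Y) (kap : Lt -> Y) (lev : nat -> Y -> Prop).
Hypotheses (tauD : {morph tauY : x y / x + y}) (tauZ : forall c y, tauY (c *: y) = c *: tauY y).
Hypotheses (kapD : {morph kap : x y / x + y})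
  (kap_phi : forall m b, kap (m * phi b) = rF b *: kap m)
  (kap_tau : forall m, kap (tau * m) = tauY (kap m)).
Hypotheses (lev0 : forall n, lev n 0) (levD : forall n y z, lev n y -> lev n z -> lev n (y + z))
  (levZ : forall n c y, integral c -> lev n y -> lev n (c *: y))
  (lev_le : forall m n y, (m <= n)%N -> lev n y -> lev m y)
  (lev_up : forall k n y, lev n y -> lev (k + n) (rF a ^+ k *: y))
  (lev_down : forall k n y, lev (k + n) y -> lev n ((rF a ^+ k)^-1 *: y))
  (lev_kap : forall m, lev 0 (kap m)) (lev_tau : forall y, lev 0 y -> lev 0 (tauY y))
  (lev_ex : forall y, exists n, lev 0 (rF a ^+ n *: y)).
Hypotheses (approx : forall n y, lev 0 y -> exists m, lev n (y - kap m))
  (complete : forall f : nat -> Lt, (forall k, size (pol (f k)) < size (pol P))%N ->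
    exists y, forall n, lev n (y - kap (\sum_(k < n) f k * P ^+ k)))
  (separated : forall y, (forall n, lev n y) -> y = 0)
  (kap_div : forall m n, lev n (kap m) -> exists v, m = v * P ^+ n).

Let a0 : rF a != 0 := rF_neq0 aP.
Let aX0 n : rF a ^+ n != 0 := expf_neq0 n a0.

Lemma lev_sum n (I : Type) (s : seq I) (Q : pred I) (f : I -> Y) :
  (forall i, Q i -> lev n (f i)) -> lev n (\sum_(i <- s | Q i) f i).
Proof. by move=> fn; apply: big_ind => //; apply: levD. Qed.

Lemma integral_const u : integral (cF u).
Proof. exact: (integral_reg p (rc u)). Qed.

Lemma levN n y : lev n y -> lev n (- y).
Proof. by rewrite -scaleN1r; apply: levZ; apply/integralN/integral1. Qed.

Lemma levB n y z : lev n y -> lev n z -> lev n (y - z).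
Proof. by move=> yn zn; apply: levD => //; apply: levN. Qed.

Lemma lev_upE k y : lev 0 y -> lev k (rF a ^+ k *: y).
Proof. by move/(lev_up k); rewrite addn0. Qed.

Lemma lev_downE k y : lev k y -> lev 0 ((rF a ^+ k)^-1 *: y).
Proof. by move=> yk; apply: lev_down; rewrite addn0. Qed.

Lemma lev_small n c y : integral (c / rF a ^+ n) -> lev 0 y -> lev n (c *: y).
Proof.
move=> cn y0; rewrite -[c](divfK (aX0 n)) mulrC -scalerA; apply: lev_upE; exact: levZ.
Qed.

Lemma lev_tau_n n y : lev n y -> lev n (tauY y).
Proof.
move=> /lev_downE/lev_tau/(lev_upE n).
by rewrite tauZ scalerA divff // scale1r.
Qed.

Lemma kapB : {morph kap : x y / x - y}. Proof. exact: additive_sub. Qed.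

Lemma kap_phiX m n : kap (m * P ^+ n) = rF a ^+ n *: kap m.
Proof. by rewrite -(rmorphXn phi) kap_phi rmorphXn. Qed.

Lemma kap_P m n : lev n (kap (m * P ^+ n)).
Proof. by rewrite kap_phiX; apply/lev_upE/lev_kap. Qed.

Lemma kap_const u m : kap (tw_const iL (iL u) * m) = cF u *: kap m.
Proof. by rewrite -tw_const_central -phi_const kap_phi. Qed.

Definition invariant y := tauY y = y.

Lemma invariantD y z : invariant y -> invariant z -> invariant (y + z).
Proof. by rewrite /invariant tauD => -> ->. Qed.

Lemma invariantZ c y : invariant y -> invariant (c *: y).
Proof. by rewrite /invariant tauZ => ->. Qed.

Lemma invariant0 : invariant 0. Proof. exact: additive_zero. Qed.

Lemma invariant_sum (I : finType) (c : I -> Fp) (w : I -> Y) :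
  (forall i, invariant (w i)) -> invariant (\sum_i c i *: w i).
Proof.
move=> wI; apply: (big_ind invariant) => [|x y|i _]; first exact: invariant0.
  exact: invariantD.
exact: invariantZ.
Qed.

Lemma invariantB y z : invariant y -> invariant z -> invariant (y - z).
Proof. by move=> yI zI; apply: invariantD => //; rewrite -scaleN1r; apply: invariantZ. Qed.

(** The solution of [lang_modulo] is replaced by its remainder modulo P, since [complete] admits
    only digits shorter than P; its quotient goes into the multiple of P. *)
Lemma lang_digit (f : Lt) : exists cv : Lt * Lt, (size (pol cv.1) < size (pol P))%N /\
  f + (tau * cv.1 - cv.1) = cv.2 * P.
Proof.
have [c [v cv]] := lang_modulo f P0; have [[Q R] /= cE sR] := tw_division c P0.
exists (R, v - (tau * Q - Q)); split=> //=.
rewrite mulrBl -cv mulrBl -mulrA; have -> : R = c - Q * P by rewrite cE addrC addKr.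
by rewrite mulrBr !opprD !opprK -[RHS]addrA; congr (_ + _); exact: addrACA.
Qed.

(** Successive approximation: adding c_k P^(n+k) moves the error U_k P^(n+k) of tau - 1 to level n +
    k + 1, and the sum of all corrections converges in a^n times the lattice. *)
Lemma lift_invariant n m u : tau * m - m = u * P ^+ n ->
  exists w, [/\ invariant w, lev 0 w & lev n (w - kap m)].
Proof.
move=> mu; have /choice[g gP] := lang_digit.
pose U k := iter k (fun v => (g v).2) u; pose c k := (g (U k)).1.
have [y yP] := complete (fun k => (gP (U k)).1).
pose M k := m + \sum_(i < k) c i * P ^+ (n + i).
have ME k : tau * M k - M k = U k * P ^+ (n + k).
  elim: k => [|k IHk]; first by rewrite /M big_ord0 addr0 addn0 mu.
  have -> : M k.+1 = M k + c k * P ^+ (n + k) by rewrite /M big_ord_recr addrA.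
  rewrite mulrDr opprD addrACA IHk mulrA -mulrBl -mulrDl.
  by rewrite (gP (U k)).2 -mulrA -exprS addnS.
exists (kap m + rF a ^+ n *: y).
have wM N : lev (n + N) (kap m + rF a ^+ n *: y - kap (M N)).
  rewrite kapD opprD addrACA subrr add0r.
  have -> : \sum_(i < N) c i * P ^+ (n + i) = (\sum_(i < N) c i * P ^+ i) * P ^+ n.
    by rewrite mulr_suml; apply: eq_bigr => i _; rewrite -mulrA -exprD addnC.
  by rewrite kap_phiX -scalerBr; apply: lev_up.
split.
- apply/eqP; rewrite -subr_eq0; apply/eqP/separated => N.
  set w := kap m + _.
  have -> : tauY w - w = tauY (w - kap (M N)) - (w - kap (M N)) + kap (tau * M N - M N).
    by rewrite kapB kap_tau (additive_sub tauD) addrAC subrKA opprB addrA subrK.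
  have wN : lev N (w - kap (M N)) by apply: lev_le (wM N); rewrite leq_addl.
  apply: levD; first by apply: levB => //; apply: lev_tau_n.
  by rewrite ME; apply: lev_le (kap_P _ _); rewrite leq_addl.
- apply: levD; first exact: lev_kap.
  apply: (lev_le (leq0n n)); apply: lev_upE.
  by have := yP 0; rewrite big_ord0 (additive_zero kapD) subr0.
- rewrite addrC addKr; apply: lev_upE.
  by have := yP 0; rewrite big_ord0 (additive_zero kapD) subr0.
Qed.

Lemma approx_invariant n w m : invariant w -> lev n (w - kap m) ->
  exists u, tau * m - m = u * P ^+ n.
Proof.
move=> wI wm; apply: kap_div; rewrite kapB kap_tau.
have -> : tauY (kap m) - kap m = (w - kap m) - tauY (w - kap m).
  by rewrite (additive_sub tauD) wI opprB [RHS]addrC addrA subrK.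
by apply: levB => //; apply: lev_tau_n.
Qed.

Let PX0 n : P ^+ n != 0.
Proof.
elim: n => [|n IHn]; first by rewrite expr0 oner_eq0.
by rewrite exprS twM_eq0 negb_or P0.
Qed.

Lemma vanishing_invariant n w m : invariant w -> lev n (w - kap m) ->
  (forall x, ev (P ^+ n) x = 0 -> ev m x = 0) -> lev n w.
Proof.
move=> wI wm mP; have [u mu] := approx_invariant wI wm.
have [v mE] := invariant_divides (PX0 n) mu mP.
by rewrite -[w](subrK (kap m)); apply: levD => //; rewrite mE; apply: kap_P.
Qed.

(** A finite form of the duality: the invariants [w i] modulo a^n against ker P^n, paired through
    their approximations [m i] in the twisted polynomials. *)
Definition dual_system n N (z : 'I_N -> L) (w : 'I_N -> Y) (m : 'I_N -> Lt) :=
  [/\ forall x, ev (P ^+ n) x = 0 -> exists u : 'I_N -> Fq, x = \sum_i iL (u i) * z i,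
      forall i, ev (P ^+ n) (z i) = 0,
      forall i, [/\ invariant (w i), lev 0 (w i) & lev n (w i - kap (m i))] &
      forall i k, ev (m i) (z k) = (k == i)%:R].

Lemma exists_dual_system n : exists N z w m, @dual_system n N z w m.
Proof.
have [N [z [zP zF zS]]] := kernel_basis (PX0 n).
have /choice[m /choice[u mu]] := dual_invariants (PX0 n) zF zS.
have /choice[w wP] i := lift_invariant (mu i).1.
by exists N, z, w, m; split=> // i k; apply: (mu i).2.
Qed.

(** The values of [my] on ker P^n are fixed by Frobenius, because tau my - my is a right multiple of
    P^n. Subtracting the matching combination of the [w i] leaves an invariant whose approximation
    vanishes on ker P^n. *)
Lemma dual_system_coordinates n N z w m y my : @dual_system n N z w m ->
  invariant y -> lev 0 y -> lev n (y - kap my) -> exists u : 'I_N -> Fq,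
    (forall i, ev my (z i) = iL (u i)) /\ lev n (y - \sum_i cF (u i) *: w i).
Proof.
move=> [zS zP wP mz] yI y0 ym; have [v myv] := approx_invariant yI ym.
have /choice[u uE] i : exists u, ev my (z i) = iL u.
  apply: frobenius_fixed; apply/eqP; rewrite -subr_eq0; apply/eqP.
  by rewrite -(ev_tau iL) -tw_evalM -evB myv tw_evalM zP tw_eval0r.
exists u; split=> //.
apply: (@vanishing_invariant n _ (my - \sum_i tw_const iL (iL (u i)) * m i)).
- by apply: invariantB => //; apply: invariant_sum => i; have [] := wP i.
- have -> : y - \sum_i cF (u i) *: w i - kap (my - \sum_i tw_const iL (iL (u i)) * m i) =
      (y - kap my) - \sum_i cF (u i) *: (w i - kap (m i)).
    rewrite kapB !opprB (additive_sum kapD); under [in RHS]eq_bigr do rewrite scalerBr -kap_const.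
    by rewrite sumrB opprB addrACA [RHS]addrACA; congr (_ + _); exact: addrC.
  apply: levB => //; apply: lev_sum => i _.
  by apply: levZ; [apply: integral_const | have [] := wP i].
- move=> x /zS[c ->]; rewrite ev_combination big1 // => k _.
  have evD : {morph (fun m => ev m (z k)) : m m' / m + m'}.
    by move=> m1 m2; apply: tw_eval_addl.
  rewrite evB uE (additive_sum evD) (bigD1 k) //= tw_evalM mz eqxx ev_const mulr1.
  rewrite big1 ?addr0 ?subrr ?mulr0 // => i ik.
  by rewrite tw_evalM mz eq_sym (negPf ik) tw_eval0r.
Qed.

Section Pairing.
Variables (psi : (Fp -> L) -> Y -> Fp -> L).

Definition torsion_map (f : Fp -> L) := [/\ {morph f : x y / x + y},
  forall b z, f (rF b * z) = ev (phi b) (f z) & continuous_at a f].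

Hypotheses (psiDl : forall f z, torsion_map f -> {morph (fun y => psi f y z) : x y / x + y})
  (psiZ : forall f c y z, torsion_map f -> psi f (c *: y) z = psi f y (c * z))
  (psi_kap : forall f m z, torsion_map f -> psi f (kap m) z = ev m (f z))
  (psi_tau : forall f y z, torsion_map f -> psi f (tauY y) z = (psi f y z) ^+ q)
  (psi_lev : forall f y z, torsion_map f -> (forall w, integral w -> f (w * z) = 0) ->
    lev 0 y -> psi f y z = 0)
  (psiDr : forall f y, torsion_map f -> {morph psi f y : x z / x + z})
  (psi_const : forall f y u z, torsion_map f -> psi f y (cF u * z) = iL u * psi f y z)
  (psi_cont : forall f y, torsion_map f -> continuous_at a (psi f y)).

Lemma pairing_representable f w : torsion_map f -> invariant w ->
  exists c, forall z, psi f w z = iL (lam (c * z)).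
Proof.
move=> fT wI; have [_ _ _ _ lam_rep] := lamP.
have /choice[mu muE] z : exists u, psi f w z = iL u.
  by apply: frobenius_fixed; rewrite -psi_tau // wI.
have [|||c cE] := lam_rep mu.
- by move=> x y; apply: (fmorph_inj iL); rewrite rmorphD -!muE psiDr.
- by move=> u z; apply: (fmorph_inj iL); rewrite rmorphM -!muE psi_const.
- have [N NP] := psi_cont w fT; exists N => z /NP; rewrite muE => /eqP.
  by rewrite fmorph_eq0 => /eqP.
by exists c => z; rewrite muE cE.
Qed.

Lemma annihilator f z : torsion_map f -> exists N, forall w, integral w ->
  f (w * (rF a ^+ N * z)) = 0.
Proof.
move=> [_ _ [N fN]]; have [M Mz] := integral_multiple_ex aP z.
exists (N + M)%N => w wi; apply: fN.
by rewrite exprD cancel_middle //; apply: integralM.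
Qed.

(** The error y - kap m is a^n times an element of level 0, and f vanishes on a^n A_p z, so the
    pairing does not see it. *)
Lemma pairing_approx f y n m z : torsion_map f -> lev n (y - kap m) ->
  (forall w, integral w -> f (w * (rF a ^+ n * z)) = 0) -> psi f y z = ev m (f z).
Proof.
move=> fT ym fz; rewrite -[y](subrK (kap m)) psiDl // psi_kap // [X in X + _](_ : _ = 0) ?add0r //.
have -> : y - kap m = rF a ^+ n *: ((rF a ^+ n)^-1 *: (y - kap m)).
  by rewrite scalerA divff // scale1r.
by rewrite psiZ // psi_lev //; apply: lev_downE.
Qed.

Lemma torsionX f z n : torsion_map f -> f (rF a ^+ n * z) = ev (P ^+ n) (f z).
Proof. by move=> [_ fphi _]; rewrite -(rmorphXn rF) fphi rmorphXn. Qed.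

(** f z lies in some ker P^n, and its coordinates there are the values of the pairing with the
    members of a dual system. *)
Lemma pairing_injective f : torsion_map f ->
  (forall w, invariant w -> forall z, psi f w z = 0) -> forall z, f z = 0.
Proof.
move=> fT f0 z; have [n nP] := annihilator z fT.
have [N [zs [w [m [zS zP wP mz]]]]] := exists_dual_system n.
have [|u fzE] := zS (f z).
  by rewrite -torsionX // -[_ * z]mul1r nP //; apply: integral1.
rewrite fzE big1 // => k _; suff -> : iL (u k) = 0 by rewrite mul0r.
have [wI w0 wm] := wP k; have := pairing_approx fT wm nP; rewrite f0 // fzE ev_combination.
rewrite (bigD1 k) //= mz eqxx mulr1 big1 ?addr0 // => i ik.
by rewrite mz (negPf ik) mulr0.
Qed.

Section Representation.
Variable ell : Y -> Fp.
Hypothesis ellP : forall c y z, invariant y -> invariant z -> ell (c *: y + z) = c * ell y + ell z.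

Lemma ellD y z : invariant y -> invariant z -> ell (y + z) = ell y + ell z.
Proof. by move=> yI zI; rewrite -{1}[y]scale1r ellP // mul1r. Qed.

Lemma ell0 : ell 0 = 0.
Proof.
by apply: (@addrI _ (ell 0)); rewrite -ellD ?addr0 //; apply: invariant0.
Qed.

Lemma ellZ c y : invariant y -> ell (c *: y) = c * ell y.
Proof. by move=> yI; rewrite -[c *: y]addr0 ellP ?ell0 ?addr0 //; apply: invariant0. Qed.

Lemma ell_sum (I : finType) (c : I -> Fp) (w : I -> Y) : (forall i, invariant (w i)) ->
  ell (\sum_i c i *: w i) = \sum_i c i * ell (w i).
Proof.
move=> wI; suff [] : invariant (\sum_i c i *: w i) /\
    ell (\sum_i c i *: w i) = \sum_i c i * ell (w i) by [].
apply: (big_rec2 (fun y x => invariant y /\ ell y = x)).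
  by split; [apply: invariant0 | apply: ell0].
move=> i y x _ [yI yE]; split; last by rewrite ellP // yE.
by apply: invariantD => //; apply: invariantZ.
Qed.

(* The invariants of level 0 form a finitely generated module over the integral
   elements, generated by a dual system modulo a. *)
Lemma ell_bounded : exists M, forall w, invariant w -> lev 0 w -> integral (rF a ^+ M * ell w).
Proof.
have [N [zs [w [m dual]]]] := exists_dual_system 1; have [_ _ wP _] := dual.
have wI i : invariant (w i) by have [] := wP i.
have /choice[M MP] i := integral_multiple_ex aP (ell (w i)).
exists (\max_i M i)%N => y yI y0.
have /choice[g gP] (x : Y) : exists ux : ('I_N -> Fq) * Y, invariant x -> lev 0 x ->
    [/\ invariant ux.2, lev 0 ux.2 & x = \sum_i cF (ux.1 i) *: w i + rF a *: ux.2].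
  have [[xI x0]|nx] := pselect (invariant x /\ lev 0 x); last first.
    by exists (fun=> 0, 0) => xI x0; case: nx.
  have [mx xm] := approx 1 x0.
  have [u [_ xu]] := dual_system_coordinates dual xI x0 xm.
  exists (u, (rF a)^-1 *: (x - \sum_i cF (u i) *: w i)) => _ _ /=; split.
  - by apply/invariantZ/invariantB => //; apply: invariant_sum.
  - exact: (lev_downE xu).
  - by rewrite scalerA divff // scale1r addrC subrK.
pose x k := iter k (fun y => (g y).2) y; pose u i k := (g (x k)).1 i.
have xP k : invariant (x k) /\ lev 0 (x k).
  by elim: k => [|k [kI k0]] //=; have [] := gP _ kI k0.
have yE n : y = \sum_i (\sum_(k < n) rF (rc (u i k)) * rF a ^+ k) *: w i + rF a ^+ n *: x n.
  elim: n => [|n IHn].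
    by rewrite scale1r big1 ?add0r // => i _; rewrite big_ord0 scale0r.
  have [nI n0] := xP n; have [_ _ xE] := gP _ nI n0.
  rewrite {1}IHn [in LHS]xE scalerDr addrA scalerA -exprSr; congr (_ + _).
  rewrite scaler_sumr -big_split; apply: eq_bigr => i _.
  by rewrite big_ord_recr /= scalerDl scalerA [rF a ^+ n * _]mulrC.
have /choice[c cP] i := series_limit aP (fun k => rc (u i k)).
have -> : y = \sum_i c i *: w i.
  apply/eqP; rewrite -subr_eq0; apply/eqP/separated => n.
  rewrite (yE n) addrAC -sumrB; apply: levD; last by apply: lev_upE; have [] := xP n.
  apply: lev_sum => i _; rewrite -scalerBl -opprB scaleNr; apply: levN.
  by apply: lev_small; [apply: cP | have [] := wP i].
rewrite ell_sum // mulr_sumr; apply: integral_sum => i _.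
rewrite mulrCA; apply: integralM.
  by have := cP i 0; rewrite big_ord0 subr0 expr0 divr1.
rewrite -(subnK (leq_bigmax i)) exprD -mulrA; apply: integralM (MP i).
by rewrite -(rmorphXn rF); apply: integral_reg.
Qed.

(** What x = f z has to satisfy if f is to induce [ell]. Quantifying over all invariants and all
    their approximations makes x unique, from which additivity and A-linearity of f follow. *)
Definition represents z x := exists N, ev (P ^+ N) x = 0 /\
  forall w m, invariant w -> lev 0 w -> lev N (w - kap m) -> ev m x = iL (lam (ell w * z)).

Lemma evPX_le N M x : (N <= M)%N -> ev (P ^+ N) x = 0 -> ev (P ^+ M) x = 0.
Proof. by move=> NM x0; rewrite -(subnK NM) exprD tw_evalM x0 tw_eval0r. Qed.

Lemma represents_ex z : exists x, represents z x.
Proof.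
have [lamD lamZ lam0 _ _] := lamP.
have [M MP] := ell_bounded; have [M' M'P] := integral_multiple_ex aP z.
(* a^M' makes z integral and a^M makes [ell] integral on level 0. So for an invariant w of level n,
   ell w * z is integral and lam vanishes on it: only the dual system matters. *)
pose n := (M' + M)%N; have [N [zs [w [m dual]]]] := exists_dual_system n.
have [_ zP wP mz] := dual.
exists (\sum_i iL (lam (ell (w i) * z)) * zs i), n; split.
  by rewrite ev_combination big1 // => i _; rewrite zP mulr0.
move=> y my yI y0 ym; have [u [uE yu]] := dual_system_coordinates dual yI y0 ym.
rewrite ev_combination.
pose y1 := y - \sum_i cF (u i) *: w i.
have wI i : invariant (w i) by have [] := wP i.
have sI := invariant_sum (fun i => cF (u i)) wI.
have y1I : invariant y1 by apply: invariantB.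
have -> : y = (rF a ^+ n *: ((rF a ^+ n)^-1 *: y1)) + \sum_i cF (u i) *: w i.
  by rewrite scalerA divff // scale1r subrK.
rewrite ellP //; last exact: invariantZ.
rewrite mulrDl lamD [lam (_ * _ * _)]lam0 ?add0r; last first.
  have := integralM M'P (MP _ (invariantZ (rF a ^+ n)^-1 y1I) (lev_downE yu)).
  move: (ell _) => t; rewrite /n exprD; congr integral.
  by rewrite mulrACA [z * t]mulrC mulrA.
rewrite ell_sum // mulr_suml (additive_sum lamD) rmorph_sum; apply: eq_bigr => i _.
by rewrite uE -mulrA lamZ rmorphM mulrC.
Qed.

(** Both elements lie in a common ker P^n, where the [m i] of a dual system separate points. *)
Lemma represents_unique z x y : represents z x -> represents z y -> x = y.
Proof.
move=> [N [xN xP]] [M [yM yP]]; pose n := maxn N M.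
have [k [zs [w [m [zS zP wP mz]]]]] := exists_dual_system n.
apply/eqP; rewrite -subr_eq0; apply/eqP.
have [|u uE] := zS (x - y).
  rewrite -[_ - _]/(x + - y) tw_evalD (evPX_le _ xN) ?leq_maxl // add0r.
  rewrite -mulN1r -(rmorph1 iL) -rmorphN evZ (evPX_le _ yM) ?mulr0 //; exact: leq_maxr.
rewrite uE big1 // => i _; suff -> : iL (u i) = 0 by rewrite mul0r.
have [wI w0 wm] := wP i.
have := congr1 (ev (m i)) uE; rewrite ev_combination (bigD1 i) //= mz eqxx mulr1.
rewrite big1 ?addr0 => [<-|l li]; last by rewrite mz (negPf li) mulr0.
rewrite -[_ - _]/(x + - y) tw_evalD -[- y]mulN1r -(rmorph1 iL) -rmorphN evZ.
rewrite (xP (w i) (m i)) ?(yP (w i) (m i)) //.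
- by rewrite rmorphN rmorph1 mulN1r subrr.
- by apply: lev_le wm; apply: leq_maxr.
- by apply: lev_le wm; apply: leq_maxl.
Qed.

Lemma representsD z z' x x' : represents z x -> represents z' x' -> represents (z + z') (x + x').
Proof.
have [lamD _ _ _ _] := lamP.
move=> [N [xN xP]] [M [yM yP]]; exists (maxn N M); split.
  by rewrite tw_evalD (evPX_le _ xN) ?leq_maxl // (evPX_le _ yM) ?addr0 // leq_maxr.
move=> w m wI w0 wm; rewrite tw_evalD mulrDr lamD rmorphD.
by rewrite (xP w m) ?(yP w m) //; apply: lev_le wm; rewrite ?leq_maxl ?leq_maxr.
Qed.

Lemma represents_phi b z x : represents z x -> represents (rF b * z) (ev (phi b) x).
Proof.
move=> [N [xN xP]]; exists N; split.
  rewrite -tw_evalM -(rmorphXn phi) -rmorphM mulrC rmorphM tw_evalM rmorphXn xN.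
  exact: tw_eval0r.
move=> w m wI w0 wm; rewrite -tw_evalM (xP (rF b *: w)).
- by rewrite ellZ // mulrCA mulrA.
- exact: invariantZ.
- by apply: levZ => //; apply: integral_reg.
- by rewrite kap_phi -scalerBr; apply: levZ => //; apply: integral_reg.
Qed.

Lemma pairing_surjective : exists f, torsion_map f /\
  forall w, invariant w -> forall z, psi f w z = iL (lam (ell w * z)).
Proof.
have [_ _ lam0 _ _] := lamP.
have /choice[f fP] := represents_ex.
have fT : torsion_map f.
  split=> [x y|b z|].
  - by apply: (represents_unique (fP _)); apply: representsD.
  - by apply: (represents_unique (fP _)); apply: represents_phi.
  have [M MP] := ell_bounded; exists M => z zM.
  apply: (represents_unique (fP _)); exists 0%N; split; first by rewrite tw_eval0r.
  move=> w m wI w0 wm; rewrite tw_eval0r lam0 ?rmorph0 //.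
  have := integralM (MP w wI w0) zM; congr integral.
  exact: cancel_outer.
exists f; split=> //.
have main w z : invariant w -> lev 0 w -> psi f w z = iL (lam (ell w * z)).
  move=> wI w0; have [n nP] := annihilator z fT; have [N [_ xP]] := fP z.
  have [m wm] := approx (maxn n N) w0.
  rewrite (@pairing_approx f w n m z) //; last by apply: lev_le wm; apply: leq_maxl.
  by apply: xP => //; apply: lev_le wm; apply: leq_maxr.
move=> w wI z; have [n wn] := lev_ex w.
have -> : w = (rF a ^+ n)^-1 *: (rF a ^+ n *: w) by rewrite scalerA mulVf // scale1r.
rewrite psiZ // main //; last exact: invariantZ.
by rewrite !ellZ //; [congr (iL (lam _)); rewrite mulrCA mulrA | exact: invariantZ].
Qed.

End Representation.
End Pairing.

End TorsionPairing.

Lemma cancel_inv (T : fieldType) (x y : T) : y != 0 -> y * (x * y)^-1 = x^-1.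
Proof. by move=> y0; rewrite invfM mulrCA divff // mulr1. Qed.

(** * The rational Tate module as functions on F_p *)

Section TateModule.
Variables (Fq : finFieldType) (F : fieldType) (iF : {rmorphism Fq -> F}).
Variables (inf : place iF) (p : finite_place inf).
Variables (K : fieldType) (iK : {rmorphism Fq -> K}).
Variables (L : fieldType) (j : {rmorphism K -> L}).
Variables (r : nat).
Local Notation A := (regular inf).
Local Notation Fp := (completion p).
Local Notation rF := (reg_Fp p).
Local Notation FpA := (restr (@complA_val _ _ _ _ p) Fp^o).

Definition proj (z : Fp) : FmodA p := quot_pi (complA_submod p) (z : FpA).

Lemma projD : {morph proj : x y / x + y}.
Proof. exact: (@quot_piD _ FpA (complA_submod p)). Qed.

Lemma projZ (c : complA p) z : c *: proj z = proj (complA_val c * z).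
Proof. exact: (@quot_scaleE _ FpA (complA_submod p)). Qed.

Lemma proj_reg b z : reg_in p b *: proj z = proj (rF b * z).
Proof. exact: projZ. Qed.

Lemma proj_repr x : proj (repr x) = x.
Proof. exact: (@quot_pi_repr _ FpA (complA_submod p)). Qed.

Lemma proj_integral z w : proj z = proj w <-> integral (z - w).
Proof. exact: (@quot_piP _ FpA (complA_submod p)). Qed.

Section OneModule.
Variable phi : drinfeld inf iK r.
Local Notation T := (Tate p j phi).
Local Notation V := (rational_Tate p j phi).

Lemma tate_val_scale (i : complA p) (t : T) x : val (i *: t) x = val t (i *: x).
Proof. by []. Qed.

Lemma tate_val_bal (i : complA p) (c z : Fp) (t : T) :
  val t (proj ((complA_val i *: (c : Fp^o) : Fp) * z)) = val (i *: t) (proj (c * z)).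
Proof. by rewrite tate_val_scale projZ mulrA. Qed.

Definition tate_eval : V -> Fp -> L :=
  tens_lift (fun (c : Fp) (t : T) => fun z : Fp => val t (proj (c * z))).

Lemma tate_eval_balanced : balanced (fun (c : complA p) (x : Fp^o) => complA_val c *: x)
  (fun (c : complA p) (t : T) => c *: t)
  (fun (c : Fp) (t : T) => fun z : Fp => val t (proj (c * z))).
Proof.
split=> [t c c'|c t t'|i c t]; apply/funext => z.
- by have [tD _ _] := TateP t; rewrite mulrDl projD tD.
- by [].
- exact: tate_val_bal.
Qed.

Definition pure (c : Fp) (t : T) : V := @mten _ _ (@complA_val _ _ _ _ p) Fp^o T c t.

Lemma pureDr c : {morph pure c : t s / t + s}.
Proof. by move=> t s; rewrite /pure mtenDr. Qed.

Lemma pure_bal c i t : pure c (i *: t) = pure (complA_val i * c) t.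
Proof. by rewrite /pure -mten_bal. Qed.

Lemma pureZ c d t : c *: pure d t = pure (c * d) t.
Proof. by rewrite /pure mtenZ. Qed.

Lemma pure0 c : pure c 0 = 0. Proof. exact: (additive_zero (pureDr c)). Qed.

Lemma tate_evalE c t z : tate_eval (pure c t) z = val t (proj (c * z)).
Proof. by rewrite /tate_eval (tens_liftE tate_eval_balanced). Qed.

Lemma tate_evalD : {morph tate_eval : v w / v + w}.
Proof. exact: (tens_liftD tate_eval_balanced). Qed.

Lemma tate_eval0 : tate_eval 0 = 0.
Proof. exact: (tens_lift0 tate_eval_balanced). Qed.

Lemma tate_evalZ c v z : tate_eval (c *: v) z = tate_eval v (c * z).
Proof.
elim/tens_ind: v z => [|v w IHv IHw|c' t] z; first by rewrite scaler0 tate_eval0.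
  by rewrite scalerDr !tate_evalD -[LHS]/(tate_eval _ z + tate_eval _ z) IHv IHw.
rewrite -/(pure c' t) pureZ !tate_evalE.
by rewrite mulrA [c' * c]mulrC.
Qed.

Variables (h : nat) (a : A).
Hypothesis aP : local_generator p h a.
Let a0 : rF a != 0 := rF_neq0 aP.
Let aX0 n : rF a ^+ n != 0 := expf_neq0 n a0.

Definition tate_map (f : Fp -> L) := [/\ {morph f : x y / x + y},
  forall b z, f (rF b * z) = tw_eval j (phi b) (f z) & continuous_at a f].

Lemma tate_eval_map v : tate_map (tate_eval v).
Proof.
elim/tens_ind: v => [|v w [vD vZ [N vN]] [wD wZ [M wM]]|c t].
- rewrite tate_eval0; split=> [x y|b z|]; last by exists 0%N.
    exact/esym/addr0.
  by rewrite -[LHS]/(0 : L) tw_eval0r.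
- rewrite tate_evalD; split=> [x y|b z|].
  + by rewrite -[LHS]/(tate_eval v _ + tate_eval w _) vD wD addrACA.
  + by rewrite -[LHS]/(tate_eval v _ + tate_eval w _) vZ wZ -tw_evalD.
  exists (N + M)%N => z zI; rewrite -[LHS]/(tate_eval v z + tate_eval w z) vN ?wM ?addr0 //.
    have := integralM (integral_reg p (a ^+ N)) zI; congr integral.
    by rewrite (rmorphXn rF) exprD invfM mulrCA mulVKf.
  have := integralM (integral_reg p (a ^+ M)) zI; congr integral.
  by rewrite (rmorphXn rF) addnC exprD invfM mulrCA mulVKf.
have [tD tA _] := TateP t; rewrite -/(pure c t); split=> [x y|b z|].
- by rewrite !tate_evalE mulrDr projD tD.
- by rewrite !tate_evalE mulrCA -proj_reg tA.
have [N Nc] := integral_multiple_ex aP c; exists N => z zN; rewrite tate_evalE.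
have -> : proj (c * z) = 0.
  rewrite -[RHS](additive_zero projD); apply/proj_integral; rewrite subr0.
  have := integralM Nc zN; congr integral; exact: cancel_outer.
by apply: additive_zero.
Qed.

(** After passing to a common denominator a^n, the integral numerators act on the Tate module
    itself. A v giving the zero function then has zero Tate component, which proves
    [tate_eval_inj]. *)
Lemma tate_one_denominator v : exists n t, v = pure (rF a ^+ n)^-1 t.
Proof.
elim/tens_ind: v => [|v w [n [t ->]] [m [s ->]]|c t].
- by exists 0%N, 0; rewrite pure0.
- have aux k l u : pure (rF a ^+ k)^-1 u = pure (rF a ^+ (k + l))^-1 (reg_in p (a ^+ l) *: u).
    rewrite pure_bal; congr (pure _ u); rewrite -[complA_val _]/(rF (a ^+ l)).
    by rewrite (rmorphXn rF) exprD; apply: esym; exact: cancel_inv.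
  exists (n + m)%N, (reg_in p (a ^+ m) *: t + reg_in p (a ^+ n) *: s).
  by rewrite (aux n m) (aux m n) addnC pureDr.
have [n nc] := integral_multiple_ex aP c.
pose c0 : complA p := Sub (rF a ^+ n * c) (introT (asboolP _) nc).
exists n, (c0 *: t); rewrite pure_bal; congr (pure _ t).
by rewrite -[complA_val _]/(rF a ^+ n * c) mulrC mulKf.
Qed.

Lemma tate_eval_inj v : (forall z, tate_eval v z = 0) -> v = 0.
Proof.
have [n [t ->]] := tate_one_denominator v => t0.
suff -> : t = 0 by exact: pure0.
apply: val_inj; apply/funext => x; rewrite -(proj_repr x).
by have := t0 (rF a ^+ n * repr x); rewrite tate_evalE mulKf.
Qed.

Lemma in_ideal_pow_ord n b : in_ideal_pow p n b -> ord_ge p n%:Z (reg_val b).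
Proof.
elim: n b => [|n IHn] b; first by move=> _; apply: reg_ord_ge.
move=> [s sP ->]; rewrite (raddf_sum (@reg_val _ _ _ inf)) big_seq.
apply: (big_ind (ord_ge p n.+1%:Z)) => [|x y|t ts]; first by left.
  exact: (@fil_D _ (place_fil p)).
have [t1 /IHn t2] := sP t ts.
suff : ord_ge p n.+1%:Z (reg_val t.1 * reg_val t.2) by [].
by rewrite -[n.+1]add1n PoszD; apply: ord_ge_M.
Qed.

(** If f vanishes on a^N A_p, then z |-> f(a^N z) factors through F_p / A_p. Its values are torsion
    because an element of p^n lowers a pole at p by at least n. *)
Lemma tate_eval_surj f : tate_map f -> exists v, tate_eval v =1 f.
Proof.
move=> [fD fA [N fN]].
have [t tE] : exists t : FmodA p -> L, forall z, t (proj z) = f (rF a ^+ N * z).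
  exists (fun x => f (rF a ^+ N * repr x)) => z.
  apply/eqP; rewrite -subr_eq0 -(additive_sub fD) -mulrBr; apply/eqP/fN.
  rewrite mulrC mulKf //; apply/proj_integral; exact: proj_repr.
have tD x y : t (proj x + proj y) = t (proj x) + t (proj y) by rewrite -projD !tE mulrDr fD.
have tA b x : t (reg_in p b *: proj x) = tw_eval j (phi b) (t (proj x)).
  by rewrite proj_reg !tE mulrCA fA.
have tN x : exists n, torsion p j phi n (t (proj x)).
  have [m mx] := cfil_ex x.
  exists `|m|%N => b /in_ideal_pow_ord bm; rewrite tE -fA mulrCA; apply: fN.
  rewrite mulrC mulKf //; apply: (@fil_S _ (compl_fil p) 0 (`|m|%N%:Z + m)); first lia.
  by apply: fil_M => //; apply: fil_compl_in.
have tT : is_Tate j phi t.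
  split=> [x y|b x|x]; rewrite -(proj_repr x); [rewrite -(proj_repr y)| |].
  - exact: tD.
  - exact: tA.
  - exact: tN.
exists (pure (rF a ^+ N)^-1 (mk_Tate tT)) => z.
by rewrite tate_evalE -[LHS]/(t _) tE mulVKf.
Qed.

Lemma rational_Tate_galD (g : galois_aut j) :
  {morph @rational_Tate_gal _ _ _ _ p _ _ _ _ _ phi g : v w / v + w}.
Proof.
apply: (tens_mod_mapD (s := id)) => // [f1 f2|c f1]; apply: val_inj => //.
by apply/funext => x /=; apply: rmorphD.
Qed.

Lemma tate_eval_gal (g : galois_aut j) v z :
  tate_eval (rational_Tate_gal g v) z = g (tate_eval v z).
Proof.
elim/tens_ind: v => [|v w IHv IHw|c t].
- by rewrite (additive_zero (rational_Tate_galD g)) tate_eval0 rmorph0.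
- rewrite rational_Tate_galD !tate_evalD -[LHS]/(tate_eval _ z + tate_eval _ z) IHv IHw.
  exact/esym/rmorphD.
by rewrite rational_Tate_galE -!/(pure c _) !tate_evalE.
Qed.

End OneModule.

Lemma rational_Tate_homD (phi phi' : drinfeld inf iK r) (u : twisted iK)
    (uP : is_dr_hom phi phi' u) :
  {morph @rational_Tate_hom _ _ _ _ p _ _ _ j _ _ _ _ uP : v w / v + w}.
Proof.
apply: (tens_mod_mapD (s := id)) => // [f1 f2|c f1]; apply: val_inj => //.
by apply/funext => x /=; apply: tw_evalD.
Qed.

Lemma tate_eval_hom (phi phi' : drinfeld inf iK r) (u : twisted iK)
    (uP : is_dr_hom phi phi' u) (v : rational_Tate p j phi) z :
  tate_eval (rational_Tate_hom uP v) z = tw_eval j u (tate_eval v z).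
Proof.
elim/tens_ind: v => [|v w IHv IHw|c t].
- by rewrite (additive_zero (rational_Tate_homD uP)) !tate_eval0 tw_eval0r.
- rewrite rational_Tate_homD !tate_evalD -[LHS]/(tate_eval _ z + tate_eval _ z) IHv IHw.
  exact/esym/tw_evalD.
by rewrite rational_Tate_homE -!/(pure c _) !tate_evalE.
Qed.

End TateModule.

(** * The motive satisfies the hypotheses of the abstract duality *)

Section Instance.
Variables (Fq : finFieldType) (F : fieldType) (iF : {rmorphism Fq -> F}).
Hypothesis ff : is_function_field iF.
Variables (inf : place iF) (p : finite_place inf).
Variables (K : fieldType) (iK : {rmorphism Fq -> K}).
Variables (L : closedFieldType) (j : {rmorphism K -> L}).
Variables (r : nat) (phi : drinfeld inf iK r).
Local Notation A := (regular inf).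
Local Notation iL := (iKbar iK j).
Local Notation Lt := (twisted iL).
Local Notation Fp := (completion p).
Local Notation rF := (reg_Fp p).
Local Notation E := (@elt _ _ _ _ p _ iL).
Local Notation br := (@bracket _ _ _ _ p _ iK _ j _ phi).
Local Notation kap := (@kappa _ _ _ iK j _ _ _ E br).
Local Notation ev := (tw_eval (iK := iL) (idfun : {rmorphism L -> L})).
Local Notation EDl := (@eltDl _ _ _ _ p _ iL).
Local Notation EDr := (@eltDr _ _ _ _ p _ iL).
Local Notation EM := (@eltM _ _ _ _ p _ iL).
Local Notation E1 := (elt1 p iL).
Local Notation bDl := (@bracketDl _ _ _ _ p _ iK _ j _ phi).
Local Notation bDr := (@bracketDr _ _ _ _ p _ iK _ j _ phi).
Local Notation bZ := (@bracketZ _ _ _ _ p _ iK _ j _ phi).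
Local Notation bB := (@bracket_bal _ _ _ _ p _ iK _ j _ phi).
Local Notation Y := (restr (@Fp_FK _ _ _ _ p _ iL) (MF_bar p j phi)).
Variables (h : nat) (a : A) (d : nat) (e : 'I_d -> A) (lam : Fp -> Fq) (D : nat).
Hypotheses (aP : local_generator p h a) (eS : degA_spans a e) (lamP : dualizing a lam).
Hypotheses (aD : size (phi a : {poly K}) = D.+1) (D0 : (0 < D)%N).
Local Notation lev := (level br D h (FL_fil p iL)).

Definition phibar : {rmorphism A -> Lt} := (tw_map j : {rmorphism twisted iK -> Lt}) \o phi.

Lemma phibar_const u : phibar (reg_const inf u) = tw_const iL (iL u).
Proof. by rewrite /= dr_const tw_map_const. Qed.

Lemma phibar_neq0 : phibar a != 0.
Proof. by rewrite -[_ != 0]/((phibar a : {poly L}) != 0) -size_poly_gt0 size_tw_map aD. Qed.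

Lemma Fp_scaleE (c : Fp) (y : Y) : c *: y = E c 1 *: (y : MF_bar p j phi).
Proof. by []. Qed.

Lemma tauY_scale (c : Fp) (y : Y) :
  MF_bar_tau (c *: y : Y) = (c *: (MF_bar_tau (y : MF_bar p j phi) : Y) : Y).
Proof. by rewrite !Fp_scaleE MF_bar_tau_semilinear sigmaF_bar_Fp. Qed.

Lemma kap_phibar m b : kap (m * phibar b) = (rF b *: (kap m : Y) : Y).
Proof. exact: (kappa_phi EDr EM bDl bDr bZ bB). Qed.

Lemma kap_tau_bar m : kap (Defs.tau iL * m) = MF_bar_tau (kap m).
Proof.
apply: (kappa_tau EDr bDl (sigma := sigmaF_bar p iK j)).
- exact: MF_bar_tauD.
- exact: bracket_tau.
- by move=> x; apply: sigma_elt.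
Qed.

Lemma lev_scale n (c : Fp) (y : Y) : integral c -> lev n y -> lev n (c *: y : Y).
Proof. by move=> ci; apply: (levelZ bZ); apply: elt_fil. Qed.

Lemma lev_raise k n (y : Y) : lev n y -> lev (k + n)%N (rF a ^+ k *: y : Y).
Proof.
by rewrite Fp_scaleE -(E_X EM E1); apply: (level_alpha bZ (elt_gen iL aP)).
Qed.

Lemma lev_lower k n (y : Y) : lev (k + n)%N y -> lev n ((rF a ^+ k)^-1 *: y : Y).
Proof.
by rewrite Fp_scaleE -exprVn -(E_X EM E1); apply: (level_alphaV bZ (elt_genV iL aP)).
Qed.

Lemma lev_kappa m : lev 0 (kap m).
Proof. exact: (level_kappa bDl bDr bB h aD D0 (elt_reg p iL)). Qed.

Lemma lev_bracket n c m : FL_fil p iL (h * n)%N%:Z c -> lev n (br c m).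
Proof. exact: (level_br bDl bDr bB aD D0 (elt_reg p iL)). Qed.

Lemma lev_tau_stable y : lev 0 y -> lev 0 (MF_bar_tau y).
Proof.
rewrite {1}/level muln0 => -[b b0 ->].
rewrite (additive_sum (@MF_bar_tauD _ _ _ _ _ _ _ _ _ _ _)).
apply: (level_sum bDl) => i _; rewrite bracket_tau; apply: lev_bracket.
by rewrite muln0; apply: sigma_fil.
Qed.

Lemma lev_add n y z : lev n y -> lev n z -> lev n (y + z).
Proof. exact: (levelD bDl). Qed.

Lemma lev_mono m n (y : MF_bar p j phi) : (m <= n)%N -> lev n y -> lev m y.
Proof. exact: level_le. Qed.

Lemma lev_zero n : lev n (0 : MF_bar p j phi).
Proof. exact: (level0 bDl). Qed.

Lemma lev_exists (y : Y) : exists n, lev 0 (rF a ^+ n *: y : Y).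
Proof.
move: y; apply: bracket_ind => [|x y [n xn] [m ym]|c m].
- by exists 0%N; rewrite scaler0; apply: (level0 bDl).
- exists (n + m)%N.
  have -> : (rF a ^+ (n + m) *: (x + y : Y) : Y) =
      rF a ^+ m *: (rF a ^+ n *: (x : Y)) + rF a ^+ n *: (rF a ^+ m *: (y : Y)).
    by rewrite !scalerA -!exprD [(m + n)%N]addnC scalerDr.
  by apply: lev_add; apply: lev_scale => //; apply/integralX/integral_reg.
have [n cn] := cfil_ex c; exists `|n|%N; rewrite Fp_scaleE bracketZ.
apply: lev_bracket; rewrite muln0.
apply: (@fil_S _ (FL_fil p iL) 0 ((h * `|n|)%N%:Z + n)).
  by have [h0 _ _] := aP; move: h0; clear; move: (h) => k k0; nia.
by apply: fil_M => //; apply: elt_fil; apply: compl_fil_aX.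
Qed.

Lemma lev_approx n y : lev 0 y -> exists m, lev n (y - kap m).
Proof.
exact: (level_approx EDr EM bDl bDr bZ bB aD D0 (elt_reg p iL) (elt_approx ff aP eS)).
Qed.

Lemma lev_complete (f : nat -> Lt) :
  (forall k, (size (f k : {poly L}) < size (phibar a : {poly L}))%N) ->
  exists y, forall n, lev n (y - kap (\sum_(k < n) f k * phibar a ^+ k)).
Proof.
move=> fD; apply: (level_complete EDr EM E1 bDl bDr bZ bB aD D0 (elt_reg p iL) (elt_series iL aP)).
by move=> k; have := fD k; rewrite size_tw_map aD ltnS.
Qed.

Definition eval_test (f : Fp -> L) (m : Lt) (z : Fp) : L := ev m (f z).

Lemma tate_torsion (f : Fp -> L) : tate_map j phi a f <-> torsion_map a phibar (f : Fp -> L).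
Proof.
split=> -[fD fA fC]; split=> // b z; rewrite fA; first exact: tw_map_eval.
exact/esym/tw_map_eval.
Qed.

Lemma eval_testP (f : Fp -> L) : torsion_map a phibar (f : Fp -> L) -> test phi (eval_test f).
Proof.
move=> [fD fA [N fN]]; split=> [m m'|m|x m z|m b z].
- by apply/funext => z; apply: tw_eval_addl.
- split=> [x y|u z|].
  + by rewrite /eval_test fD tw_evalD.
  + rewrite /eval_test -[const_Fp p u]/(rF (reg_const inf u)) fA phibar_const.
    by rewrite ev_const evZ.
  exists (h * N)%N%:Z => z /(integral_divP aP)/fN fz.
  by rewrite /eval_test fz tw_eval0r.
- by rewrite /eval_test tw_evalM ev_const.
- by rewrite /eval_test tw_evalM fA.
Qed.

Definition pair (f : Fp -> L) : Y -> Fp -> L := psi (phi := phi) (eval_test f).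

Lemma pairDl f z : torsion_map a phibar (f : Fp -> L) -> {morph (fun y => pair f y z) : x y / x + y}.
Proof. by move=> /eval_testP fT x y; rewrite /pair (psiD fT). Qed.

Lemma pairZ f c y z : torsion_map a phibar (f : Fp -> L) -> pair f (c *: y : Y) z = pair f y (c * z).
Proof. by move=> /eval_testP fT; apply: psi_Fp. Qed.

Lemma pair_kap f m z : torsion_map a phibar (f : Fp -> L) -> pair f (kap m) z = ev m (f z).
Proof. by move=> /eval_testP fT; apply: psi_kappa. Qed.

Lemma pair_tau f y z : torsion_map a phibar (f : Fp -> L) -> pair f (MF_bar_tau y) z = pair f y z ^+ #|Fq|.
Proof.
move=> /eval_testP fT; apply: psi_tau => // m w.
by rewrite /eval_test tw_evalM ev_tau.
Qed.

Lemma pair_lev f y z : torsion_map a phibar (f : Fp -> L) ->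
  (forall w, integral w -> f (w * z) = 0) -> lev 0 y -> pair f y z = 0.
Proof.
move=> /eval_testP fT fz; apply: (psi_level0 fT) => m w wi.
by rewrite /eval_test fz // tw_eval0r.
Qed.

Lemma pairDr f y : torsion_map a phibar (f : Fp -> L) -> {morph pair f y : x z / x + z}.
Proof. by move=> /eval_testP fT; have [] := psi_adm fT y. Qed.

Lemma pair_const f y u z : torsion_map a phibar (f : Fp -> L) ->
  pair f y (const_Fp p u * z) = iL u * pair f y z.
Proof. by move=> /eval_testP fT; have [_ yZ _] := psi_adm fT y; apply: yZ. Qed.

Lemma pair_continuous f y : torsion_map a phibar (f : Fp -> L) -> continuous_at a (pair f y).
Proof.
move=> /eval_testP fT; have [_ _ [m ym]] := psi_adm fT y.
have [n nP] := fil_integral_div aP m.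
by exists n => z /nP; apply: ym.
Qed.

Lemma pair_representable f w : torsion_map a phibar (f : Fp -> L) -> MF_bar_tau w = w ->
  exists c, forall z, pair f w z = iL (lam (c * z)).
Proof.
exact: (@pairing_representable _ _ _ _ _ _ _ _ _ lamP phibar Y (@MF_bar_tau _ _ _ _ p _ _ _ j _ phi)
  pair pair_tau pairDr pair_const pair_continuous).
Qed.

Lemma pair_injective f : torsion_map a phibar (f : Fp -> L) ->
  (forall w, MF_bar_tau w = w -> forall z, pair f w z = 0) -> forall z, f z = 0.
Proof.
exact: (@pairing_injective _ _ _ _ _ _ _ _ _ aP phibar phibar_neq0 Y
  (@MF_bar_tau _ _ _ _ p _ _ _ j _ phi) kap lev (@MF_bar_tauD _ _ _ _ _ _ _ _ _ _ _)
  tauY_scale (kappaD EDr bDl) kap_phibar kap_tau_bar lev_add lev_scale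
  lev_mono lev_raise lev_lower lev_kappa
  lev_tau_stable lev_complete (lev_separated ff aP eS aD D0) pair
  pairDl pairZ pair_kap pair_lev f).
Qed.

Lemma pair_surjective (ell : Y -> Fp) :
  (forall (c : Fp) (y z : Y), MF_bar_tau (y : MF_bar p j phi) = y ->
     MF_bar_tau (z : MF_bar p j phi) = z -> ell (c *: y + z) = c * ell y + ell z) ->
  exists f, torsion_map a phibar (f : Fp -> L) /\
    forall w, MF_bar_tau w = w -> forall z, pair f w z = iL (lam (ell w * z)).
Proof.
exact: (@pairing_surjective _ _ _ _ _ _ _ _ _ _ aP lamP phibar phibar_const phibar_neq0 Y
  (@MF_bar_tau _ _ _ _ p _ _ _ j _ phi) kap lev (@MF_bar_tauD _ _ _ _ _ _ _ _ _ _ _)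
  tauY_scale (kappaD EDr bDl) kap_phibar kap_tau_bar lev_zero
  lev_add lev_scale
  lev_mono lev_raise lev_lower lev_kappa
  lev_tau_stable lev_exists lev_approx lev_complete (lev_separated ff aP eS aD D0)
  (kappa_divides ff aP eS aD) pair
  pairDl pairZ pair_kap pair_lev ell).
Qed.

End Instance.

(** * The comparison isomorphism *)

Section PairingNaturality.
Variables (Fq : finFieldType) (F : fieldType) (iF : {rmorphism Fq -> F}).
Variables (inf : place iF) (p : finite_place inf).
Variables (K : fieldType) (iK : {rmorphism Fq -> K}).
Variables (L : closedFieldType) (j : {rmorphism K -> L}) (r : nat).
Local Notation A := (regular inf).
Local Notation iL := (iKbar iK j).
Local Notation Fp := (completion p).
Variables (h : nat) (a : A).
Hypothesis aP : local_generator p h a.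

Section OneModule.
Variable phi : drinfeld inf iK r.
Local Notation pair := (@pair _ _ _ _ p _ _ _ j _ phi).
Local Notation good := (torsion_map (p := p) a (phibar j phi)).

Lemma psi_0 g z : test (p := p) (j := j) phi g -> psi (phi := phi) g 0 z = 0.
Proof. by move=> gT; rewrite (additive_zero (psiD gT)). Qed.

Lemma psi_add g u v z : test (p := p) (j := j) phi g ->
  psi (phi := phi) g (u + v) z = psi g u z + psi g v z.
Proof. by move=> gT; rewrite (psiD gT). Qed.

Lemma pair_addf f f' y z : good f -> good f' -> good (f + f') ->
  pair (f + f') y z = pair f y z + pair f' y z.
Proof.
move=> /(eval_testP aP) fT /(eval_testP aP) fT' /(eval_testP aP) fT''.
rewrite /pair; move: y; apply: bracket_ind => [|x y Hx Hy|c m].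
- by rewrite !psi_0 // addr0.
- by rewrite !psi_add // Hx Hy addrACA.
rewrite !psi_bracket //.
have -> : eval_test (f + f') (tw_map j m) = eval_test f (tw_map j m) + eval_test f' (tw_map j m).
  by apply/funext => w; apply: tw_evalD.
by apply: actDr; [have [] := fT | have [] := fT'].
Qed.

(** Scaling the argument of f by c is the action of c (x) 1, which commutes with the action of all
    coefficients. This yields the F_p-linearity in the Tate variable. *)
Lemma pair_shift f (c : Fp) y z : good f -> good (fun z => f (c * z)) ->
  pair (fun z => f (c * z)) y z = pair f y (c * z).
Proof.
move=> /(eval_testP aP) fT /(eval_testP aP) fT'.
rewrite /pair; move: y; apply: bracket_ind => [|x y Hx Hy|b m].
- by rewrite !psi_0.
- by rewrite !psi_add // Hx Hy.
rewrite !psi_bracket //; have [_ fA _ _] := fT.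
have -> : eval_test (fun z => f (c * z)) (tw_map j m) = act (elt iL c 1) (eval_test f (tw_map j m)).
  by apply/funext => w; rewrite [RHS]act_in_ten ?mul1r.
rewrite -[LHS](actM b (elt iL c 1) z (fA _)) mulrC actM; last exact: fA.
rewrite [LHS]act_in_ten ?mul1r //; exact: admissible_act.
Qed.

Lemma pair_gal (g : galois_aut j) f y z : good f -> good (Defs.gal_fun g \o f) ->
  pair (Defs.gal_fun g \o f) y z = Defs.gal_fun g (pair f (MF_bar_gal (Defs.gal_inv g) y) z).
Proof.
move=> /(eval_testP aP) fT /(eval_testP aP) fT'.
rewrite /pair (psi_gal (s := Defs.gal_inv g) y z fT' fT) ?gal_inv_funK // => m w.
by rewrite /eval_test /= -!tw_map_eval -gal_eval /= gal_funK.
Qed.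

End OneModule.

Lemma pair_hom (phi phi' : drinfeld inf iK r) (u : twisted iK) (uP : is_dr_hom phi phi' u)
    f (y : MF_bar p j phi') z :
  torsion_map (p := p) a (phibar j phi) f ->
  torsion_map (p := p) a (phibar j phi') (fun z => tw_eval j u (f z)) ->
  pair (phi := phi') (fun z => tw_eval j u (f z)) y z = pair (phi := phi) f (MF_bar_hom phi u y) z.
Proof.
move=> /(eval_testP aP) fT /(eval_testP aP) fT'.
apply: (psi_hom uP _ _ fT fT') => m w.
by rewrite /eval_test -!tw_map_eval tw_evalM.
Qed.

End PairingNaturality.

Section Matching.
Variables (Fq : finFieldType) (F : fieldType) (iF : {rmorphism Fq -> F}).
Hypothesis ff : is_function_field iF.
Variables (inf : place iF) (p : finite_place inf).
Variables (K : fieldType) (iK : {rmorphism Fq -> K}).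
Variables (L : closedFieldType) (j : {rmorphism K -> L}) (r : nat).
Hypothesis r_gt0 : (0 < r)%N.
Local Notation A := (regular inf).
Local Notation iL := (iKbar iK j).
Local Notation Fp := (completion p).
Variables (h : nat) (a : A) (d : nat) (e : 'I_d -> A) (lam : Fp -> Fq).
Hypotheses (aP : local_generator p h a) (eS : degA_spans a e) (lamP : dualizing a lam).

Lemma lam_inj (c c' : Fp) : (forall z, iL (lam (c * z)) = iL (lam (c' * z))) -> c = c'.
Proof.
have [lamD _ _ lamN _] := lamP => cc'; apply/eqP; rewrite -subr_eq0; apply/eqP/lamN => z.
rewrite mulrBl (additive_sub lamD); apply/eqP; rewrite subr_eq0; apply/eqP.
exact: (fmorph_inj iL).
Qed.

Section OneModule.
Variable phi : drinfeld inf iK r.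
Local Notation V := (rational_Tate p j phi).
Local Notation T := (T0 p j phi).
Local Notation pair := (@pair _ _ _ _ p _ _ _ j _ phi).

(** A relation instead of a map: linearity, equivariance and functoriality are checked on related
    elements and transferred to the comparison map by [matches_unique]. *)
Definition matches (v : V) (l : T0_dual p j phi) := forall (w : T) z,
  pair (tate_eval v) (T0_val w) z = iL (lam ((val l w : Fp) * z)).

Lemma tate_good v : torsion_map a (phibar j phi) (tate_eval (p := p) (j := j) (phi := phi) v).
Proof. exact/tate_torsion/(tate_eval_map aP). Qed.

(** If a had degree 0, then 1 would be a multiple of a, although a vanishes at p. *)
Lemma phi_degree : exists D, size (phi a : {poly K}) = D.+1 /\ (0 < D)%N.
Proof.
have [d' [b bP] sz] := dr_deg phi (local_generator_neq0' aP).
exists (r * d')%N; split=> //; rewrite muln_gt0 r_gt0 /= lt0n; apply/eqP => d0.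
have [c [[y yE] _]] := bP 1; apply: (@generator_not_unit _ _ _ _ _ _ _ aP y).
by rewrite yE big1 ?add0r // => i _; have := ltn_ord i; rewrite {2}d0.
Qed.

Lemma matches_unique v l l' : matches v l -> matches v l' -> l = l'.
Proof.
move=> vl vl'; apply: val_inj; apply/funext => w; apply: lam_inj => z.
by rewrite -vl -vl'.
Qed.

Lemma matches_ex v : exists l, matches v l.
Proof.
have [D [aD D0]] := phi_degree; have vT := tate_good v.
have /choice[l lP] (w : T) : exists c : Fp, forall z,
    pair (tate_eval v) (T0_val w) z = iL (lam (c * z)).
  by apply: (pair_representable aP lamP vT); apply: T0P.
have lL : linear (l : T -> Fp^o).
  move=> c x y; apply: lam_inj => z; rewrite -lP.
  have [lamD _ _ _ _] := lamP.
  have -> : (c *: (l x : Fp^o) + l y : Fp) * z = l x * (c * z) + l y * z.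
    by rewrite mulrDl -[_ *: _]/(c * l x) [c * _]mulrC mulrA.
  rewrite lamD rmorphD -(lP x) -(lP y) -(pairZ aP c (T0_val x) z vT).
  exact: (pairDl aP z vT).
by exists (mk_dual lL).
Qed.

Lemma matches_linear c v v' l l' : matches v l -> matches v' l' ->
  matches (c *: v + v') (c *: l + l').
Proof.
move=> vl vl' w z; have [lamD _ _ _ _] := lamP.
have E1 : tate_eval (c *: v) = fun z => tate_eval v (c * z).
  by apply/funext => x; apply: tate_evalZ.
have E2 : tate_eval (c *: v + v') = tate_eval (c *: v) + tate_eval v'.
  exact: tate_evalD.
have G := tate_good (c *: v + v'); rewrite E2 in G *.
rewrite (pair_addf aP) //; [|exact: tate_good..].
have G1 := tate_good (c *: v); rewrite E1 in G1 *.
rewrite (pair_shift aP) //; last exact: tate_good.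
rewrite vl vl' -rmorphD -lamD; congr (iL (lam _)).
by rewrite -[val (_ + _) w]/(c * (val l w : Fp) + (val l' w : Fp)) mulrDl mulrCA mulrA.
Qed.

Lemma matches_inj v : matches v 0 -> v = 0.
Proof.
move=> v0; have [D [aD D0]] := phi_degree; apply: (tate_eval_inj aP).
apply: (pair_injective ff aP eS aD D0 (tate_good v)) => w wT z.
have wP : T0_pred w by apply/eqP.
have := v0 (Sub w wP : T) z; rewrite /T0_val SubK => ->.
have [lamD _ _ _ _] := lamP; rewrite -[val 0 _]/(0 : Fp) mul0r.
by rewrite (additive_zero lamD) rmorph0.
Qed.

Lemma matches_surj l : exists v, matches v l.
Proof.
have [D [aD D0]] := phi_degree.
(* [pair_surjective] takes a function on the whole module that is linear on invariants; the
   functional on [T0] is extended by 0. *)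
pose ell (y : restr (@Fp_FK _ _ _ _ p _ iL) (MF_bar p j phi)) : Fp :=
  if pselect (T0_pred y) is left yP then val l (Sub y yP : T) else 0.
have ellE (w : T) : ell (val w) = val l w.
  by rewrite /ell; case: pselect => [wP|]; [congr (val l _); apply: val_inj | case; apply: valP].
have [|f [fT fP]] := @pair_surjective _ _ _ ff _ _ _ _ _ _ _ phi h a d e lam D aP eS lamP aD D0 ell.
  move=> c y z /eqP yP /eqP zP.
  pose y' : T := Sub y (yP : T0_pred y); pose z' : T := Sub z (zP : T0_pred z).
  have := dualP l c y' z'; rewrite -!ellE; exact.
have [v vf] := tate_eval_surj aP (proj2 (tate_torsion j phi a f) fT).
exists v => w z.
have -> : tate_eval v = f by apply/funext.
by rewrite fP ?ellE //; apply: T0P.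
Qed.

Lemma matches_gal (g : galois_aut j) v l : matches v l ->
  matches (rational_Tate_gal g v) (dual_gal g l).
Proof.
move=> vl w z.
have E : tate_eval (rational_Tate_gal g v) = Defs.gal_fun g \o tate_eval v.
  by apply/funext => x; apply: tate_eval_gal.
have G := tate_good (rational_Tate_gal g v); rewrite E in G *.
rewrite (pair_gal aP) //; last exact: tate_good.
by rewrite -[MF_bar_gal _ _]/(T0_val (T0_gal (Defs.gal_inv g) w)) vl; apply: gal_const.
Qed.

End OneModule.

Lemma matches_hom (phi phi' : drinfeld inf iK r) (u : twisted iK) (uP : is_dr_hom phi phi' u)
    (v : rational_Tate p j phi) l : matches v l ->
  matches (rational_Tate_hom uP v) (dual_hom uP l).
Proof.
move=> vl w z.
have E : tate_eval (rational_Tate_hom uP v) = fun x => tw_eval j u (tate_eval v x).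
  by apply/funext => x; apply: tate_eval_hom.
have G := tate_good (rational_Tate_hom uP v); rewrite E in G *.
rewrite (pair_hom aP uP) //; last exact: tate_good.
exact: (vl (T0_hom uP w)).
Qed.

End Matching.

Section LinearOf.
Variables (R : pzRingType) (V W : lmodType R) (f : V -> W).
Definition linear_of of linear f : V -> W := f.
HB.instance Definition _ (fL : linear f) := GRing.isLinear.Build R V W *:%R (linear_of fL) fL.
End LinearOf.

Lemma injective_surjective_bijective (S T : Type) (f : S -> T) :
  injective f -> (forall y, exists x, f x = y) -> bijective f.
Proof.
move=> f_inj /choice[g gK]; exists g => // x.
by apply: f_inj; rewrite gK.
Qed.

Section TensorLine.
Variables (A : comPzRingType) (T : fieldType) (rF : {rmorphism A -> T}).
Variables (V : lmodType T) (Om : lmodType A) (w0 : Om) (kd : Om -> T).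
Hypotheses (kdD : {morph kd : x y / x + y}) (kdZ : forall b x, kd (b *: x) = rF b * kd x)
  (kd0 : kd w0 = 1) (kdP : forall w, exists b c, rF b != 0 /\ b *: w = c *: w0).

Definition tensor_line (f : V) : tens_mod rF V Om := mten f w0.

Lemma tensor_line_linear : linear tensor_line.
Proof. by move=> c f g; rewrite /tensor_line mtenDl mtenZ. Qed.

Lemma tensor_line_bij : bijective tensor_line.
Proof.
pose ev : tens_mod rF V Om -> V := tens_lift (fun (f : V) (w : Om) => kd w *: f).
have evB : balanced (fun (b : A) (f : V) => rF b *: f) (fun (b : A) (w : Om) => b *: w)
    (fun (f : V) (w : Om) => kd w *: f).
  split=> [w f g|f w w'|b f w]; first exact: scalerDr.
    by rewrite kdD scalerDl.
  by rewrite kdZ scalerA mulrC.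
exists ev => [f|]; first by rewrite /ev [LHS](tens_liftE evB) kd0 scale1r.
have lD : {morph tensor_line : f g / f + g} by move=> f g; apply: mtenDl.
apply: tens_ind => [|x y Hx Hy|f w].
- by rewrite /ev (tens_lift0 evB) (additive_zero lD).
- by rewrite /ev (tens_liftD evB) lD -!/(ev _) Hx Hy.
by rewrite /ev [tens_lift _ _](tens_liftE evB); exact/esym/(mten_line kdZ kd0 kdP).
Qed.

End TensorLine.

Theorem proposition17p13
  (Fq : finFieldType) (F : fieldType) (iF : {rmorphism Fq -> F})
  (F_function_field : is_function_field iF)
  (inf : place iF) (p : finite_place inf)
  (K : fieldType) (iK : {rmorphism Fq -> K})
  (Kbar : closedFieldType) (j : {rmorphism K -> Kbar})
  (Kbar_algebraic : forall x : Kbar, algebraicOver j x)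
  (r : nat) (r_gt0 : (0 < r)%N) :
  exists Theta : forall phi : drinfeld inf iK r,
      {linear rational_Tate p j phi -> dual_Omega p j phi},
    [/\ forall phi, bijective (Theta phi),
        forall phi (g : galois_aut j) (v : rational_Tate p j phi),
          Theta phi (rational_Tate_gal g v) = dual_Omega_gal g (Theta phi v) &
        forall (phi phi' : drinfeld inf iK r) (u : twisted iK)
            (uP : is_dr_hom phi phi' u) (v : rational_Tate p j phi),
          Theta phi' (rational_Tate_hom uP v) = dual_Omega_hom uP (Theta phi v)].
Proof.
(* The degrees of some Drinfeld module serve as height on A in finding a; if there is no module at
   all, the statement is vacuous. The data a, lam and w0 are fixed before phi and shared by all
   modules, as naturality requires. *)
have [[phi0]|no_phi] := pselect (inhabited (drinfeld inf iK r)); last first.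
  by exists (fun phi => False_rect _ (no_phi (inhabits phi)));
    split=> phi; case: (no_phi (inhabits phi)).
have [h [a aP]] := exists_local_generator F_function_field p r_gt0 phi0.
have [d dA _] := dr_deg phi0 (local_generator_neq0' aP).
have [e [eS eF]] := degA_basis dA.
have [lam lamP] := exists_dualizing F_function_field aP eS eF.
have [w0 [kd [kdD kdZ kd0 kdP]]] := Kaehler_line F_function_field p.
pose Phi phi v := sval (cid (@matches_ex _ _ _ _ p _ iK _ j _ r_gt0 _ _ _ aP lamP phi v)).
have PhiP phi v : matches lam v (Phi phi v) by rewrite /Phi; case: cid.
have PhiE phi v l : matches lam v l -> Phi phi v = l.
  by move=> vl; apply: (matches_unique lamP (PhiP phi v) vl).
have PhiL phi : linear (Phi phi).
  by move=> c v v'; apply: PhiE; apply: (matches_linear aP lamP).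
have PhiB phi : bijective (Phi phi).
  apply: injective_surjective_bijective => [v v' vv'|l]; last first.
    by have [v vl] := matches_surj F_function_field r_gt0 aP eS lamP l; exists v; apply: PhiE.
  apply/eqP; rewrite -subr_eq0; apply/eqP.
  apply: (matches_inj F_function_field r_gt0 aP eS lamP).
  have -> : 0 = -1 *: Phi phi v' + Phi phi v by rewrite vv' scaleN1r addNr.
  by rewrite -PhiL scaleN1r addrC; apply: PhiP.
have ThetaL phi : linear (fun v => tensor_line (reg_Fp p) w0 (Phi phi v)).
  by move=> c v v'; rewrite PhiL tensor_line_linear.
exists (fun phi => linear_of (ThetaL phi)); split.
- move=> phi; suff : bijective (tensor_line (reg_Fp p) w0 \o Phi phi) by [].
  exact: (bij_comp (tensor_line_bij _ kdD kdZ kd0 kdP) (PhiB phi)).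
- move=> phi g v; rewrite /= /linear_of [RHS]dual_Omega_galE; congr (tensor_line _ _ _).
  by apply: PhiE; apply: (matches_gal aP).
- move=> phi phi' u uP v; rewrite /= /linear_of [RHS]dual_Omega_homE; congr (tensor_line _ _ _).
  by apply: PhiE; apply: (matches_hom aP).
Qed.
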